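(* Let $T>0$, let $\beta\in C^1([0,1])$ with $\beta>0$, and let $(\eta,u)$ be the solution of the initial-boundary-value problem $$\eta_t+(\eta u)_x+(\beta u)_x=0,\qquad u_t+\eta_x+uu_x=0,\qquad 0\le x\le 1,\ 0\le t\le T,$$ $$\eta(x,0)=\eta^0(x),\quad u(x,0)=u^0(x),\quad 0\le x\le 1,\qquad u(0,t)=u(1,t)=0,\quad 0\le t\le T,$$ assumed to be sufficiently smooth and to satisfy $\beta(x)+\eta(x,t)>0$ for all $(x,t)\in[0,1]\times[0,T]$. Let $r\ge 3$ and $0\le k\le r-2$ be integers, and let $S_h$, $S_{h,0}$ be the finite element spaces defined in the context, on quasiuniform partitions of $[0,1]$ with maximal mesh length $h$. Then, if $h$ is sufficiently small, the semidiscrete initial-value problem of finding $\eta_h:[0,T]\to S_h$, $u_h:[0,T]\to S_{h,0}$ such that for $t\in[0,T]$ $$(\eta_{ht},\varphi)+((\eta_hu_h)_x,\varphi)+((\beta u_h)_x,\varphi)=0\quad\forall\varphi\in S_h,$$ $$(u_{ht},\chi)+(\eta_{hx},\chi)+(u_hu_{hx},\chi)=0\quad\forall\chi\in S_{h,0},$$ $$\eta_h(0)=\mathrm{P}\eta^0,\qquad u_h(0)=\mathrm{P}_0u^0,$$ has a unique solution $(\eta_h,u_h)$ for $t\in[0,T]$, and $$\max_{0\le t\le T}\left(\|\eta(t)-\eta_h(t)\|+\|u(t)-u_h(t)\|\right)\le C h^{r-1},$$ where $C$ is a constant independent of $h$.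
   Context: $(\cdot,\cdot)$ and $\|\cdot\|$ denote the inner product and norm of $L^2=L^2(0,1)$; $C^m$ denotes the $m$ times continuously differentiable functions on $[0,1]$; $\mathbb P_m$ denotes polynomials of degree at most $m$. Let $0=x_1<x_2<\dots<x_{N+1}=1$ be a quasiuniform partition of $[0,1]$ with $h:=\max_i(x_{i+1}-x_i)$ (quasiuniform: $h\le c\,\min_i(x_{i+1}-x_i)$ with a constant $c$ independent of the partition in the family considered). For integers $r\ge2$, $0\le k\le r-2$, $$S_h=\{\varphi\in C^k:\ \varphi|_{[x_j,x_{j+1}]}\in\mathbb P_{r-1},\ 1\le j\le N\},\qquad S_{h,0}=\{\varphi\in S_h:\ \varphi(0)=\varphi(1)=0\}.$$ $\mathrm P$ and $\mathrm P_0$ are the $L^2$-projection operators onto $S_h$ and $S_{h,0}$, respectively. ''Sufficiently smooth'' means that the data and the solution $(\eta,u)$ have as many continuous (bounded) derivatives on $[0,1]\times[0,T]$ as required for the error estimation. ''$h$ sufficiently small'' means that there is $h_0>0$ such that the conclusion holds for all partitions in the quasiuniform family with $h\le h_0$, with $C$ the same for all of them. *)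

(* Defs.v *)
From Stdlib Require Import Reals.
From Coquelicot Require Import Coquelicot.
Open Scope R_scope.

Definition Icc (a b x : R) : Prop := a <= x <= b.

(* Derivative relative to [D]; one-sided at the end points when [D] is a
   closed interval. *)
Definition is_derive_on (D : R -> Prop) (f : R -> R) (x l : R) : Prop :=
  filterdiff f (within D (locally x)) (fun y => scal y l).

Fixpoint C_on (a b : R) (m : nat) (f : R -> R) : Prop :=
  match m with
  | O => continuous_on (Icc a b) f
  | S n => exists f' : R -> R,
      (forall x, Icc a b x -> is_derive_on (Icc a b) f x (f' x)) /\
      C_on a b n f'
  end.

(* All mixed partial derivatives of order at most [m] of [f], as a function of
   (x, t), exist and are continuous on [0,1] x [0,T]. *)
Fixpoint C_rect (T : R) (m : nat) (f : R -> R -> R) : Prop :=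
  continuous_on (fun p : R * R => Icc 0 1 (fst p) /\ Icc 0 T (snd p))
    (fun p => f (fst p) (snd p)) /\
  match m with
  | O => True
  | S n => exists fx ft : R -> R -> R,
      (forall x t, Icc 0 1 x -> Icc 0 T t ->
         is_derive_on (Icc 0 1) (fun y => f y t) x (fx x t) /\
         is_derive_on (Icc 0 T) (fun s => f x s) t (ft x t)) /\
      C_rect T n fx /\ C_rect T n ft
  end.

Definition inner (f g : R -> R) : R := RInt (fun x => f x * g x) 0 1.
Definition L2norm (f : R -> R) : R := sqrt (inner f f).

(* The nodes are X 1, ..., X (N + 1); other values of [X] are irrelevant. *)
Definition is_partition (N : nat) (X : nat -> R) : Prop :=
  X 1%nat = 0 /\ X (N + 1)%nat = 1 /\
  forall j, (1 <= j <= N)%nat -> X j < X (j + 1)%nat.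

Fixpoint mesh (N : nat) (X : nat -> R) : R :=
  match N with
  | O => 0
  | S n => Rmax (mesh n X) (X (N + 1)%nat - X N)
  end.

Definition quasiuniform (c : R) (N : nat) (X : nat -> R) : Prop :=
  forall j, (1 <= j <= N)%nat -> mesh N X <= c * (X (j + 1)%nat - X j).

Definition is_poly_on (d : nat) (a b : R) (f : R -> R) : Prop :=
  exists p : nat -> R,
    forall x, Icc a b x -> f x = sum_n (fun i => p i * x ^ i) d.

(* Splines are functions on R of which only the restriction to [0,1] matters. *)
Definition Sh (r k N : nat) (X : nat -> R) (f : R -> R) : Prop :=
  C_on 0 1 k f /\
  forall j, (1 <= j <= N)%nat -> is_poly_on (r - 1) (X j) (X (j + 1)%nat) f.

Definition Sh0 (r k N : nat) (X : nat -> R) (f : R -> R) : Prop :=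
  Sh r k N X f /\ f 0 = 0 /\ f 1 = 0.

Definition is_L2_projection (V : (R -> R) -> Prop) (f p : R -> R) : Prop :=
  V p /\ forall phi, V phi -> inner p phi = inner f phi.

Definition is_ibvp_solution (T : R) (beta eta0 u0 : R -> R)
    (eta u : R -> R -> R) : Prop :=
  (forall x t, Icc 0 1 x -> Icc 0 T t ->
     exists eta_t etau_x betau_x : R,
       is_derive_on (Icc 0 T) (fun s => eta x s) t eta_t /\
       is_derive_on (Icc 0 1) (fun y => eta y t * u y t) x etau_x /\
       is_derive_on (Icc 0 1) (fun y => beta y * u y t) x betau_x /\
       eta_t + etau_x + betau_x = 0) /\
  (forall x t, Icc 0 1 x -> Icc 0 T t ->
     exists u_t eta_x u_x : R,
       is_derive_on (Icc 0 T) (fun s => u x s) t u_t /\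
       is_derive_on (Icc 0 1) (fun y => eta y t) x eta_x /\
       is_derive_on (Icc 0 1) (fun y => u y t) x u_x /\
       u_t + eta_x + u x t * u_x = 0) /\
  (forall x, Icc 0 1 x -> eta x 0 = eta0 x /\ u x 0 = u0 x) /\
  (forall t, Icc 0 T t -> u 0 t = 0 /\ u 1 t = 0).

(* The discrete solution takes the time first: [etah t] is an element of S_h.
   Space derivatives under the integrals are taken with [Derive]; for k = 0
   they may fail to exist at the nodes, which does not affect the integrals. *)
Definition is_semidiscrete_solution (T : R) (beta eta0 u0 : R -> R)
    (r k N : nat) (X : nat -> R) (etah uh : R -> R -> R) : Prop :=
  (forall t, Icc 0 T t -> Sh r k N X (etah t) /\ Sh0 r k N X (uh t)) /\
  (exists etah_t uh_t : R -> R -> R,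
     (forall t x, Icc 0 T t -> Icc 0 1 x ->
        is_derive_on (Icc 0 T) (fun s => etah s x) t (etah_t t x) /\
        is_derive_on (Icc 0 T) (fun s => uh s x) t (uh_t t x)) /\
     (forall t, Icc 0 T t -> forall phi, Sh r k N X phi ->
        inner (etah_t t) phi
        + inner (Derive (fun y => etah t y * uh t y)) phi
        + inner (Derive (fun y => beta y * uh t y)) phi = 0) /\
     (forall t, Icc 0 T t -> forall chi, Sh0 r k N X chi ->
        inner (uh_t t) chi
        + inner (Derive (etah t)) chi
        + inner (fun x => uh t x * Derive (uh t) x) chi = 0)) /\
  is_L2_projection (Sh r k N X) eta0 (etah 0) /\
  is_L2_projection (Sh0 r k N X) u0 (uh 0).

(* Main.v *)
Require Import Defs.
From Stdlib Require Import Reals Arith Lra Lia List Classical IndefiniteDescription.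
From Coquelicot Require Import Coquelicot.
Open Scope R_scope.

(** Energy method. Write [w = beta + eta], let [theta] and [xi] be the differences
    between the L^2-projections of [eta], [u] and the discrete [eta_h], [u_h], and
    test the two equations with [theta] and with the projection of [w xi]. The
    critical terms combine to the exact derivative of [w xi theta], whose integral
    vanishes because [xi] is 0 at both ends. Replacing [w xi] by its projection
    costs one power of [h] by super-approximation, which pays for the inverse
    inequality applied to [theta_x]; the projection errors contribute [h^(r-1)].
    Gronwall's lemma for the weighted energy [|theta|^2 + (w xi, xi)] then gives
    the rate as long as [xi_x] stays bounded. By an inverse inequality this holds
    while the energy is at most a multiple of [h^3], and since [2 (r - 1) > 3] for
    [r >= 3] the estimate itself is stronger when [h] is small, so a continuity
    argument reaches the time [T]. Existence comes from Picard iteration for the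
    quadratic coordinate system with clamped arguments, the clamp being inactive
    in view of the error bound.

    Super-approximation and approximation for every smoothness [k] come from one
    construction: a discontinuous piecewise polynomial with small jumps is made
    smooth by spreading each jump over [r] consecutive knots with truncated
    powers of degree [r - 1]. *)

(** * Finite sums *)

(** The weight w symmetrizes the hyperbolic system: multiplied by w, the coupling in the second
    equation matches that in the first, and w > 0 makes the energy equivalent to the squared L^2
    norm. The price is that w xi is not a spline.

    The threshold h^3 comes from the inverse inequality from L^2 to the maximum of a derivative,
    which costs h^(-3/2). The energy starts at 0 because the discrete initial values are the
    projections themselves, so Gronwall's lemma leaves the projection error alone.

    Both unknowns form one element of L^2 x L^2, where an orthonormal basis of the spline pairs is
    built; projections and the coordinate system then need no mass matrix. A discrete solution has
    time derivatives only pointwise in x, so its coordinates are expressed through point values and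
    not through integrals before they are differentiated.

    Truncated powers of degree r - 1 belong to the spline space for every admissible k, and r knots
    are the fewest at which they can reproduce all polynomials of degree r - 1. The spreading runs
    to the right, so near the right end there is no room for it, and the data are frozen there. *)

Fixpoint bsum (n : nat) (f : nat -> R) : R :=
  match n with
  | O => 0
  | S m => bsum m f + f m
  end.

Lemma bsum_ext n f g :
  (forall i, (i < n)%nat -> f i = g i) -> bsum n f = bsum n g.
Proof.
  induction n as [|n IH]; simpl; intros H; [easy|].
  rewrite IH, H; auto.
Qed.

Lemma bsum_0 n f : (forall i, (i < n)%nat -> f i = 0) -> bsum n f = 0.
Proof.
  induction n as [|n IH]; simpl; intros H; [easy|].
  rewrite IH, H by auto; lra.
Qed.

Lemma bsum_plus n f g : bsum n (fun i => f i + g i) = bsum n f + bsum n g.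
Proof. induction n as [|n IH]; simpl; [|rewrite IH]; ring. Qed.

Lemma bsum_minus n f g : bsum n (fun i => f i - g i) = bsum n f - bsum n g.
Proof. induction n as [|n IH]; simpl; [|rewrite IH]; ring. Qed.

Lemma bsum_scal_l n c f : bsum n (fun i => c * f i) = c * bsum n f.
Proof. induction n as [|n IH]; simpl; [|rewrite IH]; ring. Qed.

Lemma bsum_scal_r n c f : bsum n (fun i => f i * c) = bsum n f * c.
Proof. induction n as [|n IH]; simpl; [|rewrite IH]; ring. Qed.

Lemma bsum_const n c : bsum n (fun _ => c) = INR n * c.
Proof. induction n as [|n IH]; [simpl; ring|]. rewrite S_INR; simpl; rewrite IH; ring. Qed.

Lemma bsum_le n f g :
  (forall i, (i < n)%nat -> f i <= g i) -> bsum n f <= bsum n g.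
Proof.
  induction n as [|n IH]; simpl; intros H; [lra|].
  apply Rplus_le_compat; auto.
Qed.

Lemma bsum_nonneg n f : (forall i, (i < n)%nat -> 0 <= f i) -> 0 <= bsum n f.
Proof.
  intros H; rewrite <- (bsum_0 n (fun _ => 0)) by easy.
  now apply bsum_le.
Qed.

Lemma bsum_term_le n f i :
  (forall j, (j < n)%nat -> 0 <= f j) -> (i < n)%nat -> f i <= bsum n f.
Proof.
  induction n as [|n IH]; simpl; intros H Hi; [lia|].
  assert (H0 : 0 <= bsum n f) by (apply bsum_nonneg; auto).
  destruct (Nat.eq_dec i n) as [->|Hn]; [lra|].
  assert (f i <= bsum n f) by (apply IH; auto; lia).
  specialize (H n (Nat.lt_succ_diag_r n)); lra.
Qed.

Lemma bsum_Rabs n f : Rabs (bsum n f) <= bsum n (fun i => Rabs (f i)).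
Proof.
  induction n as [|n IH]; simpl; [rewrite Rabs_R0; lra|].
  eapply Rle_trans; [apply Rabs_triang|lra].
Qed.

Lemma bsum_swap n m f :
  bsum n (fun i => bsum m (fun j => f i j)) =
  bsum m (fun j => bsum n (fun i => f i j)).
Proof.
  induction n as [|n IH]; simpl.
  - now rewrite bsum_0.
  - now rewrite IH, <- bsum_plus.
Qed.

Definition kron (i j : nat) : R := if Nat.eq_dec i j then 1 else 0.

Lemma bsum_kron n f i : (i < n)%nat -> bsum n (fun j => f j * kron i j) = f i.
Proof.
  unfold kron; induction n as [|n IH]; simpl; intros Hi; [lia|].
  destruct (Nat.eq_dec i n) as [->|Hn].
  - rewrite bsum_0; [ring|]. intros j Hj.
    destruct (Nat.eq_dec n j); [lia|ring].
  - rewrite IH by lia; ring.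
Qed.

(** Cauchy-Schwarz against the constant vector 1. In the inductive step 2 a b <= s + N b^2 follows,
    after multiplication by N, from (a - N b)^2 >= 0 and the hypothesis a^2 <= N s; this is why N =
    0 is split off. *)
Lemma bsum_sqr_le n f : bsum n f * bsum n f <= INR n * bsum n (fun i => f i * f i).
Proof.
  induction n as [|n IH]; [simpl; lra|].
  rewrite S_INR; simpl.
  destruct n as [|n]; [simpl; lra|].
  assert (Hn : 0 < INR (S n)) by (apply lt_0_INR; lia).
  set (a := bsum (S n) f) in *; set (N := INR (S n)) in *.
  set (s := bsum (S n) (fun i => f i * f i)) in *; set (b := f (S n)).
  assert (H : 2 * a * b <= s + N * (b * b)).
  { apply Rmult_le_reg_l with N; [easy|].
    assert (0 <= (a - N * b) * (a - N * b)) by apply Rle_0_sqr. nra. }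
  nra.
Qed.

Lemma bsum_shift n f : bsum (S n) f = f O + bsum n (fun i => f (S i)).
Proof.
  induction n as [|n IH]; [simpl; ring|].
  change (bsum (S (S n)) f) with (bsum (S n) f + f (S n)).
  rewrite IH; simpl; ring.
Qed.

Lemma bsum_continuous n (f : nat -> R -> R) x :
  (forall i, (i < n)%nat -> continuous (f i) x) ->
  continuous (fun y => bsum n (fun i => f i y)) x.
Proof.
  induction n as [|n IH]; simpl; intros H.
  - apply continuous_const.
  - apply (continuous_plus (fun y => bsum n (fun i => f i y)) (f n)); auto.
Qed.

Lemma bsum_is_derive n (f : nat -> R -> R) (df : nat -> R) x :
  (forall i, (i < n)%nat -> is_derive (f i) x (df i)) ->
  is_derive (fun y => bsum n (fun i => f i y)) x (bsum n df).
Proof.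
  induction n as [|n IH]; simpl; intros H.
  - apply (is_derive_const 0 x).
  - apply (is_derive_plus (fun y => bsum n (fun i => f i y)) (f n)); auto.
Qed.

(** * One-sided continuity through clamping *)

(** Retraction of R onto [a, b], 1-Lipschitz. It extends functions on an interval to all of R by
    constants, and later truncates the coordinates in the differential equation. *)
Definition clamp (a b x : R) : R := Rmax a (Rmin b x).

Lemma clamp_Icc a b x : a <= b -> Icc a b (clamp a b x).
Proof.
  unfold clamp, Icc, Rmax, Rmin; intros.
  destruct (Rle_dec b x); destruct (Rle_dec a _); lra.
Qed.

Lemma clamp_id a b x : Icc a b x -> clamp a b x = x.
Proof.
  unfold clamp, Icc, Rmax, Rmin; intros.
  destruct (Rle_dec b x); destruct (Rle_dec a _); lra.
Qed.

Lemma clamp_lipschitz a b x y : Rabs (clamp a b x - clamp a b y) <= Rabs (x - y).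
Proof.
  unfold clamp, Rmax, Rmin.
  repeat destruct (Rle_dec _ _); apply Rabs_le; unfold Rabs; destruct (Rcase_abs _); lra.
Qed.

Lemma clamp_continuous a b x : continuous (clamp a b) x.
Proof.
  intros P [e He]; exists e; intros y Hy; apply He.
  eapply Rle_lt_trans; [apply clamp_lipschitz|exact Hy].
Qed.

(** Continuity on [a, b] encoded as continuity everywhere of the constant extension, so that the
    pointwise lemmas for functions on R apply without the filter [within]. For a <= b it is
    equivalent to [continuous_on (Icc a b) f]. *)
Definition ccont (a b : R) (f : R -> R) : Prop :=
  forall x, continuous (fun y => f (clamp a b y)) x.

Lemma continuous_on_ccont a b f : a <= b -> continuous_on (Icc a b) f -> ccont a b f.
Proof.
  intros Hab H x.
  apply (filterlim_comp _ _ _ (clamp a b) f _ (within (Icc a b) (locally (clamp a b x)))).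
  - intros P HP.
    assert (H1 := clamp_continuous a b x _ HP).
    unfold filtermap in *.
    eapply filter_imp; [|exact H1]. intros y Hy. apply Hy. now apply clamp_Icc.
  - apply H. now apply clamp_Icc.
Qed.

Lemma ccont_continuous_on a b f : ccont a b f -> continuous_on (Icc a b) f.
Proof.
  intros H x Hx P HP.
  specialize (H x). unfold continuous in H. rewrite (clamp_id a b x Hx) in H.
  specialize (H P HP). unfold filtermap, within in *.
  eapply filter_imp; [|exact H]. intros y Hy Hi. simpl in Hy. now rewrite clamp_id in Hy.
Qed.

Lemma continuous_ccont a b f : a <= b ->
  (forall x, Icc a b x -> continuous f x) -> ccont a b f.
Proof.
  intros Hab H x.
  apply (continuous_comp (clamp a b) f); [apply clamp_continuous|].
  now apply H, clamp_Icc.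
Qed.

Lemma locally_Ioo a b x : a < x < b -> locally x (fun y => a < y < b).
Proof.
  intros H.
  assert (He : 0 < Rmin (x - a) (b - x)) by (apply Rmin_pos; lra).
  exists (mkposreal _ He); intros y Hy. unfold ball in Hy; simpl in Hy.
  unfold AbsRing_ball, abs, minus, plus, opp in Hy; simpl in Hy.
  assert (Rmin (x - a) (b - x) <= x - a) by apply Rmin_l.
  assert (Rmin (x - a) (b - x) <= b - x) by apply Rmin_r.
  apply Rabs_lt_between in Hy. lra.
Qed.

Lemma ccont_ext a b f g : a <= b ->
  (forall x, Icc a b x -> f x = g x) -> ccont a b f -> ccont a b g.
Proof.
  intros Hab H Hf x. apply (continuous_ext (fun y => f (clamp a b y))); [|apply Hf].
  intros y. now apply H, clamp_Icc.
Qed.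

Lemma ccont_const a b c : ccont a b (fun _ => c).
Proof. intros x; apply continuous_const. Qed.

Lemma ccont_plus a b f g : ccont a b f -> ccont a b g -> ccont a b (fun x => f x + g x).
Proof. intros Hf Hg x. apply (continuous_plus (fun y => f (clamp a b y)) (fun y => g (clamp a b y))); auto. Qed.

Lemma ccont_minus a b f g : ccont a b f -> ccont a b g -> ccont a b (fun x => f x - g x).
Proof. intros Hf Hg x. apply (continuous_minus (fun y => f (clamp a b y)) (fun y => g (clamp a b y))); auto. Qed.

Lemma ccont_mult a b f g : ccont a b f -> ccont a b g -> ccont a b (fun x => f x * g x).
Proof. intros Hf Hg x. apply (continuous_mult (fun y => f (clamp a b y)) (fun y => g (clamp a b y))); auto. Qed.

Lemma ccont_bsum a b n (f : nat -> R -> R) :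
  (forall i, (i < n)%nat -> ccont a b (f i)) -> ccont a b (fun x => bsum n (fun i => f i x)).
Proof. intros H x. apply (bsum_continuous n (fun i y => f i (clamp a b y))). intros i Hi; now apply H. Qed.

Lemma ccont_sub a b c d f : c <= d -> a <= c -> d <= b -> ccont a b f -> ccont c d f.
Proof.
  intros Hcd Hac Hdb H. apply continuous_on_ccont; [easy|].
  intros x Hx. assert (H1 := ccont_continuous_on _ _ _ H x).
  intros P HP. assert (Hx' : Icc a b x) by (unfold Icc in *; lra).
  specialize (H1 Hx' P HP). unfold filtermap, within in *.
  eapply filter_imp; [|exact H1]. intros y Hy Hi. apply Hy. unfold Icc in *; lra.
Qed.

Lemma ccont_bounded a b f : a <= b -> ccont a b f ->
  exists M, 0 < M /\ forall x, Icc a b x -> Rabs (f x) <= M.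
Proof.
  intros Hab H.
  destruct (bounded_continuity (fun y => f (clamp a b y)) a b) as [M HM].
  - intros x _; apply H.
  - exists (Rmax M 1). split; [eapply Rlt_le_trans; [|apply Rmax_r]; lra|].
    intros x Hx. eapply Rle_trans; [|apply Rmax_l].
    specialize (HM x Hx). rewrite clamp_id in HM by easy. now left.
Qed.

(** At the end points only relative continuity is available, so the standard theorem is applied to
    the clamped function, which agrees with [f] near every interior point. *)
Lemma mvt a b f df : a < b -> ccont a b f ->
  (forall x, a < x < b -> is_derive f x (df x)) ->
  exists c, a < c < b /\ f b - f a = df c * (b - a).
Proof.
  intros Hab Hc Hd.
  set (g := fun y => f (clamp a b y)).
  assert (Hg : forall x, a < x < b -> is_derive g x (df x)).
  { intros x Hx. apply (is_derive_ext_loc f); [|auto].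
    eapply filter_imp; [|apply (locally_Ioo a b x Hx)].
    intros y Hy; unfold g. now rewrite clamp_id by (unfold Icc; lra). }
  assert (pr1 : forall c, a < c < b -> derivable_pt g c).
  { intros c Hx. exists (df c). apply is_derive_Reals; auto. }
  destruct (MVT g id a b pr1 (fun c _ => derivable_pt_id c) Hab) as [c [Hcc H]].
  - intros c _. apply continuity_pt_filterlim, Hc.
  - intros c _. apply derivable_continuous_pt, derivable_pt_id.
  - exists c. split; [easy|].
    rewrite derive_pt_id in H. unfold id in H.
    assert (E : derive_pt g c (pr1 c Hcc) = df c).
    { apply derive_pt_eq_0, is_derive_Reals; auto. }
    rewrite E in H. unfold g in H.
    rewrite !clamp_id in H by (unfold Icc; lra). lra.
Qed.

Lemma mvt_lipschitz a b f df M : ccont a b f ->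
  (forall x, a < x < b -> is_derive f x (df x)) ->
  (forall x, a < x < b -> Rabs (df x) <= M) ->
  forall x y, Icc a b x -> Icc a b y -> Rabs (f x - f y) <= M * Rabs (x - y).
Proof.
  intros Hc Hd HM.
  assert (W : forall x y, Icc a b x -> Icc a b y -> x < y -> Rabs (f x - f y) <= M * Rabs (x - y)).
  { intros x y Hx Hy Hxy. unfold Icc in *.
    destruct (mvt x y f df) as [c [Hcc E]]; [easy| | |].
    - apply (ccont_sub a b); lra || easy.
    - intros z Hz; apply Hd; lra.
    - rewrite Rabs_minus_sym, E, Rabs_mult, (Rabs_minus_sym x y).
      apply Rmult_le_compat_r; [apply Rabs_pos|]. apply HM; lra. }
  intros x y Hx Hy. destruct (Rtotal_order x y) as [H|[->|H]].
  - now apply W.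
  - rewrite !Rminus_diag, Rabs_R0; lra.
  - rewrite Rabs_minus_sym, (Rabs_minus_sym x y). now apply W.
Qed.

(** * Relative derivatives *)

(** [filterdiff] quantifies over all limits of its filter; [D x] makes [x] the only limit of the
    [within] filter, and an epsilon-delta statement remains. *)
Lemma is_derive_on_eps (D : R -> Prop) f x l : D x ->
  is_derive_on D f x l <->
  forall eps : posreal, exists d : posreal, forall y, D y -> Rabs (y - x) < d ->
    Rabs (f y - f x - (y - x) * l) <= eps * Rabs (y - x).
Proof.
  intros Dx. split.
  - intros [_ H] eps.
    assert (Hl : is_filter_lim (within D (locally x)) x).
    { intros P HP. unfold within. eapply filter_imp; [|exact HP]. auto. }
    destruct (H x Hl eps) as [d Hd]. exists d. intros y Dy Hy. exact (Hd y Hy Dy).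
  - intros H. split; [exact (@is_linear_scal_l R_AbsRing R_NormedModule l)|].
    intros y Hy eps.
    assert (E : x = y).
    { apply NNPP; intros Hn.
      assert (He : 0 < Rabs (x - y)) by (apply Rabs_pos_lt; lra).
      destruct (Hy (ball y (mkposreal _ He)) (locally_ball _ _)) as [d Hd].
      specialize (Hd x (ball_center _ _) Dx).
      unfold ball in Hd; simpl in Hd. unfold AbsRing_ball, abs, minus, plus, opp in Hd; simpl in Hd.
      unfold Rminus in Hd; lra. }
    subst y. destruct (H eps) as [d Hd]. exists d. intros y Hb Dy. exact (Hd y Dy Hb).
Qed.

Lemma is_derive_on_of_is_derive (D : R -> Prop) f x l : D x -> is_derive f x l -> is_derive_on D f x l.
Proof.
  intros Dx H. apply is_derive_on_eps; [easy|]. intros eps.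
  destruct H as [_ H].
  destruct (H x (fun P HP => HP) eps) as [d Hd].
  exists d. intros y _ Hy. exact (Hd y Hy).
Qed.

Lemma is_derive_of_is_derive_on a b f x l :
  a < x < b -> is_derive_on (Icc a b) f x l -> is_derive f x l.
Proof.
  intros Hx H. split; [exact (@is_linear_scal_l R_AbsRing R_NormedModule l)|].
  intros y Hy. apply (@is_filter_lim_locally_unique R_AbsRing R_NormedModule) in Hy. subst y. intros eps.
  assert (Hx' : Icc a b x) by (unfold Icc; lra).
  destruct (proj1 (is_derive_on_eps _ f x l Hx') H eps) as [d Hd].
  assert (H1 : locally x (fun y => Rabs (y - x) < d)) by (exists d; auto).
  eapply filter_imp; [|apply (filter_and _ _ H1 (locally_Ioo a b x Hx))].
  intros y [Hy1 Hy2]. apply Hd; [unfold Icc; lra|easy].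
Qed.

Lemma is_derive_on_continuous_on (D : R -> Prop) f :
  (forall x, D x -> exists l, is_derive_on D f x l) -> continuous_on D f.
Proof.
  intros H x Dx. destruct (H x Dx) as [l Hl].
  apply filterlim_locally. intros eps.
  rewrite is_derive_on_eps in Hl by easy.
  destruct (Hl (mkposreal _ Rlt_0_1)) as [d Hd]. simpl in Hd.
  assert (Hm : 0 < Rmin d (eps / (1 + Rabs l))).
  { apply Rmin_pos; [apply cond_pos|]. apply Rdiv_lt_0_compat; [apply cond_pos|].
    assert (0 <= Rabs l) by apply Rabs_pos; lra. }
  exists (mkposreal _ Hm). intros y Hy Dy.
  change (Rabs (y - x) < Rmin d (eps / (1 + Rabs l))) in Hy.
  change (Rabs (f y - f x) < eps).
  assert (Hy1 : Rabs (y - x) < d) by (eapply Rlt_le_trans; [exact Hy|apply Rmin_l]).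
  assert (Hy2 : Rabs (y - x) < eps / (1 + Rabs l)) by (eapply Rlt_le_trans; [exact Hy|apply Rmin_r]).
  specialize (Hd y Dy Hy1).
  assert (Hp : 0 < 1 + Rabs l) by (assert (0 <= Rabs l) by apply Rabs_pos; lra).
  apply (Rmult_lt_compat_l (1 + Rabs l)) in Hy2; [|easy].
  replace ((1 + Rabs l) * (eps / (1 + Rabs l))) with (pos eps) in Hy2 by (field; lra).
  replace (f y - f x) with ((f y - f x - (y - x) * l) + (y - x) * l) by ring.
  eapply Rle_lt_trans; [apply Rabs_triang|]. rewrite Rabs_mult. nra.
Qed.

Lemma is_derive_on_ccont a b f df : a <= b ->
  (forall x, Icc a b x -> is_derive_on (Icc a b) f x (df x)) -> ccont a b f.
Proof.
  intros Hab H. apply continuous_on_ccont; [easy|].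
  apply is_derive_on_continuous_on. intros x Hx; exists (df x); auto.
Qed.

Lemma is_derive_on_unique a b f x l l' : a < b -> Icc a b x ->
  is_derive_on (Icc a b) f x l -> is_derive_on (Icc a b) f x l' -> l = l'.
Proof.
  intros Hab Hx H H'.
  rewrite is_derive_on_eps in H, H' by easy.
  apply NNPP; intros Hn.
  assert (He : 0 < Rabs (l - l') / 3).
  { assert (0 < Rabs (l - l')) by (apply Rabs_pos_lt; lra); lra. }
  destruct (H (mkposreal _ He)) as [d Hd], (H' (mkposreal _ He)) as [d' Hd']. simpl in *.
  (* A point of the interval other than [x], within both radii: the step goes towards the half where
     at least (b - a) / 2 of room is left. *)
  assert (Hy : exists y, Icc a b y /\ Rabs (y - x) < d /\ Rabs (y - x) < d' /\ 0 < Rabs (y - x)).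
  { set (s := Rmin (Rmin (d / 2) (d' / 2)) ((b - a) / 2)).
    assert (Hs : 0 < s).
    { unfold s. assert (0 < d) by apply cond_pos. assert (0 < d') by apply cond_pos.
      repeat apply Rmin_pos; lra. }
    assert (s <= d / 2) by (eapply Rle_trans; [apply Rmin_l|apply Rmin_l]).
    assert (s <= d' / 2) by (eapply Rle_trans; [apply Rmin_l|apply Rmin_r]).
    assert (s <= (b - a) / 2) by apply Rmin_r.
    unfold Icc in *.
    destruct (Rle_dec x ((a + b) / 2)) as [Hm|Hm].
    - exists (x + s). replace (x + s - x) with s by ring. rewrite Rabs_pos_eq by lra.
      repeat split; lra.
    - exists (x - s). replace (x - s - x) with (- s) by ring.
      rewrite Rabs_Ropp, Rabs_pos_eq by lra. repeat split; lra. }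
  destruct Hy as [y [Hy [H1 [H2 H3]]]].
  specialize (Hd y Hy H1); specialize (Hd' y Hy H2).
  assert (Rabs ((y - x) * (l - l')) <= 2 * (Rabs (l - l') / 3) * Rabs (y - x)).
  { replace ((y - x) * (l - l')) with
      (- (f y - f x - (y - x) * l) + (f y - f x - (y - x) * l')) by ring.
    eapply Rle_trans; [apply Rabs_triang|]. rewrite Rabs_Ropp. lra. }
  rewrite Rabs_mult in H0. nra.
Qed.

Lemma is_derive_on_sub (D D' : R -> Prop) f x l :
  (forall y, D' y -> D y) -> D' x -> is_derive_on D f x l -> is_derive_on D' f x l.
Proof.
  intros HD Dx H. rewrite is_derive_on_eps in * by auto.
  intros eps; destruct (H eps) as [d Hd]; exists d; auto.
Qed.

Lemma is_derive_on_ext (D : R -> Prop) f g x l :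
  (forall y, D y -> f y = g y) -> D x -> is_derive_on D f x l -> is_derive_on D g x l.
Proof.
  intros HD Dx H. rewrite is_derive_on_eps in * by auto.
  intros eps; destruct (H eps) as [d Hd]; exists d; intros y Dy Hy.
  rewrite <- !HD by auto. auto.
Qed.

Lemma is_derive_on_lin (D : R -> Prop) f g x l l' a b : D x ->
  is_derive_on D f x l -> is_derive_on D g x l' ->
  is_derive_on D (fun y => a * f y + b * g y) x (a * l + b * l').
Proof.
  intros Dx H H'. rewrite is_derive_on_eps in * by auto. intros eps.
  set (k := 1 + Rabs a + Rabs b).
  assert (Hk : 0 < k) by (unfold k; generalize (Rabs_pos a) (Rabs_pos b); lra).
  assert (He : 0 < eps / k) by (apply Rdiv_lt_0_compat; [apply cond_pos|easy]).
  destruct (H (mkposreal _ He)) as [d Hd], (H' (mkposreal _ He)) as [d' Hd'].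
  assert (Hm : 0 < Rmin d d') by (apply Rmin_pos; apply cond_pos).
  exists (mkposreal _ Hm). simpl in *. intros y Dy Hy.
  specialize (Hd y Dy (Rlt_le_trans _ _ _ Hy (Rmin_l _ _))).
  specialize (Hd' y Dy (Rlt_le_trans _ _ _ Hy (Rmin_r _ _))).
  replace (_ - _ - _) with
    (a * (f y - f x - (y - x) * l) + b * (g y - g x - (y - x) * l')) by ring.
  eapply Rle_trans; [apply Rabs_triang|]. rewrite !Rabs_mult.
  replace (eps * Rabs (y - x)) with (k * (eps / k * Rabs (y - x))) by (field; lra).
  set (Z := eps / k * Rabs (y - x)) in *.
  assert (0 <= Z) by (apply Rmult_le_pos; [lra|apply Rabs_pos]).
  unfold k. generalize (Rabs_pos a) (Rabs_pos b). intros. nra.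
Qed.

(** * Integrals of piecewise continuous functions *)

(* Nodes are numbered from 0 here: [Y j] is the paper's x_(j+1). *)
Definition grid (N : nat) (Y : nat -> R) : Prop :=
  Y O = 0 /\ Y N = 1 /\ forall j, (j < N)%nat -> Y j < Y (S j).

Definition inner_pt (N : nat) (Y : nat -> R) (x : R) : Prop :=
  exists j, (j < N)%nat /\ Y j < x < Y (S j).

(** Agreement with a function continuous on all of R gives integrability up to the nodes and leaves
    the values at the nodes free, as befits the [Derive] of a spline with kinks. *)
Definition pc (N : nat) (Y : nat -> R) (f : R -> R) : Prop :=
  forall j, (j < N)%nat -> exists g : R -> R,
    (forall x, continuous g x) /\ forall x, Y j < x < Y (S j) -> f x = g x.

Notation I f := (RInt f 0 1).

Lemma grid_le N Y i j : grid N Y -> (i <= j <= N)%nat -> Y i <= Y j.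
Proof.
  intros [_ [_ H]] [Hi Hj]. induction j as [|j IH].
  - replace i with O by lia; lra.
  - destruct (Nat.eq_dec i (S j)) as [->|Hn]; [lra|].
    apply Rle_trans with (Y j); [apply IH; lia|]. left; apply H; lia.
Qed.

Lemma grid_01 N Y j : grid N Y -> (j <= N)%nat -> 0 <= Y j <= 1.
Proof.
  intros H Hj. assert (H' := H). destruct H' as [H0 [H1 _]].
  rewrite <- H0 at 1. rewrite <- H1. split; apply (grid_le N); auto; lia.
Qed.

Lemma grid_locate N Y x : grid N Y -> Icc 0 1 x -> exists j, (j < N)%nat /\ Y j <= x <= Y (S j).
Proof.
  intros [H0 [H1 _]] [Hx0 Hx1].
  assert (W : forall m, x <= Y m -> (exists j, (j < m)%nat /\ Y j <= x <= Y (S j)) \/ (m = O)).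
  { induction m as [|m IH]; intros Hm; [now right|left].
    destruct (Rle_dec x (Y m)) as [Hl|Hl].
    - destruct (IH Hl) as [[j [Hj Hj']]| ->].
      + exists j; split; [lia|easy].
      + exists O; split; [lia|]. lra.
    - exists m; split; [lia|lra]. }
  destruct (W N) as [H| ->]; [lra|easy|]. lra.
Qed.

Lemma inner_pt_01 N Y x : grid N Y -> inner_pt N Y x -> 0 < x < 1.
Proof.
  intros HG [j [Hj Hx]].
  assert (0 <= Y j <= 1) by (apply (grid_01 N); auto; lia).
  assert (0 <= Y (S j) <= 1) by (apply (grid_01 N); auto; lia). lra.
Qed.

Lemma inner_pt_locally N Y x : inner_pt N Y x -> locally x (inner_pt N Y).
Proof.
  intros [j [Hj Hx]]. eapply filter_imp; [|apply (locally_Ioo _ _ _ Hx)].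
  intros y Hy; exists j; auto.
Qed.

Section Pc.
Context {N : nat} {Y : nat -> R}.

Lemma pc_ext f g : (forall x, inner_pt N Y x -> f x = g x) -> pc N Y f -> pc N Y g.
Proof.
  intros H Hf j Hj. destruct (Hf j Hj) as [u [Hu E]]. exists u; split; [easy|].
  intros x Hx. rewrite <- H; auto. exists j; auto.
Qed.

Lemma pc_continuous f : (forall x, continuous f x) -> pc N Y f.
Proof. intros H j _; exists f; auto. Qed.

Lemma pc_const c : pc N Y (fun _ => c).
Proof. apply pc_continuous; intros; apply continuous_const. Qed.

Lemma pc_plus f g : pc N Y f -> pc N Y g -> pc N Y (fun x => f x + g x).
Proof.
  intros Hf Hg j Hj. destruct (Hf j Hj) as [u [Hu E]], (Hg j Hj) as [v [Hv F]].
  exists (fun x => u x + v x); split.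
  - intros x; apply (continuous_plus u v); auto.
  - intros x Hx; now rewrite E, F.
Qed.

Lemma pc_mult f g : pc N Y f -> pc N Y g -> pc N Y (fun x => f x * g x).
Proof.
  intros Hf Hg j Hj. destruct (Hf j Hj) as [u [Hu E]], (Hg j Hj) as [v [Hv F]].
  exists (fun x => u x * v x); split.
  - intros x; apply (continuous_mult u v); auto.
  - intros x Hx; now rewrite E, F.
Qed.

Lemma pc_opp f : pc N Y f -> pc N Y (fun x => - f x).
Proof.
  intros Hf. apply (pc_ext (fun x => -1 * f x)); [intros; ring|].
  apply pc_mult; auto using pc_const.
Qed.

Lemma pc_minus f g : pc N Y f -> pc N Y g -> pc N Y (fun x => f x - g x).
Proof. intros Hf Hg. apply (pc_plus f (fun x => - g x)); auto using pc_opp. Qed.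

Lemma pc_bsum n (f : nat -> R -> R) :
  (forall i, (i < n)%nat -> pc N Y (f i)) -> pc N Y (fun x => bsum n (fun i => f i x)).
Proof.
  induction n as [|n IH]; simpl; intros H; [apply pc_const|].
  apply (pc_plus (fun x => bsum n (fun i => f i x)) (f n)); auto.
Qed.

Context (HG : grid N Y).

Lemma pc_ccont f : ccont 0 1 f -> pc N Y f.
Proof.
  intros H j Hj. exists (fun x => f (clamp 0 1 x)); split; [exact H|].
  intros x Hx. rewrite clamp_id; [easy|].
  assert (0 < x < 1) by (apply (inner_pt_01 N Y); auto; exists j; auto). unfold Icc; lra.
Qed.

Lemma pc_ex_RInt_piece f j : pc N Y f -> (j < N)%nat -> ex_RInt f (Y j) (Y (S j)).
Proof.
  intros Hf Hj. destruct (Hf j Hj) as [g [Hg E]].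
  assert (Y j < Y (S j)) by (apply HG; lia).
  apply (ex_RInt_ext g).
  - intros x Hx. rewrite Rmin_left, Rmax_right in Hx by lra. now rewrite E.
  - apply (ex_RInt_continuous g); auto.
Qed.

Lemma pc_RInt_bsum f m : pc N Y f -> (m <= N)%nat ->
  is_RInt f 0 (Y m) (bsum m (fun j => RInt f (Y j) (Y (S j)))).
Proof.
  intros Hf. induction m as [|m IH]; intros Hm; simpl.
  - replace (Y O) with 0 by (symmetry; apply HG). apply (is_RInt_point f 0).
  - apply (is_RInt_Chasles f 0 (Y m)); [apply IH; lia|].
    apply (@RInt_correct R_CompleteNormedModule). apply pc_ex_RInt_piece; auto.
Qed.

Lemma pc_ex_RInt f : pc N Y f -> ex_RInt f 0 1.
Proof.
  intros Hf. exists (bsum N (fun j => RInt f (Y j) (Y (S j)))).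
  replace 1 with (Y N) by apply HG. now apply pc_RInt_bsum.
Qed.

Lemma pc_I_pieces f : pc N Y f -> I f = bsum N (fun j => RInt f (Y j) (Y (S j))).
Proof.
  intros Hf. apply is_RInt_unique.
  replace 1 with (Y N) by apply HG. now apply pc_RInt_bsum.
Qed.

Lemma I_le f g : pc N Y f -> pc N Y g ->
  (forall x, inner_pt N Y x -> f x <= g x) -> I f <= I g.
Proof.
  intros Hf Hg H. rewrite !pc_I_pieces by auto. apply bsum_le. intros j Hj.
  apply RInt_le; [left; apply HG; lia| | |]; auto using pc_ex_RInt_piece.
  intros x Hx; apply H; exists j; auto.
Qed.

Lemma I_ext f g : pc N Y f ->
  (forall x, inner_pt N Y x -> f x = g x) -> I f = I g.
Proof.
  intros Hf H. assert (Hg : pc N Y g) by (apply (pc_ext f); auto).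
  apply Rle_antisym; apply I_le; auto; intros x Hx; rewrite H; auto; lra.
Qed.

Lemma I_ge0 f : pc N Y f -> (forall x, inner_pt N Y x -> 0 <= f x) -> 0 <= I f.
Proof.
  intros Hf H.
  assert (E : I (fun _ => 0) = 0) by (rewrite RInt_const; exact (Rmult_0_r _)).
  apply Rle_trans with (1 := Req_le _ _ (eq_sym E)). apply I_le; auto using pc_const.
Qed.

Lemma I_plus f g : pc N Y f -> pc N Y g -> I (fun x => f x + g x) = I f + I g.
Proof. intros; apply (RInt_plus f g); now apply pc_ex_RInt. Qed.

Lemma I_minus f g : pc N Y f -> pc N Y g -> I (fun x => f x - g x) = I f - I g.
Proof. intros; apply (RInt_minus f g); now apply pc_ex_RInt. Qed.

Lemma I_scal c f : pc N Y f -> I (fun x => c * f x) = c * I f.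
Proof. intros; apply (RInt_scal f); now apply pc_ex_RInt. Qed.

Lemma I_bsum n (f : nat -> R -> R) : (forall i, (i < n)%nat -> pc N Y (f i)) ->
  I (fun x => bsum n (fun i => f i x)) = bsum n (fun i => I (f i)).
Proof.
  induction n as [|n IH]; simpl; intros H.
  - rewrite RInt_const. exact (Rmult_0_r _).
  - rewrite I_plus, IH; auto. apply pc_bsum; auto.
Qed.

Lemma I_bsum_mult n (c : nat -> R) (f : nat -> R -> R) g :
  (forall i, (i < n)%nat -> pc N Y (f i)) -> pc N Y g ->
  I (fun x => bsum n (fun i => c i * f i x) * g x) = bsum n (fun i => c i * I (fun x => f i x * g x)).
Proof.
  intros Hf Hg.
  rewrite (I_ext _ (fun x => bsum n (fun i => c i * (f i x * g x)))).
  - rewrite I_bsum; [|intros; apply pc_mult; auto using pc_const, pc_mult].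
    apply bsum_ext; intros. apply I_scal; auto using pc_mult.
  - apply pc_mult; [|easy]. apply pc_bsum; intros; apply pc_mult; auto using pc_const.
  - intros x _. rewrite <- bsum_scal_r. apply bsum_ext; intros; ring.
Qed.

(* Only the derivative at the inner points enters, so [f] may have kinks at the
   nodes. *)
Lemma I_derivative f df : ccont 0 1 f -> pc N Y df ->
  (forall x, inner_pt N Y x -> is_derive f x (df x)) -> I df = f 1 - f 0.
Proof.
  intros Hf Hdf H. rewrite pc_I_pieces by easy.
  assert (E : forall j, (j < N)%nat -> RInt df (Y j) (Y (S j)) = f (Y (S j)) - f (Y j)).
  { intros j Hj. destruct (Hdf j Hj) as [g [Hg Eg]].
    assert (Hy : Y j < Y (S j)) by (apply HG; lia).
    assert (0 <= Y j <= 1) by (apply (grid_01 N); auto; lia).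
    assert (0 <= Y (S j) <= 1) by (apply (grid_01 N); auto; lia).
    rewrite (RInt_ext df g) by (intros x Hx; rewrite Rmin_left, Rmax_right in Hx by lra; auto).
    assert (HD : forall x, is_derive (fun x => RInt g (Y j) x) x (g x)).
    { intros x. apply (is_derive_RInt g _ (Y j)); [|apply Hg].
      apply filter_forall. intros y. apply (@RInt_correct R_CompleteNormedModule).
      apply (ex_RInt_continuous g); auto. }
    (* The difference from the antiderivative of [g] has derivative 0 inside the piece and is
       continuous up to the nodes, so its end values coincide. *)
    destruct (mvt (Y j) (Y (S j)) (fun x => f x - RInt g (Y j) x) (fun x => df x - g x)) as [c [Hc Ec]].
    - easy.
    - apply ccont_minus; [apply (ccont_sub 0 1); auto; lra|].
      apply continuous_ccont; [lra|]. intros x _.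
      apply (ex_derive_continuous (fun x => RInt g (Y j) x)). eexists; apply HD.
    - intros x Hx. apply (is_derive_minus f); [apply H; exists j; auto|apply HD].
    - rewrite Eg in Ec by easy. rewrite RInt_point in Ec. change zero with 0 in Ec. lra. }
  rewrite (bsum_ext _ _ _ E).
  replace 1 with (Y N) by apply HG. replace 0 with (Y O) by apply HG.
  clear. generalize N as m; induction m as [|m IH]; simpl; [ring|]. rewrite IH; ring.
Qed.

(** * Piecewise continuously differentiable functions *)

(** The class in which integration by parts over [0, 1] works: continuity across the nodes removes
    the node terms. It contains the splines of every smoothness k, also k = 0. *)
Definition pc1 (f : R -> R) : Prop :=
  ccont 0 1 f /\ (forall x, inner_pt N Y x -> ex_derive f x) /\ pc N Y (Derive f).

Lemma pc1_pc f : pc1 f -> pc N Y f.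
Proof. intros H; apply pc_ccont, H. Qed.

Lemma pc1_Derive f : pc1 f -> pc N Y (Derive f).
Proof. intros H; apply H. Qed.

Lemma pc1_intro f df : ccont 0 1 f -> (forall x, inner_pt N Y x -> is_derive f x (df x)) ->
  pc N Y df -> pc1 f.
Proof.
  intros Hc Hd Hp. split; [easy|split].
  - intros x Hx; exists (df x); auto.
  - apply (pc_ext df); [|easy]. intros x Hx. symmetry. apply is_derive_unique; auto.
Qed.

Lemma pc1_is_derive f x : pc1 f -> inner_pt N Y x -> is_derive f x (Derive f x).
Proof. intros H Hx. apply Derive_correct. now apply H. Qed.

Lemma pc1_const c : pc1 (fun _ => c).
Proof.
  apply (pc1_intro _ (fun _ => 0)); auto using ccont_const, pc_const.
  intros x _; apply (is_derive_const c x).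
Qed.

Lemma is_derive_Rmult (f g : R -> R) x df dg :
  is_derive f x df -> is_derive g x dg -> is_derive (fun y => f y * g y) x (df * g x + f x * dg).
Proof. intros. apply (is_derive_mult f g); auto. intros; apply Rmult_comm. Qed.

Lemma pc1_plus f g : pc1 f -> pc1 g -> pc1 (fun x => f x + g x).
Proof.
  intros Hf Hg. apply (pc1_intro _ (fun x => Derive f x + Derive g x)).
  - apply ccont_plus; [apply Hf|apply Hg].
  - intros x Hx. apply (is_derive_plus f g); apply pc1_is_derive; auto.
  - apply pc_plus; auto using pc1_Derive.
Qed.

Lemma pc1_mult f g : pc1 f -> pc1 g -> pc1 (fun x => f x * g x).
Proof.
  intros Hf Hg. apply (pc1_intro _ (fun x => Derive f x * g x + f x * Derive g x)).
  - apply ccont_mult; [apply Hf|apply Hg].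
  - intros x Hx. apply is_derive_Rmult; apply pc1_is_derive; auto.
  - apply pc_plus; apply pc_mult; auto using pc1_Derive, pc1_pc.
Qed.

Lemma pc1_scal c f : pc1 f -> pc1 (fun x => c * f x).
Proof. intros Hf. apply pc1_mult; [apply pc1_const|easy]. Qed.

Lemma pc1_bsum n (f : nat -> R -> R) :
  (forall i, (i < n)%nat -> pc1 (f i)) -> pc1 (fun x => bsum n (fun i => f i x)).
Proof.
  induction n as [|n IH]; simpl; intros H; [apply pc1_const|].
  apply (pc1_plus (fun x => bsum n (fun i => f i x)) (f n)); auto.
Qed.

Lemma I_Derive f : pc1 f -> I (Derive f) = f 1 - f 0.
Proof.
  intros H. apply I_derivative; [apply H|apply H|].
  intros x Hx; now apply pc1_is_derive.
Qed.

Lemma Derive_ext_inner f g x : (forall y, Icc 0 1 y -> f y = g y) -> inner_pt N Y x ->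
  Derive f x = Derive g x.
Proof.
  intros H Hx. apply Derive_ext_loc.
  eapply filter_imp; [|apply (inner_pt_locally N Y x Hx)].
  intros y Hy. apply H. assert (H1 := inner_pt_01 N Y y HG Hy). unfold Icc; lra.
Qed.

(** A nonzero value inside makes the integral over a small neighbourhood positive. The end points
    are separate: by continuity a nonzero value there would persist at nearby interior points. *)
Lemma I_sqr_0 f : ccont 0 1 f -> I (fun x => f x * f x) = 0 -> forall x, Icc 0 1 x -> f x = 0.
Proof.
  intros Hf H0.
  set (g := fun x => f (clamp 0 1 x) * f (clamp 0 1 x)).
  assert (Hg : forall x, continuous g x).
  { intros x. apply (continuous_mult (fun x => f (clamp 0 1 x)) (fun x => f (clamp 0 1 x))); apply Hf. }
  assert (Hex : forall a b, ex_RInt g a b) by (intros; apply (ex_RInt_continuous g); auto).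
  assert (G0 : RInt g 0 1 = 0).
  { transitivity (I (fun x => f x * f x)); [|exact H0]. apply RInt_ext. intros x Hx. rewrite Rmin_left, Rmax_right in Hx by lra.
    unfold g. rewrite clamp_id; [easy|unfold Icc; lra]. }
  assert (Z : forall x, 0 < x < 1 -> f x = 0).
  { intros x Hx. apply NNPP; intros Hn.
    assert (Hp : 0 < g x).
    { unfold g. rewrite clamp_id by (unfold Icc; lra). apply Rsqr_pos_lt in Hn. exact Hn. }
    destruct (Hg x (fun z => 0 < z) (open_gt 0 _ Hp)) as [d Hd].
    set (s := Rmin (d / 2) (Rmin (x / 2) ((1 - x) / 2))).
    assert (0 < d) by apply cond_pos.
    assert (Hs : 0 < s) by (unfold s; repeat apply Rmin_pos; lra).
    assert (s <= d / 2) by apply Rmin_l.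
    assert (s <= x / 2) by (eapply Rle_trans; [apply Rmin_r|apply Rmin_l]).
    assert (s <= (1 - x) / 2) by (eapply Rle_trans; [apply Rmin_r|apply Rmin_r]).
    assert (Hpos : 0 < RInt g (x - s) (x + s)).
    { apply RInt_gt_0; [lra| |auto]. intros y Hy. apply Hd.
      unfold ball; simpl. unfold AbsRing_ball, abs, minus, plus, opp; simpl.
      apply Rabs_lt_between. lra. }
    assert (J1 : 0 <= RInt g 0 (x - s)) by (apply RInt_ge_0; [lra|auto|intros; apply Rle_0_sqr]).
    assert (J2 : 0 <= RInt g (x + s) 1) by (apply RInt_ge_0; [lra|auto|intros; apply Rle_0_sqr]).
    assert (E1 := RInt_Chasles g 0 (x - s) 1 (Hex _ _) (Hex _ _)).
    assert (E2 := RInt_Chasles g (x - s) (x + s) 1 (Hex _ _) (Hex _ _)).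
    unfold plus in E1, E2; simpl in E1, E2. lra. }
  assert (W : forall x, (x = 0 \/ x = 1) -> f x = 0).
  { intros x Hx. apply NNPP; intros Hn.
    assert (Hx1 : Icc 0 1 x) by (unfold Icc; lra).
    assert (Hfx := Hf x). unfold continuous in Hfx. rewrite (clamp_id _ _ _ Hx1) in Hfx.
    assert (O : open (fun z : R => z <> 0)) by apply open_neq.
    destruct (Hfx _ (O _ Hn)) as [d Hd].
    assert (0 < d) by apply cond_pos.
    set (s := Rmin (d / 2) (1 / 2)).
    assert (0 < s) by (apply Rmin_pos; lra).
    assert (s <= d / 2) by apply Rmin_l. assert (s <= 1 / 2) by apply Rmin_r.
    destruct Hx as [-> | ->].
    - apply (Hd s).
      + unfold ball; simpl. unfold AbsRing_ball, abs, minus, plus, opp; simpl. apply Rabs_lt_between. lra.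
      + rewrite clamp_id by (unfold Icc; lra). apply Z; lra.
    - apply (Hd (1 - s)).
      + unfold ball; simpl. unfold AbsRing_ball, abs, minus, plus, opp; simpl. apply Rabs_lt_between. lra.
      + rewrite clamp_id by (unfold Icc; lra). apply Z; lra. }
  intros x [Hx0 Hx1]. destruct Hx0; [destruct Hx1|]; auto.
Qed.

End Pc.

Arguments pc1 : clear implicits.

(** * Orthonormal bases *)

(* Both equations are handled at once in the Hilbert space L^2 x L^2. *)
Definition pair2 : Type := ((R -> R) * (R -> R))%type.

Definition ip (e f : pair2) : R :=
  I (fun x => fst e x * fst f x) + I (fun x => snd e x * snd f x).

Definition lin2 (n : nat) (c : nat -> R) (o : nat -> pair2) : pair2 :=
  (fun x => bsum n (fun i => c i * fst (o i) x),
   fun x => bsum n (fun i => c i * snd (o i) x)).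

Definition eq2 (e f : pair2) : Prop :=
  forall x, Icc 0 1 x -> fst e x = fst f x /\ snd e x = snd f x.

Definition pc2 (N : nat) (Y : nat -> R) (e : pair2) : Prop := pc N Y (fst e) /\ pc N Y (snd e).

Definition ccont2 (e : pair2) : Prop := ccont 0 1 (fst e) /\ ccont 0 1 (snd e).

Definition orthonormal (n : nat) (o : nat -> pair2) : Prop :=
  forall i j, (i < n)%nat -> (j < n)%nat -> ip (o i) (o j) = kron i j.

Definition inspan (n : nat) (o : nat -> pair2) (e : pair2) : Prop :=
  exists c, eq2 e (lin2 n c o).

Lemma kron_sym i j : kron i j = kron j i.
Proof. unfold kron; destruct (Nat.eq_dec i j), (Nat.eq_dec j i); congruence. Qed.

Lemma ip_sym e f : ip e f = ip f e.
Proof.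
  unfold ip. f_equal; apply RInt_ext; intros; apply Rmult_comm.
Qed.

Section Ip.
Context {N : nat} {Y : nat -> R} (HG : grid N Y).

Lemma ccont2_pc2 e : ccont2 e -> pc2 N Y e.
Proof. intros [H1 H2]; split; apply pc_ccont; auto. Qed.

Lemma lin2_pc2 n c o : (forall i, (i < n)%nat -> pc2 N Y (o i)) -> pc2 N Y (lin2 n c o).
Proof.
  intros H; split; simpl; apply pc_bsum; intros i Hi; apply pc_mult; auto using pc_const; now apply H.
Qed.

Lemma ip_eq2 e e' f : pc2 N Y e -> pc2 N Y f -> eq2 e e' -> ip e f = ip e' f.
Proof.
  intros [He1 He2] [Hf1 Hf2] H. unfold ip. f_equal; apply (I_ext HG);
    try (apply pc_mult; auto); intros x Hx;
    assert (Hx' := inner_pt_01 N Y x HG Hx); rewrite (fun h => proj1 (H x h)) || rewrite (fun h => proj2 (H x h));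
    auto; unfold Icc; lra.
Qed.

Lemma ip_lin2_l n c o f : (forall i, (i < n)%nat -> pc2 N Y (o i)) -> pc2 N Y f ->
  ip (lin2 n c o) f = bsum n (fun i => c i * ip (o i) f).
Proof.
  intros Ho [Hf1 Hf2]. unfold ip at 1; simpl.
  rewrite !(I_bsum_mult HG) by (auto; intros i Hi; apply Ho; auto).
  rewrite <- bsum_plus. apply bsum_ext; intros; unfold ip; ring.
Qed.

Lemma ip_ge0 e : pc2 N Y e -> 0 <= ip e e.
Proof.
  intros [H1 H2]. unfold ip.
  assert (0 <= I (fun x => fst e x * fst e x)).
  { apply (I_ge0 HG); [apply pc_mult; auto|]. intros; apply Rle_0_sqr. }
  assert (0 <= I (fun x => snd e x * snd e x)).
  { apply (I_ge0 HG); [apply pc_mult; auto|]. intros; apply Rle_0_sqr. }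
  lra.
Qed.

Lemma ip_lin2_orthonormal n c o j : (forall i, (i < n)%nat -> pc2 N Y (o i)) ->
  orthonormal n o -> (j < n)%nat -> ip (lin2 n c o) (o j) = c j.
Proof.
  intros Ho Hon Hj. rewrite ip_lin2_l by auto.
  rewrite <- (bsum_kron n c j Hj). apply bsum_ext; intros i Hi.
  now rewrite Hon, kron_sym.
Qed.

Lemma ip_lin2_lin2 n c d o : (forall i, (i < n)%nat -> pc2 N Y (o i)) ->
  orthonormal n o -> ip (lin2 n c o) (lin2 n d o) = bsum n (fun i => c i * d i).
Proof.
  intros Ho Hon. rewrite ip_lin2_l by (auto using lin2_pc2). apply bsum_ext; intros i Hi.
  now rewrite ip_sym, ip_lin2_orthonormal.
Qed.

Lemma inspan_coords n o e : (forall i, (i < n)%nat -> pc2 N Y (o i)) -> orthonormal n o ->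
  pc2 N Y e -> inspan n o e -> eq2 e (lin2 n (fun i => ip e (o i)) o).
Proof.
  intros Ho Hon He [c Hc].
  assert (E : forall i, (i < n)%nat -> ip e (o i) = c i).
  { intros i Hi. rewrite (ip_eq2 e (lin2 n c o)) by auto. now apply ip_lin2_orthonormal. }
  intros x Hx. destruct (Hc x Hx) as [-> ->]. simpl.
  split; apply bsum_ext; intros i Hi; now rewrite E.
Qed.

Lemma ip_minus_l e f g : pc2 N Y e -> pc2 N Y f -> pc2 N Y g ->
  ip (fun x => fst e x - fst f x, fun x => snd e x - snd f x) g = ip e g - ip f g.
Proof.
  intros [] [] []. unfold ip; simpl.
  rewrite (I_ext HG _ (fun x => fst e x * fst g x - fst f x * fst g x))
    by (try (intros; ring); auto using pc_mult, pc_minus).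
  rewrite (I_ext HG (fun x => (snd e x - snd f x) * snd g x)
      (fun x => snd e x * snd g x - snd f x * snd g x))
    by (try (intros; ring); auto using pc_mult, pc_minus).
  rewrite !(I_minus HG) by (apply pc_mult; auto). ring.
Qed.

Lemma ip_lin2_proj n o e f : (forall i, (i < n)%nat -> pc2 N Y (o i)) -> orthonormal n o ->
  pc2 N Y e -> pc2 N Y f -> inspan n o f -> ip (lin2 n (fun i => ip e (o i)) o) f = ip e f.
Proof.
  intros Ho Hon He Hf Hs.
  assert (Hc := inspan_coords n o f Ho Hon Hf Hs).
  rewrite ip_sym, (ip_eq2 f _ _ Hf (lin2_pc2 _ _ _ Ho) Hc).
  rewrite (ip_sym e), (ip_eq2 f _ _ Hf He Hc).
  rewrite ip_lin2_lin2, ip_lin2_l by auto. apply bsum_ext; intros i Hi.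
  now rewrite (ip_sym (o i) e).
Qed.

(** Pythagoras: [e - p] is orthogonal to the span, so the two squared distances differ by the
    squared norm of [p - f]. *)
Lemma lin2_proj_best n o e f : (forall i, (i < n)%nat -> pc2 N Y (o i)) -> orthonormal n o ->
  pc2 N Y e -> pc2 N Y f -> inspan n o f ->
  let p := lin2 n (fun i => ip e (o i)) o in
  ip (fun x => fst e x - fst p x, fun x => snd e x - snd p x)
     (fun x => fst e x - fst p x, fun x => snd e x - snd p x) <=
  ip (fun x => fst e x - fst f x, fun x => snd e x - snd f x)
     (fun x => fst e x - fst f x, fun x => snd e x - snd f x).
Proof.
  intros Ho Hon He Hf Hs p.
  assert (Hp : pc2 N Y p) by now apply lin2_pc2.
  assert (Hsp : inspan n o p) by (eexists; intros x Hx; split; reflexivity).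
  assert (D : forall g, pc2 N Y g ->
    pc2 N Y (fun x => fst e x - fst g x, fun x => snd e x - snd g x)).
  { intros g [G1 G2]; destruct He; split; simpl; auto using pc_minus. }
  rewrite !ip_minus_l by auto.
  rewrite !(ip_sym e), !(ip_sym p), !(ip_sym f (_, _)), !ip_minus_l by auto.
  assert (E1 : ip p p = ip e p) by (apply ip_lin2_proj; auto).
  assert (E2 : ip p f = ip e f) by (apply ip_lin2_proj; auto).
  assert (Q : 0 <= ip (fun x => fst p x - fst f x, fun x => snd p x - snd f x)
     (fun x => fst p x - fst f x, fun x => snd p x - snd f x)).
  { apply ip_ge0. destruct Hp, Hf; split; simpl; auto using pc_minus. }
  rewrite ip_minus_l in Q by (auto; destruct Hp, Hf; split; simpl; auto using pc_minus).
  rewrite !(ip_sym p), !(ip_sym f (_, _)), !ip_minus_l in Q by auto.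
  rewrite (ip_sym f p) in *. rewrite (ip_sym f e), (ip_sym p e). lra.
Qed.

End Ip.

(** The partition consisting of the single interval [0, 1]. It serves the integral lemmas where all
    functions are continuous and no mesh is at hand. *)
Definition grid1 (j : nat) : R := INR j.

Lemma grid1_grid : grid 1 grid1.
Proof.
  split; [easy|split; [easy|]]. intros j Hj. unfold grid1. apply lt_INR; lia.
Qed.

Lemma ip_0 e : ccont2 e -> ip e e = 0 -> eq2 e (fun _ => 0, fun _ => 0).
Proof.
  intros [H1 H2] H. unfold ip in H.
  assert (0 <= I (fun x => fst e x * fst e x)).
  { apply (I_ge0 grid1_grid); [apply pc_mult; apply pc_ccont; auto using grid1_grid|]. intros; apply Rle_0_sqr. }
  assert (0 <= I (fun x => snd e x * snd e x)).
  { apply (I_ge0 grid1_grid); [apply pc_mult; apply pc_ccont; auto using grid1_grid|]. intros; apply Rle_0_sqr. }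
  intros x Hx; split; simpl; apply I_sqr_0; auto; lra.
Qed.

(** The closure condition on [W] is exactly one step of the process: subtract the projection, then
    rescale. An element with zero residual is dropped, so the list may be linearly dependent and no
    dimension has to be known; that a residual of norm 0 vanishes pointwise needs the continuity of
    the members of [W]. *)
Lemma gram_schmidt (W : pair2 -> Prop) :
  (forall e, W e -> ccont2 e) ->
  (forall e n c o a, W e -> (forall i, (i < n)%nat -> W (o i)) ->
     W (fun x => a * (fst e x - fst (lin2 n c o) x), fun x => a * (snd e x - snd (lin2 n c o) x))) ->
  forall L, (forall e, In e L -> W e) ->
  exists n o, (forall i, (i < n)%nat -> W (o i)) /\ orthonormal n o /\
    forall e, In e L -> inspan n o e.
Proof.
  intros Wc Wl. induction L as [|e L IH]; intros HL.
  - exists O, (fun _ => (fun _ => 0, fun _ => 0)).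
    split; [intros; lia|split; [intros i j Hi; lia|intros e []]].
  - destruct IH as [n [o [Ho [Hon Hs]]]]; [intros; apply HL; now right|].
    assert (He : W e) by (apply HL; now left).
    set (c := fun i => ip e (o i)).
    set (g := (fun x => fst e x - fst (lin2 n c o) x, fun x => snd e x - snd (lin2 n c o) x) : pair2).
    assert (HG := grid1_grid).
    assert (Pc : forall f, W f -> pc2 1 grid1 f) by (intros f Hf; apply ccont2_pc2; auto).
    assert (Hg : ccont2 g).
    { destruct (Wc e He) as [A1 A2]. split; simpl; apply ccont_minus; auto; apply ccont_bsum;
      intros i Hi; apply ccont_mult; auto using ccont_const; apply Wc; auto. }
    assert (Hgp : pc2 1 grid1 g) by now apply ccont2_pc2.
    assert (Hgo : forall j, (j < n)%nat -> ip g (o j) = 0).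
    { intros j Hj. unfold g. rewrite (ip_minus_l HG) by (auto; apply lin2_pc2; auto).
      rewrite (ip_lin2_orthonormal HG) by auto. unfold c; ring. }
    destruct (Req_dec (ip g g) 0) as [G0|G0].
    + exists n, o. split; [easy|split; [easy|]]. intros e' [<-|Hin]; [|auto].
      exists c. intros x Hx. destruct (ip_0 g Hg G0 x Hx) as [Q1 Q2]. simpl in Q1, Q2.
      simpl; split; lra.
    + assert (Hpos : 0 < ip g g).
      { assert (0 <= ip g g) by now apply (ip_ge0 HG). lra. }
      set (s := / sqrt (ip g g)).
      assert (Hsq : 0 < sqrt (ip g g)) by now apply sqrt_lt_R0.
      assert (Hss : sqrt (ip g g) * sqrt (ip g g) = ip g g) by (apply sqrt_sqrt; lra).
      set (v := (fun x => s * fst g x, fun x => s * snd g x) : pair2).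
      assert (Hv : forall f, pc2 1 grid1 f -> ip v f = s * ip g f).
      { intros f Hf.
        assert (E := ip_lin2_l HG 1 (fun _ => s) (fun _ => g) f (fun _ _ => Hgp) Hf).
        simpl in E. rewrite <- (Rplus_0_l (s * ip g f)), <- E. unfold ip; simpl.
        f_equal; apply RInt_ext; intros; simpl; ring. }
      assert (Wv : W v) by (apply Wl; auto).
      exists (S n), (fun i => if Nat.eq_dec i n then v else o i).
      assert (Ext : forall d e', eq2 e' (lin2 n d o) -> forall a,
        eq2 (fun x => fst e' x + a * fst v x, fun x => snd e' x + a * snd v x)
          (lin2 (S n) (fun i => if Nat.eq_dec i n then a else d i)
             (fun i => if Nat.eq_dec i n then v else o i))).
      { intros d e' H a x Hx. destruct (H x Hx) as [Q1 Q2]. simpl in *.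
        destruct (Nat.eq_dec n n) as [_|]; [|easy]. rewrite Q1, Q2.
        split; f_equal; apply bsum_ext; intros i Hi; destruct (Nat.eq_dec i n); (lia || easy). }
      split; [|split].
      * intros i Hi. destruct (Nat.eq_dec i n); [easy|]. apply Ho; lia.
      * assert (Vo : forall j, (j < n)%nat -> ip v (o j) = 0).
        { intros j Hj. rewrite Hv, Hgo by auto. ring. }
        assert (Vv : ip v v = 1).
        { rewrite Hv, ip_sym, Hv by (auto). unfold s. rewrite <- Hss at 3. field. lra. }
        intros i j Hi Hj. unfold kron.
        destruct (Nat.eq_dec i n) as [->|Hin], (Nat.eq_dec j n) as [->|Hjn].
        -- destruct (Nat.eq_dec n n); [easy|lia].
        -- destruct (Nat.eq_dec n j); [lia|]. apply Vo; lia.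
        -- destruct (Nat.eq_dec i n); [lia|]. rewrite ip_sym. apply Vo; lia.
        -- apply (Hon i j); lia.
      * intros e' [<-|Hin].
        -- eexists. intros x Hx.
           assert (Q := Ext c (lin2 n c o) (fun x _ => conj eq_refl eq_refl) (sqrt (ip g g)) x Hx).
           destruct Q as [Q1 Q2]. rewrite <- Q1, <- Q2. simpl. unfold s. split; field; lra.
        -- destruct (Hs e' Hin) as [d Hd]. eexists. intros x Hx.
           destruct (Ext d e' Hd 0 x Hx) as [Q1 Q2]. rewrite <- Q1, <- Q2. simpl. split; ring.
Qed.

(** * Polynomials *)

(** [n] counts coefficients, so the degree is below [n]; on a spline piece [n] is r. *)
Definition peval (n : nat) (c : nat -> R) (x : R) : R := bsum n (fun m => c m * x ^ m).

Lemma peval_ext n c d x : (forall m, (m < n)%nat -> c m = d m) -> peval n c x = peval n d x.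
Proof. intros H. apply bsum_ext; intros; rewrite H; auto. Qed.

Lemma peval_lin n c d a b x :
  peval n (fun m => a * c m + b * d m) x = a * peval n c x + b * peval n d x.
Proof.
  unfold peval. rewrite <- !bsum_scal_l, <- bsum_plus. apply bsum_ext; intros; ring.
Qed.

Lemma peval_scale n c s x : peval n c (s * x) = peval n (fun m => c m * s ^ m) x.
Proof. apply bsum_ext; intros. rewrite Rpow_mult_distr; ring. Qed.

Lemma peval_S n c x : peval (S n) c x = c O + x * peval n (fun m => c (S m)) x.
Proof.
  unfold peval. rewrite bsum_shift, <- bsum_scal_l. simpl pow. f_equal; [ring|].
  apply bsum_ext; intros; ring.
Qed.

Lemma peval_at_0 n c : (0 < n)%nat -> peval n c 0 = c O.
Proof. destruct n as [|n]; [lia|]. intros _. rewrite peval_S; ring. Qed.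

Lemma peval_pad n c : exists d, (forall x, peval (S n) d x = peval n c x) /\
  d n = 0 /\ forall m, (m < n)%nat -> d m = c m.
Proof.
  assert (W : forall y, peval (S n) (fun m => if Nat.eq_dec m n then 0 else c m) y = peval n c y).
  { intros y. unfold peval; simpl. destruct (Nat.eq_dec n n); [|lia].
    rewrite Rmult_0_l, Rplus_0_r. apply bsum_ext; intros i Hi. destruct (Nat.eq_dec i n); [lia|easy]. }
  exists (fun m => if Nat.eq_dec m n then 0 else c m). repeat split; auto.
  - destruct (Nat.eq_dec n n); [easy|lia].
  - intros m Hm. destruct (Nat.eq_dec m n); [lia|easy].
Qed.

Definition pderiv (c : nat -> R) (m : nat) : R := INR (S m) * c (S m).

Lemma peval_is_derive n c x : is_derive (peval n c) x (peval (pred n) (pderiv c) x).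
Proof.
  assert (E : peval (pred n) (pderiv c) x = bsum n (fun m => c m * (INR m * x ^ pred m))).
  { destruct n as [|n]; [easy|]. rewrite bsum_shift. unfold peval; simpl pred. simpl (INR 0).
    rewrite Rmult_0_l, Rmult_0_r, Rplus_0_l. apply bsum_ext; intros. unfold pderiv. ring. }
  rewrite E. apply (bsum_is_derive n (fun m y => c m * y ^ m)). intros m _.
  apply (is_derive_scal (fun y => y ^ m)).
  auto_derive; [easy|ring].
Qed.

Lemma peval_continuous n c x : continuous (peval n c) x.
Proof. apply (ex_derive_continuous (peval n c)). eexists; apply peval_is_derive. Qed.

(** Differentiation lowers the number of coefficients, and the derivative vanishes on the same
    interval; the constant term is read off at the midpoint at the end. *)
Lemma peval_0 n c a b : a < b -> (forall x, a < x < b -> peval n c x = 0) ->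
  forall m, (m < n)%nat -> c m = 0.
Proof.
  intros Hab. revert c. induction n as [|n IH]; intros c H m Hm; [lia|].
  assert (D : forall i, (i < n)%nat -> c (S i) = 0).
  { intros i Hi. assert (E : pderiv c i = 0).
    { apply (IH (pderiv c)); [|easy]. intros x Hx.
      transitivity (Derive (peval (S n) c) x).
      - symmetry. apply is_derive_unique, (peval_is_derive (S n)).
      - rewrite <- (Derive_const 0 x). apply Derive_ext_loc.
        eapply filter_imp; [|apply (locally_Ioo a b x Hx)]. intros y Hy; now apply H. }
    unfold pderiv in E. apply Rmult_integral in E. destruct E as [E|E]; [|easy].
    exfalso. revert E. apply not_0_INR; lia. }
  destruct m as [|m]; [|apply D; lia].
  assert (Hx : a < (a + b) / 2 < b) by lra.
  specialize (H _ Hx). rewrite peval_S in H.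
  unfold peval in H. rewrite bsum_0 in H; [lra|]. intros i Hi. rewrite D by easy; ring.
Qed.

Lemma peval_mul_affine n d a s : exists e, forall z, (a + s * z) * peval n d z = peval (S n) e z.
Proof.
  destruct (peval_pad n d) as [d' [Hd' _]].
  exists (fun m => a * d' m + s * (match m with O => 0 | S p => d p end)).
  intros z. rewrite (peval_lin (S n) d'). rewrite Hd'.
  rewrite (peval_S n (fun m => match m with O => 0 | S p => d p end)).
  change (fun m => d m) with d. ring.
Qed.

Lemma peval_affine n c a s : exists d, forall z, peval n c (a + s * z) = peval n d z.
Proof.
  revert c. induction n as [|n IH]; intros c; [exists c; easy|].
  destruct (IH (fun m => c (S m))) as [d Hd].
  destruct (peval_mul_affine n d a s) as [e He].
  exists (fun m => 1 * e m + c O * kron 0 m).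
  intros z. rewrite peval_S, Hd, He, peval_lin, (peval_S n (kron 0)).
  unfold peval at 3. rewrite (bsum_0 n); [unfold kron; simpl; ring|].
  intros i _. unfold kron; simpl; ring.
Qed.

Lemma peval_Rabs_le n c z M : (forall m, (m < n)%nat -> Rabs (c m) <= M) -> Rabs z <= 1 ->
  Rabs (peval n c z) <= INR n * M.
Proof.
  intros Hc Hz. unfold peval. eapply Rle_trans; [apply bsum_Rabs|].
  rewrite <- bsum_const. apply bsum_le. intros m Hm.
  rewrite Rabs_mult, <- RPow_abs. rewrite <- (Rmult_1_r M).
  apply Rmult_le_compat; auto using Rabs_pos.
  - apply pow_le, Rabs_pos.
  - rewrite <- (pow1 m). apply pow_incr. split; [apply Rabs_pos|easy].
Qed.

(* Expanding in an orthonormal basis of the polynomials bounds each coefficient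
   by the L^2 norm. *)
Lemma peval_coef_bound n : exists C, 0 < C /\ forall c m, (m < n)%nat ->
  c m * c m <= C * I (fun x => peval n c x * peval n c x).
Proof.
  set (W := fun e : pair2 => exists c, (forall x, fst e x = peval n c x) /\ forall x, snd e x = 0).
  assert (PC : forall c, ccont 0 1 (peval n c)).
  { intros c. apply continuous_ccont; [lra|]. intros; apply peval_continuous. }
  assert (Wc : forall e, W e -> ccont2 e).
  { intros e [c [H1 H2]]. split.
    - apply (ccont_ext 0 1 (peval n c)); [lra|auto|auto].
    - apply (ccont_ext 0 1 (fun _ => 0)); [lra|auto|apply ccont_const]. }
  assert (mono : forall m, (m < n)%nat -> W (fun x => x ^ m, fun _ => 0)).
  { intros m Hm. exists (kron m). split; [|easy]. intros x; simpl.
    rewrite <- (bsum_kron n (fun i => x ^ i) m Hm) at 1. apply bsum_ext; intros; ring. }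
  destruct (gram_schmidt W Wc) with (L := map (fun m => (fun x : R => x ^ m, fun _ : R => 0)) (seq 0 n))
    as [k [o [Ho [Hon Hs]]]].
  - intros e k c o a [ce [E1 E2]] Ho.
    assert (Q : exists d, (forall x, fst (lin2 k c o) x = peval n d x) /\ forall x, snd (lin2 k c o) x = 0).
    { simpl. clear -Ho. induction k as [|k IH].
      - exists (fun _ => 0). split; intros; simpl; [|easy].
        unfold peval; rewrite bsum_0; [easy|]. intros; ring.
      - destruct IH as [d [D1 D2]]; [auto|]. destruct (Ho k) as [d' [D1' D2']]; [lia|].
        exists (fun m => 1 * d m + c k * d' m). split; intros x; simpl.
        + rewrite peval_lin, D1, D1'. ring.
        + rewrite D2, D2'. ring. }
    destruct Q as [d [D1 D2]].
    exists (fun m => a * ce m + (- a) * d m). split; intros x; simpl fst; simpl snd.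
    + simpl in D1. rewrite peval_lin, E1, D1. ring.
    + simpl in D2. rewrite E2, D2. ring.
  - intros e He. apply in_map_iff in He. destruct He as [m [<- Hm]].
    apply mono. apply in_seq in Hm. lia.
  - assert (HD : exists d : nat -> nat -> R, forall i, (i < k)%nat -> forall x, fst (o i) x = peval n (d i) x).
    { destruct (functional_choice (fun i c => (i < k)%nat -> forall x, fst (o i) x = peval n c x)) as [d Hd].
      - intros i. destruct (Nat.lt_ge_cases i k) as [Hi|Hi].
        + destruct (Ho i Hi) as [c [Hc _]]. exists c; auto.
        + exists (fun _ => 0); lia.
      - exists d; auto. }
    destruct HD as [d Hd].
    set (S := fun m => bsum k (fun i => Rabs (d i m))).
    assert (S0 : forall m, 0 <= S m) by (intros; apply bsum_nonneg; intros; apply Rabs_pos).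
    exists (1 + bsum n (fun m => S m * S m)).
    assert (Sn : 0 <= bsum n (fun m => S m * S m)) by (apply bsum_nonneg; intros; apply Rmult_le_pos; auto).
    split; [lra|]. intros c m Hm.
    set (e := (peval n c, fun _ => 0) : pair2).
    assert (We : W e) by (exists c; auto).
    assert (Se : inspan k o e).
    { assert (G : forall j, (j <= n)%nat -> inspan k o (peval j c, fun _ => 0)).
      { induction j as [|j IH]; intros Hj.
        - exists (fun _ => 0). intros x _; unfold lin2, peval; simpl. split; symmetry; apply bsum_0; intros; ring.
        - destruct IH as [a Ha]; [lia|].
          destruct (Hs (fun x => x ^ j, fun _ => 0)) as [b Hb].
          { apply in_map_iff. exists j. split; [easy|]. apply in_seq; lia. }
          exists (fun i => a i + c j * b i). intros x Hx.
          destruct (Ha x Hx) as [A1 A2], (Hb x Hx) as [B1 B2]. simpl in *. split.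
          + unfold peval in *; simpl. rewrite A1, B1, <- bsum_scal_l, <- bsum_plus.
            apply bsum_ext; intros; ring.
          + rewrite (bsum_ext k _ (fun i => a i * snd (o i) x + c j * (b i * snd (o i) x))) by (intros; ring).
            rewrite bsum_plus, bsum_scal_l, <- A2, <- B2. ring. }
      apply (G n); lia. }
    assert (HG := grid1_grid).
    assert (Pc : forall f, W f -> pc2 1 grid1 f) by (intros f Hf; apply ccont2_pc2; auto).
    assert (Hc := inspan_coords HG k o e (fun i Hi => Pc _ (Ho i Hi)) Hon (Pc _ We) Se).
    set (a := fun i => ip e (o i)) in Hc.
    set (J := I (fun x => peval n c x * peval n c x)).
    assert (EJ : ip e e = J).
    { unfold ip, e; simpl. rewrite (RInt_ext (fun _ => 0 * 0) (fun _ => 0)) by (intros; apply Rmult_0_l).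
      rewrite RInt_const. unfold J, scal; simpl; unfold mult; simpl; ring. }
    assert (Ha : forall i, (i < k)%nat -> a i * a i <= J).
    { intros i Hi. rewrite <- EJ, (ip_eq2 HG e _ e (Pc _ We) (Pc _ We) Hc), ip_sym.
      rewrite (ip_eq2 HG e _ _ (Pc _ We) (lin2_pc2 _ _ _ (fun i Hi => Pc _ (Ho i Hi))) Hc).
      rewrite (ip_lin2_lin2 HG) by auto.
      apply (bsum_term_le k (fun i => a i * a i)); [|easy]. intros; apply Rle_0_sqr. }
    assert (HJ : 0 <= J) by (rewrite <- EJ; apply (ip_ge0 HG); auto).
    (* [peval_0] carries the expansion in the orthonormal family over from functions to
       coefficients. *)
    assert (Ec : c m = bsum k (fun i => a i * d i m)).
    { assert (Z : c m + -1 * bsum k (fun i => a i * d i m) = 0); [|lra].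
      apply (peval_0 n (fun m => 1 * c m + -1 * bsum k (fun i => a i * d i m)) 0 1) in Hm; [lra|lra|].
      intros x Hx. rewrite peval_lin.
      destruct (Hc x) as [Q _]; [unfold Icc; lra|]. simpl in Q. rewrite Q. unfold peval.
      assert (Z : bsum n (fun m => bsum k (fun i => a i * d i m) * x ^ m) =
                  bsum k (fun i => a i * fst (o i) x)); [|rewrite Z; ring].
      transitivity (bsum n (fun m => bsum k (fun i => a i * (d i m * x ^ m)))).
      - apply bsum_ext; intros p Hp. rewrite <- bsum_scal_r. apply bsum_ext; intros; ring.
      - rewrite bsum_swap. apply bsum_ext; intros i Hi. now rewrite bsum_scal_l, Hd. }
    assert (Hb : Rabs (c m) <= sqrt J * S m).
    { rewrite Ec. eapply Rle_trans; [apply bsum_Rabs|]. unfold S. rewrite <- bsum_scal_l.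
      apply bsum_le. intros i Hi. rewrite Rabs_mult. apply Rmult_le_compat_r; [apply Rabs_pos|].
      rewrite <- sqrt_Rsqr_abs. apply sqrt_le_1_alt. now apply Ha. }
    assert (Q := Rmult_le_compat _ _ _ _ (Rabs_pos _) (Rabs_pos _) Hb Hb).
    rewrite <- Rabs_mult, Rabs_pos_eq in Q by apply Rle_0_sqr.
    replace (sqrt J * S m * (sqrt J * S m)) with (sqrt J * sqrt J * (S m * S m)) in Q by ring.
    rewrite sqrt_sqrt in Q by easy.
    assert (Sm : S m * S m <= bsum n (fun m => S m * S m)).
    { apply (bsum_term_le n (fun m => S m * S m)); [|easy]. intros; apply Rmult_le_pos; auto. }
    nra.
Qed.

(** Scaling to the unit interval. The local variable runs backwards from the right end [b], because
    the polynomial is later continued to the right of [b] in powers of the distance from [b]. *)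
Lemma peval_local_coef n : exists C, 0 < C /\ forall c a b, a < b ->
  exists d, (forall z, peval n c (b + - (b - a) * z) = peval n d z) /\
    forall m, (m < n)%nat ->
      d m * d m <= C / (b - a) * RInt (fun x => peval n c x * peval n c x) a b.
Proof.
  destruct (peval_coef_bound n) as [C [HC H]]. exists C; split; [easy|].
  intros c a b Hab. destruct (peval_affine n c b (- (b - a))) as [d Hd].
  exists d. split; [easy|]. intros m Hm. eapply Rle_trans; [apply (H d m Hm)|].
  unfold Rdiv. rewrite Rmult_assoc. apply Rmult_le_compat_l; [lra|]. right.
  set (f := fun x => peval n c x * peval n c x).
  assert (Hf : forall u v, ex_RInt f u v).
  { intros u v. apply (ex_RInt_continuous f). intros x _.
    apply (continuous_mult (peval n c) (peval n c)); apply peval_continuous. }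
  assert (E := RInt_comp_lin f (- (b - a)) b 0 1 (Hf _ _)).
  rewrite Rmult_0_r, Rmult_1_r, Rplus_0_l in E.
  replace (- (b - a) + b) with a in E by ring.
  rewrite <- (opp_RInt_swap f b a) by apply Hf. rewrite <- E.
  rewrite (RInt_scal (fun y => f (- (b - a) * y + b)) 0 1 (- (b - a))).
  - unfold opp, scal; simpl; unfold mult; simpl.
    rewrite (RInt_ext (fun y => f (- (b - a) * y + b)) (fun x => peval n d x * peval n d x)).
    + symmetry. field. lra.
    + intros x _. unfold f. rewrite Rplus_comm, Hd. easy.
  - apply (ex_RInt_continuous (fun y => f (- (b - a) * y + b))). intros z _.
    apply (ex_derive_continuous (fun y => f (- (b - a) * y + b))).
    apply (ex_derive_comp f (fun y => - (b - a) * y + b)).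
    + unfold f. apply (ex_derive_mult (peval n c) (peval n c)); eexists; apply peval_is_derive.
    + auto_derive; easy.
Qed.

(** * Cutting off a polynomial by truncated powers *)

(** Divided difference of order [d] at z 0, ..., z d. Applied to y -> (x - y)^d it yields weights
    that combine the shifted powers into a nonzero constant. *)
Fixpoint divdiff (d : nat) (z : nat -> R) (f : R -> R) : R :=
  match d with
  | O => f (z O)
  | S n => (divdiff n z f - divdiff n (fun i => z (S i)) f) / (z O - z (S n))
  end.

Definition gaps (d : nat) (delta : R) (z : nat -> R) : Prop :=
  forall i j, (i < j <= d)%nat -> delta <= z j - z i.

Lemma gaps_S d delta z : gaps (S d) delta z -> gaps d delta z /\ gaps d delta (fun i => z (S i)).
Proof. intros H; split; intros i j Hij; apply H; lia. Qed.

(** Product rule for divided differences with the affine factor y -> x - y: only its value at z 0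
    and its first difference -1 survive. *)
Lemma divdiff_Leibniz d z delta f x : 0 < delta -> gaps (S d) delta z ->
  divdiff (S d) z (fun y => (x - y) * f y) =
  (x - z O) * divdiff (S d) z f - divdiff d (fun i => z (S i)) f.
Proof.
  intros Hd. revert z. induction d as [|d IH]; intros z Hz.
  - assert (H := Hz O 1%nat ltac:(lia)). simpl. field. lra.
  - destruct (gaps_S _ _ _ Hz) as [H1 H2].
    change (divdiff (S (S d)) z (fun y => (x - y) * f y)) with
      ((divdiff (S d) z (fun y => (x - y) * f y) -
        divdiff (S d) (fun i => z (S i)) (fun y => (x - y) * f y)) / (z O - z (S (S d)))).
    rewrite (IH z H1), (IH _ H2).
    assert (G1 := Hz O (S (S d)) ltac:(lia)).
    assert (G2 := Hz 1%nat (S (S d)) ltac:(lia)).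
    set (A := divdiff (S d) z f).
    change (divdiff (S (S d)) z f) with
      ((A - divdiff (S d) (fun i => z (S i)) f) / (z O - z (S (S d)))).
    set (B := divdiff (S d) (fun i => z (S i)) f).
    (* The recursion on the nodes without z 0 eliminates the third of the lower differences; the
       rest is algebra in [A], [B] and one lower difference. *)
    assert (E : divdiff d (fun i => z (S i)) f - divdiff d (fun i => z (S (S i))) f =
      (z 1%nat - z (S (S d))) * B) by (unfold B; simpl; field; lra).
    replace (divdiff d (fun i => z (S (S i))) f) with
      (divdiff d (fun i => z (S i)) f - (z 1%nat - z (S (S d))) * B) by lra.
    field. lra.
Qed.

(** Each use of the Leibniz rule lowers the exponent and replaces a difference by one of the same
    order, which vanishes by induction, and one of order one less; a factor -1 is picked up each
    time. *)
Lemma divdiff_power d z delta x : 0 < delta -> gaps d delta z ->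
  divdiff d z (fun y => (x - y) ^ d) = (-1) ^ d /\
  forall m, (m < d)%nat -> divdiff d z (fun y => (x - y) ^ m) = 0.
Proof.
  intros Hdl. revert z.
  assert (C : forall d z, divdiff (S d) z (fun _ => 1) = 0).
  { clear. assert (W : forall d z z', divdiff d z (fun _ => 1) = divdiff d z' (fun _ => 1)).
    - induction d as [|d IH]; intros z z'; [easy|]. simpl.
      rewrite (IH (fun i => z (S i)) z), (IH (fun i => z' (S i)) z').
      unfold Rdiv; rewrite !Rminus_diag; ring.
    - intros d z. simpl. rewrite (W d (fun i => z (S i)) z). unfold Rdiv; rewrite Rminus_diag; ring. }
  assert (W : forall m d z, gaps d delta z ->
    (m = d -> divdiff d z (fun y => (x - y) ^ m) = (-1) ^ d) /\
    ((m < d)%nat -> divdiff d z (fun y => (x - y) ^ m) = 0)).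
  { induction m as [|m IH]; intros [|d'] z Hz; split; intros H; try lia; try apply C; try easy.
    - injection H as <-. destruct (gaps_S _ _ _ Hz) as [H1 H2].
      simpl pow. rewrite (divdiff_Leibniz m z delta) by auto.
      rewrite (proj2 (IH (S m) z Hz)) by lia. rewrite (proj1 (IH m _ H2)) by easy. ring.
    - destruct (gaps_S _ _ _ Hz) as [H1 H2].
      simpl pow. rewrite (divdiff_Leibniz d' z delta) by auto.
      rewrite (proj2 (IH (S d') z Hz)) by lia. rewrite (proj2 (IH d' _ H2)) by lia. ring. }
  intros z Hz. split; [now apply W|]. intros m Hm; now apply W.
Qed.

(** A divided difference is a combination of point values. Each order at most doubles the weights
    and divides them by a gap, so the bound depends on [d] and [delta] only. *)
Lemma divdiff_weights d delta : 0 < delta -> exists C, 0 < C /\ forall z, gaps d delta z ->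
  exists g, (forall f, divdiff d z f = bsum (S d) (fun i => g i * f (z i))) /\
    forall i, (i <= d)%nat -> Rabs (g i) <= C.
Proof.
  intros Hdl. induction d as [|d [C [HC IH]]].
  - exists 1. split; [lra|]. intros z _. exists (fun _ => 1). split.
    + intros f; simpl; ring.
    + intros i _; rewrite Rabs_R1; lra.
  - exists ((C + C) / delta). split; [apply Rdiv_lt_0_compat; lra|]. intros z Hz.
    destruct (gaps_S _ _ _ Hz) as [H1 H2].
    destruct (IH z H1) as [g [G1 G2]], (IH _ H2) as [k [K1 K2]].
    assert (Hz0 := Hz O (S d) ltac:(lia)).
    exists (fun i => ((if Nat.eq_dec i (S d) then 0 else g i) - (match i with O => 0 | S p => k p end)) / (z O - z (S d))).
    split.
    + intros f. change (divdiff (S d) z f) with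
        ((divdiff d z f - divdiff d (fun i => z (S i)) f) / (z O - z (S d))).
      rewrite G1, K1.
      rewrite (bsum_ext (S (S d)) _ (fun i => / (z O - z (S d)) *
         ((if Nat.eq_dec i (S d) then 0 else g i) * f (z i) -
          (match i with O => 0 | S p => k p end) * f (z i)))).
      * rewrite bsum_scal_l, bsum_minus. unfold Rdiv. rewrite Rmult_comm. f_equal. f_equal.
        -- change (bsum (S (S d)) ?h) with (bsum (S d) h + h (S d)). cbv beta.
           destruct (Nat.eq_dec (S d) (S d)); [|lia]. rewrite Rmult_0_l, Rplus_0_r.
           apply bsum_ext. intros i Hi. destruct (Nat.eq_dec i (S d)); [lia|easy].
        -- rewrite (bsum_shift (S d)). ring.
      * intros i _. unfold Rdiv. ring.
    + intros i Hi. unfold Rdiv. rewrite Rabs_mult.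
      apply Rmult_le_compat; try apply Rabs_pos.
      * eapply Rle_trans; [apply Rabs_triang|]. rewrite Rabs_Ropp. apply Rplus_le_compat.
        -- destruct (Nat.eq_dec i (S d)); [rewrite Rabs_R0; lra|]. apply G2; lia.
        -- destruct i; [rewrite Rabs_R0; lra|]. apply K2; lia.
      * rewrite Rabs_inv by lra. apply Rinv_le_contravar; [easy|].
        rewrite Rabs_minus_sym, Rabs_pos_eq; lra.
Qed.

(** The divided difference in y of (x - y)^d equals (-1)^d for every x, so its weights, multiplied
    by (-1)^d, represent the constant 1. *)
Lemma one_shifted_powers d delta : 0 < delta -> exists C, 0 < C /\ forall z, gaps d delta z ->
  exists g, (forall x, bsum (S d) (fun i => g i * (x - z i) ^ d) = 1) /\
    forall i, (i <= d)%nat -> Rabs (g i) <= C.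
Proof.
  intros Hdl. destruct (divdiff_weights d delta Hdl) as [C [HC H]].
  exists C; split; [easy|]. intros z Hz. destruct (H z Hz) as [g [G1 G2]].
  exists (fun i => (-1) ^ d * g i). split.
  - intros x. rewrite (bsum_ext _ _ (fun i => (-1) ^ d * (g i * (x - z i) ^ d))) by (intros; ring).
    rewrite bsum_scal_l, <- (G1 (fun y => (x - y) ^ d)).
    rewrite (proj1 (divdiff_power d z delta x Hdl Hz)).
    rewrite <- Rpow_mult_distr. replace (-1 * -1) with 1 by ring. apply pow1.
  - intros i Hi. rewrite Rabs_mult, <- RPow_abs, Rabs_m1, pow1, Rmult_1_l. auto.
Qed.

(* Induction on the degree by integration; the constant of integration is
   corrected with [one_shifted_powers]. *)
Lemma monomial_shifted_powers d delta K : 0 < delta -> 0 <= K -> exists C, 0 < C /\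
  forall z, gaps d delta z -> (forall i, (i <= d)%nat -> Rabs (z i) <= K) ->
  forall m, (m <= d)%nat -> exists a, (forall x, bsum (S d) (fun i => a i * (x - z i) ^ d) = x ^ m) /\
    forall i, (i <= d)%nat -> Rabs (a i) <= C.
Proof.
  intros Hdl HK. induction d as [|d [C [HC IH]]].
  - exists 1. split; [lra|]. intros z _ _ m Hm. exists (fun _ => 1). split.
    + intros x. replace m with O by lia. simpl; ring.
    + intros i _; rewrite Rabs_R1; lra.
  - destruct (one_shifted_powers (S d) delta Hdl) as [G [HG Hone]].
    set (D := INR (S d)). assert (HD : 0 < D) by (apply lt_0_INR; lia).
    (* The first summand bounds the correction [M * P 0 * g i], with M <= D, |P 0| estimated
       termwise by |z i| <= K, and |g i| <= G; the second bounds the integrated coefficients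
       [M * a i / D]. *)
    set (B := D * (INR (S d) * (C * K ^ S d / D)) * G + C).
    assert (HB : 0 <= D * (INR (S d) * (C * K ^ S d / D)) * G).
    { repeat apply Rmult_le_pos; try lra; try apply pos_INR.
      - now apply pow_le.
      - left; now apply Rinv_0_lt_compat. }
    exists (G + B). split; [unfold B; lra|]. intros z Hz Hzk m Hm.
    destruct (gaps_S _ _ _ Hz) as [H1 _].
    destruct (Hone z Hz) as [g [G1 G2]].
    destruct m as [|m].
    + exists g. split; [exact G1|]. intros i Hi. specialize (G2 i Hi). unfold B; lra.
    + destruct (IH z H1 (fun i Hi => Hzk i (le_S _ _ Hi)) m) as [a [A1 A2]]; [lia|].
      set (M := INR (S m)). assert (HM : 0 < M) by (apply lt_0_INR; lia).
      assert (HMD : M <= D) by (apply le_INR; lia).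
      set (P := fun x => bsum (S d) (fun i => a i * (x - z i) ^ S d) / D).
      (* Both sides vanish at 0 and have the derivative x^m, by the representation of x^m with
         powers of degree d. *)
      assert (EP : forall x, x ^ S m / M = P x - P 0).
      { intros x.
        assert (Q : forall y, is_derive (fun x => x ^ S m / M - P x) y 0).
        { intros y. replace 0 with (y ^ m - bsum (S d) (fun i => a i * (y - z i) ^ d)) by (rewrite A1; ring).
          apply (is_derive_minus (fun x => x ^ S m / M) P).
          - auto_derive; [easy|]. simpl pred.
            change (match m with O => 1 | S _ => INR m + 1 end) with M. field; lra.
          - unfold P, Rdiv.
            apply (is_derive_ext (fun x => bsum (S d) (fun i => a i * (x - z i) ^ S d * / D))).
            { intros t. apply bsum_scal_r. }
            apply (bsum_is_derive (S d) (fun i x => a i * (x - z i) ^ S d * / D)).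
            intros i _. auto_derive; [easy|]. simpl pred.
            change (match d with O => 1 | S _ => INR d + 1 end) with D.
            change (y + - z i) with (y - z i). field; lra. }
        destruct (MVT_gen (fun x => x ^ S m / M - P x) 0 x (fun _ => 0)) as [c [_ Hc]].
        - intros; apply Q.
        - intros y _. apply continuity_pt_filterlim.
          apply (ex_derive_continuous (fun x => x ^ S m / M - P x)). eexists; apply Q.
        - simpl in Hc. unfold Rdiv in *. rewrite !Rmult_0_l in Hc. simpl. lra. }
      exists (fun i => M * (if Nat.eq_dec i (S d) then 0 else a i / D) + - M * P 0 * g i).
      split.
      * intros x.
        rewrite (bsum_ext _ _ (fun i => M * ((if Nat.eq_dec i (S d) then 0 else a i / D) * (x - z i) ^ S d) +
           - M * P 0 * (g i * (x - z i) ^ S d))) by (intros; ring).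
        rewrite bsum_plus, !bsum_scal_l, G1.
        assert (E : bsum (S (S d)) (fun i => (if Nat.eq_dec i (S d) then 0 else a i / D) * (x - z i) ^ S d) = P x).
        { change (bsum (S (S d)) ?h) with (bsum (S d) h + h (S d)). cbv beta.
          destruct (Nat.eq_dec (S d) (S d)); [|lia]. rewrite Rmult_0_l, Rplus_0_r.
          unfold P, Rdiv. rewrite <- bsum_scal_r. apply bsum_ext. intros i Hi.
          destruct (Nat.eq_dec i (S d)); [lia|ring]. }
        rewrite E. specialize (EP x). apply (f_equal (Rmult M)) in EP.
        replace (M * (x ^ S m / M)) with (x ^ S m) in EP by (field; lra). rewrite EP. ring.
      * intros i Hi. eapply Rle_trans; [apply Rabs_triang|].
        assert (B1 : Rabs (M * (if Nat.eq_dec i (S d) then 0 else a i / D)) <= C).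
        { rewrite Rabs_mult, (Rabs_pos_eq M) by lra.
          destruct (Nat.eq_dec i (S d)); [rewrite Rabs_R0; lra|].
          unfold Rdiv. rewrite Rabs_mult, (Rabs_pos_eq (/ D)) by (left; now apply Rinv_0_lt_compat).
          specialize (A2 i ltac:(lia)).
          replace C with (D * (C * / D)) by (field; lra).
          assert (0 < / D) by now apply Rinv_0_lt_compat.
          apply Rmult_le_compat; try lra.
          - apply Rmult_le_pos; [apply Rabs_pos|lra].
          - apply Rmult_le_compat_r; lra. }
        assert (B2 : Rabs (P 0) <= INR (S d) * (C * K ^ S d / D)).
        { unfold P, Rdiv. rewrite <- bsum_scal_r, <- bsum_const.
          eapply Rle_trans; [apply bsum_Rabs|]. apply bsum_le. intros j Hj.
          rewrite !Rabs_mult, (Rabs_pos_eq (/ D)) by (left; now apply Rinv_0_lt_compat).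
          apply Rmult_le_compat_r; [left; now apply Rinv_0_lt_compat|].
          apply Rmult_le_compat; try apply Rabs_pos; [apply A2; lia|].
          rewrite <- RPow_abs. apply pow_incr. split; [apply Rabs_pos|].
          rewrite Rminus_0_l, Rabs_Ropp. apply Hzk; lia. }
        assert (B3 : Rabs (- M * P 0 * g i) <= D * (INR (S d) * (C * K ^ S d / D)) * G).
        { rewrite !Rabs_mult, Rabs_Ropp, (Rabs_pos_eq M) by lra.
          apply Rmult_le_compat; [| |apply Rmult_le_compat|auto]; try apply Rabs_pos; try lra.
          apply Rmult_le_pos; [lra|apply Rabs_pos]. }
        unfold B. lra.
Qed.

(** Truncated power. For m = 0 it is the constant 1 and not a step function, hence the hypothesis 0
    < m of [tpow_left]. *)
Definition tpow (m : nat) (a x : R) : R := Rmax 0 (x - a) ^ m.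

Lemma tpow_left m a x : (0 < m)%nat -> x <= a -> tpow m a x = 0.
Proof.
  intros Hm Hx. unfold tpow. rewrite Rmax_left by lra. now apply pow_i.
Qed.

Lemma tpow_right m a x : a <= x -> tpow m a x = (x - a) ^ m.
Proof. intros Hx. unfold tpow. now rewrite Rmax_right by lra. Qed.

Lemma peval_Rabs_le_pow n c z M K : (forall m, (m < n)%nat -> Rabs (c m) <= M) -> 0 <= M ->
  1 <= K -> Rabs z <= K -> Rabs (peval n c z) <= INR n * (M * K ^ n).
Proof.
  intros Hc HM HK Hz. unfold peval. eapply Rle_trans; [apply bsum_Rabs|].
  rewrite <- bsum_const. apply bsum_le. intros m Hm.
  rewrite Rabs_mult, <- RPow_abs.
  apply Rmult_le_compat; auto using Rabs_pos.
  - apply pow_le, Rabs_pos.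
  - apply Rle_trans with (K ^ m).
    + apply pow_incr. split; [apply Rabs_pos|easy].
    + apply Rle_pow; [easy|lia].
Qed.

(* The powers [(x - y i) ^ (r - 1)] at [r] separated knots span the polynomials of
   degree below [r], so truncated powers can vanish to the left of all the knots
   and reproduce a given polynomial to the right of them. *)
Lemma cutoff r c : (2 <= r)%nat -> 0 < c -> exists C, 0 < C /\
  forall h (y : nat -> R), 0 < h ->
  (forall i, (S i < r)%nat -> h <= c * (y (S i) - y i) /\ y (S i) - y i <= h) ->
  forall e M, 0 <= M -> (forall m, (m < r)%nat -> Rabs (e m) <= M) ->
  exists a, let s := fun x => bsum r (fun i => a i * tpow (r - 1) (y i) x) in
    (forall x, y (r - 1)%nat <= x -> s x = peval r e ((x - y O) / h)) /\
    (forall x, y O <= x <= y (r - 1)%nat -> Rabs (s x - peval r e ((x - y O) / h)) <= C * M).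
Proof.
  intros Hr Hc.
  assert (Hdl : 0 < / c) by now apply Rinv_0_lt_compat.
  assert (Hr0 : 1 <= INR r) by (apply (le_INR 1); lia).
  destruct (monomial_shifted_powers (r - 1) (/ c) (INR r) Hdl) as [C [HC H]]; [lra|].
  set (D := INR r * C).
  assert (HDp : 0 < D) by (apply Rmult_lt_0_compat; lra).
  assert (HR : 1 <= INR r ^ r) by (apply pow_R1_Rle; lra).
  exists (INR r * (D * INR r ^ r) + INR r * (1 * INR r ^ r)).
  split.
  { assert (0 < INR r * (D * INR r ^ r)).
    { apply Rmult_lt_0_compat; [lra|]. apply Rmult_lt_0_compat; lra. }
    assert (0 < INR r * (1 * INR r ^ r)).
    { apply Rmult_lt_0_compat; [lra|]. apply Rmult_lt_0_compat; lra. }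
    lra. }
  intros h y Hh Hy e M HM He.
  assert (Hrr : S (r - 1) = r) by lia.
  assert (Hc1 : 1 <= c).
  { destruct (Hy O) as [A B]; [lia|]. nra. }
  assert (Gp : forall i j, (i < j <= r - 1)%nat -> h * / c <= y j - y i).
  { intros i j [Hij Hj]. induction j as [|j IH]; [lia|].
    destruct (Hy j) as [A _]; [lia|].
    assert (h * / c <= y (S j) - y j).
    { apply Rmult_le_reg_l with c; [easy|]. replace (c * (h * / c)) with h by (field; lra). easy. }
    assert (0 < h * / c) by (apply Rmult_lt_0_compat; auto).
    destruct (Nat.eq_dec i j) as [->|Hn]; [easy|]. assert (h * / c <= y j - y i) by (apply IH; lia). lra. }
  assert (Gu : forall i, (i <= r - 1)%nat -> 0 <= y i - y O <= INR i * h).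
  { induction i as [|i IH]; intros Hi; [simpl; lra|].
    destruct (Hy i) as [A B]; [lia|]. rewrite S_INR. destruct IH as [I1 I2]; [lia|]. nra. }
  (* The scaled knots lie in [0, r] and have gaps of at least 1 / c, so all constants depend on r
     and c alone. *)
  set (z := fun i => (y i - y O) / h).
  assert (Hz : gaps (r - 1) (/ c) z).
  { intros i j Hij. unfold z. replace ((y j - y O) / h - (y i - y O) / h) with ((y j - y i) / h) by (field; lra).
    apply Rmult_le_reg_l with h; [easy|]. replace (h * ((y j - y i) / h)) with (y j - y i) by (field; lra). auto. }
  assert (Hzk0 : forall i, (i <= r - 1)%nat -> 0 <= z i <= INR r).
  { intros i Hi. destruct (Gu i Hi) as [A B]. unfold z. split.
    - apply Rmult_le_pos; [easy|left; now apply Rinv_0_lt_compat].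
    - apply Rmult_le_reg_r with h; [easy|]. replace ((y i - y O) / h * h) with (y i - y O) by (field; lra).
      eapply Rle_trans; [exact B|]. apply Rmult_le_compat_r; [lra|]. apply le_INR; lia. }
  assert (Hzk : forall i, (i <= r - 1)%nat -> Rabs (z i) <= INR r).
  { intros i Hi. specialize (Hzk0 i Hi). rewrite Rabs_pos_eq; lra. }
  destruct (functional_choice (fun m a => (m < r)%nat ->
     (forall x, bsum r (fun i => a i * (x - z i) ^ (r - 1)) = x ^ m) /\
     forall i, (i < r)%nat -> Rabs (a i) <= C)) as [A HA].
  { intros m. destruct (Nat.lt_ge_cases m r) as [Hm|Hm].
    - destruct (H z Hz Hzk m) as [a [A1 A2]]; [lia|]. rewrite Hrr in A1.
      exists a. intros _. split; [easy|]. intros i Hi; apply A2; lia.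
    - exists (fun _ => 0). lia. }
  set (al := fun i => bsum r (fun m => e m * A m i)).
  assert (Hal : forall i, (i < r)%nat -> Rabs (al i) <= D * M).
  { intros i Hi. unfold al. eapply Rle_trans; [apply bsum_Rabs|].
    unfold D. rewrite Rmult_assoc, <- bsum_const. apply bsum_le. intros m Hm.
    rewrite Rabs_mult, Rmult_comm. apply Rmult_le_compat; try apply Rabs_pos; auto. now apply HA. }
  assert (Ep : forall t, bsum r (fun i => al i * (t - z i) ^ (r - 1)) = peval r e t).
  { intros t. unfold al, peval.
    rewrite (bsum_ext r _ (fun i => bsum r (fun m => e m * (A m i * (t - z i) ^ (r - 1))))).
    - rewrite bsum_swap. apply bsum_ext. intros m Hm. rewrite bsum_scal_l. f_equal. now apply HA.
    - intros i Hi. rewrite <- bsum_scal_r. apply bsum_ext; intros; ring. }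
  assert (Sh : forall x i, (x - y O) / h - z i = (x - y i) / h) by (intros; unfold z; field; lra).
  exists (fun i => al i / h ^ (r - 1)). cbv zeta.
  assert (Hhp : 0 < h ^ (r - 1)) by now apply pow_lt.
  assert (Term : forall x i, y i <= x ->
    al i / h ^ (r - 1) * tpow (r - 1) (y i) x = al i * ((x - y O) / h - z i) ^ (r - 1)).
  { intros x i Hx. rewrite tpow_right, Sh by easy. unfold Rdiv at 2.
    rewrite Rpow_mult_distr, pow_inv. field. lra. }
  split.
  - intros x Hx. rewrite <- Ep. apply bsum_ext. intros i Hi. apply Term.
    destruct (Nat.eq_dec i (r - 1)) as [->|Hn]; [easy|].
    assert (G := Gp i (r - 1)%nat ltac:(lia)).
    assert (0 < h * / c) by (apply Rmult_lt_0_compat; auto). lra.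
  - intros x Hx. unfold Rminus at 1.
    eapply Rle_trans; [apply Rabs_triang|]. rewrite Rabs_Ropp, Rmult_plus_distr_r.
    assert (Hxz : 0 <= (x - y O) / h <= INR r).
    { destruct (Gu (r - 1)%nat (Nat.le_refl _)) as [_ B]. split.
      - apply Rmult_le_pos; [lra|left; now apply Rinv_0_lt_compat].
      - apply Rmult_le_reg_r with h; [easy|]. replace ((x - y O) / h * h) with (x - y O) by (field; lra).
        apply Rle_trans with (INR (r - 1) * h); [lra|]. apply Rmult_le_compat_r; [lra|]. apply le_INR; lia. }
    apply Rplus_le_compat.
    + eapply Rle_trans; [apply bsum_Rabs|]. rewrite Rmult_assoc, <- bsum_const. apply bsum_le.
      intros i Hi. destruct (Rle_dec (y i) x) as [Hl|Hl].
      * rewrite Term by easy. rewrite Rabs_mult.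
        replace (D * INR r ^ r * M) with (D * M * INR r ^ r) by ring.
        apply Rmult_le_compat; try apply Rabs_pos; [now apply Hal|].
        rewrite <- RPow_abs. apply Rle_trans with (INR r ^ (r - 1)).
        -- apply pow_incr. split; [apply Rabs_pos|]. specialize (Hzk0 i ltac:(lia)).
           assert (0 <= (x - y O) / h - z i).
           { rewrite Sh. apply Rmult_le_pos; [lra|left; now apply Rinv_0_lt_compat]. }
           rewrite Rabs_pos_eq; lra.
        -- apply Rle_pow; [easy|lia].
      * rewrite tpow_left by (lia || lra). rewrite Rmult_0_r, Rabs_R0.
        apply Rmult_le_pos; [|easy]. apply Rmult_le_pos; lra.
    + replace (INR r * (1 * INR r ^ r) * M) with (INR r * (M * INR r ^ r)) by ring.
      apply peval_Rabs_le_pow; auto. rewrite Rabs_pos_eq; lra.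
Qed.

(** * Splines *)

Lemma C_on_ext a b k f g : (forall x, Icc a b x -> f x = g x) -> C_on a b k f -> C_on a b k g.
Proof.
  destruct k as [|k]; simpl; intros H Hf.
  - intros x Hx. rewrite <- H by easy.
    apply (filterlim_ext_loc f); [|now apply Hf].
    unfold within. apply filter_forall. auto.
  - destruct Hf as [f' [Hd Hc]]. exists f'; split; [|easy].
    intros x Hx. apply (is_derive_on_ext _ f); auto.
Qed.

Lemma C_on_ccont a b k f : a <= b -> C_on a b k f -> ccont a b f.
Proof.
  intros Hab. destruct k as [|k]; simpl.
  - now apply continuous_on_ccont.
  - intros [f' [Hd _]]. now apply (is_derive_on_ccont a b f f').
Qed.

Lemma C_on_lin a b k f g u v : a <= b -> C_on a b k f -> C_on a b k g ->
  C_on a b k (fun x => u * f x + v * g x).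
Proof.
  intros Hab. revert f g. induction k as [|k IH]; simpl; intros f g Hf Hg.
  - apply ccont_continuous_on. apply ccont_plus; apply ccont_mult; auto using ccont_const, continuous_on_ccont.
  - destruct Hf as [f' [Hf Hf']], Hg as [g' [Hg Hg']].
    exists (fun x => u * f' x + v * g' x). split; [|now apply IH].
    intros x Hx. apply is_derive_on_lin; auto.
Qed.

Lemma C_on_of_derive a b (F : nat -> R -> R) : a <= b ->
  (forall k x, is_derive (F k) x (F (S k) x)) -> forall m k, C_on a b m (F k).
Proof.
  intros Hab H. induction m as [|m IH]; intros k; simpl.
  - apply ccont_continuous_on, continuous_ccont; [easy|]. intros x _.
    apply (ex_derive_continuous (F k)). eexists; apply H.
  - exists (F (S k)). split; [|easy]. intros x Hx. now apply is_derive_on_of_is_derive.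
Qed.

Lemma C_on_peval a b k n c : a <= b -> C_on a b k (peval n c).
Proof.
  intros Hab.
  set (F := fix F i := match i with O => (n, c) | S i => (pred (fst (F i)), pderiv (snd (F i))) end).
  apply (C_on_of_derive a b (fun i => peval (fst (F i)) (snd (F i))) Hab) with (k := O).
  intros i x. apply peval_is_derive.
Qed.

Lemma tpow_is_derive m a x : is_derive (tpow (S (S m)) a) x (INR (S (S m)) * tpow (S m) a x).
Proof.
  destruct (Rtotal_order x a) as [H|[->|H]].
  - rewrite tpow_left by (lia || lra). rewrite Rmult_0_r.
    apply (is_derive_ext_loc (fun _ => 0)); [|apply (is_derive_const 0 x)].
    eapply filter_imp; [|apply (locally_Ioo (x - 1) a x); lra].
    intros y Hy. symmetry. apply tpow_left; lia || lra.
  - rewrite tpow_left by (lia || lra). rewrite Rmult_0_r.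
    apply is_derive_Reals. intros e He. exists (mkposreal _ (Rmin_pos _ _ He Rlt_0_1)).
    intros y Hy Hb. simpl in Hb.
    assert (B1 : Rabs y < e) by (eapply Rlt_le_trans; [exact Hb|apply Rmin_l]).
    assert (B2 : Rabs y < 1) by (eapply Rlt_le_trans; [exact Hb|apply Rmin_r]).
    rewrite (tpow_left _ a a) by (lia || lra). rewrite !Rminus_0_r.
    destruct (Rle_dec y 0) as [Hn|Hn].
    + rewrite tpow_left by (lia || lra). unfold Rdiv; rewrite Rmult_0_l, Rabs_R0; lra.
    + rewrite tpow_right by lra. replace (a + y - a) with y by ring.
      replace (y ^ S (S m) / y) with (y * y ^ m) by (simpl; field; lra).
      rewrite Rabs_pos_eq in * by lra.
      assert (P : 0 < y ^ m <= 1).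
      { split; [apply pow_lt; lra|]. rewrite <- (pow1 m). apply pow_incr; lra. }
      rewrite Rabs_pos_eq by nra. nra.
  - rewrite tpow_right by lra.
    apply (is_derive_ext_loc (fun y => (y - a) ^ S (S m))).
    + eapply filter_imp; [|apply (locally_Ioo a (x + 1) x); lra].
      intros y Hy. symmetry. apply tpow_right; lra.
    + auto_derive; [easy|]. simpl pred.
      change (x + - a) with (x - a). change (match m with O => 1 | S _ => INR m + 1 end) with (INR (S m)).
      rewrite (S_INR (S m)). change ((x - a) ^ S m) with ((x - a) * (x - a) ^ m). ring.
Qed.

Lemma C_on_tpow u v k m a : u <= v -> (k < m)%nat -> C_on u v k (tpow m a).
Proof.
  intros Huv. revert m. induction k as [|k IH]; intros m Hm; simpl.
  - apply ccont_continuous_on, continuous_ccont; [easy|]. intros x _.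
    destruct m as [|[|m]]; [lia| |].
    + apply (continuous_ext (fun x => (x - a + Rabs (x - a)) / 2)).
      * intros y. unfold tpow; rewrite pow_1. unfold Rmax, Rabs.
        destruct (Rle_dec 0 (y - a)), (Rcase_abs (y - a)); lra.
      * apply (continuous_mult (fun x => x - a + Rabs (x - a)) (fun _ => / 2)); [|apply continuous_const].
        apply (continuous_plus (fun x => x - a) (fun x => Rabs (x - a))).
        -- apply (continuous_minus (fun x => x) (fun _ => a)); [apply continuous_id|apply continuous_const].
        -- apply (continuous_comp (fun x => x - a) Rabs); [|apply continuous_Rabs].
           apply (continuous_minus (fun x => x) (fun _ => a)); [apply continuous_id|apply continuous_const].
    + apply (ex_derive_continuous (tpow (S (S m)) a)). eexists; apply tpow_is_derive.
  - destruct m as [|[|m]]; [lia|lia|].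
    exists (fun x => INR (S (S m)) * tpow (S m) a x + 0 * tpow (S m) a x). split.
    + intros x Hx. apply is_derive_on_of_is_derive; [easy|].
      rewrite Rmult_0_l, Rplus_0_r. apply tpow_is_derive.
    + apply C_on_lin; auto; apply IH; lia.
Qed.

(** [Sh] with the nodes numbered from 0 and the pieces given by r coefficients. *)
Definition spl (r k N : nat) (Y : nat -> R) (f : R -> R) : Prop :=
  C_on 0 1 k f /\ forall j, (j < N)%nat ->
    exists c, forall x, Icc (Y j) (Y (S j)) x -> f x = peval r c x.

Lemma sum_n_bsum f n : sum_n f n = bsum (S n) f.
Proof.
  induction n as [|n IH].
  - rewrite sum_O. symmetry. apply Rplus_0_l.
  - rewrite sum_Sn, IH. easy.
Qed.

Lemma Sh_spl r k N X f : (1 <= r)%nat -> Sh r k N X f <-> spl r k N (fun j => X (S j)) f.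
Proof.
  intros Hr. unfold Sh, spl, is_poly_on.
  assert (E : forall p x, sum_n (fun i => p i * x ^ i) (r - 1) = peval r p x).
  { intros p x. rewrite sum_n_bsum. replace (S (r - 1)) with r by lia. easy. }
  split; intros [H1 H2]; (split; [easy|]).
  - intros j Hj. destruct (H2 (S j)) as [p Hp]; [lia|]. exists p. intros x Hx.
    rewrite <- E. apply Hp. now rewrite Nat.add_1_r.
  - intros [|j] Hj; [lia|]. destruct (H2 j) as [p Hp]; [lia|]. exists p. intros x Hx.
    rewrite E. apply Hp. now rewrite Nat.add_1_r in Hx.
Qed.

Section Spline.
Context {r k N : nat} {Y : nat -> R}.

Lemma spl_lin f g u v : spl r k N Y f -> spl r k N Y g -> spl r k N Y (fun x => u * f x + v * g x).
Proof.
  intros [F1 F2] [G1 G2]. split; [apply C_on_lin; auto; lra|].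
  intros j Hj. destruct (F2 j Hj) as [c Hc], (G2 j Hj) as [d Hd].
  exists (fun m => u * c m + v * d m). intros x Hx. now rewrite peval_lin, Hc, Hd.
Qed.

Lemma spl_ext f g : grid N Y -> (forall x, Icc 0 1 x -> f x = g x) -> spl r k N Y f -> spl r k N Y g.
Proof.
  intros HG H [F1 F2]. split; [now apply (C_on_ext 0 1 k f)|].
  intros j Hj. destruct (F2 j Hj) as [c Hc]. exists c. intros x Hx.
  rewrite <- H; [now apply Hc|].
  assert (A := grid_01 N Y j HG ltac:(lia)). assert (B := grid_01 N Y (S j) HG ltac:(lia)).
  unfold Icc in *; lra.
Qed.

Lemma spl_peval c : spl r k N Y (peval r c).
Proof. split; [apply C_on_peval; lra|]. intros j _; exists c; auto. Qed.

Lemma spl_0 : spl r k N Y (fun _ => 0).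
Proof.
  split.
  - apply (C_on_ext 0 1 k (peval 0 (fun _ => 0))); [easy|]. apply C_on_peval; lra.
  - intros j _; exists (fun _ => 0). intros x _. unfold peval. rewrite bsum_0; [easy|]. intros; ring.
Qed.

Lemma spl_bsum n (c : nat -> R) (f : nat -> R -> R) : (forall i, (i < n)%nat -> spl r k N Y (f i)) ->
  spl r k N Y (fun x => bsum n (fun i => c i * f i x)).
Proof.
  intros H. induction n as [|n IH]; simpl; [apply spl_0|].
  assert (Q := spl_lin (fun x => bsum n (fun i => c i * f i x)) (f n) 1 (c n) (IH ltac:(auto)) (H n ltac:(lia))).
  destruct Q as [Q1 Q2]. split.
  - revert Q1. apply C_on_ext. intros; ring.
  - intros j Hj. destruct (Q2 j Hj) as [d Hd]. exists d. intros x Hx. rewrite <- Hd by easy. ring.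
Qed.

Context (HG : grid N Y).

Lemma spl_tpow m j : (k < m < r)%nat -> (j <= N)%nat -> spl r k N Y (tpow m (Y j)).
Proof.
  intros Hm Hj. split; [apply C_on_tpow; (lra || lia)|].
  intros i Hi. destruct (le_lt_dec j i) as [H|H].
  - assert (Hji : Y j <= Y i) by (apply (grid_le N); auto; lia).
    assert (Ex : exists c, forall x, (x - Y j) ^ m = peval r c x).
    { destruct (peval_affine r (kron m) (- Y j) 1) as [c Hc]. exists c. intros x.
      rewrite <- Hc. unfold peval. rewrite <- (bsum_kron r (fun i => (x - Y j) ^ i) m) by lia.
      apply bsum_ext. intros i' _. replace (- Y j + 1 * x) with (x - Y j) by ring. ring. }
    destruct Ex as [c Hc]. exists c. intros x Hx. rewrite tpow_right by (unfold Icc in Hx; lra). apply Hc.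
  - assert (Hji : Y (S i) <= Y j) by (apply (grid_le N); auto; lia).
    exists (fun _ => 0). intros x Hx. rewrite tpow_left by (lia || (unfold Icc in Hx; lra)).
    unfold peval. rewrite bsum_0; [easy|]. intros; ring.
Qed.

Lemma spl_ccont f : spl r k N Y f -> ccont 0 1 f.
Proof. intros [H _]. apply (C_on_ccont 0 1 k); [lra|easy]. Qed.

Lemma spl_piece_derive f j c x : (j < N)%nat ->
  (forall x, Icc (Y j) (Y (S j)) x -> f x = peval r c x) -> Y j < x < Y (S j) ->
  is_derive f x (peval (pred r) (pderiv c) x).
Proof.
  intros Hj Hc Hx. apply (is_derive_ext_loc (peval r c)); [|apply peval_is_derive].
  eapply filter_imp; [|apply (locally_Ioo _ _ _ Hx)].
  intros y Hy. symmetry. apply Hc. unfold Icc; lra.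
Qed.

Lemma spl_pc1 f : spl r k N Y f -> pc1 N Y f.
Proof.
  intros H. split; [now apply spl_ccont|]. destruct H as [_ H]. split.
  - intros x [j [Hj Hx]]. destruct (H j Hj) as [c Hc]. eexists. now apply (spl_piece_derive f j c).
  - intros j Hj. destruct (H j Hj) as [c Hc]. exists (peval (pred r) (pderiv c)). split.
    + intros; apply peval_continuous.
    + intros x Hx. apply is_derive_unique. now apply (spl_piece_derive f j c).
Qed.

(** Induction on the smoothness: uniqueness of one-sided derivatives identifies [f'] with the
    derived polynomial on each closed side of [z], at [z] itself included, and the values at [z]
    compare the constant terms. *)
Lemma C_on_jump n a b z p q f : a < z < b -> C_on 0 1 k f -> 0 <= a -> b <= 1 ->
  (forall x, Icc a z x -> f x = peval n p (x - z)) ->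
  (forall x, Icc z b x -> f x = peval n q (x - z)) ->
  forall m, (m <= k)%nat -> (m < n)%nat -> p m = q m.
Proof.
  intros Hz Hf H0 H1. revert n p q f Hf.
  induction k as [|k' IH]; intros n p q f Hf Hp Hq m Hm Hmn.
  - replace m with O by lia.
    assert (E1 := Hp z ltac:(unfold Icc; lra)). assert (E2 := Hq z ltac:(unfold Icc; lra)).
    rewrite Rminus_diag, peval_at_0 in E1, E2 by lia. lra.
  - destruct m as [|m].
    { assert (E1 := Hp z ltac:(unfold Icc; lra)). assert (E2 := Hq z ltac:(unfold Icc; lra)).
      rewrite Rminus_diag, peval_at_0 in E1, E2 by lia. lra. }
    destruct Hf as [f' [Hd Hf']].
    assert (Der : forall c x, is_derive (fun x => peval n c (x - z)) x (peval (pred n) (pderiv c) (x - z))).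
    { intros c x. rewrite <- (Rmult_1_l (peval _ _ _)).
      apply (is_derive_comp (peval n c) (fun x => x - z)); [apply peval_is_derive|].
      auto_derive; [easy|ring]. }
    assert (W : forall u v c, u < v -> 0 <= u -> v <= 1 ->
       (forall x, Icc u v x -> f x = peval n c (x - z)) ->
       forall x, Icc u v x -> f' x = peval (pred n) (pderiv c) (x - z)).
    { intros u v c Huv Hu Hv Hc x Hx. apply (is_derive_on_unique u v f x); auto.
      - apply (is_derive_on_sub (Icc 0 1)); auto; [unfold Icc in *; intros; lra|].
        apply Hd. unfold Icc in *; lra.
      - apply (is_derive_on_ext _ (fun x => peval n c (x - z))); auto.
        + intros; symmetry; auto.
        + now apply is_derive_on_of_is_derive. }
    assert (E := IH (pred n) (pderiv p) (pderiv q) f' Hf'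
      (W a z p ltac:(lra) ltac:(lra) ltac:(lra) Hp) (W z b q ltac:(lra) ltac:(lra) ltac:(lra) Hq) m ltac:(lia) ltac:(lia)).
    unfold pderiv in E. apply Rmult_eq_reg_l in E; [easy|]. apply not_0_INR; lia.
Qed.

Lemma spl_pieces f : spl r k N Y f -> exists p d : nat -> nat -> R,
  (forall j, (j < N)%nat -> forall x, Icc (Y j) (Y (S j)) x -> f x = peval r (p j) x) /\
  (forall j, (S j < N)%nat -> forall x,
     peval r (p (S j)) x - peval r (p j) x = peval r (d (S j)) (x - Y (S j))) /\
  (forall j m, (m <= k)%nat -> d j m = 0).
Proof.
  intros [HC HP].
  destruct (functional_choice (fun j c => (j < N)%nat ->
     forall x, Icc (Y j) (Y (S j)) x -> f x = peval r c x)) as [p Hp].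
  { intros j. destruct (le_lt_dec N j) as [Hj|Hj].
    - exists (fun _ => 0); lia.
    - destruct (HP j Hj) as [c Hc]; exists c; auto. }
  assert (Sh : forall c z, exists c', forall x, peval r c x = peval r c' (x - z)).
  { intros c z. destruct (peval_affine r c z 1) as [c' Hc']. exists c'. intros x.
    rewrite <- Hc'. f_equal; ring. }
  destruct (functional_choice (fun j d =>
     ((0 < j < N)%nat -> forall x, peval r (p j) x - peval r (p (pred j)) x = peval r d (x - Y j)) /\
     (forall m, (m <= k)%nat -> d m = 0))) as [d Hd].
  { intros j. destruct (le_lt_dec N j) as [Hj|Hj]; [exists (fun _ => 0); split; [lia|easy]|].
    destruct j as [|j]; [exists (fun _ => 0); split; [lia|easy]|].
    destruct (Sh (p (S j)) (Y (S j))) as [q Hq], (Sh (p j) (Y (S j))) as [q' Hq'].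
    assert (Y1 : Y j < Y (S j)) by (apply HG; lia).
    assert (Y2 : Y (S j) < Y (S (S j))) by (apply HG; lia).
    assert (A := grid_01 N Y j HG ltac:(lia)). assert (B := grid_01 N Y (S (S j)) HG ltac:(lia)).
    assert (J : forall m, (m <= k)%nat -> (m < r)%nat -> q' m = q m).
    { apply (C_on_jump r (Y j) (Y (S (S j))) (Y (S j)) q' q f); auto; try lra.
      - intros x Hx. rewrite <- Hq'. apply Hp; [lia|easy].
      - intros x Hx. rewrite <- Hq. apply Hp; [lia|easy]. }
    (* Set to 0 outright for m <= k, whatever the coefficients with index r or more are; for indices
       below r this is the true difference, by [J]. *)
    exists (fun m => if le_lt_dec m k then 0 else q m - q' m). split.
    - intros _ x. simpl pred. rewrite Hq, Hq'. symmetry.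
      rewrite (peval_ext r _ (fun m => 1 * q m + -1 * q' m)).
      + rewrite peval_lin. ring.
      + intros m Hm. cbv beta. destruct (le_lt_dec m k) as [Hk|Hk]; [|ring].
        rewrite J by easy. ring.
    - intros m Hm. destruct (le_lt_dec m k); [easy|lia]. }
  exists p, d. split; [auto|split].
  - intros j Hj x. destruct (Hd (S j)) as [E _]. apply E; lia.
  - intros j m Hm. now apply Hd.
Qed.

Lemma bsum_truncate n i f : (i <= n)%nat -> (forall j, (i <= j < n)%nat -> f j = 0) ->
  bsum n f = bsum i f.
Proof.
  intros Hi H. induction n as [|n IH].
  - replace i with O by lia. easy.
  - destruct (Nat.eq_dec i (S n)) as [->|Hn]; [easy|].
    simpl. rewrite IH, H by (try lia; intros; apply H; lia). ring.
Qed.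

Lemma bsum_telescope f n : bsum n (fun j => f (S j) - f j) = f n - f O.
Proof. induction n as [|n IH]; simpl; [ring|]. rewrite IH; ring. Qed.

Lemma tpow_jump_left d x j : (forall m, (m <= k)%nat -> d m = 0) -> x <= Y j ->
  bsum r (fun m => d m * tpow m (Y j) x) = 0.
Proof.
  intros Hd Hx. apply bsum_0. intros m _. destruct m as [|m].
  (* At m = 0 the truncated power is 1 on the left as well, so the coefficient itself has to vanish,
     which it does as 0 <= k. *)
  - rewrite Hd by lia; ring.
  - rewrite tpow_left by (lia || lra). ring.
Qed.

Lemma tpow_jump_right d x j : Y j <= x ->
  bsum r (fun m => d m * tpow m (Y j) x) = peval r d (x - Y j).
Proof. intros Hx. apply bsum_ext. intros m _. now rewrite tpow_right. Qed.

Lemma spl_jump d j : (forall m, (m <= k)%nat -> d m = 0) -> (j <= N)%nat ->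
  spl r k N Y (fun x => bsum r (fun m => d m * tpow m (Y j) x)).
Proof.
  intros Hd Hj.
  apply (spl_ext (fun x => bsum r (fun m => d m * (if le_lt_dec m k then 0 else tpow m (Y j) x)))); [easy| |].
  - intros x _. apply bsum_ext. intros m Hm. destruct (le_lt_dec m k); [|easy]. rewrite Hd by easy; ring.
  - apply (spl_bsum r d (fun m x => if le_lt_dec m k then 0 else tpow m (Y j) x)).
    intros m Hm. destruct (le_lt_dec m k); [apply spl_0|]. apply spl_tpow; [lia|easy].
Qed.

(** Truncated power representation: the jumps at the nodes to the left of x telescope from the first
    piece to the current one, and those to the right contribute nothing. *)
Lemma spl_representation f p d :
  (forall j, (j < N)%nat -> forall x, Icc (Y j) (Y (S j)) x -> f x = peval r (p j) x) ->
  (forall j, (S j < N)%nat -> forall x,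
     peval r (p (S j)) x - peval r (p j) x = peval r (d (S j)) (x - Y (S j))) ->
  (forall j m, (m <= k)%nat -> d j m = 0) ->
  forall x, Icc 0 1 x -> f x = peval r (p O) x +
    bsum (N - 1) (fun j => bsum r (fun m => d (S j) m * tpow m (Y (S j)) x)).
Proof.
  intros Hp Hj Hd x Hx. destruct (grid_locate N Y x HG Hx) as [i [Hi Hxi]].
  rewrite (Hp i Hi x Hxi).
  rewrite (bsum_truncate (N - 1) i).
  - rewrite (bsum_ext i _ (fun j => peval r (p (S j)) x - peval r (p j) x)).
    + rewrite (bsum_telescope (fun j => peval r (p j) x)). ring.
    + intros j Hji. rewrite Hj by lia. apply tpow_jump_right.
      apply Rle_trans with (Y i); [apply (grid_le N); auto; lia|lra].
  - lia.
  - intros j Hji. apply tpow_jump_left; [auto|].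
    apply Rle_trans with (Y (S i)); [lra|]. apply (grid_le N); auto; lia.
Qed.

End Spline.

(** * Inverse inequalities *)

Lemma Rle_sqr_abs x y : 0 <= y -> x * x <= y * y -> Rabs x <= y.
Proof. intros Hy H. apply Rsqr_le_abs_0 in H. now rewrite (Rabs_pos_eq y) in H. Qed.

Lemma Rabs_le_sqr x y : Rabs x <= y -> x * x <= y * y.
Proof.
  intros H. apply Rsqr_le_abs_1. eapply Rle_trans; [exact H|apply Rle_abs].
Qed.

Lemma peval_sqr_ex_RInt n q a b : ex_RInt (fun x => peval n q x * peval n q x) a b.
Proof.
  apply (ex_RInt_continuous (fun x => peval n q x * peval n q x)). intros x _.
  apply (continuous_mult (peval n q) (peval n q)); apply peval_continuous.
Qed.

Lemma peval_sqr_RInt_ge0 n q a b : a < b -> 0 <= RInt (fun x => peval n q x * peval n q x) a b.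
Proof.
  intros Hab. apply RInt_ge_0; [lra|apply peval_sqr_ex_RInt|]. intros; apply Rle_0_sqr.
Qed.

Lemma peval_scaled_coef n c : 0 < c -> exists C, 0 < C /\ forall q a b h,
  a < b -> h <= c * (b - a) -> b - a <= h ->
  exists e, (forall x, peval n q x = peval n e ((x - b) / h)) /\
    forall m, (m < n)%nat ->
      e m * e m <= C / h * RInt (fun x => peval n q x * peval n q x) a b.
Proof.
  intros Hc. destruct (peval_local_coef n) as [C [HC H]].
  (* Passing from the length l of the interval to h multiplies the m-th coefficient by a power of h
     / l <= c, whose square is covered by the power of 1 + c^2; the single factor c turns 1 / l into
     c / h. *)
  exists (C * c * (1 + c * c) ^ n).
  assert (Hp : forall m, 0 < (1 + c * c) ^ m) by (intros; apply pow_lt; nra).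
  split; [apply Rmult_lt_0_compat; [nra|apply Hp]|].
  intros q a b h Hab Hh1 Hh2. destruct (H q a b Hab) as [d [Hd1 Hd2]].
  set (l := b - a) in *. assert (Hl : 0 < l) by (unfold l; lra).
  exists (fun m => d m * (- (h / l)) ^ m). split.
  - intros x. rewrite <- (peval_scale n d (- (h / l))), <- Hd1. f_equal. field. lra.
  - intros m Hm. specialize (Hd2 m Hm).
    set (J := RInt (fun x => peval n q x * peval n q x) a b) in *.
    assert (HJ : 0 <= J) by now apply peval_sqr_RInt_ge0.
    assert (E1 : (- (h / l)) ^ m * (- (h / l)) ^ m <= (1 + c * c) ^ n).
    { rewrite <- Rpow_mult_distr. apply Rle_trans with ((1 + c * c) ^ m).
      - apply pow_incr. assert (K1 : 0 <= h / l) by (apply Rmult_le_pos; [lra|left; now apply Rinv_0_lt_compat]).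
        assert (K2 : h / l <= c).
        { apply Rmult_le_reg_r with l; [easy|]. replace (h / l * l) with h by (field; lra). easy. }
        nra.
      - apply Rle_pow; [nra|lia]. }
    assert (E2 : C / l * J <= C * c / h * J).
    { apply Rmult_le_compat_r; [easy|].
      apply Rmult_le_reg_r with (l * h); [nra|].
      replace (C / l * (l * h)) with (C * h) by (field; lra).
      replace (C * c / h * (l * h)) with (C * (c * l)) by (field; lra). nra. }
    replace (d m * (- (h / l)) ^ m * (d m * (- (h / l)) ^ m)) with
      (d m * d m * ((- (h / l)) ^ m * (- (h / l)) ^ m)) by ring.
    replace (C * c * (1 + c * c) ^ n / h * J) with (C * c / h * J * (1 + c * c) ^ n) by (field; lra).
    apply Rmult_le_compat; try lra; try apply Rle_0_sqr.
Qed.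

(** All norms on polynomials of fixed degree are equivalent; in the variable scaled by h the
    coefficients control everything. For squares, a point value costs 1 / h and a derivative a
    further 1 / h^2. *)
Lemma peval_inverse n c : 0 < c -> exists C, 0 < C /\ forall q a b h x,
  a < b -> h <= c * (b - a) -> b - a <= h -> a <= x <= b ->
  peval n q x * peval n q x <= C / h * RInt (fun x => peval n q x * peval n q x) a b /\
  peval (pred n) (pderiv q) x * peval (pred n) (pderiv q) x <=
    C / (h * h * h) * RInt (fun x => peval n q x * peval n q x) a b.
Proof.
  intros Hc. destruct (peval_scaled_coef n c Hc) as [C [HC H]].
  (* (1 + n)^4 covers n^2, needed for the values, and n^4, needed for the derivative, whose
     coefficients gain a factor of at most n. *)
  set (n4 := (1 + INR n) * (1 + INR n) * ((1 + INR n) * (1 + INR n))).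
  assert (Hn0 : 0 <= INR n) by apply pos_INR.
  exists (n4 * C).
  assert (Hn4 : 1 <= n4) by (unfold n4; nra).
  split; [nra|]. intros q a b h x Hab Hh1 Hh2 Hx.
  destruct (H q a b h Hab Hh1 Hh2) as [e [He1 He2]].
  assert (Hh : 0 < h) by lra.
  set (J := RInt (fun x => peval n q x * peval n q x) a b) in *.
  assert (HJ : 0 <= J) by now apply peval_sqr_RInt_ge0.
  set (E := sqrt (C / h * J)).
  assert (HE0 : 0 <= E) by apply sqrt_pos.
  assert (HP : 0 <= C / h * J).
  { apply Rmult_le_pos; [|easy]. apply Rmult_le_pos; [lra|left; now apply Rinv_0_lt_compat]. }
  assert (HEE : E * E = C / h * J) by now apply sqrt_sqrt.
  assert (He : forall m, (m < n)%nat -> Rabs (e m) <= E).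
  { intros m Hm. apply Rle_sqr_abs; [easy|]. rewrite HEE. auto. }
  assert (Hz : Rabs ((x - b) / h) <= 1).
  { unfold Rdiv. rewrite Rabs_mult, (Rabs_pos_eq (/ h)) by (left; now apply Rinv_0_lt_compat).
    apply Rmult_le_reg_r with h; [easy|]. rewrite Rmult_assoc, Rinv_l by lra.
    rewrite Rabs_minus_sym, Rabs_pos_eq; lra. }
  split.
  - rewrite He1. assert (B := peval_Rabs_le n e _ E He Hz). apply Rabs_le_sqr in B.
    eapply Rle_trans; [exact B|].
    replace (n4 * C / h * J) with (n4 * (E * E)) by (rewrite HEE; field; lra).
    replace (INR n * E * (INR n * E)) with (INR n * INR n * (E * E)) by ring.
    apply Rmult_le_compat_r; [nra|]. unfold n4. nra.
  - assert (D : peval (pred n) (pderiv q) x = / h * peval (pred n) (pderiv e) ((x - b) / h)).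
    { transitivity (Derive (peval n q) x); [symmetry; apply is_derive_unique, peval_is_derive|].
      apply is_derive_unique. apply (is_derive_ext (fun x => peval n e ((x - b) / h))); [auto|].
      apply (is_derive_comp (peval n e) (fun x => (x - b) / h)); [apply peval_is_derive|].
      auto_derive; [easy|]. field; lra. }
    rewrite D.
    assert (He' : forall m, (m < pred n)%nat -> Rabs (pderiv e m) <= INR n * E).
    { intros m Hm. unfold pderiv. rewrite Rabs_mult, (Rabs_pos_eq (INR (S m))) by apply pos_INR.
      apply Rmult_le_compat; [apply pos_INR|apply Rabs_pos|apply le_INR; lia|apply He; lia]. }
    assert (B := peval_Rabs_le (pred n) (pderiv e) _ _ He' Hz).
    assert (B' : Rabs (peval (pred n) (pderiv e) ((x - b) / h)) <= INR n * (INR n * E)).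
    { eapply Rle_trans; [exact B|]. apply Rmult_le_compat_r; [nra|]. apply le_INR; lia. }
    apply Rabs_le_sqr in B'. set (Z := peval (pred n) (pderiv e) ((x - b) / h)) in *.
    replace (/ h * Z * (/ h * Z)) with (/ (h * h) * (Z * Z)) by (field; lra).
    replace (n4 * C / (h * h * h) * J) with (/ (h * h) * (n4 * (E * E))) by (rewrite HEE; field; lra).
    apply Rmult_le_compat_l; [left; apply Rinv_0_lt_compat; nra|].
    eapply Rle_trans; [exact B'|].
    replace (INR n * (INR n * E) * (INR n * (INR n * E))) with
      (INR n * INR n * (INR n * INR n) * (E * E)) by ring.
    apply Rmult_le_compat_r; [nra|]. unfold n4. apply Rmult_le_compat; nra.
Qed.

(** * Local approximation by splines *)

Definition quasi (c h : R) (N : nat) (Y : nat -> R) : Prop :=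
  forall j, (j < N)%nat -> h <= c * (Y (S j) - Y j) /\ Y (S j) - Y j <= h.

Definition piece (Y : nat -> R) (j : nat) (f : R -> R) : R := RInt f (Y j) (Y (S j)).

Section Pieces.
Context {N : nat} {Y : nat -> R} (HG : grid N Y).

Lemma piece_le f g j : pc N Y f -> pc N Y g -> (j < N)%nat ->
  (forall x, Y j < x < Y (S j) -> f x <= g x) -> piece Y j f <= piece Y j g.
Proof.
  intros Hf Hg Hj H. apply RInt_le; auto; try (apply (pc_ex_RInt_piece HG); auto).
  left; apply HG; auto.
Qed.

Lemma piece_ge0 f j : pc N Y f -> (j < N)%nat ->
  (forall x, Y j < x < Y (S j) -> 0 <= f x) -> 0 <= piece Y j f.
Proof.
  intros Hf Hj H. apply RInt_ge_0; auto; try (apply (pc_ex_RInt_piece HG); auto).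
  left; apply HG; auto.
Qed.

Lemma piece_le_const f j h M : pc N Y f -> (j < N)%nat -> Y (S j) - Y j <= h -> 0 <= M ->
  (forall x, Y j < x < Y (S j) -> f x <= M) -> piece Y j f <= h * M.
Proof.
  intros Hf Hj Hh HM H.
  assert (Y j < Y (S j)) by (apply HG; auto).
  apply Rle_trans with (piece Y j (fun _ => M)); [apply piece_le; auto using pc_const|].
  unfold piece. rewrite RInt_const. unfold scal; simpl; unfold mult; simpl.
  apply Rmult_le_compat_r; lra.
Qed.

Lemma piece_lin f g j u v : pc N Y f -> pc N Y g -> (j < N)%nat ->
  piece Y j (fun x => u * f x + v * g x) = u * piece Y j f + v * piece Y j g.
Proof.
  intros Hf Hg Hj. unfold piece.
  assert (P : forall w f, pc N Y f -> ex_RInt (fun x => w * f x) (Y j) (Y (S j)))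
    by (intros; apply (pc_ex_RInt_piece HG); auto using pc_mult, pc_const).
  rewrite (RInt_plus (fun x => u * f x) (fun x => v * g x)) by auto.
  rewrite (RInt_scal f), (RInt_scal g) by (apply (pc_ex_RInt_piece HG); auto). easy.
Qed.

Lemma bsum_piece f : pc N Y f -> bsum N (fun j => piece Y j f) = I f.
Proof. intros Hf. symmetry. now apply (pc_I_pieces HG). Qed.

End Pieces.

(** On interval i only the latest r jumps are still being spread; their bounds are listed backwards
    from i. Truncated subtraction can only add nonnegative terms on the right. *)
Lemma bsum_window i r eps : (forall j, 0 <= eps j) ->
  bsum i (fun j => if le_lt_dec (j + S r) i then 0 else eps (S j)) <= bsum r (fun s => eps (i - s)%nat).
Proof.
  intros He. induction r as [|r IH].
  - simpl. right. apply bsum_0. intros j Hj. destruct (le_lt_dec (j + 1) i); [easy|lia].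
  - simpl. eapply Rle_trans; [|apply Rplus_le_compat_r; exact IH].
    apply Rle_trans with (bsum i (fun j => (if le_lt_dec (j + S r) i then 0 else eps (S j)) +
       (if le_lt_dec (S r) i then eps (S j) * kron (i - S r) j else 0))).
    + apply bsum_le. intros j Hj. unfold kron.
      destruct (le_lt_dec (j + S (S r)) i), (le_lt_dec (j + S r) i), (le_lt_dec (S r) i);
        try lia; destruct (Nat.eq_dec (i - S r) j); try lia; specialize (He (S j)); lra.
    + rewrite bsum_plus. apply Rplus_le_compat_l.
      destruct (le_lt_dec (S r) i) as [H|H].
      * rewrite bsum_kron by lia. replace (S (i - S r)) with (i - r)%nat by lia. lra.
      * rewrite bsum_0; auto.
Qed.

(** Shifting by s drops the last s terms; the first ones become g 0 through truncated subtraction,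
    hence the hypothesis that g 0 vanishes. *)
Lemma bsum_delay N s g : (forall j, 0 <= g j) -> g O = 0 ->
  bsum N (fun i => g (i - s)%nat) <= bsum N g.
Proof.
  revert g. induction s as [|s IH]; intros g Hg H0.
  - right. apply bsum_ext. intros; f_equal; lia.
  - apply Rle_trans with (bsum N (fun i => g (pred i))).
    + rewrite (bsum_ext N _ (fun i => (fun j => g (pred j)) (i - s)%nat)).
      * apply (IH (fun j => g (pred j))); auto.
      * intros i _. simpl. f_equal. lia.
    + destruct N as [|n]; [simpl; lra|].
      rewrite bsum_shift. simpl pred. rewrite H0. simpl.
      change (fun i => g i) with g. specialize (Hg n). lra.
Qed.

(* The discontinuous piecewise polynomial [Q] becomes a spline when the part
   [q j] of its jump at [Y (S j)] that violates the smoothness is spread over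
   [r] consecutive knots by [cutoff]; the last [r - 1] nodes must carry no such
   jump, so that the value at 1 is unchanged. *)
Lemma smoothing r k c : (2 <= r)%nat -> (k <= r - 2)%nat -> 0 < c -> exists C, 0 < C /\
  forall N Y h, grid N Y -> 0 < h -> quasi c h N Y -> (r <= N)%nat ->
  forall Q D : nat -> nat -> R,
  (forall j m, (m <= k)%nat -> D j m = 0) ->
  let q j x := peval r (Q (S j)) x - peval r (Q j) x - peval r (D (S j)) (x - Y (S j)) in
  (forall j x, (N - r + 1 <= j)%nat -> (S j < N)%nat -> q j x = 0) ->
  exists psi, spl r k N Y psi /\ psi 0 = peval r (Q O) 0 /\ psi 1 = peval r (Q (N - 1)%nat) 1 /\
    bsum N (fun i => piece Y i (fun x => (psi x - peval r (Q i) x) * (psi x - peval r (Q i) x))) <=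
    C * bsum (N - 1) (fun j => piece Y j (fun x => q j x * q j x)).
Proof.
  intros Hr Hk Hc.
  destruct (peval_scaled_coef r c Hc) as [C0 [HC0 Hcoef]].
  destruct (cutoff r c Hr Hc) as [C1 [HC1 Hcut]].
  assert (Hr0 : 0 < INR r) by (apply lt_0_INR; lia).
  exists (C1 * C1 * (INR r * INR r) * C0). split; [repeat apply Rmult_lt_0_compat; easy|].
  intros N Y h HG Hh Hq HN Q D HD q Hlast.
  assert (HN1 : Y N = 1) by apply HG.
  set (nrm := fun j => piece Y j (fun x => q j x * q j x)).
  (* [eps (S j)] bounds the scaled coefficients of [q j], by [peval_scaled_coef]. The value 0 at
     index 0 is what [bsum_delay] asks for. *)
  set (eps := fun j => match j with O => 0 | S j => sqrt (C0 / h * nrm j) end).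
  assert (HC0h : 0 < C0 / h) by now apply Rdiv_lt_0_compat.
  assert (Heps0 : forall j, 0 <= eps j) by (intros [|j]; simpl; [lra|apply sqrt_pos]).
  assert (HQ : exists G : nat -> nat -> R, forall j x, q j x = peval r (G j) x).
  { destruct (functional_choice (fun j g => forall x, q j x = peval r g x)) as [G HGG]; [|now exists G].
    intros j. destruct (peval_affine r (D (S j)) (- Y (S j)) 1) as [d Hd].
    exists (fun m => 1 * (1 * Q (S j) m + -1 * Q j m) + -1 * d m). intros x.
    rewrite peval_lin, peval_lin, <- Hd. unfold q.
    replace (- Y (S j) + 1 * x) with (x - Y (S j)) by ring. ring. }
  destruct HQ as [G HGq].
  assert (Enrm : forall j, nrm j = RInt (fun x => peval r (G j) x * peval r (G j) x) (Y j) (Y (S j))).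
  { intros j. unfold nrm, piece. apply RInt_ext. intros; now rewrite HGq. }
  assert (Hnrm : forall j, (j < N)%nat -> 0 <= nrm j).
  { intros j Hj. rewrite Enrm. apply peval_sqr_RInt_ge0. apply HG; auto. }
  (* The function s vanishes up to the node [Y (S j)], equals [q j] after r knots, and is off by at
     most C1 eps in between. Where fewer than r knots remain, [q j] is 0 and all coefficients are
     taken to be 0. *)
  assert (Hcuts : exists a : nat -> nat -> R, forall j, (S j < N)%nat ->
    let s := fun x => bsum r (fun i => a j i * tpow (r - 1) (Y (S j + i)%nat) x) in
    (forall i x, (j + r <= i)%nat -> (i < N)%nat -> Icc (Y i) (Y (S i)) x -> s x = q j x) /\
    (forall x, Y (S j) <= x <= 1 -> Rabs (s x - q j x) <= C1 * eps (S j)) /\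
    s 1 = q j 1 /\ spl r k N Y s /\ forall x, x <= Y (S j) -> s x = 0).
  { destruct (functional_choice (fun j (a : nat -> R) => (S j < N)%nat ->
    let s := fun x => bsum r (fun i => a i * tpow (r - 1) (Y (S j + i)%nat) x) in
    (forall i x, (j + r <= i)%nat -> (i < N)%nat -> Icc (Y i) (Y (S i)) x -> s x = q j x) /\
    (forall x, Y (S j) <= x <= 1 -> Rabs (s x - q j x) <= C1 * eps (S j)) /\
    s 1 = q j 1 /\ spl r k N Y s /\ forall x, x <= Y (S j) -> s x = 0)) as [a Ha]; [|now exists a].
    intros j. destruct (le_lt_dec (N - r + 1) j) as [Hj|Hj].
    - exists (fun _ => 0). intros HjN s.
      assert (S0 : forall x, s x = 0) by (intros; unfold s; apply bsum_0; intros; ring).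
      split; [intros; now rewrite S0, Hlast|]. split; [|split; [now rewrite S0, Hlast|split; [|auto]]].
      + intros x _. rewrite S0, Hlast, Rminus_diag, Rabs_R0 by auto.
        apply Rmult_le_pos; [lra|auto].
      + apply (spl_ext (fun _ => 0)); auto using spl_0.
    - destruct (Hcoef (G j) (Y j) (Y (S j)) h) as [e [He1 He2]].
      { apply HG; lia. } { apply Hq; lia. } { apply Hq; lia. }
      assert (Hm : forall m, (m < r)%nat -> Rabs (e m) <= eps (S j)).
      { intros m Hm. apply Rle_sqr_abs; [auto|]. simpl. rewrite sqrt_sqrt.
        - rewrite Enrm. auto.
        - apply Rmult_le_pos; [lra|]. apply Hnrm; lia. }
      destruct (Hcut h (fun i => Y (S j + i)%nat) Hh) with (e := e) (M := eps (S j)) as [a [A1 A2]]; auto.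
      { intros i Hi. replace (S j + S i)%nat with (S (S j + i)) by lia. apply Hq; lia. }
      cbv beta zeta in A1, A2. rewrite Nat.add_0_r in A1, A2.
      exists a. intros HjN s. fold s in A1, A2.
      assert (Eq : forall x, peval r e ((x - Y (S j)) / h) = q j x) by (intros; now rewrite HGq, He1).
      assert (A1' : forall x, Y (S j + (r - 1))%nat <= x -> s x = q j x) by (intros; rewrite <- Eq; now apply A1).
      assert (HYl : Y (S j + (r - 1))%nat <= 1) by (apply (grid_01 N); auto; lia).
      split; [|split; [|split; [|split]]].
      + intros i x Hi HiN Hx. apply A1'. apply Rle_trans with (Y i); [|apply Hx].
        apply (grid_le N); auto; lia.
      + intros x Hx. destruct (Rle_dec x (Y (S j + (r - 1))%nat)) as [Hl|Hl].
        * rewrite <- Eq. apply A2. lra.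
        * rewrite A1' by lra. rewrite Rminus_diag, Rabs_R0. apply Rmult_le_pos; [lra|auto].
      + now apply A1'.
      + apply (spl_bsum r a (fun i => tpow (r - 1) (Y (S j + i)%nat))).
        intros i Hi. apply (spl_tpow HG); lia.
      + intros x Hx. apply bsum_0. intros i Hi. rewrite tpow_left; [ring|lia|].
        eapply Rle_trans; [exact Hx|]. apply (grid_le N); auto; lia. }
  destruct Hcuts as [a Ha].
  set (s := fun j x => bsum r (fun i => a j i * tpow (r - 1) (Y (S j + i)%nat) x)).
  set (t := fun j x => bsum r (fun m => D (S j) m * tpow m (Y (S j)) x)).
  (* Starting from the first piece, each jump keeps its admissible part [t j] at the node, while the
     rest [q j] enters gradually as [s j]. *)
  set (psi := fun x => peval r (Q O) x + bsum (N - 1) (fun j => t j x + s j x)).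
  assert (Hpsi : forall i x, (i < N)%nat -> Icc (Y i) (Y (S i)) x ->
    psi x - peval r (Q i) x = bsum i (fun j => s j x - q j x)).
  { intros i x Hi Hx. unfold psi. rewrite (bsum_truncate (N - 1) i).
    - replace (peval r (Q i) x) with (peval r (Q O) x + bsum i (fun j => peval r (Q (S j)) x - peval r (Q j) x))
        by (rewrite (bsum_telescope (fun j => peval r (Q j) x)); ring).
      match goal with |- ?A + ?B - (?A + ?B') = ?E => replace (A + B - (A + B')) with (B - B') by ring end.
      rewrite <- bsum_minus. apply bsum_ext. intros j Hj.
      assert (Et : t j x = peval r (D (S j)) (x - Y (S j))).
      { apply tpow_jump_right. apply Rle_trans with (Y i); [apply (grid_le N); auto; lia|apply Hx]. }
      rewrite Et. unfold q. ring.
    - lia.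
    - intros j Hj.
      assert (HxS : x <= Y (S j)) by (apply Rle_trans with (Y (S i)); [apply Hx|apply (grid_le N); auto; lia]).
      assert (Et : t j x = 0) by (apply (tpow_jump_left (k := k)); auto).
      destruct (Ha j) as [_ [_ [_ [_ Hs]]]]; [lia|].
      assert (Es : s j x = 0) by now apply Hs.
      rewrite Et, Es; ring. }
  assert (Spsi : spl r k N Y psi).
  { apply (spl_ext (fun x => 1 * peval r (Q O) x + 1 * bsum (N - 1) (fun j => 1 * (1 * t j x + 1 * s j x)))); [easy| |].
    - intros x _. unfold psi. rewrite !Rmult_1_l. f_equal. apply bsum_ext; intros; ring.
    - apply spl_lin; [apply spl_peval|]. apply (spl_bsum (N - 1) (fun _ => 1)).
      intros j Hj. apply spl_lin.
      + apply (spl_jump HG); [auto|lia].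
      + apply Ha; lia. }
  exists psi. split; [easy|]. split; [|split].
  - assert (E := Hpsi O 0 ltac:(lia)). simpl in E.
    assert (Y 0%nat = 0) by apply HG. assert (Y 0%nat < Y 1%nat) by (apply HG; lia).
    assert (psi 0 - peval r (Q 0%nat) 0 = 0) by (apply E; unfold Icc; lra). lra.
  - assert (E := Hpsi (N - 1)%nat 1 ltac:(lia)).
    replace (S (N - 1)) with N in E by lia.
    assert (Y (N - 1)%nat < Y (S (N - 1))) by (apply HG; lia).
    replace (S (N - 1)) with N in * by lia.
    rewrite bsum_0 in E.
    + assert (psi 1 - peval r (Q (N - 1)%nat) 1 = 0) by (apply E; unfold Icc; lra). lra.
    + intros j Hj. destruct (Ha j) as [_ [_ [E1 _]]]; [lia|].
      assert (Es : s j 1 = q j 1) by easy. rewrite Es; ring.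
  - assert (Hbd : forall i x, (i < N)%nat -> Icc (Y i) (Y (S i)) x ->
      Rabs (psi x - peval r (Q i) x) <= C1 * bsum r (fun s => eps (i - s)%nat)).
    { intros i x Hi Hx. rewrite (Hpsi i x Hi Hx).
      eapply Rle_trans; [apply bsum_Rabs|].
      apply Rle_trans with (C1 * bsum i (fun j => if le_lt_dec (j + S r) i then 0 else eps (S j))).
      - rewrite <- bsum_scal_l. apply bsum_le. intros j Hj.
        destruct (Ha j) as [E1 [E2 _]]; [lia|].
        destruct (le_lt_dec (j + S r) i) as [Hl|Hl].
        + assert (Es : s j x = q j x) by (apply (E1 i); auto; lia).
          rewrite Es, Rminus_diag, Rabs_R0; lra.
        + apply (E2 x). unfold Icc in Hx. split.
          * apply Rle_trans with (Y i); [apply (grid_le N); auto; lia|apply Hx].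
          * apply Rle_trans with (Y (S i)); [apply Hx|]. apply (grid_01 N); auto; lia.
      - apply Rmult_le_compat_l; [lra|]. now apply bsum_window. }
    assert (Hpcp : pc N Y psi) by (apply (pc_ccont HG), spl_ccont with (1 := Spsi)).
    (* The length h of an interval cancels the 1 / h inside [eps]. One factor r is Cauchy-Schwarz
       over the window, the other counts the shifts in it. *)
    apply Rle_trans with (bsum N (fun i => h * (C1 * C1 * (INR r * bsum r (fun s => eps (i - s)%nat * eps (i - s)%nat))))).
    { apply bsum_le. intros i Hi.
      apply (piece_le_const HG); auto.
      - apply pc_mult; apply pc_minus; auto; apply pc_continuous; intros; apply peval_continuous.
      - apply Hq; auto.
      - repeat apply Rmult_le_pos; try lra. apply bsum_nonneg. intros; apply Rle_0_sqr.
      - intros x Hx. assert (B := Hbd i x Hi ltac:(unfold Icc; lra)).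
        apply Rabs_le_sqr in B. eapply Rle_trans; [exact B|].
        assert (B2 := bsum_sqr_le r (fun s => eps (i - s)%nat)). cbv beta in B2.
        set (Z := bsum r (fun s => eps (i - s)%nat)) in *.
        replace (C1 * Z * (C1 * Z)) with (C1 * C1 * (Z * Z)) by ring.
        apply Rmult_le_compat_l; [nra|]. exact B2. }
    rewrite bsum_scal_l, bsum_scal_l, bsum_scal_l, bsum_swap.
    apply Rle_trans with (h * (C1 * C1 * (INR r * bsum r (fun _ => bsum N (fun i => eps i * eps i))))).
    { repeat (apply Rmult_le_compat_l; [nra|]). apply bsum_le. intros j Hj.
      apply (bsum_delay N j (fun i => eps i * eps i)); [intros; apply Rle_0_sqr|simpl; ring]. }
    rewrite bsum_const.
    assert (Es : bsum N (fun i => eps i * eps i) = C0 / h * bsum (N - 1) nrm).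
    { replace N with (S (N - 1)) at 1 by lia. rewrite bsum_shift. simpl (eps O).
      rewrite <- bsum_scal_l, Rmult_0_l, Rplus_0_l. apply bsum_ext. intros j Hj.
      simpl. apply sqrt_sqrt. apply Rmult_le_pos; [lra|]. apply Hnrm; lia. }
    rewrite Es. right. unfold nrm. field. lra.
Qed.

Lemma sqr_plus_le a b : (a + b) * (a + b) <= 2 * (a * a) + 2 * (b * b).
Proof. assert (0 <= (a - b) * (a - b)) by apply Rle_0_sqr. lra. Qed.

Lemma grid_dist N Y c h a b : grid N Y -> quasi c h N Y -> (a <= b <= N)%nat ->
  Y b - Y a <= INR (b - a) * h.
Proof.
  intros HG Hq [Hab Hb]. induction b as [|b IH].
  - replace a with O by lia. simpl; lra.
  - destruct (Nat.eq_dec a (S b)) as [->|Hn].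
    + rewrite Nat.sub_diag, Rminus_diag. simpl; lra.
    + destruct (Hq b) as [_ H]; [lia|]. specialize (IH ltac:(lia) ltac:(lia)).
      replace (S b - a)%nat with (S (b - a)) by lia. rewrite S_INR. lra.
Qed.

(* The node whose data are used on the i-th interval; frozen near 1. *)
Lemma base_node_dist N Y c h r i x : grid N Y -> 0 < h -> quasi c h N Y ->
  (2 <= r <= N)%nat -> (i < N)%nat -> Icc (Y i) (Y (S i)) x ->
  0 <= x - Y (min i (N - r + 1)) <= INR r * h /\ 0 <= x - Y (min (S i) (N - r + 1)) + h /\
  x - Y (min (S i) (N - r + 1)) <= INR r * h.
Proof.
  intros HG Hh Hq [Hr HN] Hi [Hx1 Hx2].
  assert (A := grid_dist N Y c h (min i (N - r + 1)) (S i) HG Hq ltac:(lia)).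
  assert (B := grid_dist N Y c h (min (S i) (N - r + 1)) (S i) HG Hq ltac:(lia)).
  assert (A1 : INR (S i - min i (N - r + 1)) * h <= INR r * h).
  { apply Rmult_le_compat_r; [lra|]. apply le_INR; lia. }
  assert (B1 : INR (S i - min (S i) (N - r + 1)) * h <= INR r * h).
  { apply Rmult_le_compat_r; [lra|]. apply le_INR; lia. }
  assert (C := grid_le N Y (min i (N - r + 1)) i HG ltac:(lia)).
  assert (D := grid_le N Y (min (S i) (N - r + 1)) (S i) HG ltac:(lia)).
  destruct (Hq i Hi). lra.
Qed.

(* Freezing [w] at a nearby node on each interval turns [w f] into a discontinuous
   piecewise polynomial whose jumps are [O (L h)] times the size of [f]. *)
Lemma superapproximation r k c : (2 <= r)%nat -> (k <= r - 2)%nat -> 0 < c -> exists C, 0 < C /\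
  forall N Y h, grid N Y -> 0 < h -> quasi c h N Y -> (r <= N)%nat ->
  forall f w L, spl r k N Y f -> ccont 0 1 w -> 0 <= L ->
  (forall x y, Icc 0 1 x -> Icc 0 1 y -> Rabs (w x - w y) <= L * Rabs (x - y)) ->
  exists psi, spl r k N Y psi /\ (f 0 = 0 -> psi 0 = 0) /\ (f 1 = 0 -> psi 1 = 0) /\
    I (fun x => (psi x - w x * f x) * (psi x - w x * f x)) <=
    C * (L * h * (L * h)) * I (fun x => f x * f x).
Proof.
  intros Hr Hk Hc. destruct (smoothing r k c Hr Hk Hc) as [C [HC Hsm]].
  assert (Hr0 : 0 < INR r) by (apply lt_0_INR; lia).
  (* The term 2 C comes from the smoothing, 2 r^2 from freezing w at a node at distance at most r
     h. *)
  exists (2 * C + 2 * (INR r * INR r)). split; [nra|].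
  intros N Y h HG Hh Hq HN f w L Hf Hw HL HLip.
  assert (HN1 : Y N = 1) by apply HG. assert (H00 : Y O = 0) by apply HG.
  destruct (spl_pieces HG f Hf) as [p [d [Hp [Hd Hd0]]]].
  (* Constant from the index N - r + 1 on, so that the last jumps are admissible, as [smoothing]
     requires. *)
  set (W := fun j => w (Y (min j (N - r + 1)))).
  assert (Hcf : ccont 0 1 f) by (eapply spl_ccont; exact Hf).
  assert (Pf : pc N Y f) by now apply pc_ccont.
  assert (Pw : pc N Y w) by now apply pc_ccont.
  assert (Pp : forall q, pc N Y (peval r q)) by (intros; apply pc_continuous; intros; apply peval_continuous).
  assert (Sc : forall a q x, peval r (fun m => a * q m) x = a * peval r q x).
  { intros a q x. unfold peval. rewrite <- bsum_scal_l. apply bsum_ext; intros; ring. }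
  (* The jump of [f] times the new weight is admissible; subtracting it leaves [W (S j) - W j] times
     the piece [p j], which is O(L h) times [f]. *)
  destruct (Hsm N Y h HG Hh Hq HN (fun j m => W j * p j m) (fun j m => W j * d j m)) as [psi [S1 [S2 [S3 S4]]]].
  { intros j m Hm. rewrite Hd0 by easy; ring. }
  { intros j x Hj HjN. rewrite !Sc.
    assert (E := Hd j HjN x).
    assert (EW : W j = W (S j)) by (unfold W; do 2 f_equal; lia).
    rewrite EW, <- E. ring. }
  cbv beta in S2, S3, S4.
  assert (Hbn : forall i x, (i < N)%nat -> Icc (Y i) (Y (S i)) x -> Rabs (W i - w x) <= L * (INR r * h)).
  { intros i x Hi Hx. destruct (base_node_dist N Y c h r i x HG Hh Hq ltac:(lia) Hi Hx) as [A _].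
    assert (B := grid_01 N Y (min i (N - r + 1)) HG ltac:(lia)).
    assert (B1 := grid_01 N Y i HG ltac:(lia)). assert (B2 := grid_01 N Y (S i) HG ltac:(lia)).
    unfold W. eapply Rle_trans; [apply HLip; unfold Icc in *; lra|].
    apply Rmult_le_compat_l; [easy|]. rewrite Rabs_minus_sym, Rabs_pos_eq; lra. }
  exists psi. split; [easy|split; [|split]].
  - intros E. rewrite S2, Sc, <- (Hp O), E; [ring|lia|].
    assert (Y 0%nat < Y 1%nat) by (apply HG; lia). unfold Icc; lra.
  - intros E. rewrite S3, Sc, <- (Hp (N - 1)%nat), E; [ring|lia|].
    assert (Y (N - 1)%nat < Y (S (N - 1))) by (apply HG; lia).
    replace (S (N - 1)) with N in * by lia. unfold Icc; lra.
  - set (J := I (fun x => f x * f x)).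
    assert (PF2 : pc N Y (fun x => f x * f x)) by now apply pc_mult.
    assert (B1 : bsum (N - 1) (fun j => piece Y j (fun x =>
        (peval r (fun m => W (S j) * p (S j) m) x - peval r (fun m => W j * p j m) x -
         peval r (fun m => W (S j) * d (S j) m) (x - Y (S j))) *
        (peval r (fun m => W (S j) * p (S j) m) x - peval r (fun m => W j * p j m) x -
         peval r (fun m => W (S j) * d (S j) m) (x - Y (S j))))) <= L * h * (L * h) * J).
    { unfold J. rewrite <- (bsum_piece HG _ PF2), <- bsum_scal_l.
      apply Rle_trans with (bsum (N - 1) (fun j => L * h * (L * h) * piece Y j (fun x => f x * f x))).
      - apply bsum_le. intros j Hj.
        transitivity (piece Y j (fun x => L * h * (L * h) * (f x * f x) + 0 * 0)); [|right].
        + apply (piece_le HG); [| |lia|].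
          * assert (Q : pc N Y (fun x => peval r (fun m => W (S j) * d (S j) m) (x - Y (S j)))).
            { apply pc_continuous. intros x.
              apply (continuous_comp (fun x => x - Y (S j)) (peval r (fun m => W (S j) * d (S j) m)));
                [|apply peval_continuous].
              apply (continuous_minus (fun x => x) (fun _ => Y (S j))); [apply continuous_id|apply continuous_const]. }
            apply pc_mult; repeat apply pc_minus; auto.
          * apply pc_plus; [|apply pc_const]. apply pc_mult; [apply pc_const|easy].
          * intros x Hx. rewrite !Sc.
            assert (E := Hd j ltac:(lia) x).
            replace (peval r (d (S j)) (x - Y (S j))) with (peval r (p (S j)) x - peval r (p j) x) by lra.
            rewrite (Hp j ltac:(lia) x) by (unfold Icc; lra).
            set (P := peval r (p j) x). set (P' := peval r (p (S j)) x).
            assert (HWj : Rabs (W (S j) - W j) <= L * h).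
            { unfold W. eapply Rle_trans.
              - apply HLip; unfold Icc; apply (grid_01 N); auto; lia.
              - apply Rmult_le_compat_l; [easy|].
                rewrite Rabs_pos_eq.
                + eapply Rle_trans; [apply (grid_dist N Y c h); auto; lia|].
                  rewrite <- (Rmult_1_l h) at 2. apply Rmult_le_compat_r; [lra|].
                  apply (le_INR _ 1). lia.
                + assert (Q := grid_le N Y (min j (N - r + 1)) (min (S j) (N - r + 1)) HG ltac:(lia)). lra. }
            apply Rabs_le_sqr in HWj.
            replace ((W (S j) * P' - W j * P - W (S j) * (P' - P)) * (W (S j) * P' - W j * P - W (S j) * (P' - P)))
              with ((W (S j) - W j) * (W (S j) - W j) * (P * P)) by ring.
            rewrite Rmult_0_l, Rplus_0_r. apply Rmult_le_compat_r; [apply Rle_0_sqr|easy].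
        + rewrite (piece_lin HG (fun x => f x * f x) (fun _ => 0) j (L * h * (L * h)) 0); auto using pc_const; [ring|lia].
      - assert (P0 : forall j, (j < N)%nat -> 0 <= piece Y j (fun x => f x * f x)).
        { intros j Hj. apply (piece_ge0 HG); auto. intros; apply Rle_0_sqr. }
        replace N with (S (N - 1)) at 2 by lia. simpl.
        assert (Q := P0 (N - 1)%nat ltac:(lia)).
        assert (0 <= L * h * (L * h)) by apply Rle_0_sqr. nra. }
    assert (B2 := Rle_trans _ _ _ S4 (Rmult_le_compat_l C _ _ (Rlt_le _ _ HC) B1)).
    assert (Ppsi : pc N Y psi) by (apply (pc_ccont HG), spl_ccont with (1 := S1)).
    set (F := fun x => (psi x - w x * f x) * (psi x - w x * f x)).
    assert (PFF : pc N Y F) by (apply pc_mult; apply pc_minus; auto using pc_mult).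
    rewrite <- (bsum_piece HG F PFF).
    apply Rle_trans with (bsum N (fun i => 2 * piece Y i (fun x =>
       (psi x - peval r (fun m => W i * p i m) x) * (psi x - peval r (fun m => W i * p i m) x)) +
       2 * (L * (INR r * h) * (L * (INR r * h))) * piece Y i (fun x => f x * f x))).
    + apply bsum_le. intros i Hi.
      rewrite <- (piece_lin HG) by (auto; apply pc_mult; apply pc_minus; auto).
      apply (piece_le HG); auto.
      * apply pc_plus; apply pc_mult; auto using pc_const; apply pc_mult; apply pc_minus; auto.
      * intros x Hx. unfold F.
        replace (psi x - w x * f x) with ((psi x - peval r (fun m => W i * p i m) x) +
           (peval r (fun m => W i * p i m) x - w x * f x)) by ring.
        eapply Rle_trans; [apply sqr_plus_le|]. apply Rplus_le_compat_l.
        rewrite Sc, <- (Hp i Hi x) by (unfold Icc; lra).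
        assert (B := Hbn i x Hi ltac:(unfold Icc; lra)). apply Rabs_le_sqr in B.
        replace ((W i * f x - w x * f x) * (W i * f x - w x * f x)) with
          ((W i - w x) * (W i - w x) * (f x * f x)) by ring.
        rewrite (Rmult_assoc 2 (L * (INR r * h) * _)). apply Rmult_le_compat_l; [lra|].
        apply Rmult_le_compat_r; [apply Rle_0_sqr|easy].
    + rewrite bsum_plus, !bsum_scal_l, (bsum_piece HG _ PF2). fold J.
      replace (2 * (L * (INR r * h) * (L * (INR r * h))) * J) with
        (2 * (INR r * INR r) * (L * h * (L * h)) * J) by ring. lra.
Qed.

(** * Approximation of smooth functions *)

(** The successive derivatives are data: differentiability is asked in the open interval only and
    continuity up to its ends. Iterating [Derive] would say nothing about one-sided derivatives at 0
    and 1. *)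
Definition smooth_chain (n : nat) (V : nat -> R -> R) (M : R) : Prop :=
  (forall i, (i <= n)%nat -> ccont 0 1 (V i)) /\
  (forall i x, (i < n)%nat -> 0 < x < 1 -> is_derive (V i) x (V (S i) x)) /\
  (forall x, Icc 0 1 x -> Rabs (V n x) <= M).

Definition taylor (V : nat -> R -> R) (a : R) (m : nat) : R := V m a / INR (fact m).

Lemma pderiv_taylor V a m : pderiv (taylor V a) m = taylor (fun i => V (S i)) a m.
Proof.
  unfold pderiv, taylor. rewrite fact_simpl, mult_INR.
  assert (INR (S m) <> 0) by (apply not_0_INR; lia).
  assert (INR (fact m) <> 0) by apply INR_fact_neq_0. field; auto.
Qed.

(** The remainder vanishes at [a], and its derivative is the remainder of the shifted chain; the
    mean value theorem then gives one more power of |x - a| at each step. The factor 1 / n! is given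
    up. *)
Lemma taylor_error n V M a x : smooth_chain n V M -> Icc 0 1 a -> Icc 0 1 x ->
  Rabs (V O x - peval n (taylor V a) (x - a)) <= M * Rabs (x - a) ^ n.
Proof.
  revert V x. induction n as [|n IH]; intros V x [H1 [H2 H3]] Ha Hx.
  - unfold peval; simpl. rewrite Rminus_0_r, Rmult_1_r. now apply H3.
  - assert (HV : smooth_chain n (fun i => V (S i)) M).
    { split; [|split]; [intros; apply H1; lia|intros; apply H2; auto; lia|easy]. }
    set (g := fun x => V O x - peval (S n) (taylor V a) (x - a)).
    set (dg := fun x => V 1%nat x - peval n (taylor (fun i => V (S i)) a) (x - a)).
    assert (Hg : ccont 0 1 g).
    { apply ccont_minus; [apply H1; lia|]. apply continuous_ccont; [lra|]. intros y _.
      apply (continuous_comp (fun x => x - a) (peval (S n) (taylor V a))); [|apply peval_continuous].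
      apply (continuous_minus (fun x => x) (fun _ => a)); [apply continuous_id|apply continuous_const]. }
    assert (Hdg : forall y, 0 < y < 1 -> is_derive g y (dg y)).
    { intros y Hy. apply (is_derive_minus (V O)); [apply H2; [lia|easy]|].
      rewrite <- (peval_ext n (pderiv (taylor V a))) by (intros; apply pderiv_taylor).
      rewrite <- (Rmult_1_l (peval _ _ _)).
      apply (is_derive_comp (peval (S n) (taylor V a)) (fun x => x - a)); [apply (peval_is_derive (S n))|].
      auto_derive; [easy|ring]. }
    assert (Hga : g a = 0).
    { unfold g. rewrite Rminus_diag, peval_at_0 by lia. unfold taylor. simpl. field. }
    assert (HM0 : 0 <= M) by (eapply Rle_trans; [apply Rabs_pos|apply (H3 x Hx)]).
    assert (W : forall z, Rmin a x < z < Rmax a x -> Rabs (dg z) <= M * Rabs (x - a) ^ n).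
    { intros z Hz. unfold Icc in *.
      assert (Hz01 : 0 <= z <= 1) by (unfold Rmin, Rmax in Hz; destruct (Rle_dec a x); lra).
      eapply Rle_trans; [apply (IH (fun i => V (S i)) z HV Ha Hz01)|].
      apply Rmult_le_compat_l; [easy|]. apply pow_incr. split; [apply Rabs_pos|].
      unfold Rmin, Rmax in Hz; destruct (Rle_dec a x); unfold Rabs; destruct (Rcase_abs _), (Rcase_abs _); lra. }
    change (Rabs (g x) <= M * Rabs (x - a) ^ S n).
    replace (g x) with (g x - g a) by (rewrite Hga; ring).
    simpl pow. rewrite (Rmult_comm (Rabs (x - a))), <- Rmult_assoc.
    unfold Icc in *.
    destruct (Rtotal_order a x) as [Hlt|[->|Hlt]].
    + rewrite Rmin_left, Rmax_right in W by lra.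
      destruct (mvt a x g dg Hlt) as [z [Hz Ez]].
      * apply (ccont_sub 0 1); auto; lra.
      * intros; apply Hdg; lra.
      * rewrite Ez, Rabs_mult. apply Rmult_le_compat_r; [apply Rabs_pos|auto].
    + rewrite !Rminus_diag, Rabs_R0. lra.
    + rewrite Rmin_right, Rmax_left in W by lra.
      destruct (mvt x a g dg Hlt) as [z [Hz Ez]].
      * apply (ccont_sub 0 1); auto; lra.
      * intros; apply Hdg; lra.
      * rewrite Rabs_minus_sym, Ez, Rabs_mult, (Rabs_minus_sym a x).
        apply Rmult_le_compat_r; [apply Rabs_pos|auto].
Qed.

Lemma taylor_poly r a : exists q : (nat -> R) -> nat -> R, forall e,
  (forall x, peval r (q e) x = peval r e (x - a)) /\
  forall x, peval (pred r) (pderiv (q e)) x = peval (pred r) (pderiv e) (x - a).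
Proof.
  destruct (functional_choice (fun e q => forall x, peval r q x = peval r e (x - a))) as [q Hq].
  - intros e. destruct (peval_affine r e (- a) 1) as [d Hd]. exists d. intros x.
    rewrite <- Hd. f_equal; ring.
  - exists q. intros e. split; [auto|]. intros x.
    transitivity (Derive (peval r (q e)) x); [symmetry; apply is_derive_unique, peval_is_derive|].
    apply is_derive_unique. apply (is_derive_ext (fun x => peval r e (x - a))); [auto|].
    rewrite <- (Rmult_1_l (peval _ _ _)).
    apply (is_derive_comp (peval r e) (fun x => x - a)); [apply peval_is_derive|].
    auto_derive; [easy|ring].
Qed.

(** Taylor polynomials at neighbouring base nodes differ by O(h^r) on the interval between them, so
    their whole jumps can be spread. The value at 0 is exact because the first base node is 0; the
    value at 1 is corrected by a multiple of x. The discontinuous pieces [Q] are returned too, since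
    they approximate the derivative as well. *)
Lemma approximation r k c : (2 <= r)%nat -> (k <= r - 2)%nat -> 0 < c -> exists C, 0 < C /\
  forall N Y h, grid N Y -> 0 < h -> quasi c h N Y -> (r <= N)%nat ->
  forall V M, smooth_chain r V M ->
  (exists psi, spl r k N Y psi /\ psi 0 = V O 0 /\ psi 1 = V O 1 /\
    I (fun x => (V O x - psi x) * (V O x - psi x)) <= C * (M * h ^ r * (M * h ^ r))) /\
  (exists Q : nat -> nat -> R, forall i x, (i < N)%nat -> Icc (Y i) (Y (S i)) x ->
     Rabs (V O x - peval r (Q i) x) <= C * (M * h ^ r) /\
     Rabs (V 1%nat x - peval (pred r) (pderiv (Q i)) x) <= C * (M * h ^ (r - 1))).
Proof.
  intros Hr Hk Hc. destruct (smoothing r k c Hr Hk Hc) as [C [HC Hsm]].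
  set (R0 := INR r ^ r).
  assert (Hr1 : 1 <= INR r) by (apply (le_INR 1); lia).
  assert (HR0 : 1 <= R0) by (apply pow_R1_Rle; easy).
  (* The error is a sum of three terms, whose square costs a factor 3: the smoothing of jumps of
     size 2 R0 M h^r, and twice R0 M h^r, from the Taylor remainder and from the correction at 1. *)
  set (K := 3 * (C * (4 * (R0 * R0))) + 6 * (R0 * R0)).
  exists (K + R0). assert (HKp : 0 <= K) by (unfold K; assert (0 <= R0 * R0) by nra; nra). split; [lra|].
  intros N Y h HG Hh Hq HN V M HV.
  assert (HN1 : Y N = 1) by apply HG. assert (H00 : Y O = 0) by apply HG.
  assert (HM : 0 <= M).
  { destruct HV as [_ [_ H]]. eapply Rle_trans; [apply Rabs_pos|apply (H 0)]. unfold Icc; lra. }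
  assert (Hhr : 0 < h ^ r) by now apply pow_lt.
  assert (Hhr1 : 0 < h ^ (r - 1)) by now apply pow_lt.
  set (nd := fun j => Y (min j (N - r + 1))).
  assert (Hnd : forall j, (j <= N)%nat -> Icc 0 1 (nd j)).
  { intros j Hj. apply (grid_01 N Y (min j (N - r + 1)) HG). lia. }
  destruct (functional_choice (fun a (q : (nat -> R) -> nat -> R) => forall e,
    (forall x, peval r (q e) x = peval r e (x - a)) /\
    forall x, peval (pred r) (pderiv (q e)) x = peval (pred r) (pderiv e) (x - a)) (taylor_poly r)) as [sh Hsh].
  set (Q := fun j => sh (nd j) (taylor V (nd j))).
  assert (E0 : forall j x, (j <= N)%nat -> Icc 0 1 x -> Rabs (x - nd j) <= INR r * h ->
    Rabs (V O x - peval r (Q j) x) <= R0 * (M * h ^ r)).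
  { intros j x Hj Hx Hd. destruct (Hsh (nd j) (taylor V (nd j))) as [E _]. unfold Q. rewrite E.
    eapply Rle_trans; [apply (taylor_error r V M); auto|].
    replace (R0 * (M * h ^ r)) with (M * (INR r * h) ^ r) by (unfold R0; rewrite Rpow_mult_distr; ring).
    apply Rmult_le_compat_l; [easy|]. apply pow_incr. split; [apply Rabs_pos|easy]. }
  assert (Hdist : forall i x, (i < N)%nat -> Icc (Y i) (Y (S i)) x -> Icc 0 1 x /\
    Rabs (x - nd i) <= INR r * h /\ Rabs (x - nd (S i)) <= INR r * h).
  { intros i x Hi Hx. destruct (base_node_dist N Y c h r i x HG Hh Hq ltac:(lia) Hi Hx) as [A [B D]].
    assert (B1 := grid_01 N Y i HG ltac:(lia)). assert (B2 := grid_01 N Y (S i) HG ltac:(lia)).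
    fold (nd i) in A. fold (nd (S i)) in B, D. unfold Icc in *.
    split; [lra|]. split; apply Rabs_le; split; try lra; nra. }
  split.
  - destruct (Hsm N Y h HG Hh Hq HN Q (fun _ _ => 0)) as [psi [S1 [S2 [S3 S4]]]].
    { easy. }
    { intros j x Hj HjN. unfold Q, nd. replace (min (S j) (N - r + 1)) with (min j (N - r + 1)) by lia.
      unfold peval at 3. rewrite bsum_0 by (intros; ring). ring. }
    cbv beta in S4.
    assert (Z : forall x, peval r (fun _ => 0) x = 0) by (intros; unfold peval; apply bsum_0; intros; ring).
    assert (Pp : forall q, pc N Y (peval r q)) by (intros; apply pc_continuous; intros; apply peval_continuous).
    assert (PV : pc N Y (V O)) by (apply (pc_ccont HG), HV; lia).
    assert (Ppsi : pc N Y psi) by (apply (pc_ccont HG), spl_ccont with (1 := S1)).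
    set (G := M * h ^ r * (M * h ^ r)).
    assert (HGG : 0 <= G) by apply Rle_0_sqr.
    assert (B1 : bsum (N - 1) (fun j => piece Y j (fun x =>
        (peval r (Q (S j)) x - peval r (Q j) x - peval r (fun _ => 0) (x - Y (S j))) *
        (peval r (Q (S j)) x - peval r (Q j) x - peval r (fun _ => 0) (x - Y (S j))))) <= 4 * (R0 * R0) * G).
    { assert (One : bsum N (fun j => piece Y j (fun _ => 1)) = 1).
      { rewrite (bsum_piece HG) by apply pc_const. rewrite RInt_const.
        unfold scal; simpl; unfold mult; simpl. ring. }
      apply Rle_trans with (4 * (R0 * R0) * G * 1); [|lra]. rewrite <- One, <- bsum_scal_l.
      apply Rle_trans with (bsum (N - 1) (fun j => 4 * (R0 * R0) * G * piece Y j (fun _ => 1))).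
      - apply bsum_le. intros j Hj.
        apply Rle_trans with (piece Y j (fun _ => 4 * (R0 * R0) * G * 1 + 0 * 0)); [|right].
        + apply (piece_le HG); auto using pc_const; [|lia|].
          * assert (Pz : pc N Y (fun x => peval r (fun _ => 0) (x - Y (S j)))).
            { apply (pc_ext (fun _ => 0)); [intros; now rewrite Z|apply pc_const]. }
            apply pc_mult; repeat apply pc_minus; auto.
          * intros x Hx. rewrite Z, Rminus_0_r.
            destruct (Hdist j x ltac:(lia) ltac:(unfold Icc; lra)) as [D1 [D2 D3]].
            assert (A1 := E0 j x ltac:(lia) D1 D2). assert (A2 := E0 (S j) x ltac:(lia) D1 D3).
            assert (A : Rabs (peval r (Q (S j)) x - peval r (Q j) x) <= 2 * R0 * (M * h ^ r)).
            { replace (peval r (Q (S j)) x - peval r (Q j) x) with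
                ((V O x - peval r (Q j) x) + - (V O x - peval r (Q (S j)) x)) by ring.
              eapply Rle_trans; [apply Rabs_triang|]. rewrite Rabs_Ropp. lra. }
            apply Rabs_le_sqr in A. unfold G.
            replace (4 * (R0 * R0) * (M * h ^ r * (M * h ^ r)) * 1 + 0 * 0) with
              (2 * R0 * (M * h ^ r) * (2 * R0 * (M * h ^ r))) by ring. exact A.
        + rewrite (piece_lin HG (fun _ => 1) (fun _ => 0)); auto using pc_const; [ring|lia].
      - assert (P0 : 0 <= piece Y (N - 1) (fun _ => 1)).
        { apply (piece_ge0 HG); auto using pc_const; [lia|]. intros; lra. }
        replace N with (S (N - 1)) at 2 by lia. simpl.
        assert (0 <= 4 * (R0 * R0) * G) by (repeat apply Rmult_le_pos; lra). nra. }
    assert (B2 := Rle_trans _ _ _ S4 (Rmult_le_compat_l C _ _ (Rlt_le _ _ HC) B1)).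
    (* The linear function t x repairs the value at 1 and leaves the value at 0. *)
    set (t := V O 1 - psi 1).
    assert (Ht : t * t <= R0 * R0 * G).
    { assert (A : Rabs t <= R0 * (M * h ^ r)).
      { unfold t. rewrite S3. apply E0; [lia|unfold Icc; lra|].
        apply (Hdist (N - 1)%nat); [lia|].
        assert (Y (N - 1)%nat < Y (S (N - 1))) by (apply HG; lia).
        replace (S (N - 1)) with N in * by lia. unfold Icc; lra. }
      apply Rabs_le_sqr in A. unfold G.
      replace (R0 * R0 * (M * h ^ r * (M * h ^ r))) with (R0 * (M * h ^ r) * (R0 * (M * h ^ r))) by ring. exact A. }
    exists (fun x => 1 * psi x + t * x).
    assert (Sid : spl r k N Y (fun x => x)).
    { apply (spl_ext (peval r (kron 1))); [easy| |apply spl_peval].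
      intros x _. transitivity (x ^ 1); [|ring]. unfold peval. rewrite <- (bsum_kron r (fun i => x ^ i) 1) by lia.
      apply bsum_ext; intros; ring. }
    split; [now apply spl_lin|].
    split; [|split].
    { rewrite S2. destruct (Hsh (nd O) (taylor V (nd O))) as [E _]. unfold Q. rewrite E.
      unfold nd. simpl. rewrite H00, Rminus_diag, peval_at_0 by lia. unfold taylor; simpl; field. }
    { unfold t; ring. }
    assert (Pid : pc N Y (fun x => x)) by (apply pc_continuous; intros; apply continuous_id).
    set (F := fun x => (V O x - (1 * psi x + t * x)) * (V O x - (1 * psi x + t * x))).
    assert (PF : pc N Y F).
    { apply pc_mult; apply pc_minus; auto; apply pc_plus; apply pc_mult; auto using pc_const. }
    rewrite <- (bsum_piece HG F PF).
    apply Rle_trans with (bsum N (fun i => 3 * piece Y i (fun x =>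
       (psi x - peval r (Q i) x) * (psi x - peval r (Q i) x)) + 6 * (R0 * R0) * G * piece Y i (fun _ => 1))).
    + apply bsum_le. intros i Hi.
      rewrite <- (piece_lin HG) by (auto using pc_const; apply pc_mult; apply pc_minus; auto).
      apply (piece_le HG); auto.
      * apply pc_plus; apply pc_mult; auto using pc_const; apply pc_mult; apply pc_minus; auto.
      * intros x Hx. destruct (Hdist i x Hi ltac:(unfold Icc; lra)) as [D1 [D2 D3]].
        assert (A1 := E0 i x ltac:(lia) D1 D2). apply Rabs_le_sqr in A1.
        unfold F. set (u := V O x - peval r (Q i) x) in *. set (v := psi x - peval r (Q i) x).
        replace (V O x - (1 * psi x + t * x)) with (u - v - t * x) by (unfold u, v; ring).
        assert (A2 : t * x * (t * x) <= R0 * R0 * G).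
        { unfold Icc in D1. replace (t * x * (t * x)) with (t * t * (x * x)) by ring.
          assert (x * x <= 1) by nra. assert (0 <= t * t) by apply Rle_0_sqr. nra. }
        assert (A3 : u * u <= R0 * R0 * G).
        { unfold G. replace (R0 * R0 * (M * h ^ r * (M * h ^ r))) with (R0 * (M * h ^ r) * (R0 * (M * h ^ r))) by ring. exact A1. }
        set (y := t * x) in *.
        assert (Q1 : 0 <= (u + v) * (u + v)) by apply Rle_0_sqr.
        assert (Q2 : 0 <= (u + y) * (u + y)) by apply Rle_0_sqr.
        assert (Q3 : 0 <= (v - y) * (v - y)) by apply Rle_0_sqr.
        replace (6 * (R0 * R0) * G * 1) with (6 * (R0 * R0 * G)) by ring. lra.
    + rewrite bsum_plus, !bsum_scal_l, (bsum_piece HG) by apply pc_const.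
      rewrite RInt_const. unfold scal; simpl; unfold mult; simpl.
      fold G. apply Rle_trans with (K * G); [unfold K; lra|]. apply Rmult_le_compat_r; lra.
  - exists Q. intros i x Hi Hx. destruct (Hdist i x Hi Hx) as [D1 [D2 D3]]. split.
    + eapply Rle_trans; [apply E0; auto; lia|]. apply Rmult_le_compat_r; [|lra].
      apply Rmult_le_pos; lra.
    + destruct (Hsh (nd i) (taylor V (nd i))) as [_ E]. unfold Q. rewrite E.
      rewrite (peval_ext (pred r) _ (taylor (fun i => V (S i)) (nd i))) by (intros; apply pderiv_taylor).
      assert (HV' : smooth_chain (pred r) (fun i => V (S i)) M).
      { destruct HV as [V1 [V2 V3]]. split; [intros; apply V1; lia|split; [intros; apply V2; auto; lia|]].
        replace (S (pred r)) with r by lia. easy. }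
      eapply Rle_trans; [apply (taylor_error (pred r) (fun i => V (S i)) M); auto; apply Hnd; lia|].
      replace (pred r) with (r - 1)%nat by lia.
      apply Rle_trans with (M * (INR r * h) ^ (r - 1)).
      * apply Rmult_le_compat_l; [easy|]. apply pow_incr. split; [apply Rabs_pos|easy].
      * rewrite Rpow_mult_distr.
        assert (INR r ^ (r - 1) <= R0) by (apply Rle_pow; [easy|lia]).
        replace (M * (INR r ^ (r - 1) * h ^ (r - 1))) with (INR r ^ (r - 1) * (M * h ^ (r - 1))) by ring.
        apply Rmult_le_compat_r; [apply Rmult_le_pos; lra|lra].
Qed.

Lemma piece_le_I N Y f j : grid N Y -> pc N Y f -> (forall x, inner_pt N Y x -> 0 <= f x) ->
  (j < N)%nat -> piece Y j f <= I f.
Proof.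
  intros HG Hf H Hj. rewrite <- (bsum_piece HG f Hf).
  apply (bsum_term_le N (fun j => piece Y j f)); [|easy].
  intros i Hi. apply (piece_ge0 HG); auto. intros x Hx; apply H; exists i; auto.
Qed.

(** The pointwise bound is local, by [peval_inverse]; integration over a piece of length at most h
    wins back one factor h. *)
Lemma spl_inverse r k c : 0 < c -> exists C, 0 < C /\
  forall N Y h, grid N Y -> 0 < h -> quasi c h N Y -> forall f, spl r k N Y f ->
  I (fun x => Derive f x * Derive f x) <= C / (h * h) * I (fun x => f x * f x) /\
  forall x, inner_pt N Y x -> Derive f x * Derive f x <= C / (h * h * h) * I (fun x => f x * f x).
Proof.
  intros Hc. destruct (peval_inverse r c Hc) as [C [HC H]]. exists C; split; [easy|].
  intros N Y h HG Hh Hq f Hf.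
  assert (Pf : pc N Y f) by (apply (pc_ccont HG), spl_ccont with (1 := Hf)).
  assert (Pf2 : pc N Y (fun x => f x * f x)) by now apply pc_mult.
  assert (Pd : pc N Y (Derive f)) by exact (pc1_Derive f (spl_pc1 f Hf)).
  assert (W : forall j x, (j < N)%nat -> Y j < x < Y (S j) ->
     Derive f x * Derive f x <= C / (h * h * h) * piece Y j (fun x => f x * f x)).
  { intros j x Hj Hx. destruct Hf as [_ Hf]. destruct (Hf j Hj) as [q Hq'].
    rewrite (is_derive_unique f x _ (spl_piece_derive f j q x Hj Hq' Hx)).
    destruct (H q (Y j) (Y (S j)) h x) as [_ H2]; try apply Hq; auto; try (apply HG; auto); try lra.
    eapply Rle_trans; [exact H2|]. right. f_equal. unfold piece. apply RInt_ext.
    intros y Hy. rewrite Rmin_left, Rmax_right in Hy by lra. now rewrite Hq' by (unfold Icc; lra). }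
  assert (P0 : forall j, (j < N)%nat -> 0 <= piece Y j (fun x => f x * f x)).
  { intros j Hj. apply (piece_ge0 HG); auto. intros; apply Rle_0_sqr. }
  assert (Hh3 : 0 < C / (h * h * h)) by (apply Rdiv_lt_0_compat; [easy|repeat apply Rmult_lt_0_compat; easy]).
  split.
  - rewrite <- (bsum_piece HG (fun x => Derive f x * Derive f x)) by now apply pc_mult.
    rewrite <- (bsum_piece HG _ Pf2), <- bsum_scal_l. apply bsum_le. intros j Hj.
    apply Rle_trans with (h * (C / (h * h * h) * piece Y j (fun x => f x * f x))).
    + apply (piece_le_const HG); auto using pc_mult.
      * apply Hq; auto.
      * apply Rmult_le_pos; [lra|auto].
    + right. field. lra.
  - intros x [j [Hj Hx]]. eapply Rle_trans; [apply (W j x Hj Hx)|].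
    apply Rmult_le_compat_l; [lra|]. apply (piece_le_I N Y); auto. intros; apply Rle_0_sqr.
Qed.

(** [V 0 - A] is not a polynomial, so the inverse inequality is applied on each piece to [Q - A],
    with the local Taylor polynomial [Q] in between. Any spline with an L^2 error of order h^r
    qualifies; it will be the projection. The pointwise bound keeps the derivative of the projection
    bounded uniformly in h. *)
Lemma derivative_error r k c K : (3 <= r)%nat -> (k <= r - 2)%nat -> 0 < c -> 0 <= K -> exists C, 0 < C /\
  forall N Y h, grid N Y -> 0 < h <= 1 -> quasi c h N Y -> (r <= N)%nat ->
  forall V M A, smooth_chain r V M -> spl r k N Y A ->
  I (fun x => (V O x - A x) * (V O x - A x)) <= K * (M * h ^ r * (M * h ^ r)) ->
  I (fun x => (V 1%nat x - Derive A x) * (V 1%nat x - Derive A x)) <=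
    C * (M * h ^ (r - 1) * (M * h ^ (r - 1))) /\
  forall x, inner_pt N Y x -> (V 1%nat x - Derive A x) * (V 1%nat x - Derive A x) <= C * (M * M).
Proof.
  intros Hr Hk Hc HK.
  destruct (approximation r k c ltac:(lia) Hk Hc) as [C1 [HC1 Happ]].
  destruct (peval_inverse r c Hc) as [C2 [HC2 Hinv]].
  set (Z := 2 * (C1 * C1) + 2 * C2 * (2 * (C1 * C1) + 2 * K)).
  assert (HZ : 0 < Z).
  { unfold Z. assert (0 < C1 * C1) by nra. assert (0 <= C2 * (2 * (C1 * C1) + 2 * K)) by nra. lra. }
  exists Z. split; [easy|].
  intros N Y h HG [Hh Hh1] Hq HN V M A HV HA HI.
  destruct (Happ N Y h HG Hh Hq HN V M HV) as [_ [Q HQ]].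
  assert (PA : pc N Y A) by (apply (pc_ccont HG), spl_ccont with (1 := HA)).
  assert (PV : pc N Y (V O)) by (apply (pc_ccont HG), HV; lia).
  assert (PV1 : pc N Y (V 1%nat)) by (apply (pc_ccont HG), HV; lia).
  assert (PdA : pc N Y (Derive A)) by exact (pc1_Derive A (spl_pc1 A HA)).
  assert (Pp : forall n q, pc N Y (peval n q)) by (intros; apply pc_continuous; intros; apply peval_continuous).
  set (G := M * h ^ r * (M * h ^ r)) in *. assert (HG0 : 0 <= G) by apply Rle_0_sqr.
  set (E := fun x => (V O x - A x) * (V O x - A x)) in *.
  assert (PE : pc N Y E) by (apply pc_mult; now apply pc_minus).
  assert (PE0 : forall j, (j < N)%nat -> 0 <= piece Y j E).
  { intros j Hj. apply (piece_ge0 HG); auto. intros; apply Rle_0_sqr. }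
  assert (Hhh : 0 < h * h) by nra. assert (Hh3 : 0 < h * h * h) by nra.
  assert (EG : M * h ^ (r - 1) * (M * h ^ (r - 1)) = G / (h * h)).
  { unfold G. replace (h ^ r) with (h * h ^ (r - 1)); [field; lra|].
    change (h ^ S (r - 1) = h ^ r). f_equal; lia. }
  assert (W : forall j x, (j < N)%nat -> Y j < x < Y (S j) ->
    (V 1%nat x - Derive A x) * (V 1%nat x - Derive A x) <=
    2 * (C1 * C1) * (G / (h * h)) + 2 * C2 / (h * h * h) * (2 * h * (C1 * C1) * G + 2 * piece Y j E)).
  { intros j x Hj Hx.
    assert (Hyj : Y j < Y (S j)) by (apply HG; auto).
    assert (HA' := HA). destruct HA' as [_ HA']. destruct (HA' j Hj) as [q Hqj].
    rewrite (is_derive_unique A x _ (spl_piece_derive A j q x Hj Hqj Hx)).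
    set (e := fun m => 1 * Q j m + -1 * q m).
    assert (Ee : forall y, peval r e y = peval r (Q j) y - peval r q y).
    { intros y. unfold e. rewrite peval_lin. ring. }
    assert (Ed : peval (pred r) (pderiv e) x = peval (pred r) (pderiv (Q j)) x - peval (pred r) (pderiv q) x).
    { rewrite (peval_ext (pred r) _ (fun m => 1 * pderiv (Q j) m + -1 * pderiv q m)).
      - rewrite peval_lin. ring.
      - intros m _. unfold pderiv, e. ring. }
    destruct (Hinv e (Y j) (Y (S j)) h x Hyj) as [_ H2]; try apply Hq; auto; try lra.
    assert (B : RInt (fun x => peval r e x * peval r e x) (Y j) (Y (S j)) <= 2 * h * (C1 * C1) * G + 2 * piece Y j E).
    { apply Rle_trans with (piece Y j (fun x => 2 * (C1 * C1 * G) * 1 + 2 * E x)).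
      - change (piece Y j (fun x => peval r e x * peval r e x) <= piece Y j (fun x => 2 * (C1 * C1 * G) * 1 + 2 * E x)).
        apply (piece_le HG); auto.
        + apply pc_mult; auto.
        + apply pc_plus; [apply pc_const|]. apply pc_mult; auto using pc_const.
        + intros y Hy. rewrite Ee, <- Hqj by (unfold Icc; lra).
          destruct (HQ j y Hj) as [B1 _]; [unfold Icc; lra|].
          replace (peval r (Q j) y - A y) with (- (V O y - peval r (Q j) y) + (V O y - A y)) by ring.
          eapply Rle_trans; [apply sqr_plus_le|]. unfold E. apply Rplus_le_compat_r.
          apply Rabs_le_sqr in B1. unfold G.
          replace (C1 * (M * h ^ r) * (C1 * (M * h ^ r))) with (C1 * C1 * (M * h ^ r * (M * h ^ r))) in B1 by ring.
          replace (- (V O y - peval r (Q j) y) * - (V O y - peval r (Q j) y)) with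
            ((V O y - peval r (Q j) y) * (V O y - peval r (Q j) y)) by ring. lra.
      - rewrite (piece_lin HG (fun _ => 1) E) by auto using pc_const.
        apply Rplus_le_compat_r. unfold piece. rewrite RInt_const.
        unfold scal; simpl; unfold mult; simpl. destruct (Hq j Hj) as [_ Hl].
        assert (0 <= C1 * C1 * G) by (apply Rmult_le_pos; [nra|easy]). nra. }
    destruct (HQ j x Hj) as [_ B1]; [unfold Icc; lra|]. apply Rabs_le_sqr in B1.
    replace (V 1%nat x - peval (pred r) (pderiv q) x) with
      ((V 1%nat x - peval (pred r) (pderiv (Q j)) x) + peval (pred r) (pderiv e) x) by (rewrite Ed; ring).
    eapply Rle_trans; [apply sqr_plus_le|].
    replace (C1 * (M * h ^ (r - 1)) * (C1 * (M * h ^ (r - 1)))) with (C1 * C1 * (G / (h * h))) in B1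
      by (rewrite <- EG; ring).
    assert (B2 := Rmult_le_compat_l (C2 / (h * h * h)) _ _ (Rlt_le _ _ (Rdiv_lt_0_compat _ _ HC2 Hh3)) B).
    replace (2 * C2 / (h * h * h) * (2 * h * (C1 * C1) * G + 2 * piece Y j E)) with
      (2 * (C2 / (h * h * h) * (2 * h * (C1 * C1) * G + 2 * piece Y j E))) by (field; lra).
    lra. }
  split.
  - rewrite EG. set (F := fun x => (V 1%nat x - Derive A x) * (V 1%nat x - Derive A x)) in *.
    assert (PF : pc N Y F) by (apply pc_mult; now apply pc_minus).
    rewrite <- (bsum_piece HG F PF).
    apply Rle_trans with (bsum N (fun j => (2 * (C1 * C1) * (G / (h * h)) + 2 * C2 / (h * h * h) * (2 * h * (C1 * C1) * G)) * piece Y j (fun _ => 1)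
       + 4 * C2 / (h * h) * piece Y j E)).
    + apply bsum_le. intros j Hj.
      assert (Hyj : Y j < Y (S j)) by (apply HG; auto).
      set (a := 2 * (C1 * C1) * (G / (h * h)) + 2 * C2 / (h * h * h) * (2 * h * (C1 * C1) * G)).
      set (b := 4 * C2 / (h * h * h) * piece Y j E).
      assert (Hb0 : 0 <= b).
      { apply Rmult_le_pos; [|auto]. left. apply Rdiv_lt_0_compat; lra. }
      apply Rle_trans with (piece Y j (fun _ => a * 1 + b * 1)).
      * apply (piece_le HG); auto using pc_const. intros x Hx. unfold F.
        eapply Rle_trans; [apply (W j x Hj Hx)|]. right. unfold a, b. field. lra.
      * rewrite (piece_lin HG (fun _ => 1) (fun _ => 1)) by auto using pc_const.
        apply Rplus_le_compat_l. unfold piece at 1. rewrite RInt_const.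
        unfold scal; simpl; unfold mult; simpl. destruct (Hq j Hj) as [_ Hl].
        apply Rle_trans with (b * h); [nra|]. right. unfold b. field. lra.
    + rewrite bsum_plus, !bsum_scal_l, (bsum_piece HG _ PE), (bsum_piece HG (fun _ => 1)) by apply pc_const.
      rewrite RInt_const. unfold scal; simpl; unfold mult; simpl.
      assert (B := Rmult_le_compat_l (4 * C2 / (h * h)) _ _
        (Rlt_le _ _ (Rdiv_lt_0_compat (4 * C2) _ ltac:(lra) Hhh)) HI).
      eapply Rle_trans; [apply Rplus_le_compat_l; exact B|]. right. unfold Z. field. lra.
  - intros x [j [Hj Hx]]. eapply Rle_trans; [apply (W j x Hj Hx)|].
    assert (B : piece Y j E <= K * G).
    { eapply Rle_trans; [|exact HI]. apply (piece_le_I N Y); auto. intros; apply Rle_0_sqr. }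
    assert (GM : G <= h * h * h * (M * M)).
    { unfold G. replace (M * h ^ r * (M * h ^ r)) with (h ^ r * h ^ r * (M * M)) by ring.
      apply Rmult_le_compat_r; [apply Rle_0_sqr|].
      assert (Hr3 : h ^ r <= h * h * h).
      { replace r with (3 + (r - 3))%nat by lia. rewrite pow_add.
        assert (0 < h ^ (r - 3) <= 1).
        { split; [now apply pow_lt|]. rewrite <- (pow1 (r - 3)). apply pow_incr; lra. }
        simpl. nra. }
      assert (0 < h ^ r) by now apply pow_lt. assert (h * h <= 1) by nra. assert (h * h * h <= 1) by nra. nra. }
    assert (GM2 : G / (h * h) <= M * M).
    { apply Rmult_le_reg_r with (h * h); [easy|]. replace (G / (h * h) * (h * h)) with G by (field; lra).
      eapply Rle_trans; [exact GM|]. assert (0 <= M * M) by apply Rle_0_sqr. nra. }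
    assert (GM3 : G / (h * h * h) <= M * M).
    { apply Rmult_le_reg_r with (h * h * h); [easy|].
      replace (G / (h * h * h) * (h * h * h)) with G by (field; lra). lra. }
    apply Rle_trans with (2 * (C1 * C1) * (G / (h * h)) + 2 * C2 * (2 * (C1 * C1) * (G / (h * h)) + 2 * K * (G / (h * h * h)))).
    + apply Rplus_le_compat_l.
      apply Rle_trans with (2 * C2 / (h * h * h) * (2 * h * (C1 * C1) * G + 2 * (K * G))).
      * apply Rmult_le_compat_l; [left; apply Rdiv_lt_0_compat; lra|]. lra.
      * right. field. lra.
    + unfold Z. assert (0 < C1 * C1) by nra.
      assert (T1 : C1 * C1 * (G / (h * h)) <= C1 * C1 * (M * M)) by (apply Rmult_le_compat_l; lra).
      assert (T2 : K * (G / (h * h * h)) <= K * (M * M)) by (apply Rmult_le_compat_l; lra).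
      assert (T3 : C2 * (2 * (C1 * C1) * (G / (h * h)) + 2 * K * (G / (h * h * h))) <=
        C2 * (2 * (C1 * C1) * (M * M) + 2 * K * (M * M))) by (apply Rmult_le_compat_l; lra).
      nra.
Qed.

(** * Continuous functions on the space-time rectangle *)

(** The analogue of [ccont] on [0, 1] x [0, T], with both arguments clamped. *)
Definition cont2 (T : R) (f : R -> R -> R) : Prop :=
  forall x t, continuity_2d_pt (fun x t => f (clamp 0 1 x) (clamp 0 T t)) x t.

Lemma cont2_plus T f g : cont2 T f -> cont2 T g -> cont2 T (fun x t => f x t + g x t).
Proof. intros Hf Hg x t. apply continuity_2d_pt_plus; auto. Qed.

Lemma cont2_mult T f g : cont2 T f -> cont2 T g -> cont2 T (fun x t => f x t * g x t).
Proof. intros Hf Hg x t. apply continuity_2d_pt_mult; auto. Qed.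

Lemma cont2_const T c : cont2 T (fun _ _ => c).
Proof. intros x t. apply continuity_2d_pt_const. Qed.

Lemma cont2_space T f : ccont 0 1 f -> cont2 T (fun x _ => f x).
Proof.
  intros Hf x t. apply (continuity_1d_2d_pt_comp (fun y => f (clamp 0 1 y)) (fun u _ => u)).
  - apply continuity_pt_filterlim, Hf.
  - apply continuity_2d_pt_id1.
Qed.

Lemma cont2_time T f : ccont 0 T f -> cont2 T (fun _ t => f t).
Proof.
  intros Hf x t. apply (continuity_1d_2d_pt_comp (fun y => f (clamp 0 T y)) (fun _ v => v)).
  - apply continuity_pt_filterlim, Hf.
  - apply continuity_2d_pt_id2.
Qed.

Lemma cont2_bsum T n (f : nat -> R -> R -> R) : (forall i, (i < n)%nat -> cont2 T (f i)) ->
  cont2 T (fun x t => bsum n (fun i => f i x t)).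
Proof.
  intros H. induction n as [|n IH]; simpl; [apply cont2_const|].
  apply (cont2_plus T (fun x t => bsum n (fun i => f i x t)) (f n)); auto.
Qed.

Lemma continuity_2d_pt_line f x t : continuity_2d_pt f x t ->
  continuous (fun y => f y t) x /\ continuous (fun s => f x s) t.
Proof.
  intros H. split; apply filterlim_locally; intros e; destruct (H e) as [d Hd]; exists d; intros y Hy;
    apply Hd; auto; rewrite Rminus_diag, Rabs_R0; apply cond_pos.
Qed.

Lemma cont2_ccont_space T f t : cont2 T f -> Icc 0 T t -> ccont 0 1 (fun x => f x t).
Proof.
  intros H Ht x. destruct (continuity_2d_pt_line _ _ _ (H x t)) as [H1 _].
  rewrite (clamp_id 0 T t Ht) in H1. exact H1.
Qed.

Lemma cont2_uniform T f : 0 <= T -> cont2 T f -> forall eps : posreal, exists d : posreal,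
  forall x t y s, Icc 0 1 x -> Icc 0 T t -> Icc 0 1 y -> Icc 0 T s ->
  Rabs (y - x) < d -> Rabs (s - t) < d -> Rabs (f y s - f x t) < eps.
Proof.
  intros HT H eps.
  destruct (uniform_continuity_2d _ 0 1 0 T (fun x t _ _ => H x t) eps) as [d Hd].
  exists d. intros x t y s Hx Ht Hy Hs H1 H2.
  specialize (Hd x t y s Hx Ht Hy Hs H1 H2). now rewrite !clamp_id in Hd.
Qed.

(** Uniform continuity suffices: the segment from (0, 0) to (x, t) is cut into n equal steps, with n
    independent of the point, and each step changes [f] by less than 1. *)
Lemma cont2_bounded T f : 0 <= T -> cont2 T f ->
  exists M, 0 < M /\ forall x t, Icc 0 1 x -> Icc 0 T t -> Rabs (f x t) <= M.
Proof.
  intros HT H. destruct (cont2_uniform T f HT H (mkposreal 1 Rlt_0_1)) as [d Hd].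
  set (B := Rmax 1 T). assert (HB1 : 1 <= B) by apply Rmax_l. assert (HBT : T <= B) by apply Rmax_r.
  destruct (archimed_cor1 (d / B)) as [n [Hn Hn0]].
  { apply Rdiv_lt_0_compat; [apply cond_pos|lra]. }
  assert (Hnp : 0 < INR n) by (apply lt_0_INR; lia).
  assert (Hn1 : B / INR n < d).
  { apply (Rmult_lt_compat_l B) in Hn; [|lra].
    replace (B * (d / B)) with (pos d) in Hn by (field; lra). exact Hn. }
  exists (Rabs (f 0 0) + INR n). split; [assert (0 <= Rabs (f 0 0)) by apply Rabs_pos; lra|].
  intros x t Hx Ht.
  assert (W : forall i, (i <= n)%nat ->
    Rabs (f (INR i / INR n * x) (INR i / INR n * t)) <= Rabs (f 0 0) + INR i).
  { assert (Q : forall i, (i <= n)%nat -> 0 <= INR i / INR n <= 1).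
    { intros i Hi. split.
      - apply Rmult_le_pos; [apply pos_INR|left; now apply Rinv_0_lt_compat].
      - apply Rmult_le_reg_r with (INR n); [easy|]. unfold Rdiv. rewrite Rmult_assoc, Rinv_l by lra.
        rewrite Rmult_1_r, Rmult_1_l. now apply le_INR. }
    induction i as [|i IH]; intros Hi.
    - simpl. unfold Rdiv. rewrite !Rmult_0_l. lra.
    - specialize (IH ltac:(lia)). assert (Q1 := Q i ltac:(lia)). assert (Q2 := Q (S i) Hi).
      set (a := INR i / INR n) in *. set (b := INR (S i) / INR n) in *.
      assert (Hab : b - a = / INR n) by (unfold a, b; rewrite S_INR; field; lra).
      unfold Icc in *.
      assert (D : Rabs (f (b * x) (b * t) - f (a * x) (a * t)) < 1).
      { assert (Hin : 0 < / INR n) by now apply Rinv_0_lt_compat.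
        assert (Hd1 : forall z, 0 <= z <= B -> Rabs (b * z - a * z) < d).
        { intros z Hz. replace (b * z - a * z) with (z * / INR n) by (rewrite <- Hab; ring).
          rewrite Rabs_pos_eq by nra. eapply Rle_lt_trans; [|exact Hn1].
          apply Rmult_le_compat_r; lra. }
        apply Hd; try apply Hd1; unfold Icc; try nra; lra. }
      replace (f (b * x) (b * t)) with ((f (b * x) (b * t) - f (a * x) (a * t)) + f (a * x) (a * t)) by ring.
      eapply Rle_trans; [apply Rabs_triang|]. rewrite S_INR. lra. }
  specialize (W n (Nat.le_refl n)).
  replace (INR n / INR n) with 1 in W by (field; lra). now rewrite !Rmult_1_l in W.
Qed.

(** The reciprocal is continuous, hence bounded. *)
Lemma cont2_pos_bound T f : 0 <= T -> cont2 T f ->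
  (forall x t, Icc 0 1 x -> Icc 0 T t -> 0 < f x t) ->
  exists m, 0 < m /\ forall x t, Icc 0 1 x -> Icc 0 T t -> m <= f x t.
Proof.
  intros HT H Hp.
  destruct (cont2_bounded T (fun x t => / f x t) HT) as [M [HM HB]].
  - intros x t. apply continuity_2d_pt_inv; [apply H|].
    assert (0 < f (clamp 0 1 x) (clamp 0 T t)); [|lra].
    apply Hp; apply clamp_Icc; lra.
  - exists (/ M). split; [now apply Rinv_0_lt_compat|]. intros x t Hx Ht.
    specialize (Hp x t Hx Ht). specialize (HB x t Hx Ht).
    rewrite Rabs_pos_eq in HB by (left; now apply Rinv_0_lt_compat).
    apply Rinv_le_contravar in HB; [|now apply Rinv_0_lt_compat].
    now rewrite Rinv_inv in HB.
Qed.

Lemma cont2_I T f : 0 <= T -> cont2 T f -> ccont 0 T (fun t => I (fun x => f x t)).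
Proof.
  intros HT H t. apply filterlim_locally. intros e.
  assert (He : 0 < e / 2) by (assert (0 < e) by apply cond_pos; lra).
  destruct (cont2_uniform T f HT H (mkposreal _ He)) as [d Hd]. exists d. intros s Hs.
  change (Rabs (s - t) < d) in Hs.
  change (Rabs (I (fun x => f x (clamp 0 T s)) - I (fun x => f x (clamp 0 T t))) < e).
  assert (P : forall s, pc 1 grid1 (fun x => f x (clamp 0 T s))).
  { intros s'. apply (pc_ccont grid1_grid), (cont2_ccont_space T); [easy|]. now apply clamp_Icc. }
  rewrite <- (I_minus grid1_grid) by auto.
  eapply Rle_lt_trans.
  - apply (abs_RInt_le_const _ 0 1 (e / 2)); [lra| |].
    + apply (pc_ex_RInt grid1_grid). apply pc_minus; auto.
    + intros x Hx. left. apply Hd; try (apply clamp_Icc; easy); try (unfold Icc; lra).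
      * rewrite Rminus_diag, Rabs_R0. apply cond_pos.
      * eapply Rle_lt_trans; [apply clamp_lipschitz|exact Hs].
  - lra.
Qed.

Lemma Leibniz_rule T f g t : 0 < t < T -> cont2 T f -> cont2 T g ->
  (forall x s, Icc 0 1 x -> 0 < s < T -> is_derive (fun s => f x s) s (g x s)) ->
  is_derive (fun s => I (fun x => f x s)) t (I (fun x => g x t)).
Proof.
  intros Ht Hf Hg Hd.
  (* Clamping x extends the integrand across the ends of [0, 1], where the library theorem asks for
     a time derivative that is continuous in both variables. *)
  set (F := fun s x => f (clamp 0 1 x) s).
  assert (HFd : forall s x, 0 < s < T -> is_derive (fun s => F s x) s (g (clamp 0 1 x) s)).
  { intros s x Hs. apply Hd; [apply clamp_Icc; lra|easy]. }
  assert (Ex : forall s, Icc 0 T s -> ex_RInt (fun x => F s x) 0 1).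
  { intros s Hs. apply (ex_RInt_continuous (fun x => F s x)). intros x _.
    apply (cont2_ccont_space T f s Hf Hs x). }
  assert (Key : is_derive (fun s => I (fun x => F s x)) t (I (fun x => Derive (fun s => F s x) t))).
  { apply (is_derive_RInt_param F 0 1 t).
    - eapply filter_imp; [|apply (locally_Ioo 0 T t Ht)]. intros s Hs x _. eexists. now apply HFd.
    - intros x _. apply continuity_2d_pt_ext_loc with (fun s x => g (clamp 0 1 x) (clamp 0 T s)).
      + destruct (locally_Ioo 0 T t Ht) as [d Hd']. exists d. intros s y Hs _.
        assert (Hs' : 0 < s < T) by (apply Hd'; exact Hs).
        rewrite (clamp_id 0 T s) by (unfold Icc; lra). symmetry. apply is_derive_unique. now apply HFd.
      + intros e. destruct (Hg x t e) as [d Hd']. exists d. intros s y Hs Hy. now apply Hd'.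
    - eapply filter_imp; [|apply (locally_Ioo 0 T t Ht)]. intros s Hs. apply Ex. unfold Icc; lra. }
  assert (E1 : I (fun x => Derive (fun s => F s x) t) = I (fun x => g x t)).
  { apply RInt_ext. intros x Hx. rewrite Rmin_left, Rmax_right in Hx by lra.
    transitivity (g (clamp 0 1 x) t); [now apply is_derive_unique, HFd|].
    now rewrite clamp_id by (unfold Icc; lra). }
  rewrite <- E1. revert Key. apply is_derive_ext. intros s. apply RInt_ext.
  intros x Hx. rewrite Rmin_left, Rmax_right in Hx by lra. unfold F.
  now rewrite clamp_id by (unfold Icc; lra).
Qed.

Lemma C_rect_cont2 T m f : 0 <= T -> C_rect T m f -> cont2 T f.
Proof.
  intros HT Hf x t.
  assert (H : continuous_on (fun p : R * R => Icc 0 1 (fst p) /\ Icc 0 T (snd p))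
    (fun p => f (fst p) (snd p))) by (destruct m; apply Hf).
  specialize (H (clamp 0 1 x, clamp 0 T t)). simpl in H.
  assert (H1 := H (conj (clamp_Icc 0 1 x Rle_0_1) (clamp_Icc 0 T t HT))).
  intros e. apply filterlim_locally with (eps := e) in H1.
  destruct H1 as [d Hd]. exists d. intros y s Hy Hs.
  apply (Hd (clamp 0 1 y, clamp 0 T s)).
  - split; simpl; [change (Rabs (clamp 0 1 y - clamp 0 1 x) < d)|change (Rabs (clamp 0 T s - clamp 0 T t) < d)];
      (eapply Rle_lt_trans; [apply clamp_lipschitz|easy]).
  - simpl. split; apply clamp_Icc; lra.
Qed.

Lemma C_rect_chain T n f : 0 <= T -> C_rect T n f -> exists V : nat -> R -> R -> R,
  (forall x t, V O x t = f x t) /\ (forall i, (i <= n)%nat -> cont2 T (V i)) /\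
  forall i x t, (i < n)%nat -> Icc 0 1 x -> Icc 0 T t ->
    is_derive_on (Icc 0 1) (fun y => V i y t) x (V (S i) x t).
Proof.
  intros HT. revert f. induction n as [|n IH]; intros f Hf.
  - exists (fun _ => f). split; [easy|split; [|intros; lia]].
    intros i _. now apply (C_rect_cont2 T 0).
  - assert (Hc := C_rect_cont2 T (S n) f HT Hf).
    destruct Hf as [_ [fx [ft [Hd [Hx _]]]]].
    destruct (IH fx Hx) as [V [V0 [V1 V2]]].
    exists (fun i => match i with O => f | S i => V i end). split; [easy|split].
    + intros [|i] Hi; [easy|]. apply V1; lia.
    + intros [|i] x t Hi Hx' Ht.
      * rewrite V0. now apply Hd.
      * apply V2; auto; lia.
Qed.

(** * A basis of the discrete space *)

Lemma inspan_eq2 n o e f : eq2 f e -> inspan n o e -> inspan n o f.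
Proof.
  intros H [c Hc]. exists c. intros x Hx. destruct (H x Hx) as [-> ->]. now apply Hc.
Qed.

Lemma inspan_lin n o e f u v : inspan n o e -> inspan n o f ->
  inspan n o (fun x => u * fst e x + v * fst f x, fun x => u * snd e x + v * snd f x).
Proof.
  intros [c Hc] [d Hd]. exists (fun i => u * c i + v * d i). intros x Hx.
  destruct (Hc x Hx) as [C1 C2], (Hd x Hx) as [D1 D2]. simpl in *.
  rewrite C1, C2, D1, D2, <- !bsum_scal_l, <- !bsum_plus. split; apply bsum_ext; intros; ring.
Qed.

(** The truncated power representation as an induction principle; it shows that a finite list spans
    the spline space. *)
Lemma spl_ind r k N Y (P : (R -> R) -> Prop) : grid N Y ->
  (forall f g, (forall x, Icc 0 1 x -> f x = g x) -> P f -> P g) ->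
  P (fun _ => 0) ->
  (forall f g u v, P f -> P g -> P (fun x => u * f x + v * g x)) ->
  (forall m, (m < r)%nat -> P (fun x => x ^ m)) ->
  (forall m j, (k < m < r)%nat -> (S j < N)%nat -> P (tpow m (Y (S j)))) ->
  forall f, spl r k N Y f -> P f.
Proof.
  intros HG Pext P0 Plin Pm Pt f Hf.
  assert (Psum : forall n c (g : nat -> R -> R), (forall i, (i < n)%nat -> P (g i)) ->
    P (fun x => bsum n (fun i => c i * g i x))).
  { induction n as [|n IH]; intros c g Hg; [exact P0|].
    apply (Pext (fun x => 1 * bsum n (fun i => c i * g i x) + c n * g n x)).
    - intros x _; simpl; ring.
    - apply Plin; [apply IH|]; auto. }
  destruct (spl_pieces HG f Hf) as [p [d [Hp [Hj Hd]]]].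
  apply (Pext (fun x => 1 * peval r (p O) x + 1 * bsum (N - 1) (fun j => 1 *
    bsum r (fun m => d (S j) m * (if le_lt_dec m k then 0 else tpow m (Y (S j)) x))))).
  - intros x Hx. rewrite (spl_representation HG f p d Hp Hj Hd x Hx). rewrite !Rmult_1_l. f_equal.
    apply bsum_ext; intros j _. rewrite Rmult_1_l. apply bsum_ext; intros m _.
    destruct (le_lt_dec m k) as [Hm|Hm]; [|easy]. rewrite Hd by easy; ring.
  - apply Plin.
    + apply (Psum r (p O) (fun m x => x ^ m)). auto.
    + apply (Psum (N - 1)%nat (fun _ => 1)). intros j Hj'.
      apply (Psum r (d (S j)) (fun m x => if le_lt_dec m k then 0 else tpow m (Y (S j)) x)).
      intros m Hm. destruct (le_lt_dec m k); [exact P0|]. apply Pt; lia.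
Qed.

(** Linear projection onto the functions vanishing at 0 and 1, by subtraction of the linear
    interpolant of the end values. It maps a spanning set of the splines to one of the splines with
    zero end values. *)
Definition zero_ends (f : R -> R) (x : R) : R := f x - f 0 * (1 - x) - f 1 * x.

Definition spl2 (r k N : nat) (Y : nat -> R) (e : pair2) : Prop :=
  spl r k N Y (fst e) /\ spl r k N Y (snd e) /\ snd e 0 = 0 /\ snd e 1 = 0.

Lemma spl2_ccont2 r k N Y e : spl2 r k N Y e -> ccont2 e.
Proof. intros [H1 [H2 _]]. split; eapply spl_ccont; eassumption. Qed.

Lemma spl_monomial r k N Y m : (m < r)%nat -> grid N Y -> spl r k N Y (fun x => x ^ m).
Proof.
  intros Hm HG. apply (spl_ext (peval r (kron m))); [easy| |apply spl_peval].
  intros x _. unfold peval. rewrite <- (bsum_kron r (fun i => x ^ i) m) by easy.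
  apply bsum_ext; intros; ring.
Qed.

(** Gram-Schmidt applied to monomials and truncated powers in the first component and to their
    images under [zero_ends] in the second. As r >= 2, linear functions are splines and [zero_ends]
    stays in the space. *)
Lemma spl_basis r k N Y : grid N Y -> (2 <= r)%nat ->
  exists n o, (forall i, (i < n)%nat -> spl2 r k N Y (o i)) /\ orthonormal n o /\
    forall e, spl2 r k N Y e -> inspan n o e.
Proof.
  intros HG Hr.
  set (S0 := map (fun m x => x ^ m) (seq 0 r) ++
    flat_map (fun j => map (fun m => tpow m (Y (S j))) (seq (S k) (r - S k))) (seq 0 (N - 1))).
  assert (HS0 : forall s, In s S0 -> spl r k N Y s).
  { intros s Hs. apply in_app_iff in Hs. destruct Hs as [Hs|Hs].
    - apply in_map_iff in Hs. destruct Hs as [m [<- Hm]]. apply in_seq in Hm.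
      apply spl_monomial; [lia|easy].
    - apply in_flat_map in Hs. destruct Hs as [j [Hj Hs]].
      apply in_map_iff in Hs. destruct Hs as [m [<- Hm]]. apply in_seq in Hm, Hj.
      apply (spl_tpow HG); lia. }
  assert (Hz : forall s, spl r k N Y s -> spl r k N Y (zero_ends s)).
  { intros s Hs. apply (spl_ext (fun x => 1 * s x + 1 * (- s 0 * x ^ 0 + (s 0 - s 1) * x ^ 1))); [easy| |].
    - intros x _. unfold zero_ends. ring.
    - apply spl_lin; [easy|]. apply (spl_lin (fun x => x ^ 0) (fun x => x ^ 1)); apply spl_monomial; auto; lia. }
  destruct (gram_schmidt (spl2 r k N Y) (spl2_ccont2 r k N Y)) with
    (L := map (fun s => (s, fun _ : R => 0)) S0 ++ map (fun s => (fun _ : R => 0, zero_ends s)) S0)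
    as [n [o [Ho [Hon Hs]]]].
  - intros e n c o a [E1 [E2 [E3 E4]]] Ho.
    assert (L1 : spl r k N Y (fst (lin2 n c o))) by (apply spl_bsum; intros; now apply Ho).
    assert (L2 : spl r k N Y (snd (lin2 n c o))) by (apply spl_bsum; intros; now apply Ho).
    split; [|split; [|split]].
    + apply (spl_ext (fun x => a * fst e x + (- a) * fst (lin2 n c o) x)); [easy|intros; simpl; ring|].
      now apply spl_lin.
    + apply (spl_ext (fun x => a * snd e x + (- a) * snd (lin2 n c o) x)); [easy|intros; simpl; ring|].
      now apply spl_lin.
    + simpl. rewrite E3, bsum_0; [ring|]. intros i Hi. destruct (Ho i Hi) as [_ [_ [-> _]]]; ring.
    + simpl. rewrite E4, bsum_0; [ring|]. intros i Hi. destruct (Ho i Hi) as [_ [_ [_ ->]]]; ring.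
  - intros e He. apply in_app_iff in He. destruct He as [He|He]; apply in_map_iff in He;
      destruct He as [s [<- Hin]]; specialize (HS0 s Hin).
    + split; [easy|split; [apply spl_0|easy]].
    + split; [apply spl_0|split; [now apply Hz|]]. unfold zero_ends; simpl; split; ring.
  - exists n, o. split; [easy|split; [easy|]].
    assert (In_m : forall m, (m < r)%nat -> In (fun x => x ^ m) S0).
    { intros m Hm. apply in_app_iff. left. apply in_map_iff. exists m; split; [easy|]. apply in_seq; lia. }
    assert (In_t : forall m j, (k < m < r)%nat -> (S j < N)%nat -> In (tpow m (Y (S j))) S0).
    { intros m j Hm Hj. apply in_app_iff. right. apply in_flat_map. exists j. split; [apply in_seq; lia|].
      apply in_map_iff. exists m; split; [easy|]. apply in_seq; lia. }
    assert (I1 : forall s, In s S0 -> inspan n o (s, fun _ => 0)).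
    { intros s Hin. apply Hs, in_app_iff. left. apply in_map_iff. now exists s. }
    assert (I2 : forall s, In s S0 -> inspan n o (fun _ => 0, zero_ends s)).
    { intros s Hin. apply Hs, in_app_iff. right. apply in_map_iff. now exists s. }
    assert (Iz : inspan n o (fun _ => 0, fun _ => 0)).
    { exists (fun _ => 0). intros x _. simpl. split; symmetry; apply bsum_0; intros; ring. }
    intros e [E1 [E2 [E3 E4]]].
    assert (J1 : inspan n o (fst e, fun _ => 0)).
    { revert E1. apply (spl_ind r k N Y (fun f => inspan n o (f, fun _ => 0))); auto.
      - intros f g H. apply inspan_eq2. intros x Hx; simpl; rewrite H; auto.
      - intros f g u v Hf Hg.
        generalize (inspan_lin n o _ _ u v Hf Hg). apply inspan_eq2.
        intros x _; simpl; split; ring. }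
    assert (J2 : inspan n o (fun _ => 0, zero_ends (snd e))).
    { revert E2. apply (spl_ind r k N Y (fun f => inspan n o (fun _ => 0, zero_ends f))); auto.
      - intros f g H. apply inspan_eq2. intros x Hx; simpl. unfold zero_ends.
        rewrite !H; auto; unfold Icc; lra.
      - revert Iz. apply inspan_eq2. intros x _; unfold zero_ends; simpl; split; ring.
      - intros f g u v Hf Hg.
        generalize (inspan_lin n o _ _ u v Hf Hg). apply inspan_eq2.
        intros x _; unfold zero_ends; simpl; split; ring. }
    generalize (inspan_lin n o _ _ 1 1 J1 J2). apply inspan_eq2.
    intros x _. unfold zero_ends; simpl. rewrite E3, E4. split; ring.
Qed.

(** * Coordinates as combinations of point values *)

(** Finite combinations of point evaluations. A discrete solution is differentiable in time at each
    fixed x; such functionals inherit this at once, whereas coordinates written as integrals would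
    require an exchange of limits. *)
Inductive ev : (pair2 -> R) -> Prop :=
| ev_fst x : Icc 0 1 x -> ev (fun e => fst e x)
| ev_snd x : Icc 0 1 x -> ev (fun e => snd e x)
| ev_zero : ev (fun _ => 0)
| ev_lin a b l l' : ev l -> ev l' -> ev (fun e => a * l e + b * l' e).

Lemma ev_lin2 l n c o : ev l -> l (lin2 n c o) = bsum n (fun i => c i * l (o i)).
Proof.
  intros H. induction H as [x Hx|x Hx| |a b l l' H IH H' IH']; try easy.
  - symmetry. apply bsum_0; intros; ring.
  - rewrite IH, IH', <- !bsum_scal_l, <- bsum_plus. apply bsum_ext; intros; ring.
Qed.

Lemma ev_eq2 l e f : ev l -> eq2 e f -> l e = l f.
Proof.
  intros H He. induction H as [x Hx|x Hx| |a b l l' H IH H' IH']; try easy.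
  - now apply He.
  - now apply He.
  - now rewrite IH, IH'.
Qed.

Lemma ev_is_derive_on (D : R -> Prop) l (E : R -> pair2) e t : ev l -> D t ->
  (forall x, Icc 0 1 x -> is_derive_on D (fun s => fst (E s) x) t (fst e x) /\
     is_derive_on D (fun s => snd (E s) x) t (snd e x)) ->
  is_derive_on D (fun s => l (E s)) t (l e).
Proof.
  intros H Dt He. induction H as [x Hx|x Hx| |a b l l' H IH H' IH'].
  - now apply He.
  - now apply He.
  - apply is_derive_on_of_is_derive; [easy|]. apply (is_derive_const 0 t).
  - now apply is_derive_on_lin.
Qed.

Lemma ev_bsum n (c : nat -> R) (l : nat -> pair2 -> R) : (forall i, (i < n)%nat -> ev (l i)) ->
  exists l', ev l' /\ forall e, l' e = bsum n (fun i => c i * l i e).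
Proof.
  induction n as [|n IH]; intros H.
  - exists (fun _ => 0). split; [apply ev_zero|easy].
  - destruct IH as [l' [L1 L2]]; [auto|].
    exists (fun e => 1 * l' e + c n * l n e). split; [apply ev_lin; auto|].
    intros e. rewrite L2. simpl. ring.
Qed.

(** Induction on the family. If no point value separated [o n] from its interpolant [p] by the
    earlier functionals, [o n] would lie in the span of functions orthogonal to it, against ip (o n)
    (o n) = 1. *)
Lemma ev_dual n o : (forall i, (i < n)%nat -> ccont2 (o i)) -> orthonormal n o ->
  exists l : nat -> pair2 -> R, (forall i, (i < n)%nat -> ev (l i)) /\
    forall i j, (i < n)%nat -> (j < n)%nat -> l i (o j) = kron i j.
Proof.
  assert (HG := grid1_grid).
  induction n as [|n IH]; intros Ho Hon.
  - exists (fun _ _ => 0). split; intros; lia.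
  - destruct IH as [l [L1 L2]]; [auto|intros i j Hi Hj; apply Hon; lia|].
    assert (Hp : forall i, (i < S n)%nat -> pc2 1 grid1 (o i)) by (intros; apply ccont2_pc2; auto).
    set (p := lin2 n (fun i => l i (o n)) o).
    assert (Pp : pc2 1 grid1 p) by (apply lin2_pc2; auto).
    assert (Hne : exists l0, ev l0 /\ l0 (o n) <> l0 p).
    { apply NNPP. intros Hn.
      assert (E : eq2 (o n) p).
      { intros x Hx. split; apply NNPP; intros Hx'; apply Hn.
        - exists (fun e => fst e x). split; [now apply ev_fst|easy].
        - exists (fun e => snd e x). split; [now apply ev_snd|easy]. }
      assert (E1 : ip (o n) (o n) = 1).
      { rewrite Hon by lia. unfold kron. destruct (Nat.eq_dec n n); [easy|lia]. }
      rewrite (ip_eq2 HG (o n) p) in E1 by auto. unfold p in E1.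
      rewrite (ip_lin2_l HG) in E1 by auto. rewrite bsum_0 in E1; [lra|].
      intros i Hi. rewrite Hon by lia. unfold kron. destruct (Nat.eq_dec i n); [lia|ring]. }
    destruct Hne as [l0 [E0 N0]].
    assert (Lp : l0 p = bsum n (fun i => l i (o n) * l0 (o i))) by now apply ev_lin2.
    destruct (ev_bsum n (fun i => l0 (o i)) l) as [q [Q1 Q2]]; [auto|].
    set (g := l0 (o n) - l0 p). assert (Hg : g <> 0) by (unfold g; lra).
    (* [l0] minus its value on the interpolant of the argument, normalized at [o n]. It vanishes at
       the earlier [o j], which coincide with their interpolants; multiples of it correct the
       earlier functionals at [o n]. *)
    set (mu := fun e => / g * l0 e + (- / g) * q e).
    assert (Emu : ev mu) by now apply ev_lin.
    assert (Mj : forall j, (j < n)%nat -> mu (o j) = 0).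
    { intros j Hj. unfold mu. rewrite Q2.
      rewrite (bsum_ext n _ (fun i => l0 (o i) * kron j i)).
      - rewrite bsum_kron by easy. ring.
      - intros i Hi. now rewrite L2, kron_sym. }
    assert (Mn : mu (o n) = 1).
    { unfold mu. rewrite Q2. rewrite (bsum_ext n _ (fun i => l i (o n) * l0 (o i))) by (intros; ring).
      rewrite <- Lp. transitivity (g / g); [unfold g, Rdiv; ring|now field]. }
    exists (fun i => if Nat.eq_dec i n then mu else fun e => 1 * l i e + (- l i (o n)) * mu e).
    split.
    + intros i Hi. destruct (Nat.eq_dec i n); [easy|]. apply ev_lin; [apply L1; lia|easy].
    + intros i j Hi Hj. unfold kron.
      destruct (Nat.eq_dec i n) as [->|Hin], (Nat.eq_dec j n) as [->|Hjn].
      * rewrite Mn. destruct (Nat.eq_dec n n); [easy|lia].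
      * rewrite Mj by lia. destruct (Nat.eq_dec n j); [lia|easy].
      * rewrite Mn. destruct (Nat.eq_dec i n); [lia|ring].
      * rewrite Mj, L2 by lia. unfold kron. ring.
Qed.

(** * Ordinary differential equations *)

Definition lipschitz_field (n : nat) (L : R) (F : nat -> (nat -> R) -> R) : Prop :=
  forall i y z, (i < n)%nat -> Rabs (F i y - F i z) <= L * bsum n (fun j => Rabs (y j - z j)).

Lemma lipschitz_field_ext n L F i y z : lipschitz_field n L F -> (i < n)%nat ->
  (forall j, (j < n)%nat -> y j = z j) -> F i y = F i z.
Proof.
  intros HF Hi H. specialize (HF i y z Hi).
  rewrite (bsum_0 n (fun j => Rabs (y j - z j))) in HF.
  - rewrite Rmult_0_r in HF. assert (Q := Rabs_pos (F i y - F i z)).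
    destruct (Req_dec (F i y - F i z) 0) as [E|E]; [lra|]. apply Rabs_no_R0 in E. lra.
  - intros j Hj. now rewrite H, Rminus_diag, Rabs_R0.
Qed.

Lemma lipschitz_field_continuous n L F i (u : nat -> R -> R) t : lipschitz_field n L F -> (i < n)%nat ->
  (forall j, (j < n)%nat -> continuous (u j) t) -> continuous (fun s => F i (fun j => u j s)) t.
Proof.
  intros HF Hi Hu.
  assert (HS : continuous (fun s => Rabs L * bsum n (fun j => Rabs (u j s - u j t))) t).
  { apply (continuous_mult (fun _ => Rabs L)); [apply continuous_const|].
    apply (bsum_continuous n (fun j s => Rabs (u j s - u j t))). intros j Hj.
    apply (continuous_comp (fun s => u j s - u j t) Rabs); [|apply continuous_Rabs].
    apply (continuous_minus (u j) (fun _ => u j t)); [auto|apply continuous_const]. }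
  assert (Z : Rabs L * bsum n (fun j => Rabs (u j t - u j t)) = 0).
  { rewrite bsum_0; [ring|]. intros; now rewrite Rminus_diag, Rabs_R0. }
  apply filterlim_locally. intros e.
  apply filterlim_locally with (eps := e) in HS. rewrite Z in HS.
  eapply filter_imp; [|exact HS]. intros s Hs.
  change (Rabs (Rabs L * bsum n (fun j => Rabs (u j s - u j t)) - 0) < e) in Hs.
  change (Rabs (F i (fun j => u j s) - F i (fun j => u j t)) < e).
  rewrite Rminus_0_r in Hs. eapply Rle_lt_trans; [apply HF; auto|].
  eapply Rle_lt_trans; [|exact Hs]. eapply Rle_trans; [|apply Rle_abs].
  apply Rmult_le_compat_r; [apply bsum_nonneg; intros; apply Rabs_pos|apply Rle_abs].
Qed.

Lemma Rmax_0_continuous t : continuous (Rmax 0) t.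
Proof.
  apply filterlim_locally. intros e. exists e. intros s Hs.
  change (Rabs (s - t) < e) in Hs. change (Rabs (Rmax 0 s - Rmax 0 t) < e).
  eapply Rle_lt_trans; [|exact Hs].
  unfold Rmax; destruct (Rle_dec 0 s), (Rle_dec 0 t); unfold Rabs; repeat destruct (Rcase_abs _); lra.
Qed.

(** Contraction in the norm weighted by exp (Lam t) works on all of [0, infinity) at once, without
    gluing short intervals. Freezing the state at negative times provides a two-sided derivative at
    0. *)
Lemma picard n F L y0 : 0 <= L -> lipschitz_field n L F ->
  exists y : nat -> R -> R, (forall i, (i < n)%nat -> y i 0 = y0 i) /\
    forall i t, (i < n)%nat -> is_derive (y i) t (F i (fun j => y j (Rmax 0 t))).
Proof.
  intros HL HF.
  set (Y := fix Y k := match k with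
    | O => fun (i : nat) (_ : R) => y0 i
    | S k => fun i t => y0 i + RInt (fun s => F i (fun j => Y k j (Rmax 0 s))) 0 t
    end).
  assert (Cint : forall u : nat -> R -> R, (forall j t, (j < n)%nat -> continuous (u j) t) ->
    forall i a b, (i < n)%nat -> ex_RInt (fun s => F i (fun j => u j s)) a b).
  { intros u Hu i a b Hi. apply (ex_RInt_continuous (fun s => F i (fun j => u j s))).
    intros z _. apply (lipschitz_field_continuous n L); auto. }
  assert (Dint : forall u : nat -> R -> R, (forall j t, (j < n)%nat -> continuous (u j) t) ->
    forall i t, (i < n)%nat ->
    is_derive (fun t => y0 i + RInt (fun s => F i (fun j => u j s)) 0 t) t (F i (fun j => u j t))).
  { intros u Hu i t Hi. rewrite <- (Rplus_0_l (F i _)).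
    apply (is_derive_plus (fun _ => y0 i)); [apply (is_derive_const (y0 i) t)|].
    apply (is_derive_RInt (fun s => F i (fun j => u j s)) _ 0).
    - apply filter_forall. intros s. apply (@RInt_correct R_CompleteNormedModule). now apply Cint.
    - apply (lipschitz_field_continuous n L); auto. }
  assert (YC : forall k j t, (j < n)%nat -> continuous (Y k j) t).
  { induction k as [|k IH]; intros j t Hj; [apply continuous_const|].
    apply (ex_derive_continuous (Y (S k) j)). eexists.
    apply (Dint (fun j s => Y k j (Rmax 0 s))); [|easy]. intros i s Hi.
    apply (continuous_comp (Rmax 0) (Y k i)); [apply Rmax_0_continuous|now apply IH]. }
  assert (YC' : forall k j t, (j < n)%nat -> continuous (fun s => Y k j (Rmax 0 s)) t).
  { intros k j t Hj. apply (continuous_comp (Rmax 0) (Y k j)); [apply Rmax_0_continuous|auto]. }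
  set (K := bsum n (fun i => Rabs (F i y0))).
  assert (HK : 0 <= K) by (apply bsum_nonneg; intros; apply Rabs_pos).
  (* Chosen so that n L / Lam <= 1 / 2, the contraction factor; the summand 1 keeps it positive and
     bounds t by exp (Lam t). *)
  set (Lam := 1 + 2 * (INR n * L)).
  assert (HnL : 0 <= INR n * L) by (apply Rmult_le_pos; [apply pos_INR|easy]).
  assert (HLam : 1 <= Lam) by (unfold Lam; lra).
  (* One application of the integral operator halves the weighted distance. *)
  assert (Comp : forall (u v : nat -> R -> R) A, 0 <= A ->
    (forall j t, (j < n)%nat -> continuous (u j) t) -> (forall j t, (j < n)%nat -> continuous (v j) t) ->
    (forall j t, (j < n)%nat -> 0 <= t -> Rabs (u j t - v j t) <= A * exp (Lam * t)) ->
    forall i t, (i < n)%nat -> 0 <= t ->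
    Rabs (RInt (fun s => F i (fun j => u j s)) 0 t - RInt (fun s => F i (fun j => v j s)) 0 t) <=
    A / 2 * exp (Lam * t)).
  { intros u v A HA Hu Hv Huv i t Hi Ht.
    assert (E1 := Cint u Hu i 0 t Hi). assert (E2 := Cint v Hv i 0 t Hi).
    assert (Em : is_RInt (fun s => INR n * L * A * exp (Lam * s)) 0 t
       (INR n * L * A / Lam * exp (Lam * t) - INR n * L * A / Lam * exp (Lam * 0))).
    { apply (is_RInt_derive (fun s => INR n * L * A / Lam * exp (Lam * s))).
      - intros s _. auto_derive; [easy|]. field; lra.
      - intros s _. apply (ex_derive_continuous (fun s => INR n * L * A * exp (Lam * s))). auto_derive; easy. }
    assert (Esub : RInt (fun s => F i (fun j => u j s)) 0 t - RInt (fun s => F i (fun j => v j s)) 0 t =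
      RInt (fun s => F i (fun j => u j s) - F i (fun j => v j s)) 0 t).
    { symmetry. apply (RInt_minus (fun s => F i (fun j => u j s)) (fun s => F i (fun j => v j s))); auto. }
    assert (Exm : ex_RInt (fun s => F i (fun j => u j s) - F i (fun j => v j s)) 0 t)
      by (apply (ex_RInt_minus (fun s => F i (fun j => u j s)) (fun s => F i (fun j => v j s))); auto).
    rewrite Esub. eapply Rle_trans; [apply abs_RInt_le; auto|].
    apply Rle_trans with (RInt (fun s => INR n * L * A * exp (Lam * s)) 0 t).
    - apply RInt_le; [easy| |eexists; exact Em|].
      + apply (ex_RInt_norm (fun s => F i (fun j => u j s) - F i (fun j => v j s))). exact Exm.
      + intros s Hs. eapply Rle_trans; [apply HF; auto|].
        apply Rle_trans with (L * (INR n * (A * exp (Lam * s)))).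
        * apply Rmult_le_compat_l; [easy|]. rewrite <- bsum_const. apply bsum_le.
          intros j Hj. apply Huv; [easy|lra].
        * right; ring.
    - rewrite (is_RInt_unique _ _ _ _ Em). rewrite Rmult_0_r, exp_0.
      assert (Q1 : INR n * L / Lam <= / 2).
      { apply Rmult_le_reg_r with Lam; [lra|]. unfold Rdiv. rewrite Rmult_assoc, Rinv_l by lra. unfold Lam. lra. }
      assert (Q0 : 0 <= INR n * L / Lam) by (apply Rmult_le_pos; [easy|left; apply Rinv_0_lt_compat; lra]).
      assert (Hexp : 0 < exp (Lam * t)) by apply exp_pos.
      assert (Q2 : 0 <= A * exp (Lam * t)) by nra.
      replace (INR n * L * A / Lam * exp (Lam * t)) with (INR n * L / Lam * (A * exp (Lam * t))) by (field; lra).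
      replace (INR n * L * A / Lam * 1) with (INR n * L / Lam * A) by (field; lra).
      assert (0 <= INR n * L / Lam * A) by nra.
      replace (A / 2 * exp (Lam * t)) with (/ 2 * (A * exp (Lam * t))) by field. nra. }
  assert (Step : forall k i t, (i < n)%nat -> 0 <= t ->
    Rabs (Y (S k) i t - Y k i t) <= K * (/ 2) ^ k * exp (Lam * t)).
  { induction k as [|k IH]; intros i t Hi Ht.
    - simpl. rewrite RInt_const. unfold scal; simpl; unfold mult; simpl.
      replace (y0 i + (t - 0) * F i (fun j => y0 j) - y0 i) with (F i (fun j => y0 j) * t) by ring.
      rewrite Rabs_mult, (Rabs_pos_eq t), Rmult_1_r by easy.
      apply Rmult_le_compat; [apply Rabs_pos|easy| |].
      + apply (bsum_term_le n (fun i => Rabs (F i y0))); [intros; apply Rabs_pos|easy].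
      + assert (1 + Lam * t <= exp (Lam * t)) by apply exp_ineq1_le. nra.
    - change (Y (S (S k)) i t) with (y0 i + RInt (fun s => F i (fun j => Y (S k) j (Rmax 0 s))) 0 t).
      change (Y (S k) i t) with (y0 i + RInt (fun s => F i (fun j => Y k j (Rmax 0 s))) 0 t).
      match goal with |- Rabs (?y + ?a - (?y + ?b)) <= _ => replace (y + a - (y + b)) with (a - b) by ring end.
      replace (K * (/ 2) ^ S k * exp (Lam * t)) with (K * (/ 2) ^ k / 2 * exp (Lam * t)) by (simpl; field).
      apply (Comp (fun j s => Y (S k) j (Rmax 0 s)) (fun j s => Y k j (Rmax 0 s))); auto.
      + apply Rmult_le_pos; [easy|]. apply pow_le; lra.
      + intros j s Hj Hs. rewrite Rmax_right by easy. auto. }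
  assert (Tail : forall k m i t, (i < n)%nat -> 0 <= t -> (k <= m)%nat ->
    Rabs (Y m i t - Y k i t) <= 2 * K * ((/ 2) ^ k - (/ 2) ^ m) * exp (Lam * t)).
  { intros k m i t Hi Ht Hkm. induction m as [|m IH].
    - replace k with O by lia. rewrite !Rminus_diag, Rabs_R0. lra.
    - destruct (Nat.eq_dec k (S m)) as [->|Hn].
      + rewrite !Rminus_diag, Rabs_R0. lra.
      + specialize (IH ltac:(lia)). assert (Q := Step m i t Hi Ht).
        replace (Y (S m) i t - Y k i t) with ((Y (S m) i t - Y m i t) + (Y m i t - Y k i t)) by ring.
        eapply Rle_trans; [apply Rabs_triang|]. simpl pow.
        apply Rle_trans with (K * (/ 2) ^ m * exp (Lam * t) + 2 * K * ((/ 2) ^ k - (/ 2) ^ m) * exp (Lam * t)); [lra|].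
        right; field. }
  assert (Pow0 : forall e, 0 < e -> exists k, (/ 2) ^ k < e).
  { intros e He. destruct (pow_lt_1_zero (/ 2)) with (y := e) as [k Hk]; [rewrite Rabs_pos_eq; lra|easy|].
    exists k. specialize (Hk k (Nat.le_refl k)). rewrite Rabs_pos_eq in Hk; [easy|]. apply pow_le; lra. }
  assert (Hlim : forall i t, exists l, (i < n)%nat -> 0 <= t ->
    forall k, Rabs (l - Y k i t) <= 2 * K * (/ 2) ^ k * exp (Lam * t)).
  { intros i t. destruct (Nat.lt_ge_cases i n) as [Hi|Hi]; [|exists 0; lia].
    destruct (Rle_dec 0 t) as [Ht|Ht]; [|exists 0; lra].
    assert (Hexp : 0 < exp (Lam * t)) by apply exp_pos.
    assert (Bd : forall k m, (k <= m)%nat -> Rabs (Y m i t - Y k i t) <= 2 * K * (/ 2) ^ k * exp (Lam * t)).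
    { intros k m Hkm. eapply Rle_trans; [apply Tail; auto|].
      assert (0 <= (/ 2) ^ m) by (apply pow_le; lra).
      apply Rmult_le_compat_r; [lra|]. apply Rmult_le_compat_l; lra. }
    destruct (Rcomplete.R_complete (fun k => Y k i t)) as [l Hl].
    - intros e He. destruct (Pow0 (e / (2 * (2 * K * exp (Lam * t) + 1)))) as [k Hk].
      { apply Rdiv_lt_0_compat; [easy|]. nra. }
      assert (B : 2 * K * (/ 2) ^ k * exp (Lam * t) < e / 2).
      { assert (0 < 2 * K * exp (Lam * t) + 1) by nra.
        apply (Rmult_lt_compat_l (2 * K * exp (Lam * t) + 1)) in Hk; [|easy].
        replace ((2 * K * exp (Lam * t) + 1) * (e / (2 * (2 * K * exp (Lam * t) + 1)))) with (e / 2) in Hk by (field; lra).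
        assert (0 < (/ 2) ^ k) by (apply pow_lt; lra). nra. }
      exists k. intros p q Hp Hq. unfold Rdist.
      replace (Y p i t - Y q i t) with ((Y p i t - Y k i t) + - (Y q i t - Y k i t)) by ring.
      eapply Rle_lt_trans; [apply Rabs_triang|]. rewrite Rabs_Ropp.
      assert (B1 := Bd k p Hp). assert (B2 := Bd k q Hq). lra.
    - exists l. intros _ _ k. apply Rnot_lt_le. intros Hc.
      destruct (Hl (Rabs (l - Y k i t) - 2 * K * (/ 2) ^ k * exp (Lam * t))) as [m Hm]; [lra|].
      specialize (Hm (max m k) (Nat.le_max_l m k)). unfold Rdist in Hm.
      assert (B := Bd k (max m k) (Nat.le_max_r m k)).
      assert (Q : Rabs (l - Y k i t) <= Rabs (Y (max m k) i t - l) + Rabs (Y (max m k) i t - Y k i t)).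
      { rewrite (Rabs_minus_sym (Y (max m k) i t) l).
        replace (l - Y k i t) with ((l - Y (max m k) i t) + (Y (max m k) i t - Y k i t)) by ring. apply Rabs_triang. }
      lra. }
  destruct (functional_choice (fun (p : nat * R) l => (fst p < n)%nat -> 0 <= snd p ->
    forall k, Rabs (l - Y k (fst p) (snd p)) <= 2 * K * (/ 2) ^ k * exp (Lam * snd p))) as [w Hw].
  { intros [i t]. apply Hlim. }
  set (u := fun i t => w (i, Rmax 0 t)).
  assert (Hu : forall i t k, (i < n)%nat -> Rabs (u i t - Y k i (Rmax 0 t)) <= 2 * K * (/ 2) ^ k * exp (Lam * Rmax 0 t)).
  { intros i t k Hi. apply (Hw (i, Rmax 0 t)); [easy|apply Rmax_l]. }
  assert (Cu : forall i t, (i < n)%nat -> continuous (u i) t).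
  { intros i t Hi. apply filterlim_locally. intros e.
    set (B := exp (Lam * (Rmax 0 t + 1))). assert (HB : 0 < B) by apply exp_pos.
    assert (He : 0 < e) by apply cond_pos.
    destruct (Pow0 (e / (3 * (2 * K * B + 1)))) as [k Hk].
    { apply Rdiv_lt_0_compat; [easy|]. nra. }
    assert (Bk : 2 * K * (/ 2) ^ k * B < e / 3).
    { assert (0 < 2 * K * B + 1) by nra.
      apply (Rmult_lt_compat_l (2 * K * B + 1)) in Hk; [|easy].
      replace ((2 * K * B + 1) * (e / (3 * (2 * K * B + 1)))) with (e / 3) in Hk by (field; lra).
      assert (0 < (/ 2) ^ k) by (apply pow_lt; lra). nra. }
    assert (Bt : forall s, Rmax 0 s <= Rmax 0 t + 1 -> Rabs (u i s - Y k i (Rmax 0 s)) < e / 3).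
    { intros s Hs. eapply Rle_lt_trans; [apply Hu; easy|]. eapply Rle_lt_trans; [|exact Bk].
      apply Rmult_le_compat_l.
      - repeat apply Rmult_le_pos; try lra. apply pow_le; lra.
      - unfold B. destruct (Req_dec (Rmax 0 s) (Rmax 0 t + 1)) as [->|Hn]; [lra|].
        left. apply exp_increasing. nra. }
    assert (He3 : 0 < e / 3) by lra.
    assert (Hc := YC' k i t Hi).
    apply filterlim_locally with (eps := mkposreal _ He3) in Hc.
    assert (H1 : locally t (fun s => Rmax 0 s < Rmax 0 t + 1)).
    { assert (Q := Rmax_0_continuous t). apply filterlim_locally with (eps := mkposreal 1 Rlt_0_1) in Q.
      eapply filter_imp; [|exact Q]. intros s Hs. change (Rabs (Rmax 0 s - Rmax 0 t) < 1) in Hs.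
      apply Rabs_lt_between in Hs. lra. }
    eapply filter_imp; [|apply (filter_and _ _ Hc H1)]. intros s [Hs1 Hs2].
    change (Rabs (Y k i (Rmax 0 s) - Y k i (Rmax 0 t)) < e / 3) in Hs1.
    change (Rabs (u i s - u i t) < e).
    assert (T1 := Bt s (Rlt_le _ _ Hs2)). assert (T2 := Bt t ltac:(lra)).
    replace (u i s - u i t) with ((u i s - Y k i (Rmax 0 s)) + (Y k i (Rmax 0 s) - Y k i (Rmax 0 t))
       + - (u i t - Y k i (Rmax 0 t))) by ring.
    eapply Rle_lt_trans; [apply Rabs_triang|]. rewrite Rabs_Ropp.
    eapply Rle_lt_trans; [apply Rplus_le_compat_r, Rabs_triang|]. lra. }
  (* The limit [u] is only known to be continuous; its image under the integral operator is
     differentiable by construction, and the two agree for t >= 0. *)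
  set (y := fun i t => y0 i + RInt (fun s => F i (fun j => u j s)) 0 t).
  assert (Hy : forall i t, (i < n)%nat -> 0 <= t -> y i t = u i t).
  { intros i t Hi Ht. apply NNPP. intros Hn.
    assert (Hp : 0 < Rabs (y i t - u i t)) by (apply Rabs_pos_lt; lra).
    assert (Hexp : 0 < exp (Lam * t)) by apply exp_pos.
    destruct (Pow0 (Rabs (y i t - u i t) / (4 * K * exp (Lam * t) + 1))) as [k Hk].
    { apply Rdiv_lt_0_compat; [easy|]. nra. }
    assert (Hpk : 0 < (/ 2) ^ k) by (apply pow_lt; lra).
    assert (B1 : Rabs (y i t - Y (S k) i t) <= 2 * K * (/ 2) ^ k / 2 * exp (Lam * t)).
    { change (Y (S k) i t) with (y0 i + RInt (fun s => F i (fun j => Y k j (Rmax 0 s))) 0 t). unfold y.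
      match goal with |- Rabs (?y + ?a - (?y + ?b)) <= _ => replace (y + a - (y + b)) with (a - b) by ring end.
      apply (Comp u (fun j s => Y k j (Rmax 0 s))); auto.
      - nra.
      - intros j s Hj Hs. rewrite <- (Rmax_right 0 s) at 3 by easy. now apply Hu. }
    assert (B2 := Hu i t (S k) Hi). rewrite Rmax_right in B2 by easy. simpl pow in B2.
    assert (B3 : Rabs (y i t - u i t) <= Rabs (y i t - Y (S k) i t) + Rabs (u i t - Y (S k) i t)).
    { rewrite (Rabs_minus_sym (u i t)).
      replace (y i t - u i t) with ((y i t - Y (S k) i t) + (Y (S k) i t - u i t)) by ring. apply Rabs_triang. }
    apply (Rmult_lt_compat_l (4 * K * exp (Lam * t) + 1)) in Hk; [|nra].
    replace ((4 * K * exp (Lam * t) + 1) * (Rabs (y i t - u i t) / (4 * K * exp (Lam * t) + 1)))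
      with (Rabs (y i t - u i t)) in Hk by (field; nra).
    set (P := (/ 2) ^ k) in *. set (X := exp (Lam * t)) in *.
    assert (0 <= K * P * X) by (apply Rmult_le_pos; [apply Rmult_le_pos|]; lra). nra. }
  exists y. split.
  - intros i Hi. unfold y. rewrite RInt_point. unfold zero; simpl. ring.
  - intros i t Hi. replace (F i (fun j => y j (Rmax 0 t))) with (F i (fun j => u j t)); [now apply Dint|].
    apply (lipschitz_field_ext n L); auto. intros j Hj. rewrite Hy by (auto; apply Rmax_l).
    unfold u. f_equal. f_equal. symmetry. apply Rmax_right, Rmax_l.
Qed.

(** E exp(-C t) - D t does not increase, by the mean value theorem and exp(-C t) <= 1, so the
    differential form is enough and no integral occurs. *)
Lemma gronwall T (E dE : R -> R) C D : 0 <= C -> 0 <= D -> ccont 0 T E ->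
  (forall t, 0 < t < T -> is_derive E t (dE t)) ->
  (forall t, 0 < t < T -> dE t <= C * E t + D) ->
  forall t, Icc 0 T t -> E t <= (E 0 + D * t) * exp (C * t).
Proof.
  intros HC HD HE Hd Hle t [Ht0 HtT].
  destruct (Req_dec t 0) as [->|Hn].
  - rewrite !Rmult_0_r, exp_0. lra.
  - set (g := fun s => E s * exp (- C * s) - D * s).
    set (dg := fun s => dE s * exp (- C * s) + E s * (- C * exp (- C * s)) - D).
    destruct (mvt 0 t g dg) as [c [Hc Ec]].
    + lra.
    + assert (Hex : forall x, continuous (fun s => exp (- C * s)) x).
      { intros x. apply (ex_derive_continuous (fun s => exp (- C * s))). auto_derive; easy. }
      apply ccont_minus; apply ccont_mult.
      * apply (ccont_sub 0 T); auto; lra.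
      * apply continuous_ccont; [lra|auto].
      * apply ccont_const.
      * apply continuous_ccont; [lra|]. intros; apply continuous_id.
    + intros s Hs. apply (is_derive_minus (fun s => E s * exp (- C * s)) (fun s => D * s)).
      * apply (is_derive_Rmult E (fun s => exp (- C * s))); [apply Hd; lra|]. auto_derive; [easy|ring].
      * auto_derive; [easy|ring].
    + assert (Hx : 0 < exp (- C * c)) by apply exp_pos.
      assert (Hx1 : exp (- C * c) <= 1).
      { rewrite <- exp_0. destruct (Req_dec (- C * c) 0) as [->|Hne]; [lra|].
        left. apply exp_increasing. assert (0 <= C * c) by (apply Rmult_le_pos; lra). lra. }
      assert (Hdg : dg c <= 0).
      { unfold dg. specialize (Hle c ltac:(lra)).
        assert ((dE c - C * E c) * exp (- C * c) <= D * exp (- C * c)) by (apply Rmult_le_compat_r; lra).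
        assert (D * exp (- C * c) <= D * 1) by (apply Rmult_le_compat_l; lra). lra. }
      assert (G : g t <= g 0) by nra.
      unfold g in G. rewrite !Rmult_0_r, exp_0 in G.
      assert (Hp : exp (- C * t) * exp (C * t) = 1).
      { rewrite <- exp_plus. replace (- C * t + C * t) with 0 by ring. apply exp_0. }
      assert (He : 0 < exp (C * t)) by apply exp_pos.
      replace (E t) with (E t * exp (- C * t) * exp (C * t)) by (rewrite Rmult_assoc, Hp; ring).
      apply Rmult_le_compat_r; lra.
Qed.

(** The supremum of the times up to which the bound has held: continuity from the left extends the
    bound to the supremum, and the strict improvement there carries it further unless the supremum
    is T. *)
Lemma bootstrap T Z d : 0 <= T -> 0 < d -> ccont 0 T Z -> Z 0 <= d ->
  (forall t, Icc 0 T t -> (forall s, Icc 0 t s -> Z s <= d) -> Z t < d) ->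
  forall t, Icc 0 T t -> Z t <= d.
Proof.
  intros HT Hd HZ H0 Hstep.
  set (E := fun t => Icc 0 T t /\ forall s, Icc 0 t s -> Z s <= d).
  destruct (completeness E) as [m [Hub Hlub]].
  - exists T. intros t [Ht _]. apply Ht.
  - exists 0. split; [unfold Icc; lra|]. intros s Hs. replace s with 0 by (unfold Icc in Hs; lra). easy.
  - assert (E0 : E 0) by (split; [unfold Icc; lra|intros s Hs; replace s with 0 by (unfold Icc in Hs; lra); easy]).
    assert (Hm0 : 0 <= m) by now apply Hub.
    assert (HmT : m <= T) by (apply Hlub; intros t [Ht _]; apply Ht).
    assert (Below : forall s, 0 <= s < m -> Z s <= d).
    { intros s Hs. apply NNPP. intros Hn. assert (m <= s); [|lra].
      apply Hlub. intros t [Ht Hts]. apply Rnot_lt_le. intros Hst. apply Hn, Hts. unfold Icc; lra. }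
    assert (Cont : forall p, Icc 0 T p -> forall e : posreal, exists de : posreal, forall s, Icc 0 T s ->
       Rabs (s - p) < de -> Rabs (Z s - Z p) < e).
    { intros p Hp e. assert (Q := HZ p). apply filterlim_locally with (eps := e) in Q.
      destruct Q as [de Hde]. exists de. intros s Hs Hsp. specialize (Hde s Hsp).
      change (Rabs (Z (clamp 0 T s) - Z (clamp 0 T p)) < e) in Hde. now rewrite !clamp_id in Hde. }
    assert (Zm : Z m <= d).
    { apply Rnot_lt_le. intros Hlt.
      assert (He : 0 < Z m - d) by lra.
      destruct (Cont m ltac:(unfold Icc; lra) (mkposreal _ He)) as [de Hde]. simpl in Hde.
      destruct (Req_dec m 0) as [E1|E1]; [rewrite E1 in Hlt; lra|].
      set (s := Rmax 0 (m - de / 2)).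
      assert (0 < de) by apply cond_pos.
      assert (Hs : 0 <= s < m) by (split; [apply Rmax_l|apply Rmax_lub_lt; lra]).
      assert (m - de / 2 <= s) by apply Rmax_r.
      assert (B := Hde s ltac:(unfold Icc; lra) ltac:(apply Rabs_lt_between; lra)).
      specialize (Below s Hs). apply Rabs_lt_between in B. lra. }
    assert (Em : forall s, Icc 0 m s -> Z s <= d).
    { intros s [Hs1 Hs2]. destruct Hs2 as [Hs2| ->]; [apply Below; lra|easy]. }
    assert (HmT' : m = T).
    { apply NNPP. intros Hn. assert (Hlt : m < T) by lra.
      assert (Zs := Hstep m ltac:(unfold Icc; lra) Em).
      assert (He : 0 < d - Z m) by lra.
      destruct (Cont m ltac:(unfold Icc; lra) (mkposreal _ He)) as [de Hde]. simpl in Hde.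
      assert (0 < de) by apply cond_pos.
      set (p := Rmin T (m + de / 2)).
      assert (Hp : m < p <= T) by (split; [apply Rmin_glb_lt; lra|apply Rmin_l]).
      assert (p <= m + de / 2) by apply Rmin_r.
      assert (Ep : E p).
      { split; [unfold Icc; lra|]. intros s Hs. destruct (Rle_dec s m) as [Hsm|Hsm].
        - apply Em. unfold Icc in *; lra.
        - unfold Icc in Hs. assert (B := Hde s ltac:(unfold Icc; lra) ltac:(apply Rabs_lt_between; lra)).
          apply Rabs_lt_between in B. lra. }
      apply Hub in Ep. lra. }
    subst m. intros t Ht. now apply Em.
Qed.

(** Gronwall's lemma for the squared distance, which starts at 0; [bsum_sqr_le] converts the l^1
    Lipschitz condition into the rate 2 L n. *)
Lemma ode_unique n F L T (y z : nat -> R -> R) : 0 <= T -> 0 <= L -> lipschitz_field n L F ->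
  (forall i, (i < n)%nat -> ccont 0 T (y i)) -> (forall i, (i < n)%nat -> ccont 0 T (z i)) ->
  (forall i t, (i < n)%nat -> 0 < t < T -> is_derive (y i) t (F i (fun j => y j t))) ->
  (forall i t, (i < n)%nat -> 0 < t < T -> is_derive (z i) t (F i (fun j => z j t))) ->
  (forall i, (i < n)%nat -> y i 0 = z i 0) ->
  forall i t, (i < n)%nat -> Icc 0 T t -> y i t = z i t.
Proof.
  intros HT HL HF Cy Cz Dy Dz H0.
  set (E := fun t => bsum n (fun i => (y i t - z i t) * (y i t - z i t))).
  set (dE := fun t => bsum n (fun i => (F i (fun j => y j t) - F i (fun j => z j t)) * (y i t - z i t)
     + (y i t - z i t) * (F i (fun j => y j t) - F i (fun j => z j t)))).
  assert (G := gronwall T E dE (2 * L * INR n) 0).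
  assert (Hn : 0 <= INR n) by apply pos_INR.
  assert (E0 : E 0 = 0) by (apply bsum_0; intros i Hi; rewrite H0 by easy; ring).
  assert (Z : forall t, Icc 0 T t -> E t <= 0).
  { intros t Ht. apply Rle_trans with ((E 0 + 0 * t) * exp (2 * L * INR n * t)); [|rewrite E0; lra].
    apply G; auto.
    - repeat apply Rmult_le_pos; lra.
    - lra.
    - apply ccont_bsum. intros i Hi. apply ccont_mult; apply ccont_minus; auto.
    - intros s Hs. apply (bsum_is_derive n (fun i t => (y i t - z i t) * (y i t - z i t))).
      intros i Hi.
      assert (D : is_derive (fun t => y i t - z i t) s (F i (fun j => y j s) - F i (fun j => z j s)))
        by (apply (is_derive_minus (y i) (z i)); auto).
      now apply (is_derive_Rmult (fun t => y i t - z i t) (fun t => y i t - z i t)).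
    - intros s Hs. rewrite Rplus_0_r. unfold dE, E.
      set (S := bsum n (fun j => Rabs (y j s - z j s))).
      apply Rle_trans with (bsum n (fun i => 2 * L * S * Rabs (y i s - z i s))).
      + apply bsum_le. intros i Hi.
        assert (B := HF i (fun j => y j s) (fun j => z j s) Hi). fold S in B.
        set (a := F i (fun j => y j s) - F i (fun j => z j s)) in *. set (b := y i s - z i s) in *.
        assert (a * b <= Rabs a * Rabs b) by (rewrite <- Rabs_mult; apply Rle_abs).
        assert (Rabs a * Rabs b <= L * S * Rabs b) by (apply Rmult_le_compat_r; [apply Rabs_pos|easy]).
        lra.
      + rewrite bsum_scal_l. fold S.
        assert (Q := bsum_sqr_le n (fun j => Rabs (y j s - z j s))). fold S in Q.
        rewrite (bsum_ext n _ (fun j => (y j s - z j s) * (y j s - z j s))) in Q.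
        * set (e := bsum n (fun j => (y j s - z j s) * (y j s - z j s))) in *.
          apply Rle_trans with (2 * L * (S * S)); [lra|].
          apply Rle_trans with (2 * L * (INR n * e)); [|lra].
          apply Rmult_le_compat_l; lra.
        * intros j _. rewrite <- Rabs_mult. apply Rabs_pos_eq, Rle_0_sqr. }
  intros i t Hi Ht.
  assert (Q : (y i t - z i t) * (y i t - z i t) <= E t).
  { apply (bsum_term_le n (fun i => (y i t - z i t) * (y i t - z i t))); [intros; apply Rle_0_sqr|easy]. }
  specialize (Z t Ht). assert (Q2 : (y i t - z i t) * (y i t - z i t) = 0).
  { assert (0 <= (y i t - z i t) * (y i t - z i t)) by apply Rle_0_sqr. lra. }
  apply Rmult_integral in Q2. lra.
Qed.

(** Clamped coordinates are bounded by M and clamping is 1-Lipschitz, so each product has the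
    Lipschitz constant 2 M. *)
Lemma quadratic_clamp_lipschitz n (A : nat -> nat -> R) (B : nat -> nat -> nat -> R) M : 0 <= M ->
  exists L, 0 <= L /\ lipschitz_field n L (fun i y =>
    bsum n (fun j => A i j * clamp (- M) M (y j)) +
    bsum n (fun j => bsum n (fun l => B i j l * (clamp (- M) M (y j) * clamp (- M) M (y l))))).
Proof.
  intros HM.
  set (a := bsum n (fun i => bsum n (fun j => Rabs (A i j)))).
  set (b := bsum n (fun i => bsum n (fun j => bsum n (fun l => Rabs (B i j l))))).
  assert (Ha : 0 <= a) by (repeat (apply bsum_nonneg; intros); apply Rabs_pos).
  assert (Hb : 0 <= b) by (repeat (apply bsum_nonneg; intros); apply Rabs_pos).
  exists (a + b * (2 * M)). split; [nra|]. intros i y z Hi.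
  set (S := bsum n (fun j => Rabs (y j - z j))).
  set (c := fun x => clamp (- M) M x).
  assert (Hc : forall x, Rabs (c x) <= M).
  { intros x. apply Rabs_le. apply (clamp_Icc (- M) M x). lra. }
  assert (Hd : forall j, (j < n)%nat -> Rabs (c (y j) - c (z j)) <= S).
  { intros j Hj. eapply Rle_trans; [apply clamp_lipschitz|].
    apply (bsum_term_le n (fun j => Rabs (y j - z j))); [intros; apply Rabs_pos|easy]. }
  assert (HS : 0 <= S) by (apply bsum_nonneg; intros; apply Rabs_pos).
  assert (T1 : Rabs (bsum n (fun j => A i j * c (y j)) - bsum n (fun j => A i j * c (z j))) <= a * S).
  { rewrite <- bsum_minus. eapply Rle_trans; [apply bsum_Rabs|].
    apply Rle_trans with (bsum n (fun j => Rabs (A i j)) * S).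
    - rewrite <- bsum_scal_r. apply bsum_le. intros j Hj.
      replace (A i j * c (y j) - A i j * c (z j)) with (A i j * (c (y j) - c (z j))) by ring.
      rewrite Rabs_mult. apply Rmult_le_compat_l; [apply Rabs_pos|auto].
    - apply Rmult_le_compat_r; [easy|].
      apply (bsum_term_le n (fun i => bsum n (fun j => Rabs (A i j)))); [|easy].
      intros; apply bsum_nonneg; intros; apply Rabs_pos. }
  assert (T2 : Rabs (bsum n (fun j => bsum n (fun l => B i j l * (c (y j) * c (y l)))) -
     bsum n (fun j => bsum n (fun l => B i j l * (c (z j) * c (z l))))) <= b * (2 * M * S)).
  { rewrite <- bsum_minus. eapply Rle_trans; [apply bsum_Rabs|].
    apply Rle_trans with (bsum n (fun j => bsum n (fun l => Rabs (B i j l))) * (2 * M * S)).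
    - rewrite <- bsum_scal_r. apply bsum_le. intros j Hj.
      rewrite <- bsum_minus, <- bsum_scal_r. eapply Rle_trans; [apply bsum_Rabs|].
      apply bsum_le. intros l Hl.
      replace (B i j l * (c (y j) * c (y l)) - B i j l * (c (z j) * c (z l))) with
        (B i j l * ((c (y j) - c (z j)) * c (y l) + c (z j) * (c (y l) - c (z l)))) by ring.
      rewrite Rabs_mult. apply Rmult_le_compat_l; [apply Rabs_pos|].
      eapply Rle_trans; [apply Rabs_triang|]. rewrite !Rabs_mult.
      assert (P1 := Hd j Hj). assert (P2 := Hd l Hl). assert (P3 := Hc (y l)). assert (P4 := Hc (z j)).
      assert (U1 : Rabs (c (y j) - c (z j)) * Rabs (c (y l)) <= S * M)
        by (apply Rmult_le_compat; auto using Rabs_pos).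
      assert (U2 : Rabs (c (z j)) * Rabs (c (y l) - c (z l)) <= M * S)
        by (apply Rmult_le_compat; auto using Rabs_pos).
      lra.
    - apply Rmult_le_compat_r; [nra|].
      apply (bsum_term_le n (fun i => bsum n (fun j => bsum n (fun l => Rabs (B i j l))))); [|easy].
      intros; repeat (apply bsum_nonneg; intros); apply Rabs_pos. }
  unfold c in T1, T2.
  match goal with |- Rabs (?p + ?q - (?p' + ?q')) <= _ =>
    replace (p + q - (p' + q')) with ((p - p') + (q - q')) by ring end.
  eapply Rle_trans; [apply Rabs_triang|]. fold S.
  replace ((a + b * (2 * M)) * S) with (a * S + b * (2 * M * S)) by ring.
  apply Rplus_le_compat; [exact T1|exact T2].
Qed.

(** * The semidiscrete problem in coordinates *)

(* The spatial terms of both equations at the state [e = (eta, u)], tested with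
   [v = (phi, chi)]. *)
Definition weak (beta : R -> R) (e v : pair2) : R :=
  I (fun x => Derive (fun y => fst e y * snd e y) x * fst v x) +
  I (fun x => Derive (fun y => beta y * snd e y) x * fst v x) +
  I (fun x => Derive (fst e) x * snd v x) +
  I (fun x => snd e x * Derive (snd e) x * snd v x).

Definition pc12 (N : nat) (Y : nat -> R) (e : pair2) : Prop := pc1 N Y (fst e) /\ pc1 N Y (snd e).

Section Weak.
Context {N : nat} {Y : nat -> R} (HG : grid N Y).

Lemma pc12_pc2 e : pc12 N Y e -> pc2 N Y e.
Proof. intros [H1 H2]; split; apply (pc1_pc HG); auto. Qed.

Lemma pc1_C1 f df : ccont 0 1 f -> ccont 0 1 df -> (forall x, 0 < x < 1 -> is_derive f x (df x)) ->
  pc1 N Y f.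
Proof.
  intros Hf Hdf Hd. apply (pc1_intro f df); [easy| |now apply (pc_ccont HG)].
  intros x Hx. apply Hd. now apply (inner_pt_01 N Y).
Qed.

Lemma lin2_pc12 n c o : (forall i, (i < n)%nat -> pc12 N Y (o i)) -> pc12 N Y (lin2 n c o).
Proof.
  intros H; split; simpl; apply (pc1_bsum n); intros i Hi; apply (pc1_scal HG); now apply H.
Qed.

Lemma Derive_bsum n (c : nat -> R) (f : nat -> R -> R) x : (forall i, (i < n)%nat -> pc1 N Y (f i)) ->
  inner_pt N Y x -> Derive (fun y => bsum n (fun i => c i * f i y)) x = bsum n (fun i => c i * Derive (f i) x).
Proof.
  intros Hf Hx. apply is_derive_unique.
  apply (bsum_is_derive n (fun i y => c i * f i y)). intros i Hi.
  apply (is_derive_scal (f i)). apply pc1_is_derive with (2 := Hx). auto.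
Qed.

Lemma weak_pc_1 e v : pc12 N Y e -> pc2 N Y v ->
  pc N Y (fun x => Derive (fun y => fst e y * snd e y) x * fst v x).
Proof. intros [E1 E2] [V1 V2]. apply pc_mult; [|easy]. apply pc1_Derive, (pc1_mult HG); auto. Qed.

Lemma weak_pc_2 beta e v : pc1 N Y beta -> pc12 N Y e -> pc2 N Y v ->
  pc N Y (fun x => Derive (fun y => beta y * snd e y) x * fst v x).
Proof. intros Hb [E1 E2] [V1 V2]. apply pc_mult; [|easy]. apply pc1_Derive, (pc1_mult HG); auto. Qed.

Lemma weak_pc_3 e v : pc12 N Y e -> pc2 N Y v -> pc N Y (fun x => Derive (fst e) x * snd v x).
Proof. intros [E1 E2] [V1 V2]. apply pc_mult; [|easy]. now apply pc1_Derive. Qed.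

Lemma weak_pc_4 e v : pc12 N Y e -> pc2 N Y v ->
  pc N Y (fun x => snd e x * Derive (snd e) x * snd v x).
Proof.
  intros [E1 E2] [V1 V2]. apply pc_mult; [|easy]. apply pc_mult; [now apply (pc1_pc HG)|now apply pc1_Derive].
Qed.

Lemma weak_eq2 beta e e' v v' : pc1 N Y beta -> pc12 N Y e -> pc2 N Y v -> eq2 e e' -> eq2 v v' ->
  weak beta e v = weak beta e' v'.
Proof.
  intros Hb He Hv E V. unfold weak.
  assert (E01 : forall x, inner_pt N Y x -> Icc 0 1 x).
  { intros x Hx. assert (Q := inner_pt_01 N Y x HG Hx). unfold Icc; lra. }
  f_equal; [f_equal; [f_equal|]|]; apply (I_ext HG).
  - now apply weak_pc_1.
  - intros x Hx. f_equal; [|now apply V, E01].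
    apply (Derive_ext_inner HG); [|easy]. intros y Hy. now destruct (E y Hy) as [-> ->].
  - now apply weak_pc_2.
  - intros x Hx. f_equal; [|now apply V, E01].
    apply (Derive_ext_inner HG); [|easy]. intros y Hy. now destruct (E y Hy) as [_ ->].
  - now apply weak_pc_3.
  - intros x Hx. f_equal; [|now apply V, E01].
    apply (Derive_ext_inner HG); [|easy]. intros y Hy. now destruct (E y Hy) as [-> _].
  - now apply weak_pc_4.
  - intros x Hx. f_equal; [|now apply V, E01]. f_equal; [now apply E, E01|].
    apply (Derive_ext_inner HG); [|easy]. intros y Hy. now destruct (E y Hy) as [_ ->].
Qed.

Lemma I_mult_bsum n (c : nat -> R) (f : nat -> R -> R) g :
  (forall i, (i < n)%nat -> pc N Y (f i)) -> pc N Y g ->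
  I (fun x => g x * bsum n (fun i => c i * f i x)) = bsum n (fun i => c i * I (fun x => g x * f i x)).
Proof.
  intros Hf Hg.
  rewrite (I_ext HG _ (fun x => bsum n (fun i => c i * f i x) * g x)).
  - rewrite (I_bsum_mult HG) by auto. apply bsum_ext; intros i Hi. f_equal.
    apply RInt_ext. intros; apply Rmult_comm.
  - apply pc_mult; [easy|]. apply pc_bsum; intros; apply pc_mult; auto using pc_const.
  - intros; ring.
Qed.

Lemma weak_lin2_r beta e n c o : pc1 N Y beta -> pc12 N Y e -> (forall i, (i < n)%nat -> pc2 N Y (o i)) ->
  weak beta e (lin2 n c o) = bsum n (fun i => c i * weak beta e (o i)).
Proof.
  intros Hb [E1 E2] Ho. unfold weak at 1; simpl.
  rewrite (I_mult_bsum n c (fun i => fst (o i)) (Derive (fun y => fst e y * snd e y))).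
  2: intros i Hi; now apply Ho.
  2: apply pc1_Derive, (pc1_mult HG); auto.
  rewrite (I_mult_bsum n c (fun i => fst (o i)) (Derive (fun y => beta y * snd e y))).
  2: intros i Hi; now apply Ho.
  2: apply pc1_Derive, (pc1_mult HG); auto.
  rewrite (I_mult_bsum n c (fun i => snd (o i)) (Derive (fst e))).
  2: intros i Hi; now apply Ho.
  2: now apply pc1_Derive.
  rewrite (I_mult_bsum n c (fun i => snd (o i)) (fun x => snd e x * Derive (snd e) x)).
  2: intros i Hi; now apply Ho.
  2: apply pc_mult; [now apply (pc1_pc HG)|now apply pc1_Derive].
  rewrite <- !bsum_plus. apply bsum_ext; intros i Hi. unfold weak. ring.
Qed.

(** In coordinates the terms with beta u and eta_x are linear and those with eta u and u u_x are
    quadratic. The coefficients are fixed integrals of basis functions, so the differential equation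
    is autonomous. *)
Lemma weak_quadratic beta n o : pc1 N Y beta -> (forall i, (i < n)%nat -> pc12 N Y (o i)) ->
  exists (A : nat -> nat -> R) (B : nat -> nat -> nat -> R), forall i y, (i < n)%nat ->
  weak beta (lin2 n y o) (o i) = bsum n (fun j => A i j * y j) +
     bsum n (fun j => bsum n (fun l => B i j l * (y j * y l))).
Proof.
  intros Hb Ho.
  exists (fun i j => I (fun x => Derive (fun y => beta y * snd (o j) y) x * fst (o i) x) +
    I (fun x => Derive (fst (o j)) x * snd (o i) x)).
  exists (fun i j l => I (fun x => Derive (fun y => fst (o j) y * snd (o l) y) x * fst (o i) x) +
    I (fun x => snd (o j) x * Derive (snd (o l)) x * snd (o i) x)).
  intros i y Hi.
  assert (P1 : forall j, (j < n)%nat -> pc1 N Y (fst (o j))) by (intros; now apply Ho).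
  assert (P2 : forall j, (j < n)%nat -> pc1 N Y (snd (o j))) by (intros; now apply Ho).
  assert (Q1 : pc N Y (fst (o i))) by (apply (pc1_pc HG); auto).
  assert (Q2 : pc N Y (snd (o i))) by (apply (pc1_pc HG); auto).
  assert (HL := lin2_pc12 n y o Ho). assert (Hoi : pc2 N Y (o i)) by (now apply pc12_pc2, Ho).
  unfold weak.
  assert (W1 : I (fun x => Derive (fun z => fst (lin2 n y o) z * snd (lin2 n y o) z) x * fst (o i) x) =
    bsum n (fun j => bsum n (fun l => I (fun x => Derive (fun y => fst (o j) y * snd (o l) y) x * fst (o i) x) * (y j * y l)))).
  { rewrite (I_ext HG _ (fun x => bsum n (fun j => 1 * bsum n (fun l => (y j * y l) *
        Derive (fun y => fst (o j) y * snd (o l) y) x)) * fst (o i) x)).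
    - rewrite (I_bsum_mult HG n (fun _ => 1) (fun j x => bsum n (fun l => (y j * y l) *
        Derive (fun y => fst (o j) y * snd (o l) y) x))).
      + apply bsum_ext; intros j Hj. rewrite Rmult_1_l.
        rewrite (I_bsum_mult HG n (fun l => y j * y l) (fun l => Derive (fun y => fst (o j) y * snd (o l) y))).
        * apply bsum_ext; intros; ring.
        * intros l Hl. apply pc1_Derive, (pc1_mult HG); auto.
        * easy.
      + intros j Hj. apply pc_bsum. intros l Hl. apply pc_mult; [apply pc_const|].
        apply pc1_Derive, (pc1_mult HG); auto.
      + easy.
    - now apply weak_pc_1.
    - intros x Hx. f_equal.
      rewrite (Derive_ext _ (fun z => bsum n (fun j => 1 * bsum n (fun l => (y j * y l) * (fst (o j) z * snd (o l) z))))).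
      + rewrite (Derive_bsum n (fun _ => 1) (fun j z => bsum n (fun l => (y j * y l) * (fst (o j) z * snd (o l) z)))); auto.
        * apply bsum_ext; intros j Hj. f_equal.
          apply (Derive_bsum n (fun l => y j * y l) (fun l z => fst (o j) z * snd (o l) z)); auto.
          intros; apply (pc1_mult HG); auto.
        * intros j Hj. apply (pc1_bsum n (fun l z => y j * y l * (fst (o j) z * snd (o l) z))).
          intros l Hl. apply (pc1_scal HG), (pc1_mult HG); auto.
      + intros z. simpl. rewrite <- bsum_scal_r. apply bsum_ext; intros j Hj.
        rewrite Rmult_1_l, <- bsum_scal_l. apply bsum_ext; intros; ring. }
  assert (W2 : I (fun x => Derive (fun z => beta z * snd (lin2 n y o) z) x * fst (o i) x) =
    bsum n (fun j => I (fun x => Derive (fun y => beta y * snd (o j) y) x * fst (o i) x) * y j)).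
  { rewrite (I_ext HG _ (fun x => bsum n (fun j => y j * Derive (fun y => beta y * snd (o j) y) x) * fst (o i) x)).
    - rewrite (I_bsum_mult HG n y (fun j => Derive (fun y => beta y * snd (o j) y))); auto.
      + apply bsum_ext; intros; ring.
      + intros j Hj. apply pc1_Derive, (pc1_mult HG); auto.
    - now apply weak_pc_2.
    - intros x Hx. f_equal.
      rewrite (Derive_ext _ (fun z => bsum n (fun j => y j * (beta z * snd (o j) z)))).
      + apply (Derive_bsum n y (fun j z => beta z * snd (o j) z)); auto. intros; apply (pc1_mult HG); auto.
      + intros z. simpl. rewrite <- bsum_scal_l. apply bsum_ext; intros; ring. }
  assert (W3 : I (fun x => Derive (fst (lin2 n y o)) x * snd (o i) x) =
    bsum n (fun j => I (fun x => Derive (fst (o j)) x * snd (o i) x) * y j)).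
  { rewrite (I_ext HG _ (fun x => bsum n (fun j => y j * Derive (fst (o j)) x) * snd (o i) x)).
    - rewrite (I_bsum_mult HG n y (fun j => Derive (fst (o j)))); auto.
      + apply bsum_ext; intros; ring.
      + intros j Hj. apply pc1_Derive; auto.
    - now apply weak_pc_3.
    - intros x Hx. f_equal. apply (Derive_bsum n y (fun j => fst (o j))); auto. }
  assert (W4 : I (fun x => snd (lin2 n y o) x * Derive (snd (lin2 n y o)) x * snd (o i) x) =
    bsum n (fun j => bsum n (fun l => I (fun x => snd (o j) x * Derive (snd (o l)) x * snd (o i) x) * (y j * y l)))).
  { rewrite (I_ext HG _ (fun x => bsum n (fun j => 1 * bsum n (fun l => (y j * y l) *
        (snd (o j) x * Derive (snd (o l)) x))) * snd (o i) x)).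
    - rewrite (I_bsum_mult HG n (fun _ => 1) (fun j x => bsum n (fun l => (y j * y l) *
        (snd (o j) x * Derive (snd (o l)) x)))).
      + apply bsum_ext; intros j Hj. rewrite Rmult_1_l.
        rewrite (I_bsum_mult HG n (fun l => y j * y l) (fun l x => snd (o j) x * Derive (snd (o l)) x)).
        * apply bsum_ext; intros; ring.
        * intros l Hl. apply pc_mult; [apply (pc1_pc HG)|apply pc1_Derive]; auto.
        * easy.
      + intros j Hj. apply pc_bsum. intros l Hl. apply pc_mult; [apply pc_const|].
        apply pc_mult; [apply (pc1_pc HG)|apply pc1_Derive]; auto.
      + easy.
    - now apply weak_pc_4.
    - intros x Hx. f_equal.
      assert (D : Derive (snd (lin2 n y o)) x = bsum n (fun l => y l * Derive (snd (o l)) x))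
        by (apply (Derive_bsum n y (fun j => snd (o j))); auto).
      rewrite D. simpl. rewrite <- bsum_scal_r. apply bsum_ext; intros j Hj.
      rewrite Rmult_1_l, <- bsum_scal_l. apply bsum_ext; intros; ring. }
  rewrite W1, W2, W3, W4.
  rewrite (bsum_ext n _ _ (fun j _ => Rmult_plus_distr_r _ _ (y j))), bsum_plus.
  rewrite (bsum_ext n (fun j => bsum n (fun l => (_ + _) * _)) (fun j =>
     bsum n (fun l => I (fun x => Derive (fun y => fst (o j) y * snd (o l) y) x * fst (o i) x) * (y j * y l)) +
     bsum n (fun l => I (fun x => snd (o j) x * Derive (snd (o l)) x * snd (o i) x) * (y j * y l)))).
  - rewrite bsum_plus. ring.
  - intros j Hj. rewrite <- bsum_plus. apply bsum_ext; intros; ring.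
Qed.

End Weak.

(** * The energy inequality *)

Lemma I_Derive_vanishing N Y f : grid N Y -> pc1 N Y f -> f 0 = 0 -> f 1 = 0 -> I (Derive f) = 0.
Proof.
  intros HG Hf H0 H1. transitivity (f 1 - f 0); [now apply (I_Derive HG)|].
  rewrite H0, H1. exact (Rminus_diag 0).
Qed.

Lemma Rmult_bound a b M : Rabs a <= M -> a * b <= M * Rabs b.
Proof.
  intros H. eapply Rle_trans; [apply Rle_abs|]. rewrite Rabs_mult.
  apply Rmult_le_compat_r; [apply Rabs_pos|easy].
Qed.

Lemma Rmult3_bound a b c M : 0 <= M -> Rabs a <= M -> a * b * c <= M / 2 * (b * b + c * c).
Proof.
  intros HM Ha. rewrite Rmult_assoc. eapply Rle_trans; [apply (Rmult_bound a (b * c) M Ha)|].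
  replace (M / 2 * (b * b + c * c)) with (M * ((b * b + c * c) / 2)) by field.
  apply Rmult_le_compat_l; [easy|]. apply Rabs_le.
  assert (0 <= (b + c) * (b + c)) by apply Rle_0_sqr.
  assert (0 <= (b - c) * (b - c)) by apply Rle_0_sqr. lra.
Qed.

(* With [eps = s + xi] and [err = p + th] the two errors, this is the identity
   [eta u - eta_h u_h = eta eps + u_h err] and its analogue
   [u u_x - u_h u_hx = u_x eps + u_h eps_x], after removing the exact
   derivatives of [w xi th], [u_h th^2 / 2] and [u_h w xi^2 / 2]. *)
Lemma energy_pointwise K b b' e e' u u' p p' s s' th th' xi xi' chi et D h :
  1 <= K -> 0 < h ->
  let w := b + e in let w' := b' + e' in let g := u - s - xi in let g' := u' - s' - xi' in
  let f := e - p - th in let f' := e' - p' - th' in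
  Rabs w <= K -> Rabs w' <= K -> Rabs u' <= K -> Rabs g <= K -> Rabs g' <= K -> Rabs et <= K ->
  chi - w * xi = h * D ->
  (- (e' * u + e * u') - (b' * u + b * u')) * th + (- e' - u * u') * chi +
  ((f' * g + f * g') * th + (b' * g + b * g') * th + f' * chi + g * g' * chi) + / 2 * (et * (xi * xi)) +
  ((w' * xi + w * xi') * th + w * xi * th' + / 2 * (g' * (th * th) + g * (th' * th + th * th')) +
   / 2 * ((g' * w + g * w') * (xi * xi) + g * w * (xi' * xi + xi * xi'))) <=
  4 * (K * K) * (s' * s' + s * s + p * p + p' * p' + th * th + xi * xi + chi * chi +
     (h * th') * (h * th') + (h * xi') * (h * xi') + D * D).
Proof.
  intros HK Hh w w' g g' f f' Hw Hw' Hu' Hg Hg' Het HD.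
  (* After cancellation the derivatives of th and xi occur only as factors of chi - w xi; every
     other term is a product of two error quantities with a bounded coefficient. *)
  assert (Id : (- (e' * u + e * u') - (b' * u + b * u')) * th + (- e' - u * u') * chi +
  ((f' * g + f * g') * th + (b' * g + b * g') * th + f' * chi + g * g' * chi) + / 2 * (et * (xi * xi)) +
  ((w' * xi + w * xi') * th + w * xi * th' + / 2 * (g' * (th * th) + g * (th' * th + th * th')) +
   / 2 * ((g' * w + g * w') * (xi * xi) + g * w * (xi' * xi + xi * xi'))) =
   (- w') * s * th + (- w) * s' * th + (- g') * p * th + (- g) * p' * th + (- g') / 2 * th * th
   + (-1) * th' * (chi - w * xi) + (- g) * xi' * (chi - w * xi) + (-1) * p' * chi
   + (- u') * s * chi + (- u') * xi * chi + (- g) * s' * chi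
   + (g' * w / 2) * xi * xi + (g * w' / 2) * xi * xi + (et / 2) * xi * xi).
  { unfold f, f', w, w', g, g'. field. }
  rewrite Id, HD.
  assert (K0 : 0 <= K) by lra.
  assert (N : forall x, Rabs x <= K -> Rabs (- x) <= K) by (intros; now rewrite Rabs_Ropp).
  assert (HH : forall x, Rabs x <= K -> Rabs (x / 2) <= K).
  { intros x Hx. unfold Rdiv. rewrite Rabs_mult, (Rabs_pos_eq (/ 2)) by lra. assert (0 <= Rabs x) by apply Rabs_pos. lra. }
  assert (KK : K <= K * K) by nra.
  assert (P2 : forall x y, Rabs x <= K -> Rabs y <= K -> Rabs (x * y / 2) <= K * K).
  { intros x y Hx Hy. unfold Rdiv. rewrite !Rabs_mult, (Rabs_pos_eq (/ 2)) by lra.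
    assert (Rabs x * Rabs y <= K * K) by (apply Rmult_le_compat; auto using Rabs_pos).
    assert (0 <= Rabs x * Rabs y) by (apply Rmult_le_pos; apply Rabs_pos). lra. }
  assert (M1 : Rabs (-1) <= 1) by (rewrite Rabs_m1; lra).
  (* The factor h contained in chi - w xi moves to the derivative, where the inverse inequality
     absorbs it. *)
  replace (-1 * th' * (h * D)) with (-1 * (h * th') * D) by ring.
  replace (- g * xi' * (h * D)) with (- g * (h * xi') * D) by ring.
  assert (T1 := Rmult3_bound (- w') s th K K0 (N _ Hw')).
  assert (T2 := Rmult3_bound (- w) s' th K K0 (N _ Hw)).
  assert (T3 := Rmult3_bound (- g') p th K K0 (N _ Hg')).
  assert (T4 := Rmult3_bound (- g) p' th K K0 (N _ Hg)).
  assert (T5 := Rmult3_bound (- g' / 2) th th K K0 (HH _ (N _ Hg'))).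
  assert (T6 := Rmult3_bound (-1) (h * th') D 1 Rle_0_1 M1).
  assert (T7 := Rmult3_bound (- g) (h * xi') D K K0 (N _ Hg)).
  assert (T8 := Rmult3_bound (-1) p' chi 1 Rle_0_1 M1).
  assert (T9 := Rmult3_bound (- u') s chi K K0 (N _ Hu')).
  assert (T10 := Rmult3_bound (- u') xi chi K K0 (N _ Hu')).
  assert (T11 := Rmult3_bound (- g) s' chi K K0 (N _ Hg)).
  assert (K20 : 0 <= K * K) by nra.
  assert (T12 := Rmult3_bound (g' * w / 2) xi xi (K * K) K20 (P2 _ _ Hg' Hw)).
  assert (T13 := Rmult3_bound (g * w' / 2) xi xi (K * K) K20 (P2 _ _ Hg Hw')).
  assert (T14 := Rmult3_bound (et / 2) xi xi K K0 (HH _ Het)).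
  assert (Sq : forall x, 0 <= x * x) by (intros; apply Rle_0_sqr).
  assert (U : forall x, K * (x * x) <= K * K * (x * x)) by (intros; apply Rmult_le_compat_r; auto).
  assert (V : forall x, 1 * (x * x) <= K * K * (x * x)) by (intros; apply Rmult_le_compat_r; auto; lra).
  assert (W : forall x, 0 <= K * K * (x * x)) by (intros; apply Rmult_le_pos; auto).
  generalize (U s) (U s') (U p) (U p') (U th) (U xi) (U chi) (U (h * xi')) (U D)
    (V (h * th')) (V D) (V p') (V chi)
    (W s) (W s') (W p) (W p') (W th) (W xi) (W chi) (W (h * xi')) (W (h * th')) (W D). lra.
Qed.

(** [fh], [gh] stand for the discrete state, [th], [xi] for its distance from the projections, and
    [chi] for the projection of w xi. The integral with [et] is the contribution of the time
    derivative of the weight w. Only terms that remain small after the inverse inequality and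
    super-approximation appear on the right. *)
Lemma energy_inequality N Y h K beta eta u et ut th xi fh gh chi : grid N Y -> 0 < h -> 1 <= K ->
  pc1 N Y beta -> pc1 N Y eta -> pc1 N Y u -> pc1 N Y th -> pc1 N Y xi -> pc1 N Y fh ->
  pc1 N Y gh -> pc N Y chi -> pc N Y et -> pc N Y ut ->
  gh 0 = 0 -> gh 1 = 0 -> xi 0 = 0 -> xi 1 = 0 ->
  (forall x, inner_pt N Y x -> et x = - Derive (fun y => eta y * u y) x - Derive (fun y => beta y * u y) x) ->
  (forall x, inner_pt N Y x -> ut x = - Derive eta x - u x * Derive u x) ->
  (forall x, inner_pt N Y x -> Rabs (beta x + eta x) <= K /\ Rabs (Derive beta x + Derive eta x) <= K /\
     Rabs (Derive u x) <= K /\ Rabs (gh x) <= K /\ Rabs (Derive gh x) <= K /\ Rabs (et x) <= K) ->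
  let sq f := I (fun x => f x * f x) in
  ip (et, ut) (th, chi) + weak beta (fh, gh) (th, chi) + / 2 * I (fun x => et x * (xi x * xi x)) <=
  4 * (K * K) * (sq (fun x => Derive u x - (Derive gh x + Derive xi x)) + sq (fun x => u x - (gh x + xi x)) +
    sq (fun x => eta x - (fh x + th x)) + sq (fun x => Derive eta x - (Derive fh x + Derive th x)) +
    sq th + sq xi + sq chi + h * h * sq (Derive th) + h * h * sq (Derive xi) +
    / (h * h) * sq (fun x => chi x - (beta x + eta x) * xi x)).
Proof.
  intros HG Hh HK Pb Pe Pu Pth Pxi Pf Pg Pchi Pet Put G0 G1 X0 X1 Het Hut Hbd sq.
  set (w := fun x => beta x + eta x).
  assert (Pw : pc1 N Y w) by (apply (pc1_plus); auto).
  (* The three exact derivatives in one function. It vanishes at both ends because [xi] and [gh] do,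
     so [Derive E] may be added under the integral. *)
  set (E := fun x => w x * xi x * th x + (/ 2 * (gh x * (th x * th x)) + / 2 * (gh x * w x * (xi x * xi x)))).
  assert (PE : pc1 N Y E).
  { apply (pc1_plus (fun x => w x * xi x * th x)).
    - apply (pc1_mult HG (fun x => w x * xi x)); [now apply (pc1_mult HG w)|easy].
    - apply (pc1_plus (fun x => / 2 * (gh x * (th x * th x)))); apply (pc1_scal HG).
      + apply (pc1_mult HG gh); [easy|now apply (pc1_mult HG th)].
      + apply (pc1_mult HG (fun x => gh x * w x)); [now apply (pc1_mult HG gh)|now apply (pc1_mult HG xi)]. }
  assert (IE : I (Derive E) = 0).
  { apply (I_Derive_vanishing N Y); auto; unfold E; rewrite ?G0, ?G1, ?X0, ?X1; ring. }
  assert (C := fun f (Hf : pc1 N Y f) => pc1_pc HG f Hf).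
  assert (D := fun f (Hf : pc1 N Y f) => pc1_Derive f Hf).
  assert (Q : forall f, pc N Y f -> pc N Y (fun x => f x * f x)) by (intros; now apply pc_mult).
  set (Zf := fun x => et x * th x + ut x * chi x + (Derive (fun y => fh y * gh y) x * th x +
     Derive (fun y => beta y * gh y) x * th x + Derive fh x * chi x + gh x * Derive gh x * chi x) +
     / 2 * (et x * (xi x * xi x)) + Derive E x).
  assert (Pfg : pc1 N Y (fun y => fh y * gh y)) by now apply (pc1_mult HG).
  assert (Pbg : pc1 N Y (fun y => beta y * gh y)) by now apply (pc1_mult HG).
  assert (A1 : pc N Y (fun x => et x * th x)) by auto using pc_mult.
  assert (A2 : pc N Y (fun x => ut x * chi x)) by auto using pc_mult.
  assert (A3 : pc N Y (fun x => Derive (fun y => fh y * gh y) x * th x)) by auto using pc_mult.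
  assert (A4 : pc N Y (fun x => Derive (fun y => beta y * gh y) x * th x)) by auto using pc_mult.
  assert (A5 : pc N Y (fun x => Derive fh x * chi x)) by auto using pc_mult.
  assert (A6 : pc N Y (fun x => gh x * Derive gh x * chi x)) by auto using pc_mult.
  assert (A7 : pc N Y (fun x => et x * (xi x * xi x))) by auto using pc_mult.
  assert (A8 := D E PE).
  assert (A7' : pc N Y (fun x => / 2 * (et x * (xi x * xi x)))) by auto using pc_mult, pc_const.
  assert (EZ : I Zf = ip (et, ut) (th, chi) + weak beta (fh, gh) (th, chi) + / 2 * I (fun x => et x * (xi x * xi x))).
  { unfold Zf.
    rewrite (I_plus HG (fun x => et x * th x + ut x * chi x + (Derive (fun y => fh y * gh y) x * th x +
     Derive (fun y => beta y * gh y) x * th x + Derive fh x * chi x + gh x * Derive gh x * chi x) +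
     / 2 * (et x * (xi x * xi x))) (Derive E)) by auto 10 using pc_plus.
    rewrite IE.
    rewrite (I_plus HG (fun x => et x * th x + ut x * chi x + (Derive (fun y => fh y * gh y) x * th x +
     Derive (fun y => beta y * gh y) x * th x + Derive fh x * chi x + gh x * Derive gh x * chi x))
     (fun x => / 2 * (et x * (xi x * xi x)))) by auto 10 using pc_plus.
    rewrite (I_scal HG) by auto.
    rewrite (I_plus HG (fun x => et x * th x + ut x * chi x) (fun x => (Derive (fun y => fh y * gh y) x * th x +
     Derive (fun y => beta y * gh y) x * th x + Derive fh x * chi x + gh x * Derive gh x * chi x))) by auto 10 using pc_plus.
    rewrite (I_plus HG (fun x => et x * th x) (fun x => ut x * chi x)) by auto.
    rewrite (I_plus HG (fun x => Derive (fun y => fh y * gh y) x * th x +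
     Derive (fun y => beta y * gh y) x * th x + Derive fh x * chi x) (fun x => gh x * Derive gh x * chi x)) by auto 10 using pc_plus.
    rewrite (I_plus HG (fun x => Derive (fun y => fh y * gh y) x * th x +
     Derive (fun y => beta y * gh y) x * th x) (fun x => Derive fh x * chi x)) by auto 10 using pc_plus.
    rewrite (I_plus HG (fun x => Derive (fun y => fh y * gh y) x * th x)
      (fun x => Derive (fun y => beta y * gh y) x * th x)) by auto.
    unfold ip, weak; simpl. apply Rplus_0_r. }
  rewrite <- EZ.
  set (s := fun x => u x - (gh x + xi x)). set (s' := fun x => Derive u x - (Derive gh x + Derive xi x)).
  set (p := fun x => eta x - (fh x + th x)). set (p' := fun x => Derive eta x - (Derive fh x + Derive th x)).
  set (dd := fun x => chi x - (beta x + eta x) * xi x).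
  assert (B1 : pc N Y s') by (apply pc_minus; auto using pc_plus).
  assert (B2 : pc N Y s) by (apply pc_minus; auto using pc_plus).
  assert (B3 : pc N Y p) by (apply pc_minus; auto using pc_plus).
  assert (B4 : pc N Y p') by (apply pc_minus; auto using pc_plus).
  assert (B5 : pc N Y dd) by (apply pc_minus; auto using pc_plus, pc_mult).
  set (R1 := fun x => s' x * s' x + s x * s x + p x * p x + p' x * p' x + th x * th x + xi x * xi x + chi x * chi x).
  set (R2 := fun x => h * h * (Derive th x * Derive th x) + h * h * (Derive xi x * Derive xi x) + / (h * h) * (dd x * dd x)).
  assert (PR1 : pc N Y R1) by (unfold R1; auto 12 using pc_plus).
  assert (PR2 : pc N Y R2) by (unfold R2; repeat apply pc_plus; apply pc_mult; auto using pc_const).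
  apply Rle_trans with (I (fun x => 4 * (K * K) * (R1 x + R2 x))).
  - apply (I_le HG).
    + unfold Zf. auto 12 using pc_plus.
    + apply pc_mult; auto using pc_const, pc_plus.
    + intros x Hx. destruct (Hbd x Hx) as [H1 [H2 [H3 [H4 [H5 H6]]]]].
      assert (Du := pc1_is_derive u x Pu Hx). assert (De := pc1_is_derive eta x Pe Hx).
      assert (Db := pc1_is_derive beta x Pb Hx). assert (Dt := pc1_is_derive th x Pth Hx).
      assert (Dx := pc1_is_derive xi x Pxi Hx). assert (Df := pc1_is_derive fh x Pf Hx).
      assert (Dg := pc1_is_derive gh x Pg Hx).
      assert (Dw : is_derive w x (Derive beta x + Derive eta x)) by (now apply (is_derive_plus beta eta)).
      assert (Rm := is_derive_Rmult).
      assert (DE : Derive E x =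
        (((Derive beta x + Derive eta x) * xi x + w x * Derive xi x) * th x + w x * xi x * Derive th x) +
        (/ 2 * (Derive gh x * (th x * th x) + gh x * (Derive th x * th x + th x * Derive th x)) +
         / 2 * ((Derive gh x * w x + gh x * (Derive beta x + Derive eta x)) * (xi x * xi x) +
           gh x * w x * (Derive xi x * xi x + xi x * Derive xi x)))).
      { apply is_derive_unique. unfold E.
        apply (is_derive_plus (fun x => w x * xi x * th x)).
        - apply (Rm (fun x => w x * xi x) th); [apply (Rm w xi)|]; auto.
        - apply (is_derive_plus (fun x => / 2 * (gh x * (th x * th x)))).
          + apply (is_derive_scal (fun x => gh x * (th x * th x))).
            apply (Rm gh (fun x => th x * th x)); [easy|]. now apply (Rm th th).
          + apply (is_derive_scal (fun x => gh x * w x * (xi x * xi x)) x (/ 2)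
              ((Derive gh x * w x + gh x * (Derive beta x + Derive eta x)) * (xi x * xi x) +
               gh x * w x * (Derive xi x * xi x + xi x * Derive xi x))).
            apply (Rm (fun x => gh x * w x) (fun x => xi x * xi x)); [apply (Rm gh w)|apply (Rm xi xi)]; auto. }
      assert (P := energy_pointwise K (beta x) (Derive beta x) (eta x) (Derive eta x) (u x) (Derive u x)
        (p x) (p' x) (s x) (s' x) (th x) (Derive th x) (xi x) (Derive xi x) (chi x) (et x) (dd x / h) h HK Hh).
      cbv zeta in P.
      replace (u x - s x - xi x) with (gh x) in P by (unfold s; ring).
      replace (Derive u x - s' x - Derive xi x) with (Derive gh x) in P by (unfold s'; ring).
      replace (eta x - p x - th x) with (fh x) in P by (unfold p; ring).
      replace (Derive eta x - p' x - Derive th x) with (Derive fh x) in P by (unfold p'; ring).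
      assert (P' := P H1 H2 H3 H4 H5 H6 ltac:(unfold dd; field; lra)). clear P.
      unfold Zf. rewrite DE.
      assert (Efg : Derive (fun y => fh y * gh y) x = Derive fh x * gh x + fh x * Derive gh x)
        by (apply is_derive_unique, Rm; auto).
      assert (Ebg : Derive (fun y => beta y * gh y) x = Derive beta x * gh x + beta x * Derive gh x)
        by (apply is_derive_unique, Rm; auto).
      assert (Eeu : Derive (fun y => eta y * u y) x = Derive eta x * u x + eta x * Derive u x)
        by (apply is_derive_unique, Rm; auto).
      assert (Ebu : Derive (fun y => beta y * u y) x = Derive beta x * u x + beta x * Derive u x)
        by (apply is_derive_unique, Rm; auto).
      assert (Het' := Het x Hx). rewrite Eeu, Ebu in Het'. assert (Hut' := Hut x Hx).
      rewrite Efg, Ebg.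
      assert (ER : s' x * s' x + s x * s x + p x * p x + p' x * p' x + th x * th x + xi x * xi x + chi x * chi x +
         h * Derive th x * (h * Derive th x) + h * Derive xi x * (h * Derive xi x) + dd x / h * (dd x / h) = R1 x + R2 x).
      { unfold R1, R2. field. lra. }
      rewrite ER in P'. eapply Rle_trans; [|exact P'].
      rewrite Hut'. fold (w x).
      replace (et x * th x) with ((- (Derive eta x * u x + eta x * Derive u x) -
        (Derive beta x * u x + beta x * Derive u x)) * th x) by (rewrite Het'; ring).
      right. unfold w. ring.
  - rewrite (I_scal HG (4 * (K * K)) (fun x => R1 x + R2 x)) by (now apply pc_plus).
    apply Rmult_le_compat_l; [nra|]. rewrite (I_plus HG R1 R2) by auto.
    assert (E1 : I R1 = sq s' + sq s + sq p + sq p' + sq th + sq xi + sq chi).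
    { unfold R1, sq.
      rewrite (I_plus HG (fun x => s' x * s' x + s x * s x + p x * p x + p' x * p' x + th x * th x + xi x * xi x)
        (fun x => chi x * chi x)) by auto 12 using pc_plus.
      rewrite (I_plus HG (fun x => s' x * s' x + s x * s x + p x * p x + p' x * p' x + th x * th x)
        (fun x => xi x * xi x)) by auto 12 using pc_plus.
      rewrite (I_plus HG (fun x => s' x * s' x + s x * s x + p x * p x + p' x * p' x)
        (fun x => th x * th x)) by auto 12 using pc_plus.
      rewrite (I_plus HG (fun x => s' x * s' x + s x * s x + p x * p x) (fun x => p' x * p' x)) by auto 12 using pc_plus.
      rewrite (I_plus HG (fun x => s' x * s' x + s x * s x) (fun x => p x * p x)) by auto 12 using pc_plus.
      rewrite (I_plus HG (fun x => s' x * s' x) (fun x => s x * s x)) by auto. easy. }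
    assert (S1 : forall a f, pc N Y f -> pc N Y (fun x => a * (f x * f x)))
      by (intros; apply pc_mult; auto using pc_const).
    assert (E2 : I R2 = h * h * sq (Derive th) + h * h * sq (Derive xi) + / (h * h) * sq dd).
    { unfold R2, sq.
      rewrite (I_plus HG (fun x => h * h * (Derive th x * Derive th x) + h * h * (Derive xi x * Derive xi x))
        (fun x => / (h * h) * (dd x * dd x))) by auto 12 using pc_plus.
      rewrite (I_plus HG (fun x => h * h * (Derive th x * Derive th x))
        (fun x => h * h * (Derive xi x * Derive xi x))) by auto.
      rewrite !(I_scal HG) by auto. easy. }
    rewrite E1, E2. unfold sq, w. right. ring.
Qed.

(** * The discrete problem as an ordinary differential equation for the coordinates *)

Definition at_time (y : nat -> R -> R) (t : R) (i : nat) : R := y i t.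

Section Coordinates.
Context {r k N : nat} {X : nat -> R} (Hr : (1 <= r)%nat) (HG : grid N (fun j => X (S j))).
Context {n : nat} {o : nat -> pair2}.
Context (Ho : forall i, (i < n)%nat -> spl2 r k N (fun j => X (S j)) (o i)) (Hon : orthonormal n o)
  (Hspan : forall e, spl2 r k N (fun j => X (S j)) e -> inspan n o e).

Lemma basis_pc12 i : (i < n)%nat -> pc12 N (fun j => X (S j)) (o i).
Proof. intros Hi. destruct (Ho i Hi) as [H1 [H2 _]]. split; eapply spl_pc1; eassumption. Qed.

Lemma basis_pc2 i : (i < n)%nat -> pc2 N (fun j => X (S j)) (o i).
Proof. intros Hi. apply (pc12_pc2 HG). now apply basis_pc12. Qed.

Lemma spl2_lin2 c : spl2 r k N (fun j => X (S j)) (lin2 n c o).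
Proof.
  split; [|split; [|split]].
  - apply spl_bsum. intros; now apply Ho.
  - apply spl_bsum. intros; now apply Ho.
  - apply bsum_0. intros i Hi. destruct (Ho i Hi) as [_ [_ [-> _]]]; ring.
  - apply bsum_0. intros i Hi. destruct (Ho i Hi) as [_ [_ [_ ->]]]; ring.
Qed.

Lemma spl2_Sh e : spl2 r k N (fun j => X (S j)) e <-> Sh r k N X (fst e) /\ Sh0 r k N X (snd e).
Proof.
  unfold Sh0, spl2. rewrite !(Sh_spl r k N X) by easy. tauto.
Qed.

Lemma eq2_sym e f : eq2 e f -> eq2 f e.
Proof. intros H x Hx. destruct (H x Hx); auto. Qed.

(** The coordinates are taken with the point-value functionals of [ev_dual], which makes them
    differentiable in time; testing with the basis element [o i] then isolates the i-th derivative.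
    This direction is used for uniqueness. *)
Lemma coords_of_solution T beta eta0 u0 etah uh : 0 < T ->
  pc1 N (fun j => X (S j)) beta -> ccont2 (eta0, u0) ->
  is_semidiscrete_solution T beta eta0 u0 r k N X etah uh ->
  exists y : nat -> R -> R,
    (forall t, Icc 0 T t -> eq2 (etah t, uh t) (lin2 n (at_time y t) o)) /\
    (forall i, (i < n)%nat -> ccont 0 T (y i)) /\
    (forall i t, (i < n)%nat -> 0 < t < T ->
       is_derive (y i) t (- weak beta (lin2 n (at_time y t) o) (o i))) /\
    (forall i, (i < n)%nat -> y i 0 = ip (eta0, u0) (o i)).
Proof.
  intros HT Hb H0 [HS [[et [ut [Hd [W1 W2]]]] [I1 I2]]].
  assert (Hoc : forall i, (i < n)%nat -> ccont2 (o i)) by (intros i Hi; eapply spl2_ccont2, Ho, Hi).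
  destruct (ev_dual n o Hoc Hon) as [l [L1 L2]].
  set (y := fun i t => l i (etah t, uh t)).
  assert (Sp : forall t, Icc 0 T t -> spl2 r k N (fun j => X (S j)) (etah t, uh t)).
  { intros t Ht. apply spl2_Sh, HS, Ht. }
  assert (Ey : forall t, Icc 0 T t -> eq2 (etah t, uh t) (lin2 n (at_time y t) o)).
  { intros t Ht. destruct (Hspan _ (Sp t Ht)) as [c Hc].
    assert (E : forall i, (i < n)%nat -> c i = y i t).
    { intros i Hi. unfold y. rewrite (ev_eq2 (l i) _ _ (L1 i Hi) Hc), (ev_lin2 (l i)) by auto.
      rewrite <- (bsum_kron n c i Hi). apply bsum_ext; intros j Hj. now rewrite L2. }
    intros x Hx. destruct (Hc x Hx) as [-> ->]. simpl. split; apply bsum_ext; intros i Hi; now rewrite E. }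
  assert (Dy : forall i t, (i < n)%nat -> Icc 0 T t -> is_derive_on (Icc 0 T) (y i) t (l i (et t, ut t))).
  { intros i t Hi Ht. apply (ev_is_derive_on (Icc 0 T) (l i) (fun s => (etah s, uh s))); [now apply L1|easy|].
    intros x Hx. now apply Hd. }
  (* The time derivative is given pointwise in x only; differentiating the finite expansion and
     uniqueness of derivatives place it in the span of the basis. *)
  assert (Ed : forall t, Icc 0 T t -> eq2 (et t, ut t) (lin2 n (fun i => l i (et t, ut t)) o)).
  { intros t Ht.
    assert (Der : forall g : nat -> R, is_derive_on (Icc 0 T) (fun s => bsum n (fun i => y i s * g i)) t
       (bsum n (fun i => l i (et t, ut t) * g i))).
    { intros g. clear -Dy Ht.
      assert (W : forall m, (m <= n)%nat -> is_derive_on (Icc 0 T) (fun s => bsum m (fun i => y i s * g i)) t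
       (bsum m (fun i => l i (et t, ut t) * g i))); [|auto].
      induction m as [|m IH]; intros Hm.
      - apply is_derive_on_of_is_derive; [easy|]. apply (is_derive_const 0 t).
      - simpl. rewrite <- (Rmult_1_l (bsum m _)), (Rmult_comm _ (g m)).
        apply (is_derive_on_ext _ (fun s => 1 * bsum m (fun i => y i s * g i) + g m * y m s)); [intros; ring|easy|].
        apply is_derive_on_lin; [easy|apply IH; lia|apply Dy; [lia|easy]]. }
    intros x Hx. destruct (Hd t x Ht Hx) as [D1 D2]. simpl. split.
    - apply (is_derive_on_unique 0 T (fun s => etah s x) t); auto.
      apply (is_derive_on_ext _ (fun s => bsum n (fun i => y i s * fst (o i) x))); [|easy|apply Der].
      intros s Hs. now destruct (Ey s Hs x Hx) as [E _].
    - apply (is_derive_on_unique 0 T (fun s => uh s x) t); auto.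
      apply (is_derive_on_ext _ (fun s => bsum n (fun i => y i s * snd (o i) x))); [|easy|apply Der].
      intros s Hs. now destruct (Ey s Hs x Hx) as [_ E]. }
  exists y. split; [easy|split; [|split]].
  - intros i Hi. apply (is_derive_on_ccont 0 T (y i) (fun t => l i (et t, ut t))); [lra|auto].
  - intros i t Hi Ht. assert (Ht' : Icc 0 T t) by (unfold Icc; lra).
    apply (is_derive_of_is_derive_on 0 T); [easy|].
    assert (E : l i (et t, ut t) = - weak beta (lin2 n (at_time y t) o) (o i)); [|rewrite <- E; now apply Dy].
    assert (Pl : pc2 N (fun j => X (S j)) (lin2 n (fun i => l i (et t, ut t)) o)) by (apply lin2_pc2; intros; now apply basis_pc2).
    assert (E1 : ip (et t, ut t) (o i) = l i (et t, ut t)).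
    { rewrite <- (ip_eq2 HG _ _ _ Pl (basis_pc2 i Hi) (eq2_sym _ _ (Ed t Ht'))).
      apply (ip_lin2_orthonormal HG); auto. intros; now apply basis_pc2. }
    assert (Pe : pc12 N (fun j => X (S j)) (etah t, uh t)).
    { destruct (Sp t Ht') as [S1 [S2 _]]. split; eapply spl_pc1; eassumption. }
    rewrite <- (weak_eq2 HG beta _ _ (o i) (o i) Hb Pe (basis_pc2 i Hi) (Ey t Ht') (fun x _ => conj eq_refl eq_refl)).
    rewrite <- E1. destruct (proj1 (spl2_Sh (o i)) (Ho i Hi)) as [T1 T2].
    assert (Q1 := W1 t Ht' _ T1). assert (Q2 := W2 t Ht' _ T2).
    unfold inner in Q1, Q2. unfold ip, weak; simpl. lra.
  - intros i Hi.
    assert (H00 : Icc 0 T 0) by (unfold Icc; lra).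
    assert (E1 : ip (etah 0, uh 0) (o i) = y i 0).
    { assert (Pe : pc2 N (fun j => X (S j)) (etah 0, uh 0)).
      { apply (pc12_pc2 HG). destruct (Sp 0 H00) as [S1 [S2 _]]. split; eapply spl_pc1; eassumption. }
      rewrite (ip_eq2 HG _ _ _ Pe (basis_pc2 i Hi) (Ey 0 H00)).
      rewrite (ip_lin2_orthonormal HG); auto. intros; now apply basis_pc2. }
    rewrite <- E1. destruct (proj1 (spl2_Sh (o i)) (Ho i Hi)) as [T1 T2].
    destruct I1 as [_ I1], I2 as [_ I2]. assert (Q1 := I1 _ T1). assert (Q2 := I2 _ T2).
    unfold inner in Q1, Q2. unfold ip; simpl. lra.
Qed.

(** By linearity in the test pair the coordinate equations give the identity for all spline pairs;
    test pairs with one zero component separate the two equations and the two initial projections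
    again. *)
Lemma solution_of_coords T beta eta0 u0 y : 0 < T ->
  pc1 N (fun j => X (S j)) beta -> ccont2 (eta0, u0) ->
  (forall i t, (i < n)%nat -> Icc 0 T t ->
     is_derive (y i) t (- weak beta (lin2 n (at_time y t) o) (o i))) ->
  (forall i, (i < n)%nat -> y i 0 = ip (eta0, u0) (o i)) ->
  is_semidiscrete_solution T beta eta0 u0 r k N X
    (fun t => fst (lin2 n (at_time y t) o)) (fun t => snd (lin2 n (at_time y t) o)).
Proof.
  intros HT Hb H0 Hy Hy0.
  assert (Hp2 : forall i, (i < n)%nat -> pc2 N (fun j => X (S j)) (o i)) by (intros; now apply basis_pc2).
  assert (Z : Sh r k N X (fun _ => 0)) by (apply Sh_spl; [easy|apply spl_0]).
  assert (Z0 : Sh0 r k N X (fun _ => 0)) by (split; [easy|split; easy]).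
  assert (Test : forall v, spl2 r k N (fun j => X (S j)) v -> exists c, eq2 v (lin2 n c o) /\ pc2 N (fun j => X (S j)) v).
  { intros v Hv. destruct (Hspan v Hv) as [c Hc]. exists c. split; [easy|].
    destruct Hv as [S1 [S2 _]]. split; (apply (pc_ccont HG); eapply spl_ccont; eassumption). }
  assert (In0 : forall f, inner f (fun _ => 0) = 0).
  { intros f. unfold inner. rewrite (RInt_ext _ (fun _ => 0)) by (intros; apply Rmult_0_r).
    rewrite RInt_const. apply Rmult_0_r. }
  split; [|split; [|]].
  - intros t Ht. destruct (spl2_lin2 (at_time y t)) as [S1 [S2 [S3 S4]]].
    split; [now apply Sh_spl|]. split; [now apply Sh_spl|easy].
  - set (dy := fun t i => - weak beta (lin2 n (at_time y t) o) (o i)).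
    exists (fun t => fst (lin2 n (dy t) o)), (fun t => snd (lin2 n (dy t) o)).
    assert (Key : forall t v, Icc 0 T t -> spl2 r k N (fun j => X (S j)) v ->
      ip (lin2 n (dy t) o) v + weak beta (lin2 n (at_time y t) o) v = 0).
    { intros t v Ht Hv. destruct (Test v Hv) as [c [Hc Pv]].
      assert (Pl : pc12 N (fun j => X (S j)) (lin2 n (at_time y t) o))
        by (apply (lin2_pc12 HG); intros; now apply basis_pc12).
      rewrite (weak_eq2 HG beta _ _ v (lin2 n c o) Hb Pl Pv (fun x _ => conj eq_refl eq_refl) Hc).
      rewrite (weak_lin2_r HG) by auto.
      rewrite ip_sym, (ip_eq2 HG v (lin2 n c o)) by (auto; apply lin2_pc2; auto).
      rewrite (ip_lin2_lin2 HG) by auto. rewrite <- bsum_plus. apply bsum_0.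
      intros i Hi. unfold dy. ring. }
    split; [|split].
    + intros t x Ht Hx. split; apply is_derive_on_of_is_derive; try easy.
      * apply (bsum_is_derive n (fun i s => y i s * fst (o i) x) (fun i => dy t i * fst (o i) x)).
        intros i Hi. evar_last.
        -- apply (is_derive_Rmult (y i) (fun _ => fst (o i) x)); [now apply Hy|apply (is_derive_const (fst (o i) x) t)].
        -- unfold zero; simpl. unfold dy. ring.
      * apply (bsum_is_derive n (fun i s => y i s * snd (o i) x) (fun i => dy t i * snd (o i) x)).
        intros i Hi. evar_last.
        -- apply (is_derive_Rmult (y i) (fun _ => snd (o i) x)); [now apply Hy|apply (is_derive_const (snd (o i) x) t)].
        -- unfold zero; simpl. unfold dy. ring.
    + intros t Ht phi Hphi.
      assert (Hv : spl2 r k N (fun j => X (S j)) (phi, fun _ => 0)) by (apply spl2_Sh; auto).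
      assert (K := Key t _ Ht Hv). unfold ip, weak in K. cbn [fst snd] in K.
      assert (J1 := In0 (snd (lin2 n (dy t) o))). assert (J2 := In0 (Derive (fst (lin2 n (at_time y t) o)))).
      assert (J3 := In0 (fun x => snd (lin2 n (at_time y t) o) x * Derive (snd (lin2 n (at_time y t) o)) x)).
      unfold inner in *. cbv beta in *. lra.
    + intros t Ht chi Hchi.
      assert (Hv : spl2 r k N (fun j => X (S j)) (fun _ => 0, chi)) by (apply spl2_Sh; auto).
      assert (K := Key t _ Ht Hv). unfold ip, weak in K. cbn [fst snd] in K.
      assert (J1 := In0 (fst (lin2 n (dy t) o))).
      assert (J2 := In0 (Derive (fun y0 => fst (lin2 n (at_time y t) o) y0 * snd (lin2 n (at_time y t) o) y0))).
      assert (J3 := In0 (Derive (fun y0 => beta y0 * snd (lin2 n (at_time y t) o) y0))).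
      unfold inner in *. cbv beta in *. lra.
  - assert (P0 : pc2 N (fun j => X (S j)) (eta0, u0)) by now apply (ccont2_pc2 HG).
    assert (Key : forall v, spl2 r k N (fun j => X (S j)) v -> ip (lin2 n (at_time y 0) o) v = ip (eta0, u0) v).
    { intros v Hv. destruct (Test v Hv) as [c [Hc Pv]].
      rewrite (ip_sym _ v), (ip_sym _ v).
      rewrite (ip_eq2 HG v (lin2 n c o) (eta0, u0) Pv P0 Hc).
      rewrite (ip_eq2 HG v (lin2 n c o) _ Pv (lin2_pc2 n _ o Hp2) Hc).
      rewrite (ip_lin2_lin2 HG), (ip_lin2_l HG) by auto. apply bsum_ext; intros i Hi.
      unfold at_time. now rewrite Hy0, (ip_sym (o i)). }
    destruct (spl2_lin2 (at_time y 0)) as [S1 [S2 [S3 S4]]].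
    split; (split; [|]).
    + now apply Sh_spl.
    + intros phi Hphi.
      assert (Hv : spl2 r k N (fun j => X (S j)) (phi, fun _ => 0)) by (apply spl2_Sh; auto).
      assert (K := Key _ Hv). unfold ip in K. cbn [fst snd] in K.
      assert (J1 := In0 (snd (lin2 n (at_time y 0) o))). assert (J2 := In0 u0).
      unfold inner in *. lra.
    + split; [now apply Sh_spl|easy].
    + intros chi Hchi.
      assert (Hv : spl2 r k N (fun j => X (S j)) (fun _ => 0, chi)) by (apply spl2_Sh; auto).
      assert (K := Key _ Hv). unfold ip in K. cbn [fst snd] in K.
      assert (J1 := In0 (fst (lin2 n (at_time y 0) o))). assert (J2 := In0 eta0).
      unfold inner in *. lra.
Qed.

End Coordinates.

(** * Projection error and growth rate of the energy at a fixed time *)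

Lemma pc1_bound_from_0 N Y f K : grid N Y -> pc1 N Y f -> f 0 = 0 ->
  (forall x, inner_pt N Y x -> Rabs (Derive f x) <= K) ->
  forall x, Icc 0 1 x -> Rabs (f x) <= K * x.
Proof.
  intros HG Hf H0 HK.
  assert (HY0 : Y O = 0) by apply HG.
  assert (W : forall j x, (j < N)%nat -> Icc (Y j) (Y (S j)) x -> Rabs (f (Y j)) <= K * Y j -> Rabs (f x) <= K * x).
  { intros j x Hj Hx B.
    assert (A1 := grid_01 N Y j HG ltac:(lia)). assert (A2 := grid_01 N Y (S j) HG ltac:(lia)).
    assert (L : Rabs (f x - f (Y j)) <= K * Rabs (x - Y j)).
    { apply (mvt_lipschitz (Y j) (Y (S j)) f (Derive f) K); auto.
      - apply (ccont_sub 0 1); try lra; [|apply Hf]. left; apply HG; auto.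
      - intros z Hz. apply pc1_is_derive with (1 := Hf). exists j; auto.
      - intros z Hz. apply HK. exists j; auto.
      - assert (Y j < Y (S j)) by (apply HG; auto). unfold Icc; lra. }
    unfold Icc in Hx. rewrite (Rabs_pos_eq (x - Y j)) in L by lra.
    replace (f x) with ((f x - f (Y j)) + f (Y j)) by ring.
    eapply Rle_trans; [apply Rabs_triang|]. lra. }
  assert (V : forall j, (j <= N)%nat -> Rabs (f (Y j)) <= K * Y j).
  { induction j as [|j IH]; intros Hj.
    - rewrite HY0, H0, Rabs_R0. lra.
    - apply (W j); [lia| |apply IH; lia]. assert (Y j < Y (S j)) by (apply HG; auto). unfold Icc; lra. }
  intros x Hx. destruct (grid_locate N Y x HG Hx) as [j [Hj Hxj]].
  apply (W j); auto. apply V; lia.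
Qed.

Definition basis (r k N : nat) (Y : nat -> R) (n : nat) (o : nat -> pair2) : Prop :=
  (forall i, (i < n)%nat -> spl2 r k N Y (o i)) /\ orthonormal n o /\
  forall e, spl2 r k N Y e -> inspan n o e.

(** Best approximation in L^2 x L^2 against the pair of splines from [approximation]; the zero end
    values of U make the second one admissible. Each component is bounded by the sum, hence the
    factor 2. *)
Lemma projection_error r k c : (2 <= r)%nat -> (k <= r - 2)%nat -> 0 < c -> exists C, 0 < C /\
  forall N Y h, grid N Y -> 0 < h -> quasi c h N Y -> (r <= N)%nat ->
  forall n o, basis r k N Y n o -> forall V U M, smooth_chain r V M -> smooth_chain r U M ->
  U O 0 = 0 -> U O 1 = 0 ->
  let p := lin2 n (fun i => ip (V O, U O) (o i)) o in
  I (fun x => (V O x - fst p x) * (V O x - fst p x)) <= C * (M * h ^ r * (M * h ^ r)) /\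
  I (fun x => (U O x - snd p x) * (U O x - snd p x)) <= C * (M * h ^ r * (M * h ^ r)).
Proof.
  intros Hr Hk Hc. destruct (approximation r k c Hr Hk Hc) as [C [HC H]].
  exists (2 * C). split; [lra|].
  intros N Y h HG Hh Hq HN n o [Ho [Hon Hs]] V U M HV HU U0 U1 p.
  destruct (H N Y h HG Hh Hq HN V M HV) as [[f [F1 [F2 [F3 F4]]]] _].
  destruct (H N Y h HG Hh Hq HN U M HU) as [[g [G1 [G2 [G3 G4]]]] _].
  assert (Hop : forall i, (i < n)%nat -> pc2 N Y (o i)).
  { intros i Hi. apply (ccont2_pc2 HG). eapply spl2_ccont2, Ho, Hi. }
  assert (Pe : pc2 N Y (V O, U O)).
  { apply (ccont2_pc2 HG). split; [apply HV; lia|apply HU; lia]. }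
  assert (Sfg : spl2 r k N Y (f, g)) by (repeat split; simpl; try apply F1; try apply G1; congruence).
  assert (Pfg : pc2 N Y (f, g)) by (apply (ccont2_pc2 HG); eapply spl2_ccont2, Sfg).
  assert (B := lin2_proj_best HG n o _ _ Hop Hon Pe Pfg (Hs _ Sfg)). cbv zeta in B. fold p in B.
  unfold ip at 1 2 in B. cbn [fst snd] in B.
  assert (Pp : pc2 N Y p) by now apply lin2_pc2.
  assert (N1 : 0 <= I (fun x => (V O x - fst p x) * (V O x - fst p x))).
  { apply (I_ge0 HG); [apply pc_mult; apply pc_minus; (apply Pe || apply Pp)|]. intros; apply Rle_0_sqr. }
  assert (N2 : 0 <= I (fun x => (U O x - snd p x) * (U O x - snd p x))).
  { apply (I_ge0 HG); [apply pc_mult; apply pc_minus; (apply Pe || apply Pp)|]. intros; apply Rle_0_sqr. }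
  set (a := I (fun x => (V O x - fst p x) * (V O x - fst p x))) in *.
  set (b := I (fun x => (U O x - snd p x) * (U O x - snd p x))) in *.
  rewrite Rmult_assoc. set (G := C * (M * h ^ r * (M * h ^ r))) in *. split; lra.
Qed.

Lemma Rsqr_le_1_Rabs x y : x * x <= y -> Rabs x <= 1 + y.
Proof.
  intros H. assert (0 <= x * x) by apply Rle_0_sqr.
  apply Rle_sqr_abs; [lra|]. nra.
Qed.

(* [y] holds the coordinates of the discrete solution at a fixed time, and [e]
   is its distance to the projection of the exact one. *)
Lemma error_rate r k c Kd M : (3 <= r)%nat -> (k <= r - 2)%nat -> 0 < c -> 1 <= Kd -> 0 <= M ->
  exists P Q Ci, 0 <= P /\ 0 <= Q /\ 0 < Ci /\
  forall N Y h, grid N Y -> 0 < h <= 1 -> quasi c h N Y -> (r <= N)%nat ->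
  forall n o, basis r k N Y n o -> forall V U, smooth_chain r V M -> smooth_chain r U M ->
  U O 0 = 0 -> U O 1 = 0 ->
  forall beta dbeta et ut, ccont 0 1 beta -> ccont 0 1 dbeta ->
  (forall x, 0 < x < 1 -> is_derive beta x (dbeta x)) -> ccont 0 1 et -> ccont 0 1 ut ->
  (forall x, 0 < x < 1 -> et x = - (V 1%nat x * U O x + V O x * U 1%nat x) -
     (dbeta x * U O x + beta x * U 1%nat x)) ->
  (forall x, 0 < x < 1 -> ut x = - V 1%nat x - U O x * U 1%nat x) ->
  (forall x, Icc 0 1 x -> Rabs (beta x + V O x) <= Kd /\ Rabs (dbeta x + V 1%nat x) <= Kd /\
     Rabs (U 1%nat x) <= Kd /\ Rabs (et x) <= Kd) ->
  forall y,
  let e := lin2 n (fun i => ip (V O, U O) (o i) - y i) o in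
  ip e e <= h * h * h / Ci ->
  ip (fst e, fun x => (beta x + V O x) * snd e x)
     (lin2 n (fun i => ip (et, ut) (o i) + weak beta (lin2 n y o) (o i)) o) +
  / 2 * I (fun x => et x * (snd e x * snd e x)) <=
  P * (h ^ (r - 1) * h ^ (r - 1)) + Q * ip e e.
Proof.
  intros Hr Hk Hc HKd HM.
  destruct (projection_error r k c ltac:(lia) Hk Hc) as [Ca [HCa Hproj]].
  destruct (superapproximation r k c ltac:(lia) Hk Hc) as [Cs [HCs Hsup]].
  destruct (spl_inverse r k c Hc) as [Ci [HCi Hinv]].
  destruct (derivative_error r k c Ca Hr Hk Hc (Rlt_le _ _ HCa)) as [Cd [HCd Hder]].
  set (K := Kd + (1 + Cd * (M * M)) + 1).
  assert (HM2 : 0 <= M * M) by apply Rle_0_sqr.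
  assert (HK : 1 <= K /\ Kd <= K) by (unfold K; assert (0 <= Cd * (M * M)) by nra; lra).
  assert (HKK : 0 <= 4 * (K * K)) by nra.
  set (q := 1 + Ci + (3 * Cs * (Kd * Kd) + 2 * (Kd * Kd))).
  assert (Hq0 : 0 <= q) by (unfold q; assert (0 <= Cs * (Kd * Kd)) by nra; nra).
  exists (4 * (K * K) * (2 * Cd * (M * M) + 2 * Ca * (M * M))), (4 * (K * K) * q), Ci.
  split; [apply Rmult_le_pos; [easy|]; nra|]. split; [now apply Rmult_le_pos|]. split; [easy|].
  intros N Y h HG [Hh Hh1] Hqu HN n o Hbas V U HV HU U0 U1 beta dbeta et ut Cb Cdb Db Cet Cut PDE1 PDE2 Bd y e Hsmall.
  assert (Hbas' := Hbas). destruct Hbas' as [Ho [Hon Hs]].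
  assert (Hop : forall i, (i < n)%nat -> pc2 N Y (o i)).
  { intros i Hi. apply (ccont2_pc2 HG). eapply spl2_ccont2, Ho, Hi. }
  assert (Sl : forall c, spl2 r k N Y (lin2 n c o)).
  { intros d. split; [|split; [|split]].
    - apply spl_bsum. intros; now apply Ho.
    - apply spl_bsum. intros; now apply Ho.
    - apply bsum_0. intros i Hi. destruct (Ho i Hi) as [_ [_ [-> _]]]; ring.
    - apply bsum_0. intros i Hi. destruct (Ho i Hi) as [_ [_ [_ ->]]]; ring. }
  set (a := fun i => ip (V O, U O) (o i)). set (p := lin2 n a o).
  set (fh := fst (lin2 n y o)). set (gh := snd (lin2 n y o)).
  set (th := fst e). set (xi := snd e). set (w := fun x => beta x + V O x).
  assert (Sum : forall x, fh x + th x = fst p x /\ gh x + xi x = snd p x).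
  { intros x. unfold fh, th, gh, xi, e, p, a; simpl. rewrite <- !bsum_plus.
    split; apply bsum_ext; intros; ring. }
  assert (Se := Sl (fun i => ip (V O, U O) (o i) - y i)). fold e in Se.
  assert (Sp := Sl a). fold p in Sp. assert (Sy := Sl y).
  assert (CV0 : ccont 0 1 (V O)) by (apply HV; lia). assert (CV1 : ccont 0 1 (V 1%nat)) by (apply HV; lia).
  assert (CU0 : ccont 0 1 (U O)) by (apply HU; lia). assert (CU1 : ccont 0 1 (U 1%nat)) by (apply HU; lia).
  assert (DV : forall x, 0 < x < 1 -> is_derive (V O) x (V 1%nat x)) by (intros; apply HV; auto; lia).
  assert (DU : forall x, 0 < x < 1 -> is_derive (U O) x (U 1%nat x)) by (intros; apply HU; auto; lia).
  assert (in01 : forall x, inner_pt N Y x -> 0 < x < 1) by (intros; now apply (inner_pt_01 N Y)).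
  assert (Pth : pc1 N Y th) by (eapply spl_pc1, Se). assert (Pxi : pc1 N Y xi) by (eapply spl_pc1, Se).
  assert (Pfh : pc1 N Y fh) by (eapply spl_pc1, Sy). assert (Pgh : pc1 N Y gh) by (eapply spl_pc1, Sy).
  assert (PA : pc1 N Y (fst p)) by (eapply spl_pc1, Sp). assert (PB : pc1 N Y (snd p)) by (eapply spl_pc1, Sp).
  assert (PV : pc1 N Y (V O)) by (now apply (pc1_C1 HG (V O) (V 1%nat))).
  assert (PU : pc1 N Y (U O)) by (now apply (pc1_C1 HG (U O) (U 1%nat))).
  assert (Pb : pc1 N Y beta) by (now apply (pc1_C1 HG beta dbeta)).
  assert (Cw : ccont 0 1 w) by now apply ccont_plus.
  assert (Cxi : ccont 0 1 xi) by apply Pxi.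
  set (z := (th, fun x => w x * xi x) : pair2).
  assert (Cz : ccont2 z) by (split; simpl; [apply Pth|now apply ccont_mult]).
  assert (Pz : pc2 N Y z) by now apply ccont2_pc2.
  set (kap := fun i => ip z (o i)). set (v := lin2 n kap o).
  assert (Sv := Sl kap). fold v in Sv.
  assert (Pv : pc2 N Y v) by now apply lin2_pc2.
  assert (Pet : pc2 N Y (et, ut)) by (split; now apply (pc_ccont HG)).
  assert (Py12 : pc12 N Y (lin2 n y o)) by (split; easy).
  (* [th] already lies in the spline space, so projecting (th, w xi) keeps it *)
  assert (Ev : eq2 v (th, snd v)).
  { set (e1 := (fun x => th x - fst v x, fun _ => 0) : pair2).
    assert (S1 : spl2 r k N Y e1).
    { split; [|split; [apply spl_0|easy]].
      apply (spl_ext (fun x => 1 * th x + -1 * fst v x)); [easy|intros; simpl; ring|].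
      apply spl_lin; [apply Se|apply Sv]. }
    assert (P1 : pc2 N Y e1) by (apply (ccont2_pc2 HG); eapply spl2_ccont2, S1).
    assert (Q1 : ip v e1 = ip z e1) by exact (ip_lin2_proj HG n o z e1 Hop Hon Pz P1 (Hs _ S1)).
    assert (Q2 := ip_minus_l HG z v e1 Pz Pv P1). rewrite Q1, Rminus_diag in Q2.
    assert (Z0 : I (fun x => (w x * xi x - snd v x) * 0) = 0).
    { rewrite (RInt_ext _ (fun _ => 0)) by (intros; apply Rmult_0_r).
      rewrite RInt_const. exact (Rmult_0_r _). }
    assert (Q3 : I (fun x => (th x - fst v x) * (th x - fst v x)) = 0).
    { unfold ip in Q2. cbn [fst snd z e1] in Q2. rewrite Z0, Rplus_0_r in Q2. exact Q2. }
    assert (Cd1 : ccont 0 1 (fun x => th x - fst v x)).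
    { apply ccont_minus; [apply Pth|]. eapply spl_ccont, Sv. }
    intros x Hx. split; [|easy]. cbn [fst].
    assert (Q4 := I_sqr_0 _ Cd1 Q3 x Hx). cbv beta in Q4. lra. }
  set (chi := snd v).
  assert (Pchi : pc N Y chi) by apply Pv.
  assert (ELHS : ip (th, fun x => (beta x + V O x) * xi x)
     (lin2 n (fun i => ip (et, ut) (o i) + weak beta (lin2 n y o) (o i)) o) =
     ip (et, ut) (th, chi) + weak beta (fh, gh) (th, chi)).
  { change (th, fun x => (beta x + V O x) * xi x) with z.
    rewrite ip_sym, (ip_lin2_l HG) by auto.
    rewrite (bsum_ext n _ (fun i => kap i * ip (o i) (et, ut) + kap i * weak beta (lin2 n y o) (o i))).
    - rewrite bsum_plus, <- (ip_lin2_l HG) by auto. fold v.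
      rewrite <- (weak_lin2_r HG) by auto. fold v.
      rewrite (ip_eq2 HG v _ _ Pv Pet Ev), ip_sym. f_equal.
      apply (weak_eq2 HG); auto. intros x Hx; easy.
    - intros i Hi. rewrite (ip_sym (o i) z), (ip_sym (o i)). unfold kap. ring. }
  rewrite ELHS.
  assert (Q : forall f, pc N Y f -> 0 <= I (fun x => f x * f x)).
  { intros f Hf. apply (I_ge0 HG); [now apply pc_mult|]. intros; apply Rle_0_sqr. }
  assert (Hth := Q th (pc1_pc HG th Pth)). assert (Hxi := Q xi (pc1_pc HG xi Pxi)).
  assert (Eee : ip e e = I (fun x => th x * th x) + I (fun x => xi x * xi x)) by easy.
  rewrite Eee in Hsmall |- *.
  set (Zt := I (fun x => th x * th x)) in *. set (Zx := I (fun x => xi x * xi x)) in *.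
  destruct (Hproj N Y h HG Hh Hqu HN n o Hbas V U M HV HU U0 U1) as [E1 E2]. fold a in E1, E2. fold p in E1, E2.
  destruct (Hder N Y h HG (conj Hh Hh1) Hqu HN V M (fst p) HV (proj1 Sp) E1) as [E3 _].
  destruct (Hder N Y h HG (conj Hh Hh1) Hqu HN U M (snd p) HU (proj1 (proj2 Sp)) E2) as [E4 E5].
  destruct (Hinv N Y h HG Hh Hqu th (proj1 Se)) as [E6 _].
  destruct (Hinv N Y h HG Hh Hqu xi (proj1 (proj2 Se))) as [E7 E8].
  fold Zt in E6. fold Zx in E7, E8.
  assert (Hh3 : 0 < h * h * h) by (repeat apply Rmult_lt_0_compat; easy).
  assert (Hhh : 0 < h * h) by nra.
  assert (Hhh1 : h * h <= 1) by (rewrite <- (Rmult_1_l 1); apply Rmult_le_compat; lra).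
  assert (DBsum : forall x, inner_pt N Y x -> Derive gh x + Derive xi x = Derive (snd p) x).
  { intros x Hx. symmetry. apply is_derive_unique.
    apply (is_derive_ext (fun x => gh x + xi x)); [intros t; apply Sum|].
    apply (is_derive_plus gh xi); now apply (pc1_is_derive (N := N) (Y := Y)). }
  assert (DAsum : forall x, inner_pt N Y x -> Derive fh x + Derive th x = Derive (fst p) x).
  { intros x Hx. symmetry. apply is_derive_unique.
    apply (is_derive_ext (fun x => fh x + th x)); [intros t; apply Sum|].
    apply (is_derive_plus fh th); now apply (pc1_is_derive (N := N) (Y := Y)). }
  assert (DU' : forall x, inner_pt N Y x -> Derive (U O) x = U 1%nat x) by (intros; apply is_derive_unique; auto).
  assert (DV' : forall x, inner_pt N Y x -> Derive (V O) x = V 1%nat x) by (intros; apply is_derive_unique; auto).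
  assert (Db' : forall x, inner_pt N Y x -> Derive beta x = dbeta x) by (intros; apply is_derive_unique; auto).
  assert (G0 : gh 0 = 0) by apply Sy. assert (G1 : gh 1 = 0) by apply Sy.
  assert (X0 : xi 0 = 0) by apply Se. assert (X1 : xi 1 = 0) by apply Se.
  (* Here the smallness of the error enters: h^3 / Ci is the size at which the inverse inequality
     gives exactly 1. *)
  assert (Dxi1 : forall x, inner_pt N Y x -> Rabs (Derive xi x) <= 1).
  { intros x Hx. apply Rle_sqr_abs; [lra|]. eapply Rle_trans; [apply (E8 x Hx)|].
    assert (Zx <= h * h * h / Ci) by lra.
    apply Rle_trans with (Ci / (h * h * h) * (h * h * h / Ci)).
    - apply Rmult_le_compat_l; [|easy]. left. now apply Rdiv_lt_0_compat.
    - right. field. lra. }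
  assert (Dgh : forall x, inner_pt N Y x -> Rabs (Derive gh x) <= K).
  { intros x Hx. destruct (Bd x) as [_ [_ [B3 _]]]; [unfold Icc; specialize (in01 x Hx); lra|].
    assert (B5 := Rsqr_le_1_Rabs _ _ (E5 x Hx)).
    assert (B6 := Dxi1 x Hx). specialize (DBsum x Hx).
    replace (Derive gh x) with (U 1%nat x + - (U 1%nat x - Derive (snd p) x) + - Derive xi x) by lra.
    eapply Rle_trans; [apply Rabs_triang|]. rewrite Rabs_Ropp.
    apply Rplus_le_compat; [|easy].
    eapply Rle_trans; [apply Rabs_triang|]. rewrite Rabs_Ropp. lra. }
  assert (Bgh : forall x, inner_pt N Y x -> Rabs (gh x) <= K).
  { intros x Hx. assert (Hx' := in01 x Hx).
    eapply Rle_trans; [apply (pc1_bound_from_0 N Y gh K); auto; unfold Icc; lra|]. nra. }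
  eapply Rle_trans.
  { apply (energy_inequality N Y h K beta (V O) (U O) et ut th xi fh gh chi); auto; try lra; try apply Pet.
    - intros x Hx. rewrite PDE1 by auto.
      assert (D1 : Derive (fun y => V O y * U O y) x = V 1%nat x * U O x + V O x * U 1%nat x)
        by (apply is_derive_unique, is_derive_Rmult; auto).
      assert (D2 : Derive (fun y => beta y * U O y) x = dbeta x * U O x + beta x * U 1%nat x)
        by (apply is_derive_unique, is_derive_Rmult; auto).
      now rewrite D1, D2.
    - intros x Hx. rewrite PDE2, DV', DU' by auto. easy.
    - intros x Hx. destruct (Bd x) as [B1 [B2 [B3 B4]]]; [unfold Icc; specialize (in01 x Hx); lra|].
      rewrite Db', DV', DU' by auto. repeat split; auto; lra. }
  assert (HLip : forall x x', Icc 0 1 x -> Icc 0 1 x' -> Rabs (w x - w x') <= Kd * Rabs (x - x')).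
  { apply (mvt_lipschitz 0 1 w (fun x => dbeta x + V 1%nat x)); auto.
    - intros x Hx. apply (is_derive_plus beta (V O)); auto.
    - intros x Hx. apply Bd. unfold Icc; lra. }
  destruct (Hsup N Y h HG Hh Hqu HN xi w Kd (proj1 (proj2 Se)) Cw ltac:(lra) HLip) as [psi [S1 [S2 [S3 S4]]]].
  fold Zx in S4.
  assert (Ppsi : pc N Y psi) by (apply (pc_ccont HG); eapply spl_ccont, S1).
  assert (Pwxi : pc N Y (fun x => w x * xi x)) by (apply (pc_ccont HG); now apply ccont_mult).
  (* The projection is at least as close as the pair (th, psi), where psi is the super-approximation
     of w xi; it vanishes at both ends because [xi] does, so the pair is admissible. *)
  assert (Hchi : I (fun x => (chi x - (beta x + V O x) * xi x) * (chi x - (beta x + V O x) * xi x)) <=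
     Cs * (Kd * h * (Kd * h)) * Zx).
  { assert (Spsi : spl2 r k N Y (th, psi)) by (split; [apply Se|split; [easy|split; simpl; auto]]).
    assert (Pps : pc2 N Y (th, psi)) by (split; simpl; [now apply (pc1_pc HG)|easy]).
    assert (B := lin2_proj_best HG n o z _ Hop Hon Pz Pps (Hs _ Spsi)). cbv zeta in B.
    change (fun i => ip z (o i)) with kap in B. fold v in B. unfold ip in B. cbn [fst snd z] in B.
    assert (T1 : 0 <= I (fun x => (th x - fst v x) * (th x - fst v x))).
    { apply (Q (fun x => th x - fst v x)). apply pc_minus; [now apply (pc1_pc HG)|apply Pv]. }
    assert (T2 : I (fun x => (th x - th x) * (th x - th x)) = 0).
    { rewrite (RInt_ext _ (fun _ => 0)) by (intros; rewrite Rminus_diag; apply Rmult_0_r).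
      rewrite RInt_const. apply Rmult_0_r. }
    rewrite (I_ext HG _ (fun x => (w x * xi x - snd v x) * (w x * xi x - snd v x))).
    - rewrite (I_ext HG (fun x => (w x * xi x - psi x) * (w x * xi x - psi x))
        (fun x => (psi x - w x * xi x) * (psi x - w x * xi x))) in B.
      + lra.
      + apply pc_mult; now apply pc_minus.
      + intros; ring.
    - apply pc_mult; now apply pc_minus.
    - intros x _. unfold chi, w. ring. }
  assert (Hchi2 : I (fun x => chi x * chi x) <= 2 * (Cs * (Kd * h * (Kd * h)) * Zx) + 2 * (Kd * Kd) * Zx).
  { apply Rle_trans with (I (fun x => 2 * ((chi x - (beta x + V O x) * xi x) * (chi x - (beta x + V O x) * xi x)) +
      2 * (Kd * Kd) * (xi x * xi x))).
    - assert (Px := pc1_pc HG xi Pxi).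
      apply (I_le HG); [now apply pc_mult| |].
      + apply pc_plus; (apply pc_mult; [apply pc_const|]); apply pc_mult; auto; apply pc_minus; auto.
      + intros x Hx. destruct (Bd x) as [B1 _]; [unfold Icc; specialize (in01 x Hx); lra|].
        apply Rabs_le_sqr in B1.
        replace (chi x * chi x) with (((chi x - (beta x + V O x) * xi x) + (beta x + V O x) * xi x) *
          ((chi x - (beta x + V O x) * xi x) + (beta x + V O x) * xi x)) by ring.
        eapply Rle_trans; [apply sqr_plus_le|]. apply Rplus_le_compat_l.
        replace ((beta x + V O x) * xi x * ((beta x + V O x) * xi x)) with
          ((beta x + V O x) * (beta x + V O x) * (xi x * xi x)) by ring.
        rewrite (Rmult_assoc 2 (Kd * Kd)). apply Rmult_le_compat_l; [lra|].
        apply Rmult_le_compat_r; [apply Rle_0_sqr|easy].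
    - assert (Px := pc1_pc HG xi Pxi).
      assert (Pd : pc N Y (fun x => (chi x - (beta x + V O x) * xi x) * (chi x - (beta x + V O x) * xi x)))
        by (apply pc_mult; apply pc_minus; auto).
      assert (Px2 : pc N Y (fun x => xi x * xi x)) by now apply pc_mult.
      rewrite (I_plus HG (fun x => 2 * ((chi x - (beta x + V O x) * xi x) * (chi x - (beta x + V O x) * xi x)))
        (fun x => 2 * (Kd * Kd) * (xi x * xi x))) by (apply pc_mult; auto using pc_const).
      rewrite !(I_scal HG) by auto. fold Zx. lra. }
  assert (R1 : I (fun x => (Derive (U O) x - (Derive gh x + Derive xi x)) * (Derive (U O) x - (Derive gh x + Derive xi x))) <=
    Cd * (M * h ^ (r - 1) * (M * h ^ (r - 1)))).
  { eapply Rle_trans; [right; symmetry|exact E4]. apply (I_ext HG).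
    - apply pc_mult; (apply pc_minus; [exact (pc_ccont HG (U 1%nat) CU1)|exact (pc1_Derive (snd p) PB)]).
    - intros x Hx. now rewrite DU', DBsum. }
  assert (R2 : I (fun x => (Derive (V O) x - (Derive fh x + Derive th x)) * (Derive (V O) x - (Derive fh x + Derive th x))) <=
    Cd * (M * h ^ (r - 1) * (M * h ^ (r - 1)))).
  { eapply Rle_trans; [right; symmetry|exact E3]. apply (I_ext HG).
    - apply pc_mult; (apply pc_minus; [exact (pc_ccont HG (V 1%nat) CV1)|exact (pc1_Derive (fst p) PA)]).
    - intros x Hx. now rewrite DV', DAsum. }
  assert (R3 : I (fun x => (U O x - (gh x + xi x)) * (U O x - (gh x + xi x))) <= Ca * (M * h ^ r * (M * h ^ r))).
  { eapply Rle_trans; [right|exact E2]. apply RInt_ext. intros x _. now destruct (Sum x) as [_ ->]. }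
  assert (R4 : I (fun x => (V O x - (fh x + th x)) * (V O x - (fh x + th x))) <= Ca * (M * h ^ r * (M * h ^ r))).
  { eapply Rle_trans; [right|exact E1]. apply RInt_ext. intros x _. now destruct (Sum x) as [-> _]. }
  set (H1 := h ^ (r - 1)) in *.
  assert (EH : h ^ r = h * H1) by (unfold H1; replace r with (S (r - 1)) at 1 by lia; easy).
  assert (HH1 : 0 < H1) by now apply pow_lt.
  assert (GG : M * h ^ r * (M * h ^ r) <= M * M * (H1 * H1)).
  { rewrite EH. replace (M * (h * H1) * (M * (h * H1))) with (h * h * (M * M * (H1 * H1))) by ring.
    assert (0 <= M * M * (H1 * H1)) by (apply Rmult_le_pos; [easy|apply Rle_0_sqr]).
    rewrite <- (Rmult_1_l (M * M * (H1 * H1))) at 2. now apply Rmult_le_compat_r. }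
  assert (GC := Rmult_le_compat_l Ca _ _ (Rlt_le _ _ HCa) GG).
  replace (Cd * (M * H1 * (M * H1))) with (Cd * (M * M) * (H1 * H1)) in R1, R2 by ring.
  assert (J1 : h * h * I (fun x => Derive th x * Derive th x) <= Ci * Zt).
  { apply (Rmult_le_compat_l (h * h)) in E6; [|lra].
    replace (h * h * (Ci / (h * h) * Zt)) with (Ci * Zt) in E6 by (field; lra). exact E6. }
  assert (J2 : h * h * I (fun x => Derive xi x * Derive xi x) <= Ci * Zx).
  { apply (Rmult_le_compat_l (h * h)) in E7; [|lra].
    replace (h * h * (Ci / (h * h) * Zx)) with (Ci * Zx) in E7 by (field; lra). exact E7. }
  assert (J3 : / (h * h) * I (fun x => (chi x - (beta x + V O x) * xi x) * (chi x - (beta x + V O x) * xi x)) <=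
    Cs * (Kd * Kd) * Zx).
  { apply (Rmult_le_compat_l (/ (h * h))) in Hchi; [|left; now apply Rinv_0_lt_compat].
    replace (/ (h * h) * (Cs * (Kd * h * (Kd * h)) * Zx)) with (Cs * (Kd * Kd) * Zx) in Hchi by (field; lra). exact Hchi. }
  assert (J4 : Cs * (Kd * h * (Kd * h)) * Zx <= Cs * (Kd * Kd) * Zx).
  { apply Rmult_le_compat_r; [easy|]. apply Rmult_le_compat_l; [lra|].
    replace (Kd * h * (Kd * h)) with (h * h * (Kd * Kd)) by ring.
    rewrite <- (Rmult_1_l (Kd * Kd)) at 2. apply Rmult_le_compat_r; [apply Rle_0_sqr|easy]. }
  replace (4 * (K * K) * (2 * Cd * (M * M) + 2 * Ca * (M * M)) * (H1 * H1) + 4 * (K * K) * q * (Zt + Zx)) with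
    (4 * (K * K) * ((2 * Cd * (M * M) + 2 * Ca * (M * M)) * (H1 * H1) + q * (Zt + Zx))) by ring.
  apply Rmult_le_compat_l; [easy|]. fold Zt Zx.
  assert (Hqz : Zt + Zx + Ci * Zt + Ci * Zx + (3 * Cs * (Kd * Kd) + 2 * (Kd * Kd)) * Zx <= q * (Zt + Zx)).
  { unfold q. assert (0 <= (3 * Cs * (Kd * Kd) + 2 * (Kd * Kd)) * Zt).
    { apply Rmult_le_pos; [|easy]. assert (0 <= Cs * (Kd * Kd)) by (apply Rmult_le_pos; [lra|apply Rle_0_sqr]).
      assert (0 <= Kd * Kd) by apply Rle_0_sqr. lra. }
    assert (0 <= Ci * Zt) by (apply Rmult_le_pos; lra). lra. }
  lra.
Qed.

(** * The error estimate *)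

(* The exact solution: [V i], [U i] are the i-th space derivatives of eta and u,
   and [et], [ut] their time derivatives. *)
Record exact_solution (r : nat) (T Kd M w0 : R) (beta dbeta : R -> R)
  (V U : nat -> R -> R -> R) (et ut : R -> R -> R) : Prop := {
  es_V : cont2 T (V O);
  es_U : cont2 T (U O);
  es_et : cont2 T et;
  es_ut : cont2 T ut;
  es_chain_V : forall t, Icc 0 T t -> smooth_chain r (fun i x => V i x t) M;
  es_chain_U : forall t, Icc 0 T t -> smooth_chain r (fun i x => U i x t) M;
  es_bc : forall t, Icc 0 T t -> U O 0 t = 0 /\ U O 1 t = 0;
  es_dV : forall x t, Icc 0 1 x -> 0 < t < T -> is_derive (fun s => V O x s) t (et x t);
  es_dU : forall x t, Icc 0 1 x -> 0 < t < T -> is_derive (fun s => U O x s) t (ut x t);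
  es_beta : ccont 0 1 beta;
  es_dbeta : ccont 0 1 dbeta;
  es_beta' : forall x, 0 < x < 1 -> is_derive beta x (dbeta x);
  es_pde1 : forall x t, 0 < x < 1 -> 0 < t < T ->
    et x t = - (V 1%nat x t * U O x t + V O x t * U 1%nat x t) - (dbeta x * U O x t + beta x * U 1%nat x t);
  es_pde2 : forall x t, 0 < x < 1 -> 0 < t < T -> ut x t = - V 1%nat x t - U O x t * U 1%nat x t;
  es_bound : forall x t, Icc 0 1 x -> Icc 0 T t ->
    Rabs (beta x + V O x t) <= Kd /\ Rabs (dbeta x + V 1%nat x t) <= Kd /\
    Rabs (U 1%nat x t) <= Kd /\ Rabs (et x t) <= Kd;
  es_pos : forall x t, Icc 0 1 x -> Icc 0 T t -> w0 <= beta x + V O x t }.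

(** [h0] and [C] are fixed before the exact solution and the mesh, so they depend on them only
    through the bounds [Kd], [M], [w0]. Existence and the estimate are proved together, because it
    is the estimate that identifies the clamped solution with a solution of the discrete problem. *)
Lemma semidiscrete_error r k c T Kd M w0 : (3 <= r)%nat -> (k <= r - 2)%nat -> 0 < c -> 0 < T ->
  1 <= Kd -> 0 <= M -> 0 < w0 <= 1 -> exists h0 C, 0 < h0 /\ 0 < C /\
  forall beta dbeta V U et ut, exact_solution r T Kd M w0 beta dbeta V U et ut ->
  forall eta0 u0, (forall x, Icc 0 1 x -> V O x 0 = eta0 x /\ U O x 0 = u0 x) ->
  forall N X h, grid N (fun j => X (S j)) -> 0 < h <= h0 -> quasi c h N (fun j => X (S j)) ->
  exists etah uh, is_semidiscrete_solution T beta eta0 u0 r k N X etah uh /\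
    forall t, Icc 0 T t ->
      pc N (fun j => X (S j)) (etah t) /\ pc N (fun j => X (S j)) (uh t) /\
      I (fun x => (V O x t - etah t x) * (V O x t - etah t x)) +
      I (fun x => (U O x t - uh t x) * (U O x t - uh t x)) <= C * (h ^ (r - 1) * h ^ (r - 1)).
Proof.
  intros Hr Hk Hc HT HKd HM [Hw0 Hw01].
  destruct (error_rate r k c Kd M Hr Hk Hc HKd HM) as [P [Q [Ci [HP [HQ [HCi Hrate]]]]]].
  destruct (projection_error r k c ltac:(lia) Hk Hc) as [Cp [HCp Hproj]].
  (* 2 / w0 is the coercivity constant of the energy with respect to the squared error; w0 <= 1 lets
     it serve both components. *)
  set (Lam := Q * (2 / w0)).
  assert (H2w : 0 < 2 / w0) by (apply Rdiv_lt_0_compat; lra).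
  assert (HLam : 0 <= Lam) by (apply Rmult_le_pos; lra).
  (* The Gronwall bound at time T for an energy that starts at 0, converted back to the squared
     error. *)
  set (Cz := 2 / w0 * (P * T * exp (Lam * T))).
  assert (HexpT : 0 < exp (Lam * T)) by apply exp_pos.
  assert (HCz : 0 <= Cz) by (unfold Cz; repeat apply Rmult_le_pos; lra).
  assert (Hr0 : 0 < INR r) by (apply lt_0_INR; lia).
  assert (HCC : 0 <= Cz * Ci) by (apply Rmult_le_pos; lra).
  assert (HM2 : 0 <= M * M) by apply Rle_0_sqr.
  assert (HCM : 0 <= Cp * (M * M)) by (apply Rmult_le_pos; lra).
  (* The first bound on h gives h <= 1 and r <= N, since N h >= 1; the second makes Cz h^4 smaller
     than the threshold h^3 / Ci. In [C], the projection error is doubled for each of the two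
     components, and so is the distance from the projections. *)
  exists (Rmin (/ INR r) (/ (2 * (Cz * Ci + 1)))), (4 * (Cp * (M * M)) + 2 * Cz + 1).
  split. { apply Rmin_pos; apply Rinv_0_lt_compat; lra. }
  split; [lra|].
  intros beta dbeta V U et ut [eV eU eet eut ecV ecU ebc edV edU eb edb eb' ep1 ep2 ebd epos] eta0 u0 Hini N X h HG [Hh Hh0] Hqu.
  set (Y := fun j => X (S j)) in *.
  assert (Hhr : h <= / INR r) by (eapply Rle_trans; [exact Hh0|apply Rmin_l]).
  assert (Hhc : h <= / (2 * (Cz * Ci + 1))) by (eapply Rle_trans; [exact Hh0|apply Rmin_r]).
  assert (Hrh : INR r * h <= 1).
  { apply (Rmult_le_compat_l (INR r)) in Hhr; [|lra]. rewrite Rinv_r in Hhr by lra. exact Hhr. }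
  assert (Hh1 : h <= 1).
  { assert (1 <= INR r) by (apply (le_INR 1); lia). nra. }
  assert (HhC : Cz * Ci * h < 1).
  { apply (Rmult_le_compat_l (2 * (Cz * Ci + 1))) in Hhc; [|lra]. rewrite Rinv_r in Hhc by lra. nra. }
  assert (HN : (r <= N)%nat).
  { apply INR_le. assert (D := grid_dist N Y c h 0 N HG Hqu ltac:(lia)).
    replace (Y N) with 1 in D by (symmetry; apply HG). replace (Y O) with 0 in D by (symmetry; apply HG).
    rewrite Nat.sub_0_r in D. apply Rmult_le_reg_r with h; [easy|]. lra. }
  destruct (spl_basis r k N Y HG ltac:(lia)) as [n [o Hbas]].
  assert (Hbas' := Hbas). destruct Hbas' as [Ho [Hon Hs]].
  assert (Hoc : forall i, (i < n)%nat -> ccont2 (o i)) by (intros i Hi; eapply spl2_ccont2, Ho, Hi).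
  assert (Hop : forall i, (i < n)%nat -> pc2 N Y (o i)) by (intros i Hi; apply (ccont2_pc2 HG); auto).
  assert (Ho12 : forall i, (i < n)%nat -> pc12 N Y (o i)).
  { intros i Hi. destruct (Ho i Hi) as [S1 [S2 _]]. split; eapply spl_pc1; eassumption. }
  assert (Pb : pc1 N Y beta).
  { now apply (pc1_C1 HG beta dbeta). }
  destruct (weak_quadratic HG beta n o Pb Ho12) as [A [B HAB]].
  set (a := fun i t => ip (fun x => V O x t, fun x => U O x t) (o i)).
  set (da := fun i t => ip (fun x => et x t, fun x => ut x t) (o i)).
  assert (Cip : forall f g i, cont2 T f -> cont2 T g -> (i < n)%nat ->
    ccont 0 T (fun t => ip (fun x => f x t, fun x => g x t) (o i))).
  { intros f g i Hf Hg Hi. destruct (Hoc i Hi) as [O1 O2]. unfold ip; simpl.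
    apply ccont_plus.
    - apply (cont2_I T (fun x t => f x t * fst (o i) x)); [lra|].
      apply cont2_mult; [easy|]. now apply (cont2_space T (fst (o i))).
    - apply (cont2_I T (fun x t => g x t * snd (o i) x)); [lra|].
      apply cont2_mult; [easy|]. now apply (cont2_space T (snd (o i))). }
  assert (Ca : forall i, (i < n)%nat -> ccont 0 T (a i)) by (intros; apply Cip; auto).
  assert (Cda : forall i, (i < n)%nat -> ccont 0 T (da i)) by (intros; apply Cip; auto).
  assert (Da : forall i t, (i < n)%nat -> 0 < t < T -> is_derive (a i) t (da i t)).
  { intros i t Hi Ht. destruct (Hoc i Hi) as [O1 O2]. unfold a, da, ip; simpl.
    assert (O1' := cont2_space T _ O1). assert (O2' := cont2_space T _ O2).
    apply (is_derive_plus (fun t => I (fun x => V O x t * fst (o i) x)) (fun t => I (fun x => U O x t * snd (o i) x))).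
    - apply (Leibniz_rule T (fun x t => V O x t * fst (o i) x) (fun x t => et x t * fst (o i) x)); auto.
      + now apply cont2_mult.
      + now apply cont2_mult.
      + intros x s Hx Hs'. evar_last.
        * apply (is_derive_Rmult (fun s => V O x s) (fun _ => fst (o i) x)); [now apply edV|apply (is_derive_const (fst (o i) x) s)].
        * unfold zero; simpl. ring.
    - apply (Leibniz_rule T (fun x t => U O x t * snd (o i) x) (fun x t => ut x t * snd (o i) x)); auto.
      + now apply cont2_mult.
      + now apply cont2_mult.
      + intros x s Hx Hs'. evar_last.
        * apply (is_derive_Rmult (fun s => U O x s) (fun _ => snd (o i) x)); [now apply edU|apply (is_derive_const (snd (o i) x) s)].
        * unfold zero; simpl. ring. }
  set (d := h * h * h / Ci).
  assert (Hh3 : 0 < h * h * h) by (repeat apply Rmult_lt_0_compat; easy).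
  assert (Hd : 0 < d) by now apply Rdiv_lt_0_compat.
  destruct (ccont_bounded 0 T (fun t => bsum n (fun i => a i t * a i t))) as [Ms [HMs HMa]]; [lra| |].
  { apply ccont_bsum. intros; apply ccont_mult; auto. }
  (* The coordinates of the exact solution are at most 1 + Ms and those of the error at most 1 + d
     while the squared error is at most d, so the clamp is inactive then. [Mc] may depend on the
     mesh, as it enters no error constant. *)
  set (Mc := 2 + Ms + d).
  destruct (quadratic_clamp_lipschitz n (fun i j => - A i j) (fun i j l => - B i j l) Mc) as [L [HL HF]]; [unfold Mc; lra|].
  match type of HF with lipschitz_field _ _ ?G => set (F := G) in * end.
  destruct (picard n F L (fun i => a i 0) HL HF) as [y [Hy0 Hy]].
  assert (HyF : forall i t, (i < n)%nat -> 0 <= t -> is_derive (y i) t (F i (at_time y t))).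
  { intros i t Hi Ht. assert (Q1 := Hy i t Hi). rewrite Rmax_right in Q1 by easy. exact Q1. }
  assert (Cyy : forall i t, (i < n)%nat -> continuous (y i) t).
  { intros i t Hi. apply (ex_derive_continuous (y i)). eexists. now apply Hy. }
  assert (Cy : forall i, (i < n)%nat -> ccont 0 T (y i)) by (intros; apply continuous_ccont; [lra|auto]).
  assert (CF : forall i, (i < n)%nat -> ccont 0 T (fun t => F i (at_time y t))).
  { intros i Hi. apply continuous_ccont; [lra|]. intros t _.
    apply (lipschitz_field_continuous n L F i y t HF Hi). auto. }
  set (err := fun i t => a i t - y i t).
  set (derr := fun i t => da i t - F i (at_time y t)).
  assert (Cerr : forall i, (i < n)%nat -> ccont 0 T (err i)) by (intros; apply ccont_minus; auto).
  assert (Cderr : forall i, (i < n)%nat -> ccont 0 T (derr i)) by (intros; apply ccont_minus; auto).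
  assert (Derr : forall i t, (i < n)%nat -> 0 < t < T -> is_derive (err i) t (derr i t)).
  { intros i t Hi Ht. apply (is_derive_minus (a i) (y i)); [auto|]. apply HyF; [easy|lra]. }
  set (Z := fun t => bsum n (fun i => err i t * err i t)).
  set (e := fun t => lin2 n (at_time err t) o).
  assert (EZ : forall t, Z t = ip (e t) (e t)).
  { intros t. unfold e. rewrite (ip_lin2_lin2 HG) by auto. easy. }
  assert (CZ : ccont 0 T Z) by (apply ccont_bsum; intros; apply ccont_mult; auto).
  assert (Z0 : Z 0 = 0).
  { apply bsum_0. intros i Hi. unfold err. rewrite Hy0 by easy. ring. }
  assert (Clip : forall t i, Icc 0 T t -> (i < n)%nat -> Z t <= d ->
    F i (at_time y t) = - weak beta (lin2 n (at_time y t) o) (o i)).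
  { intros t i Ht Hi HZ.
    assert (Hcl : forall j, (j < n)%nat -> clamp (- Mc) Mc (at_time y t j) = at_time y t j).
    { intros j Hj. apply clamp_id. unfold at_time.
      assert (B1 : Rabs (a j t) <= 1 + Ms).
      { apply Rsqr_le_1_Rabs. eapply Rle_trans; [|eapply Rle_trans; [apply Rle_abs|apply (HMa t Ht)]].
        apply (bsum_term_le n (fun i => a i t * a i t)); [intros; apply Rle_0_sqr|easy]. }
      assert (B2 : Rabs (err j t) <= 1 + d).
      { apply Rsqr_le_1_Rabs. eapply Rle_trans; [|exact HZ].
        apply (bsum_term_le n (fun i => err i t * err i t)); [intros; apply Rle_0_sqr|easy]. }
      unfold err in B2. apply Rabs_le_between in B1, B2. unfold Icc, Mc. lra. }
    rewrite HAB by easy. unfold F.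
    rewrite (bsum_ext n (fun j => - A i j * clamp (- Mc) Mc (at_time y t j)) (fun j => -1 * (A i j * at_time y t j)))
      by (intros j Hj; rewrite Hcl by easy; ring).
    rewrite (bsum_ext n (fun j => bsum n (fun l => - B i j l * (clamp (- Mc) Mc (at_time y t j) * clamp (- Mc) Mc (at_time y t l))))
      (fun j => -1 * bsum n (fun l => B i j l * (at_time y t j * at_time y t l)))).
    - rewrite !bsum_scal_l. ring.
    - intros j Hj. rewrite <- bsum_scal_l. apply bsum_ext. intros l Hl. rewrite !Hcl by easy. ring. }
  set (th := fun x t => bsum n (fun i => err i t * fst (o i) x)).
  set (xi := fun x t => bsum n (fun i => err i t * snd (o i) x)).
  set (dth := fun x t => bsum n (fun i => derr i t * fst (o i) x)).
  set (dxi := fun x t => bsum n (fun i => derr i t * snd (o i) x)).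
  set (w := fun x t => beta x + V O x t).
  assert (Csum : forall (g : nat -> R -> R) (q : nat -> R -> R), (forall i, (i < n)%nat -> ccont 0 T (g i)) ->
    (forall i, (i < n)%nat -> ccont 0 1 (q i)) -> cont2 T (fun x t => bsum n (fun i => g i t * q i x))).
  { intros g q Hg Hq'. apply (cont2_bsum T n (fun i x t => g i t * q i x)). intros i Hi.
    apply (cont2_mult T (fun _ t => g i t) (fun x _ => q i x)); [apply cont2_time|apply cont2_space]; auto. }
  assert (Cth : cont2 T th) by (apply (Csum err (fun i => fst (o i))); auto; intros; now apply Hoc).
  assert (Cxi : cont2 T xi) by (apply (Csum err (fun i => snd (o i))); auto; intros; now apply Hoc).
  assert (Cdth : cont2 T dth) by (apply (Csum derr (fun i => fst (o i))); auto; intros; now apply Hoc).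
  assert (Cdxi : cont2 T dxi) by (apply (Csum derr (fun i => snd (o i))); auto; intros; now apply Hoc).
  assert (Cw : cont2 T w) by (apply cont2_plus; [now apply cont2_space|easy]).
  set (E := (fun t => I (fun x => / 2 * (th x t * th x t) + / 2 * (w x t * (xi x t * xi x t)))) : R -> R).
  set (dE := (fun t => I (fun x => (th x t * dth x t + w x t * xi x t * dxi x t) + / 2 * (et x t * (xi x t * xi x t)))) : R -> R).
  assert (Half : forall f, cont2 T f -> cont2 T (fun x t => / 2 * f x t)).
  { intros f Hf. apply (cont2_mult T (fun _ _ => / 2)); [apply cont2_const|easy]. }
  assert (Cxi2 : cont2 T (fun x t => xi x t * xi x t)) by now apply (cont2_mult T xi xi).
  assert (Cen : cont2 T (fun x t => / 2 * (th x t * th x t) + / 2 * (w x t * (xi x t * xi x t)))).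
  { apply (cont2_plus T (fun x t => / 2 * (th x t * th x t))).
    - apply (Half (fun x t => th x t * th x t)). now apply (cont2_mult T th th).
    - apply (Half (fun x t => w x t * (xi x t * xi x t))). now apply (cont2_mult T w). }
  assert (Cden : cont2 T (fun x t => (th x t * dth x t + w x t * xi x t * dxi x t) + / 2 * (et x t * (xi x t * xi x t)))).
  { apply (cont2_plus T (fun x t => th x t * dth x t + w x t * xi x t * dxi x t)).
    - apply (cont2_plus T (fun x t => th x t * dth x t)); [now apply (cont2_mult T th)|].
      apply (cont2_mult T (fun x t => w x t * xi x t)); [now apply (cont2_mult T w)|easy].
    - apply (Half (fun x t => et x t * (xi x t * xi x t))). now apply (cont2_mult T et). }
  assert (CE : ccont 0 T E).
  { apply (cont2_I T (fun x t => / 2 * (th x t * th x t) + / 2 * (w x t * (xi x t * xi x t)))); [lra|easy]. }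
  assert (DE : forall t, 0 < t < T -> is_derive E t (dE t)).
  { intros t Ht.
    apply (Leibniz_rule T (fun x t => / 2 * (th x t * th x t) + / 2 * (w x t * (xi x t * xi x t)))
      (fun x t => (th x t * dth x t + w x t * xi x t * dxi x t) + / 2 * (et x t * (xi x t * xi x t)))); auto.
    - intros x s Hx Hs'.
      assert (Sd : forall q : nat -> R, is_derive (fun s => bsum n (fun i => err i s * q i)) s (bsum n (fun i => derr i s * q i))).
      { intros q. apply (bsum_is_derive n (fun i s => err i s * q i)). intros i Hi. evar_last.
        - apply (is_derive_Rmult (err i) (fun _ => q i)); [now apply Derr|apply (is_derive_const (q i) s)].
        - unfold zero; simpl. ring. }
      assert (D1 : is_derive (th x) s (dth x s)) by apply (Sd (fun i => fst (o i) x)).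
      assert (D2 : is_derive (xi x) s (dxi x s)) by apply (Sd (fun i => snd (o i) x)).
      assert (D3 : is_derive (w x) s (et x s)).
      { rewrite <- (Rplus_0_l (et x s)). apply (is_derive_plus (fun _ => beta x) (fun s => V O x s)).
        - apply (is_derive_const (beta x) s).
        - now apply edV. }
      evar_last.
      + apply (is_derive_plus (fun s => / 2 * (th x s * th x s)) (fun s => / 2 * (w x s * (xi x s * xi x s)))).
        * apply (is_derive_Rmult (fun _ => / 2) (fun s => th x s * th x s)); [apply (is_derive_const (/ 2) s)|].
          apply (is_derive_Rmult (th x) (th x)); exact D1.
        * apply (is_derive_Rmult (fun _ => / 2) (fun s => w x s * (xi x s * xi x s))); [apply (is_derive_const (/ 2) s)|].
          apply (is_derive_Rmult (w x) (fun s => xi x s * xi x s)); [exact D3|].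
          apply (is_derive_Rmult (xi x) (xi x)); exact D2.
      + unfold plus, zero; simpl. field. }
  assert (Pt : forall f t, cont2 T f -> Icc 0 T t -> pc N Y (fun x => f x t)).
  { intros f t Hf Ht. apply (pc_ccont HG). now apply (cont2_ccont_space T f t). }
  assert (in01 : forall x, inner_pt N Y x -> Icc 0 1 x).
  { intros x Hx. assert (Q1 := inner_pt_01 N Y x HG Hx). unfold Icc; lra. }
  assert (LowE : forall t, Icc 0 T t -> Z t <= 2 / w0 * E t).
  { intros t Ht. rewrite EZ. unfold ip. cbn [fst snd].
    assert (Pth := Pt th t Cth Ht). assert (Pxi := Pt xi t Cxi Ht). assert (Pw := Pt w t Cw Ht).
    assert (Pth2 : pc N Y (fun x => th x t * th x t)) by now apply pc_mult.
    assert (Pxi2 : pc N Y (fun x => xi x t * xi x t)) by now apply pc_mult.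
    change (I (fun x => th x t * th x t) + I (fun x => xi x t * xi x t) <= 2 / w0 * E t).
    assert (Q1 : I (fun x => w0 / 2 * (th x t * th x t) + w0 / 2 * (xi x t * xi x t)) <= E t).
    { apply (I_le HG).
      - apply pc_plus; apply pc_mult; auto using pc_const.
      - apply pc_plus; apply pc_mult; auto using pc_const, pc_mult.
      - intros x Hx. assert (Wp := epos x t (in01 x Hx) Ht). fold (w x t) in Wp.
        assert (0 <= th x t * th x t) by apply Rle_0_sqr. assert (0 <= xi x t * xi x t) by apply Rle_0_sqr.
        apply Rplus_le_compat.
        + apply Rmult_le_compat_r; lra.
        + assert (w0 * (xi x t * xi x t) <= w x t * (xi x t * xi x t)) by (apply Rmult_le_compat_r; lra). lra. }
    rewrite (I_plus HG (fun x => w0 / 2 * (th x t * th x t)) (fun x => w0 / 2 * (xi x t * xi x t))) in Q1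
      by (apply pc_mult; auto using pc_const).
    rewrite !(I_scal HG) in Q1 by auto.
    apply Rmult_le_reg_l with (w0 / 2); [lra|].
    replace (w0 / 2 * (2 / w0 * E t)) with (E t) by (field; lra). lra. }
  assert (Rate : forall t, 0 < t < T -> Z t <= d -> dE t <= Lam * E t + P * (h ^ (r - 1) * h ^ (r - 1))).
  { intros t Ht HZ. assert (Ht' : Icc 0 T t) by (unfold Icc; lra).
    destruct (ebc t Ht') as [U0 U1].
    assert (R1 := Hrate N Y h HG (conj Hh Hh1) Hqu HN n o Hbas (fun i x => V i x t) (fun i x => U i x t)
      (ecV t Ht') (ecU t Ht') U0 U1
      beta dbeta (fun x => et x t) (fun x => ut x t)
      (eb) (edb) (eb')
      (cont2_ccont_space T et t (eet) Ht') (cont2_ccont_space T ut t (eut) Ht')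
      (fun x Hx => ep1 x t Hx Ht) (fun x Hx => ep2 x t Hx Ht)
      (fun x Hx => ebd x t Hx Ht') (at_time y t)).
    cbv beta zeta in R1.
    change (lin2 n (fun i => ip (fun x => V O x t, fun x => U O x t) (o i) - at_time y t i) o) with (e t) in R1.
    rewrite <- EZ in R1. specialize (R1 HZ).
    assert (Pth := Pt th t Cth Ht'). assert (Pxi := Pt xi t Cxi Ht'). assert (Pw := Pt w t Cw Ht').
    assert (Pdth := Pt dth t Cdth Ht'). assert (Pdxi := Pt dxi t Cdxi Ht').
    assert (Pet := Pt et t (eet) Ht').
    (* While the clamp is inactive, the coordinates of the error have the derivative [da] plus the
       weak form, so dE is exactly the quantity bounded by [error_rate]. *)
    assert (EdE : dE t = ip (fst (e t), fun x => (beta x + V O x t) * snd (e t) x)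
      (lin2 n (fun i => ip (fun x => et x t, fun x => ut x t) (o i) + weak beta (lin2 n (at_time y t) o) (o i)) o) +
      / 2 * I (fun x => et x t * (snd (e t) x * snd (e t) x))).
    { assert (Eq : eq2 (lin2 n (at_time derr t) o)
        (lin2 n (fun i => ip (fun x => et x t, fun x => ut x t) (o i) + weak beta (lin2 n (at_time y t) o) (o i)) o)).
      { intros x _. simpl. split; apply bsum_ext; intros i Hi; unfold at_time at 1, derr; rewrite Clip by auto; unfold da; ring. }
      assert (Pze : pc2 N Y (fst (e t), fun x => (beta x + V O x t) * snd (e t) x)).
      { split; [exact Pth|]. exact (pc_mult _ _ Pw Pxi). }
      assert (Pld : pc2 N Y (lin2 n (at_time derr t) o)) by (apply lin2_pc2; auto).
      rewrite ip_sym, <- (ip_eq2 HG _ _ _ Pld Pze Eq), ip_sym.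
      unfold dE.
      rewrite (I_plus HG (fun x => th x t * dth x t + w x t * xi x t * dxi x t) (fun x => / 2 * (et x t * (xi x t * xi x t))))
        by auto 10 using pc_plus, pc_mult, pc_const.
      rewrite (I_plus HG (fun x => th x t * dth x t) (fun x => w x t * xi x t * dxi x t)) by auto using pc_mult.
      rewrite (I_scal HG) by auto using pc_mult. easy. }
    rewrite EdE. eapply Rle_trans; [exact R1|].
    assert (LE := LowE t Ht'). apply (Rmult_le_compat_l Q) in LE; [|easy].
    unfold Lam. rewrite Rmult_assoc. lra. }
  assert (HH1 : 0 < h ^ (r - 1)) by now apply pow_lt.
  set (H2 := h ^ (r - 1) * h ^ (r - 1)) in *.
  assert (HH2 : 0 < H2) by (unfold H2; now apply Rmult_lt_0_compat).
  (* By r >= 3 the rate is at least h^4, one power of h better than the threshold. *)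
  assert (HH4 : H2 <= h * h * h * h).
  { unfold H2. assert (h ^ (r - 1) <= h * h).
    { replace (r - 1)%nat with (2 + (r - 3))%nat by lia. rewrite pow_add.
      assert (Hp : 0 < h ^ (r - 3) <= 1).
      { split; [now apply pow_lt|]. rewrite <- (pow1 (r - 3)). apply pow_incr; lra. }
      replace (h ^ 2) with (h * h) by ring. rewrite <- (Rmult_1_r (h * h)) at 2.
      apply Rmult_le_compat_l; [apply Rle_0_sqr|easy]. }
    replace (h * h * h * h) with (h * h * (h * h)) by ring. apply Rmult_le_compat; lra. }
  assert (E0 : E 0 = 0).
  { unfold E. transitivity (I (fun _ => 0)); [|rewrite RInt_const; exact (Rmult_0_r _)].
    apply RInt_ext. intros x _.
    assert (T1 : th x 0 = 0) by (apply bsum_0; intros i Hi; unfold err; rewrite Hy0 by easy; ring).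
    assert (T2 : xi x 0 = 0) by (apply bsum_0; intros i Hi; unfold err; rewrite Hy0 by easy; ring).
    rewrite T1, T2. simpl. ring. }
  assert (Main : forall t, Icc 0 T t -> (forall s, Icc 0 t s -> Z s <= d) -> Z t <= Cz * H2).
  { intros t Ht Hb. assert (Ht' := Ht). destruct Ht' as [Ht0 HtT].
    assert (GE : E t <= (E 0 + P * H2 * t) * exp (Lam * t)).
    { apply (gronwall t E dE Lam (P * H2)); auto.
      - apply Rmult_le_pos; lra.
      - apply (ccont_sub 0 T); auto; lra.
      - intros s Hs'. apply DE; lra.
      - intros s Hs'. apply Rate; [lra|]. apply Hb. unfold Icc; lra.
      - unfold Icc; lra. }
    rewrite E0, Rplus_0_l in GE.
    assert (Hex : exp (Lam * t) <= exp (Lam * T)).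
    { destruct (Req_dec (Lam * t) (Lam * T)) as [->|Hne]; [lra|]. left. apply exp_increasing.
      assert (Lam * t <= Lam * T) by (apply Rmult_le_compat_l; lra). lra. }
    assert (HPH : 0 <= P * H2) by (apply Rmult_le_pos; lra).
    assert (GE2 : E t <= P * H2 * T * exp (Lam * T)).
    { eapply Rle_trans; [exact GE|]. apply Rmult_le_compat; try lra.
      - apply Rmult_le_pos; lra.
      - left; apply exp_pos.
      - apply Rmult_le_compat_l; lra. }
    eapply Rle_trans; [apply (LowE t Ht)|].
    replace (Cz * H2) with (2 / w0 * (P * H2 * T * exp (Lam * T))) by (unfold Cz; ring).
    apply Rmult_le_compat_l; lra. }
  assert (HCzd : Cz * H2 < d).
  { apply Rle_lt_trans with (Cz * (h * h * h * h)); [now apply Rmult_le_compat_l|].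
    unfold d. apply Rmult_lt_reg_r with Ci; [easy|].
    replace (h * h * h / Ci * Ci) with (h * h * h * 1) by (field; lra).
    replace (Cz * (h * h * h * h) * Ci) with (h * h * h * (Cz * Ci * h)) by ring.
    apply Rmult_lt_compat_l; lra. }
  assert (Zd : forall t, Icc 0 T t -> Z t <= d).
  { apply (bootstrap T Z d); auto; try lra. intros t Ht Hb. eapply Rle_lt_trans; [now apply Main|easy]. }
  assert (Zf : forall t, Icc 0 T t -> Z t <= Cz * H2).
  { intros t Ht. apply Main; [easy|]. intros s Hs'. apply Zd. unfold Icc in *; lra. }
  assert (Cini : ccont2 (eta0, u0)).
  { assert (I00 : Icc 0 T 0) by (unfold Icc; lra). split; simpl.
    - apply (ccont_ext 0 1 (fun x => V O x 0)); [lra|intros; now apply Hini|].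
      now apply (cont2_ccont_space T (V O) 0).
    - apply (ccont_ext 0 1 (fun x => U O x 0)); [lra|intros; now apply Hini|].
      now apply (cont2_ccont_space T (U O) 0). }
  assert (PVU : forall t, Icc 0 T t -> pc2 N Y (fun x => V O x t, fun x => U O x t)).
  { intros t Ht. split; now apply Pt. }
  exists (fun t => fst (lin2 n (at_time y t) o)), (fun t => snd (lin2 n (at_time y t) o)).
  split.
  - apply (solution_of_coords (Nat.le_trans 1 3 r ltac:(lia) Hr) HG Ho Hon Hs); auto.
    + intros i t Hi Ht. rewrite <- (Clip t i Ht Hi (Zd t Ht)). apply HyF; [easy|apply Ht].
    + intros i Hi. rewrite Hy0 by easy. unfold a.
      apply (ip_eq2 HG).
      * apply PVU. unfold Icc; lra.
      * auto.
      * intros x Hx. simpl. now apply Hini.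
  - intros t Ht.
    assert (Ply : pc2 N Y (lin2 n (at_time y t) o)) by (apply lin2_pc2; auto).
    split; [apply Ply|split; [apply Ply|]].
    destruct (ebc t Ht) as [U0 U1].
    destruct (Hproj N Y h HG Hh Hqu HN n o Hbas (fun i x => V i x t) (fun i x => U i x t) M
      (ecV t Ht) (ecU t Ht) U0 U1) as [P1 P2].
    change (fun i => ip (fun x => V O x t, fun x => U O x t) (o i)) with (at_time a t) in P1, P2.
    assert (Pla : pc2 N Y (lin2 n (at_time a t) o)) by (apply lin2_pc2; auto).
    assert (HEH : M * h ^ r * (M * h ^ r) <= M * M * H2).
    { replace (h ^ r) with (h * h ^ (r - 1)).
      - replace (M * (h * h ^ (r - 1)) * (M * (h * h ^ (r - 1)))) with (h * h * (M * M * H2)) by (unfold H2; ring).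
        rewrite <- (Rmult_1_l (M * M * H2)) at 2. apply Rmult_le_compat_r; [apply Rmult_le_pos; lra|].
        rewrite <- (Rmult_1_l 1). apply Rmult_le_compat; lra.
      - change (h ^ S (r - 1) = h ^ r). f_equal; lia. }
    assert (HEC := Rmult_le_compat_l Cp _ _ (Rlt_le _ _ HCp) HEH).
    assert (Split : forall v la ly q, pc N Y v -> pc N Y la -> pc N Y ly -> pc N Y q -> (forall x, la x - ly x = q x) ->
      I (fun x => (v x - ly x) * (v x - ly x)) <= 2 * I (fun x => (v x - la x) * (v x - la x)) + 2 * I (fun x => q x * q x)).
    { intros v la ly q Pv Pla' Ply' Pq Eq.
      assert (A1 : pc N Y (fun x => (v x - la x) * (v x - la x))) by (apply pc_mult; now apply pc_minus).
      assert (A2 : pc N Y (fun x => q x * q x)) by now apply pc_mult.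
      apply Rle_trans with (I (fun x => 2 * ((v x - la x) * (v x - la x)) + 2 * (q x * q x))).
      - apply (I_le HG).
        + apply pc_mult; now apply pc_minus.
        + apply pc_plus; apply pc_mult; auto using pc_const.
        + intros x _. replace (v x - ly x) with ((v x - la x) + q x) by (rewrite <- Eq; ring). apply sqr_plus_le.
      - rewrite (I_plus HG (fun x => 2 * ((v x - la x) * (v x - la x))) (fun x => 2 * (q x * q x)))
          by (apply pc_mult; auto using pc_const).
        rewrite !(I_scal HG) by auto. lra. }
    assert (S1 := Split (fun x => V O x t) (fst (lin2 n (at_time a t) o)) (fst (lin2 n (at_time y t) o)) (fst (e t))
      (proj1 (PVU t Ht)) (proj1 Pla) (proj1 Ply) (Pt th t Cth Ht)).
    assert (S2 := Split (fun x => U O x t) (snd (lin2 n (at_time a t) o)) (snd (lin2 n (at_time y t) o)) (snd (e t))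
      (proj2 (PVU t Ht)) (proj2 Pla) (proj2 Ply) (Pt xi t Cxi Ht)).
    assert (S1' := S1 ltac:(intros x; simpl; rewrite <- bsum_minus; apply bsum_ext; intros; unfold at_time, err; ring)).
    assert (S2' := S2 ltac:(intros x; simpl; rewrite <- bsum_minus; apply bsum_ext; intros; unfold at_time, err; ring)).
    assert (Zft := Zf t Ht). rewrite EZ in Zft. unfold ip in Zft.
    cbv beta in S1', S2', P1, P2. clear S1 S2.
    eapply Rle_trans; [apply Rplus_le_compat; [exact S1'|exact S2']|].
    apply Rle_trans with (4 * (Cp * (M * M * H2)) + 2 * (Cz * H2)); [lra|].
    replace ((4 * (Cp * (M * M)) + 2 * Cz + 1) * H2) with (4 * (Cp * (M * M * H2)) + 2 * (Cz * H2) + H2) by ring. lra.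
Qed.

(** Uniqueness holds on every mesh and uses no estimate: two solutions have continuous, hence
    bounded, coordinates, and with a clamp beyond their common bound both solve the same Lipschitz
    system with the same initial values. *)
Lemma semidiscrete_unique r k N X T beta eta0 u0 etah uh etah' uh' : (2 <= r)%nat -> 0 < T ->
  grid N (fun j => X (S j)) -> pc1 N (fun j => X (S j)) beta -> ccont2 (eta0, u0) ->
  is_semidiscrete_solution T beta eta0 u0 r k N X etah uh ->
  is_semidiscrete_solution T beta eta0 u0 r k N X etah' uh' ->
  forall t x, Icc 0 T t -> Icc 0 1 x -> etah' t x = etah t x /\ uh' t x = uh t x.
Proof.
  intros Hr HT HG Hb H0 HS HS'.
  destruct (spl_basis r k N _ HG Hr) as [n [o [Ho [Hon Hs]]]].
  assert (Hr1 : (1 <= r)%nat) by lia.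
  destruct (coords_of_solution Hr1 HG Ho Hon Hs T beta eta0 u0 etah uh HT Hb H0 HS) as [y [Y1 [Y2 [Y3 Y4]]]].
  destruct (coords_of_solution Hr1 HG Ho Hon Hs T beta eta0 u0 etah' uh' HT Hb H0 HS') as [z [Z1 [Z2 [Z3 Z4]]]].
  destruct (weak_quadratic HG beta n o Hb (fun i Hi => basis_pc12 Ho i Hi)) as [A [B HAB]].
  destruct (ccont_bounded 0 T (fun t => bsum n (fun i => y i t * y i t) + bsum n (fun i => z i t * z i t))) as [Ms [HMs HM]]; [lra| |].
  { apply ccont_plus; apply ccont_bsum; intros; apply ccont_mult; auto. }
  set (Mc := 1 + Ms).
  destruct (quadratic_clamp_lipschitz n (fun i j => - A i j) (fun i j l => - B i j l) Mc) as [L [HL HF]]; [unfold Mc; lra|].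
  match type of HF with lipschitz_field _ _ ?G => set (F := G) in * end.
  assert (Clip : forall v i, (i < n)%nat -> (forall j, (j < n)%nat -> Rabs (v j) <= Mc) ->
    - weak beta (lin2 n v o) (o i) = F i v).
  { intros v i Hi Hv.
    assert (Hcl : forall j, (j < n)%nat -> clamp (- Mc) Mc (v j) = v j).
    { intros j Hj. apply clamp_id. specialize (Hv j Hj). apply Rabs_le_between in Hv. exact Hv. }
    rewrite HAB by easy. unfold F.
    rewrite (bsum_ext n (fun j => - A i j * clamp (- Mc) Mc (v j)) (fun j => -1 * (A i j * v j)))
      by (intros j Hj; rewrite Hcl by easy; ring).
    rewrite (bsum_ext n (fun j => bsum n (fun l => - B i j l * (clamp (- Mc) Mc (v j) * clamp (- Mc) Mc (v l))))
      (fun j => -1 * bsum n (fun l => B i j l * (v j * v l)))).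
    - rewrite !bsum_scal_l. ring.
    - intros j Hj. rewrite <- bsum_scal_l. apply bsum_ext. intros l Hl. rewrite !Hcl by easy. ring. }
  assert (Bd : forall j t, (j < n)%nat -> Icc 0 T t -> Rabs (y j t) <= Mc /\ Rabs (z j t) <= Mc).
  { intros j t Hj Ht. assert (Q := Rle_trans _ _ _ (Rle_abs _) (HM t Ht)). cbv beta in Q.
    assert (Q1 := bsum_term_le n (fun i => y i t * y i t) j (fun i _ => Rle_0_sqr (y i t)) Hj).
    assert (Q2 := bsum_term_le n (fun i => z i t * z i t) j (fun i _ => Rle_0_sqr (z i t)) Hj).
    cbv beta in Q1, Q2.
    assert (0 <= y j t * y j t) by apply Rle_0_sqr. assert (0 <= z j t * z j t) by apply Rle_0_sqr.
    split; apply Rsqr_le_1_Rabs; lra. }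
  assert (E : forall i t, (i < n)%nat -> Icc 0 T t -> y i t = z i t).
  { apply (ode_unique n F L T y z); auto; try lra.
    - intros i t Hi Ht. rewrite <- (Clip (fun j => y j t) i Hi); [now apply Y3|].
      intros j Hj. apply Bd; [easy|unfold Icc; lra].
    - intros i t Hi Ht. rewrite <- (Clip (fun j => z j t) i Hi); [now apply Z3|].
      intros j Hj. apply Bd; [easy|unfold Icc; lra].
    - intros i Hi. now rewrite Y4, Z4. }
  intros t x Ht Hx.
  destruct (Y1 t Ht x Hx) as [A1 A2], (Z1 t Ht x Hx) as [B1 B2]. simpl in *.
  rewrite A1, A2, B1, B2. unfold at_time.
  split; apply bsum_ext; intros i Hi; now rewrite E.
Qed.

(** * From the formulation of the theorem to the internal setting *)

Lemma mesh_gap N X j : (j < N)%nat -> X (S (S j)) - X (S j) <= mesh N X.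
Proof.
  intros Hj. induction N as [|N IH]; [lia|].
  change (mesh (S N) X) with (Rmax (mesh N X) (X (S N + 1)%nat - X (S N))).
  destruct (Nat.eq_dec j N) as [->|Hn].
  - replace (S N + 1)%nat with (S (S N)) by lia. apply Rmax_r.
  - eapply Rle_trans; [apply IH; lia|apply Rmax_l].
Qed.

Lemma partition_grid N X : is_partition N X -> (1 <= N)%nat /\ grid N (fun j => X (S j)).
Proof.
  intros [H0 [H1 H]]. rewrite Nat.add_1_r in H1. split.
  - destruct N; [lra|lia].
  - split; [easy|split; [easy|]]. intros j Hj.
    specialize (H (S j) ltac:(lia)). now rewrite Nat.add_1_r in H.
Qed.

Lemma smooth_chain_of_rect n T V M t : (forall i, (i <= n)%nat -> cont2 T (V i)) ->
  (forall i x t, (i < n)%nat -> Icc 0 1 x -> Icc 0 T t ->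
    is_derive_on (Icc 0 1) (fun y => V i y t) x (V (S i) x t)) ->
  (forall x t, Icc 0 1 x -> Icc 0 T t -> Rabs (V n x t) <= M) ->
  Icc 0 T t -> smooth_chain n (fun i x => V i x t) M.
Proof.
  intros H1 H2 H3 Ht. split; [|split].
  - intros i Hi. apply (cont2_ccont_space T (V i)); auto.
  - intros i x Hi Hx. apply (is_derive_of_is_derive_on 0 1); [easy|].
    apply H2; auto. unfold Icc; lra.
  - auto.
Qed.

Lemma sqrt_le_of_sqr a C H : 0 <= C -> 0 <= H -> a <= C * (H * H) -> sqrt a <= sqrt C * H.
Proof.
  intros HC HH Ha. rewrite <- (sqrt_square H) by easy. rewrite <- sqrt_mult by (try apply Rle_0_sqr; easy).
  now apply sqrt_le_1_alt.
Qed.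

(* [m] is the order of smoothness required of the solution. *)
Theorem proposition2p1 :
  forall r k : nat, (3 <= r)%nat -> (k <= r - 2)%nat ->
  exists m : nat,
  forall (T : R) (beta eta0 u0 : R -> R) (eta u : R -> R -> R) (c : R),
    0 < T ->
    C_on 0 1 1 beta ->
    (forall x, Icc 0 1 x -> 0 < beta x) ->
    C_rect T m eta ->
    C_rect T m u ->
    is_ibvp_solution T beta eta0 u0 eta u ->
    (forall x t, Icc 0 1 x -> Icc 0 T t -> 0 < beta x + eta x t) ->
  exists h0 C : R, 0 < h0 /\
  forall (N : nat) (X : nat -> R),
    is_partition N X ->
    quasiuniform c N X ->
    mesh N X <= h0 ->
  exists etah uh : R -> R -> R,
    is_semidiscrete_solution T beta eta0 u0 r k N X etah uh /\
    (forall etah' uh' : R -> R -> R,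
       is_semidiscrete_solution T beta eta0 u0 r k N X etah' uh' ->
       forall t x, Icc 0 T t -> Icc 0 1 x ->
         etah' t x = etah t x /\ uh' t x = uh t x) /\
    (forall t, Icc 0 T t ->
       L2norm (fun x => eta x t - etah t x) + L2norm (fun x => u x t - uh t x)
       <= C * mesh N X ^ (r - 1)).
Proof.
  (* Order r suffices: the approximation takes r space derivatives and the energy identity one time
     derivative. *)
  intros r k Hr Hk. exists r.
  intros T beta eta0 u0 eta u c HT [dbeta [Hdb Hcb]] _ Ceta Cu [PDE1 [PDE2 [INI BC]]] Hpos.
  assert (HT0 : 0 <= T) by lra.
  destruct (C_rect_chain T r eta HT0 Ceta) as [V [V0 [V1 V2]]].
  destruct (C_rect_chain T r u HT0 Cu) as [U [U0 [U1 U2]]].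
  destruct (cont2_bounded T (V r) HT0 (V1 r (Nat.le_refl r))) as [Mv [HMv HVr]].
  destruct (cont2_bounded T (U r) HT0 (U1 r (Nat.le_refl r))) as [Mu [HMu HUr]].
  assert (Er : exists r', r = S r') by (exists (r - 1)%nat; lia).
  destruct Er as [r' Er].
  assert (Hft : forall f, C_rect T r f -> exists ft, cont2 T ft /\
    forall x t, Icc 0 1 x -> Icc 0 T t -> is_derive_on (Icc 0 T) (fun s => f x s) t (ft x t)).
  { intros f Hf. rewrite Er in Hf. destruct Hf as [_ [fx [ft [Hd [_ Ht]]]]].
    exists ft. split; [now apply (C_rect_cont2 T r')|]. intros x t Hx Ht'. now apply Hd. }
  destruct (Hft eta Ceta) as [et [Cet Det]]. destruct (Hft u Cu) as [ut [Cut Dut]].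
  assert (Cb : ccont 0 1 beta) by (apply (is_derive_on_ccont 0 1 beta dbeta); [lra|easy]).
  assert (Cdb : ccont 0 1 dbeta) by (apply continuous_on_ccont; [lra|exact Hcb]).
  assert (Db : forall x, 0 < x < 1 -> is_derive beta x (dbeta x)).
  { intros x Hx. apply (is_derive_of_is_derive_on 0 1); [easy|]. apply Hdb. unfold Icc; lra. }
  assert (Cw : cont2 T (fun x t => beta x + V O x t)) by (apply cont2_plus; [now apply cont2_space|apply V1; lia]).
  destruct (cont2_bounded T _ HT0 Cw) as [K1 [HK1 BK1]].
  destruct (cont2_bounded T (fun x t => dbeta x + V 1%nat x t) HT0) as [K2 [HK2 BK2]].
  { apply cont2_plus; [now apply cont2_space|apply V1; lia]. }
  destruct (cont2_bounded T (U 1%nat) HT0 (U1 1%nat ltac:(lia))) as [K3 [HK3 BK3]].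
  destruct (cont2_bounded T et HT0 Cet) as [K4 [HK4 BK4]].
  destruct (cont2_pos_bound T _ HT0 Cw) as [w0 [Hw0 Bw0]].
  { intros x t Hx Ht. rewrite V0. now apply Hpos. }
  (* [Rmax c 1] makes the quasiuniformity constant positive, [Rmin w0 1] normalizes the lower bound
     of w, and the sum is a common bound, at least 1, for the four coefficients. *)
  destruct (semidiscrete_error r k (Rmax c 1) T (1 + K1 + K2 + K3 + K4) (Mv + Mu) (Rmin w0 1)) as [h0 [C [Hh0 [HC Herr]]]];
    auto; try lra.
  { eapply Rlt_le_trans; [|apply Rmax_r]. lra. }
  { split; [apply Rmin_pos; lra|apply Rmin_r]. }
  assert (ES : exact_solution r T (1 + K1 + K2 + K3 + K4) (Mv + Mu) (Rmin w0 1) beta dbeta V U et ut).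
  { assert (DV : forall x t, 0 < x < 1 -> Icc 0 T t -> is_derive (fun y => eta y t) x (V 1%nat x t)).
    { intros x t Hx Ht. apply (is_derive_ext (fun y => V O y t)); [intros; apply V0|].
      apply (is_derive_of_is_derive_on 0 1); [easy|]. apply V2; [lia|unfold Icc; lra|easy]. }
    assert (DU : forall x t, 0 < x < 1 -> Icc 0 T t -> is_derive (fun y => u y t) x (U 1%nat x t)).
    { intros x t Hx Ht. apply (is_derive_ext (fun y => U O y t)); [intros; apply U0|].
      apply (is_derive_of_is_derive_on 0 1); [easy|]. apply U2; [lia|unfold Icc; lra|easy]. }
    split; auto.
    - apply V1; lia.
    - apply U1; lia.
    - intros t Ht. apply (smooth_chain_of_rect r T V); auto. intros x s Hx Hs. specialize (HVr x s Hx Hs). lra.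
    - intros t Ht. apply (smooth_chain_of_rect r T U); auto. intros x s Hx Hs. specialize (HUr x s Hx Hs). lra.
    - intros t Ht. rewrite !U0. now apply BC.
    - intros x t Hx Ht. apply (is_derive_ext (fun s => eta x s)); [intros; symmetry; apply V0|].
      apply (is_derive_of_is_derive_on 0 T); [easy|]. apply Det; [easy|unfold Icc; lra].
    - intros x t Hx Ht. apply (is_derive_ext (fun s => u x s)); [intros; symmetry; apply U0|].
      apply (is_derive_of_is_derive_on 0 T); [easy|]. apply Dut; [easy|unfold Icc; lra].
    - intros x t Hx Ht. assert (Hx' : Icc 0 1 x) by (unfold Icc; lra). assert (Ht' : Icc 0 T t) by (unfold Icc; lra).
      (* The derivatives in the differential equation are given existentially; uniqueness identifies
         them with the chains [V], [U] through the product rule. *)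
      destruct (PDE1 x t Hx' Ht') as [a [b [d [D1 [D2 [D3 E]]]]]].
      assert (Ea : a = et x t) by (apply (is_derive_on_unique 0 T (fun s => eta x s) t); auto).
      apply (is_derive_of_is_derive_on 0 1) in D2, D3; try easy.
      apply is_derive_unique in D2, D3.
      assert (Eb : b = V 1%nat x t * u x t + eta x t * U 1%nat x t).
      { rewrite <- D2. apply is_derive_unique. apply (is_derive_Rmult (fun y => eta y t) (fun y => u y t)); auto. }
      assert (Ed : d = dbeta x * u x t + beta x * U 1%nat x t).
      { rewrite <- D3. apply is_derive_unique. apply (is_derive_Rmult beta (fun y => u y t)); auto. }
      rewrite V0, U0. lra.
    - intros x t Hx Ht. assert (Hx' : Icc 0 1 x) by (unfold Icc; lra). assert (Ht' : Icc 0 T t) by (unfold Icc; lra).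
      destruct (PDE2 x t Hx' Ht') as [a [b [d [D1 [D2 [D3 E]]]]]].
      assert (Ea : a = ut x t) by (apply (is_derive_on_unique 0 T (fun s => u x s) t); auto).
      apply (is_derive_of_is_derive_on 0 1) in D2, D3; try easy.
      apply is_derive_unique in D2, D3.
      assert (Eb : b = V 1%nat x t) by (rewrite <- D2; apply is_derive_unique; auto).
      assert (Ed : d = U 1%nat x t) by (rewrite <- D3; apply is_derive_unique; auto).
      rewrite U0. rewrite <- Ea, <- Eb, <- Ed. lra.
    - intros x t Hx Ht. specialize (BK1 x t Hx Ht). specialize (BK2 x t Hx Ht).
      specialize (BK3 x t Hx Ht). specialize (BK4 x t Hx Ht). cbv beta in *. repeat split; lra.
    - intros x t Hx Ht. eapply Rle_trans; [apply Rmin_l|]. now apply Bw0. }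
  assert (I00 : Icc 0 T 0) by (unfold Icc; lra).
  assert (Ini : forall x, Icc 0 1 x -> V O x 0 = eta0 x /\ U O x 0 = u0 x).
  { intros x Hx. rewrite V0, U0. now apply INI. }
  assert (Cini : ccont2 (eta0, u0)).
  { split; simpl.
    - apply (ccont_ext 0 1 (fun x => V O x 0)); [lra|intros; now apply Ini|].
      apply (cont2_ccont_space T (V O) 0); [apply V1; lia|easy].
    - apply (ccont_ext 0 1 (fun x => U O x 0)); [lra|intros; now apply Ini|].
      apply (cont2_ccont_space T (U O) 0); [apply U1; lia|easy]. }
  (* One [sqrt C] for each of the two norms, both bounded through the sum of their squares. *)
  exists h0, (2 * sqrt C). split; [easy|]. intros N X HP HQ Hm.
  destruct (partition_grid N X HP) as [HN HG].
  assert (Hh : 0 < mesh N X).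
  { eapply Rlt_le_trans; [|apply (mesh_gap N X 0); lia]. destruct HG as [_ [_ Hg]]. specialize (Hg O ltac:(lia)). lra. }
  assert (Hqu : quasi (Rmax c 1) (mesh N X) N (fun j => X (S j))).
  { intros j Hj. split; [|now apply mesh_gap].
    assert (G : X (S j) < X (S (S j))) by (apply HG; easy).
    specialize (HQ (S j) ltac:(lia)). rewrite Nat.add_1_r in HQ. eapply Rle_trans; [exact HQ|].
    apply Rmult_le_compat_r; [lra|apply Rmax_l]. }
  destruct (Herr beta dbeta V U et ut ES eta0 u0 Ini N X (mesh N X) HG (conj Hh Hm) Hqu) as [etah [uh [Sol Est]]].
  exists etah, uh. split; [easy|split].
  - intros etah' uh' Sol'.
    apply (semidiscrete_unique r k N X T beta eta0 u0); auto; [lia|].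
    now apply (pc1_C1 HG beta dbeta).
  - intros t Ht. destruct (Est t Ht) as [Pe [Pu E]].
    assert (Pv : pc N (fun j => X (S j)) (fun x => V O x t)).
    { apply (pc_ccont HG), (cont2_ccont_space T (V O)); [apply V1; lia|easy]. }
    assert (Pw : pc N (fun j => X (S j)) (fun x => U O x t)).
    { apply (pc_ccont HG), (cont2_ccont_space T (U O)); [apply U1; lia|easy]. }
    assert (N1 : 0 <= I (fun x => (V O x t - etah t x) * (V O x t - etah t x))).
    { apply (I_ge0 HG); [apply pc_mult; now apply pc_minus|]. intros; apply Rle_0_sqr. }
    assert (N2 : 0 <= I (fun x => (U O x t - uh t x) * (U O x t - uh t x))).
    { apply (I_ge0 HG); [apply pc_mult; now apply pc_minus|]. intros; apply Rle_0_sqr. }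
    assert (L1 : L2norm (fun x => eta x t - etah t x) <= sqrt C * mesh N X ^ (r - 1)).
    { apply sqrt_le_of_sqr; [lra|apply pow_le; lra|].
      eapply Rle_trans; [|eapply Rle_trans; [|exact E]].
      - right. apply RInt_ext. intros x _. now rewrite <- V0.
      - lra. }
    assert (L2 : L2norm (fun x => u x t - uh t x) <= sqrt C * mesh N X ^ (r - 1)).
    { apply sqrt_le_of_sqr; [lra|apply pow_le; lra|].
      eapply Rle_trans; [|eapply Rle_trans; [|exact E]].
      - right. apply RInt_ext. intros x _. now rewrite <- U0.
      - lra. }
    lra.
Qed.
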